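(* Consider the decentralized bilevel problem $\min_x \Phi(x)$ and the algorithm DSGDA-GT described in the context. Suppose Assumptions 1, 2, 3 and 4 stated in the context hold, and that the multiplier $\alpha$ and the step sizes are chosen such that $$\alpha=\Theta\left((1-\rho^2)^{1/2}(nS)^{1/7}\right),\quad \eta_x=\Theta\left(\frac{(1-\rho^2)n^{2/7}}{S^{5/7}}\right),\quad \eta_y=\Theta\left(\frac{(1-\rho^2)n^{2/7}}{S^{5/7}}\right),\quad \eta_z=\Theta\left(\frac{(1-\rho^2)^{3/2}n^{3/7}}{S^{4/7}}\right).$$ Assume further a warm start for the variables $y,z$ such that $$\max\left(\|\bar y_0-y^{\alpha}_{*}(\bar x_0)\|^2,\ \|\bar z_0-z_{*}(\bar x_0)\|^2\right)=\mathcal O(1/\alpha).$$ Then DSGDA-GT run with $T=1$ and $S\ge n^{4/3}$ satisfies $$\min_{0\le s\le S-1}\mathbb E\left[\|\nabla\Phi(\bar x_s)\|\right]\le \mathcal O\left(\frac{(1-\rho^2)^{-1/2}}{(nS)^{1/7}}\right)$$ and $$\min_{0\le s\le S-1}\frac{\mathbb E\left[\|\mathbf X_s-\bar x_s\mathbf 1_n^\top\|\right]}{n}\le \mathcal O\left(\frac{n^{-1/14}}{S^{4/7}}+\frac{n^{1/7}(1-\rho^2)^{-3/2}}{S^{6/7}}\right).$$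
   Context: **Problem.** There are $n$ agents. For each $i\in\{1,\dots,n\}$, $f_i(x,y)=\mathbb E_{\xi\sim\Xi_i}[F(x,y;\xi)]$ and $g_i(x,y)=\mathbb E_{\psi\sim\Psi_i}[G(x,y;\psi)]$ are functions of $(x,y)\in\mathbb R^p\times\mathbb R^q$ accessible only to agent $i$ through stochastic gradients, written $\nabla f_i(x,y;\xi)$ and $\nabla g_i(x,y;\psi)$. Put $f=\frac1n\sum_i f_i$, $g=\frac1n\sum_i g_i$. The problem is $\min_{x\in\mathbb R^p}\Phi(x)$, where $\Phi(x)=f(x,y^*(x))$ and $y^*(x)=\arg\min_{y} g(x,y)$. For $\alpha>0$ let $\mathcal L^\alpha(x,y,z)=\frac1n\sum_{i=1}^n\left(f_i(x,y)+\alpha(g_i(x,y)-g_i(x,z))\right)$, $\Omega^\alpha(x,y)=\max_z\mathcal L^\alpha(x,y,z)$, $z_*(x)=\arg\min_z g(x,z)$, $y_*^\alpha(x)=\arg\min_y\Omega^\alpha(x,y)$. **Algorithm DSGDA-GT.** Inputs $x_0,y_0,z_0,\alpha,\eta_x,\eta_y,\eta_z,S,T$ and a mixing matrix $\mathbf W=(w_{ij})\in\mathbb R^{n\times n}$. Initialize $x_0^{(i)}=x_0$, $y_0^{(i)}=y_0$, $z_0^{(i)}=z_0$, $v_0^{(i)}=\delta_0^{(i)}=0$ on every agent $i$, and $u_{0,y}^{(i)},h_{0,y}^{(i)},u_{0,z}^{(i)},h_{0,z}^{(i)}$ such that the averages over $i$ of $u_{0,y}^{(i)}$ and $h_{0,y}^{(i)}$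 agree, and likewise for $z$. For $s=0,\dots,S-1$ and all $i$: 1. $(y_{s+1}^{(i)},u_{s+1,y}^{(i)},h_{s+1,y}^{(i)})=\mathrm{InnerLoop}\left(y_s^{(i)},\eta_y,f_i(x_s^{(i)},\cdot)+\alpha g_i(x_s^{(i)},\cdot),u_{s,y}^{(i)},h_{s,y}^{(i)},T\right)$; 2. $(z_{s+1}^{(i)},u_{s+1,z}^{(i)},h_{s+1,z}^{(i)})=\mathrm{InnerLoop}\left(z_s^{(i)},\eta_z,g_i(x_s^{(i)},\cdot),u_{s,z}^{(i)},h_{s,z}^{(i)},T\right)$; 3. $\delta_{s+1}^{(i)}=\nabla_xf_i(x_s^{(i)},y_s^{(i)};\xi_s^{(i)})+\alpha\left(\nabla_xg_i(x_s^{(i)},y_s^{(i)};\psi_s^{(i)})-\nabla_xg_i(x_s^{(i)},z_s^{(i)};\psi_s^{(i)})\right)$; 4. $v_{s+1}^{(i)}=\sum_{j}w_{ij}v_s^{(j)}+\delta_{s+1}^{(i)}-\delta_s^{(i)}$; 5. $x_{s+1}^{(i)}=\sum_jw_{ij}x_s^{(j)}-\eta_xv_{s+1}^{(i)}$. $\mathrm{InnerLoop}(\theta_0^{(i)},\gamma,\phi_i(x^{(i)},\cdot),u_0^{(i)},h_0^{(i)},T)$ performs, for $t=0,\dots,T-1$ and all $i$: $h_{t+1}^{(i)}=\nabla_\theta\phi_i(x^{(i)},\theta_t^{(i)};\zeta_t^{(i)})$ (a stochastic gradient), $u_{t+1}^{(i)}=\sum_jw_{ij}u_t^{(j)}+h_{t+1}^{(i)}-h_t^{(i)}$,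 $\theta_{t+1}^{(i)}=\sum_jw_{ij}\theta_t^{(j)}-\gamma u_{t+1}^{(i)}$; it returns $\theta_T^{(i)},u_T^{(i)},h_T^{(i)}$. **Notation.** A bar denotes the average over agents, e.g. $\bar x_s=\frac1n\sum_ix_s^{(i)}$, $\bar\delta_s=\frac1n\sum_i\delta_s^{(i)}$. $\mathbf X_s=(x_s^{(1)},\dots,x_s^{(n)})\in\mathbb R^{p\times n}$; $\mathbf 1_n$ is the all-one vector in $\mathbb R^n$; $\|\cdot\|$ is the Euclidean norm for vectors and the Frobenius norm for matrices. $\mathcal F_s$ is the $\sigma$-algebra generated by all iterates with subscripts up to $s$. **Assumption 1 (smoothness).** For each $i$: (1) $f_i(x,y)$ is $\ell_{f,0}$-Lipschitz in $y$, has $\ell_{f,1}$-Lipschitz gradient and $\ell_{f,2}$-Lipschitz Hessian; (2) $g_i(x,y)$ has $\ell_{g,1}$-Lipschitz gradient, $\ell_{g,2}$-Lipschitz Hessian, and is $\mu_g$-strongly convex in $y$. **Assumption 2 (stochastic oracles).** All stochastic oracles are unbiased with bounded variance (variances of the stochastic gradients of $f_i$ and $g_i$ at most $\sigma_f^2$ and $\sigma_g^2$). The stochastic oracles of iterates with subscript $s$ are independent conditionally on $\mathcal F_s$. **Assumption 3 (network).** $\mathbf W$ is symmetric and doubly stochastic, and its eigenvalues $\lambda_n\le\dots\le\lambda_1=1$ satisfy $\rho:=\max\{|\lambda_2|,|\lambda_n|\}<1$. **Assumption 4.** There is a constant $c_\delta$ such that $\mathbb E[\|\bar\delta_{s+1}\|^2\mid\mathcal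 F_s]\le c_\delta\alpha^2$ along the algorithm. **Asymptotic notation.** $a=\mathcal O(b)$ means $|a|\le C|b|$, and $a=\Theta(b)$ means $C_1|b|\le|a|\le C_2|b|$, for constants $C,C_1,C_2>0$ not depending on $n,S,\rho,\alpha$ (they may depend on the Lipschitz, strong convexity and variance constants, $c_\delta$, the initialization, and the initial gap $\Phi(x_0)-\inf\Phi$). *)

(* Defs.v *)
From mathcomp Require Import all_boot all_order all_algebra.
From mathcomp Require Import all_classical all_reals all_analysis.

Set Implicit Arguments.
Unset Strict Implicit.
Unset Printing Implicit Defensive.

Import Order.TTheory GRing.Theory Num.Theory.
Import numFieldNormedType.Exports.

Local Open Scope classical_set_scope.
Local Open Scope ring_scope.

Section Calculus.
Context {R : realType}.

(* The norm carried by the library's matrix types is the max norm; this is the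
   Euclidean norm on vectors and the Frobenius norm on matrices. *)
Definition fnorm m n (A : 'M[R]_(m, n)) : R :=
  Num.sqrt (\sum_i \sum_j A i j ^+ 2).

Definition grad m (h : 'rV[R]_m -> R) (w : 'rV[R]_m) : 'rV[R]_m :=
  \row_j 'D_(delta_mx 0 j) h w.

Definition hessian m (h : 'rV[R]_m -> R) (w : 'rV[R]_m) : 'M[R]_m :=
  jacobian (grad h) w.

Definition lipschitz_gradient m (L : R) (h : 'rV[R]_m -> R) : Prop :=
  (forall w, differentiable h w) /\
  (forall w w', fnorm (grad h w - grad h w') <= L * fnorm (w - w')).

Definition lipschitz_hessian m (L : R) (h : 'rV[R]_m -> R) : Prop :=
  (forall w, differentiable (grad h) w) /\
  (forall w w', fnorm (hessian h w - hessian h w') <= L * fnorm (w - w')).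

Definition strongly_convex m (mu : R) (h : 'rV[R]_m -> R) : Prop :=
  forall (w w' : 'rV[R]_m) (t : R), 0 <= t <= 1 ->
    h (t *: w + (1 - t) *: w') <=
      t * h w + (1 - t) * h w' - mu / 2 * t * (1 - t) * fnorm (w - w') ^+ 2.

(* [joint h] is h as a function on R^(p+q). *)
Definition joint p q (h : 'rV[R]_p -> 'rV[R]_q -> R) (w : 'rV[R]_(p + q)) : R :=
  h (lsubmx w) (rsubmx w).

(* A chosen minimizer, arbitrary when there is none. *)
Definition argmin m (h : 'rV[R]_m -> R) : 'rV[R]_m :=
  get [set w | forall w', h w <= h w'].

Definition avg n m (v : 'I_n -> 'rV[R]_m) : 'rV[R]_m :=
  n%:R^-1 *: \sum_i v i.

Definition stack n m (v : 'I_n -> 'rV[R]_m) : 'M[R]_(m, n) :=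
  \matrix_(k, i) v i 0 k.

Definition consensus_error n m (v : 'I_n -> 'rV[R]_m) : R :=
  fnorm (stack v - (avg v)^T *m const_mx (n := n) 1).

(* C1, C2 stand for the constants hidden in a = Theta(b). *)
Definition theta_between (C1 C2 a b : R) : Prop :=
  C1 * `|b| <= `|a| <= C2 * `|b|.

End Calculus.

(* [grad_f i x y xi], [grad_g i x y psi] are the stochastic gradients of agent
   i with respect to the joint variable (x, y); x comes first. *)
Record problem (R : realType) (n p q : nat)
    (dX : measure_display) (X : measurableType dX)
    (dY : measure_display) (Y : measurableType dY) := Problem {
  lawf : 'I_n -> probability X R ;
  lawg : 'I_n -> probability Y R ;
  Floss : 'rV[R]_p -> 'rV[R]_q -> X -> R ;
  Gloss : 'rV[R]_p -> 'rV[R]_q -> Y -> R ;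
  grad_f : 'I_n -> 'rV[R]_p -> 'rV[R]_q -> X -> 'rV[R]_(p + q) ;
  grad_g : 'I_n -> 'rV[R]_p -> 'rV[R]_q -> Y -> 'rV[R]_(p + q) }.

Section Objective.
Context {R : realType} {n p q : nat}
  {dX : measure_display} {X : measurableType dX}
  {dY : measure_display} {Y : measurableType dY}.
Variable pb : problem R n p q X Y.

Definition fi (i : 'I_n) (x : 'rV[R]_p) (y : 'rV[R]_q) : R :=
  fine ('E_(lawf pb i)[Floss pb x y])%E.

Definition gi (i : 'I_n) (x : 'rV[R]_p) (y : 'rV[R]_q) : R :=
  fine ('E_(lawg pb i)[Gloss pb x y])%E.

Definition favg (x : 'rV[R]_p) (y : 'rV[R]_q) : R := n%:R^-1 * \sum_i fi i x y.
Definition gavg (x : 'rV[R]_p) (y : 'rV[R]_q) : R := n%:R^-1 * \sum_i gi i x y.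

(* Both y^*(x) and z_*(x). *)
Definition lower_sol (x : 'rV[R]_p) : 'rV[R]_q := argmin (gavg x).

Definition Phi (x : 'rV[R]_p) : R := favg x (lower_sol x).

Definition Lagr (alpha : R) (x : 'rV[R]_p) (y z : 'rV[R]_q) : R :=
  n%:R^-1 * \sum_i (fi i x y + alpha * (gi i x y - gi i x z)).

Definition Omega (alpha : R) (x : 'rV[R]_p) (y : 'rV[R]_q) : R :=
  sup [set Lagr alpha x y z | z in [set: 'rV[R]_q]].

Definition penalty_sol (alpha : R) (x : 'rV[R]_p) : 'rV[R]_q :=
  argmin (Omega alpha x).

Definition smoothness (lf0 lf1 lf2 lg1 lg2 mug : R) : Prop :=
  forall i : 'I_n,
  [/\ forall x y y', `|fi i x y - fi i x y'| <= lf0 * fnorm (y - y'),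
      lipschitz_gradient lf1 (joint (fi i)) /\
        lipschitz_hessian lf2 (joint (fi i)),
      lipschitz_gradient lg1 (joint (gi i)) /\
        lipschitz_hessian lg2 (joint (gi i)) &
      forall x, strongly_convex mug (gi i x)].

(* Well-posedness of the expectations and of the random gradients. The joint
   variable ranges over R^(p+q) with its Borel sigma-algebra. *)
Definition regular_oracles : Prop :=
  forall i : 'I_n,
  [/\ forall x y, (lawf pb i).-integrable setT (EFin \o Floss pb x y),
      forall x y, (lawg pb i).-integrable setT (EFin \o Gloss pb x y),
      forall k, measurable_fun setT
        (fun a : g_sigma_algebraType (@open 'rV[R]_(p + q)) * X =>
           let w : 'rV[R]_(p + q) := a.1 in
           grad_f pb i (lsubmx w) (rsubmx w) a.2 0 k) &
      forall k, measurable_fun setT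
        (fun a : g_sigma_algebraType (@open 'rV[R]_(p + q)) * Y =>
           let w : 'rV[R]_(p + q) := a.1 in
           grad_g pb i (lsubmx w) (rsubmx w) a.2 0 k)].

Definition unbiased_oracles : Prop :=
  forall (i : 'I_n) (x : 'rV[R]_p) (y : 'rV[R]_q) (k : 'I_(p + q)),
  [/\ (lawf pb i).-integrable setT (fun xi => (grad_f pb i x y xi 0 k)%:E),
      ('E_(lawf pb i)[fun xi => (grad_f pb i x y xi 0 k)%R])%E =
        (grad (joint (fi i)) (row_mx x y) 0 k)%:E,
      (lawg pb i).-integrable setT (fun psi => (grad_g pb i x y psi 0 k)%:E) &
      ('E_(lawg pb i)[fun psi => (grad_g pb i x y psi 0 k)%R])%E =
        (grad (joint (gi i)) (row_mx x y) 0 k)%:E].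

Definition bounded_variance (sf sg : R) : Prop :=
  forall (i : 'I_n) (x : 'rV[R]_p) (y : 'rV[R]_q),
  ('E_(lawf pb i)[fun xi => (fnorm (grad_f pb i x y xi
      - grad (joint (fi i)) (row_mx x y)) ^+ 2)%R] <= (sf ^+ 2)%:E)%E /\
  ('E_(lawg pb i)[fun psi => (fnorm (grad_g pb i x y psi
      - grad (joint (gi i)) (row_mx x y)) ^+ 2)%R] <= (sg ^+ 2)%:E)%E.

End Objective.

(* The eigenvalues, with multiplicity, are the nonincreasing list [lam] of
   roots of the characteristic polynomial: lambda_k is [lam`_k.-1]. Since
   lambda_1 = 1, the condition rho < 1 excludes n <= 1. *)
Definition mixing_matrix (R : realType) n (W : 'M[R]_n) (rho : R) : Prop :=
  [/\ W^T = W,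
      forall i j, 0 <= W i j,
      (forall i, \sum_j W i j = 1) /\ (forall j, \sum_i W i j = 1),
      exists lam : seq R,
        [/\ size lam = n,
            sorted (fun a b => b <= a) lam,
            char_poly W = \prod_(l <- lam) ('X - l%:P),
            lam`_0 = 1 &
            rho = Num.max `|lam`_1| `|lam`_n.-1| ] &
      rho < 1].

Record init_data (R : realType) (n p q : nat) := InitData {
  x0 : 'rV[R]_p ; y0 : 'rV[R]_q ; z0 : 'rV[R]_q ;
  u0y : 'I_n -> 'rV[R]_q ; h0y : 'I_n -> 'rV[R]_q ;
  u0z : 'I_n -> 'rV[R]_q ; h0z : 'I_n -> 'rV[R]_q }.

Record inner_state (R : realType) (n q : nat) := InnerState {
  it_theta : 'I_n -> 'rV[R]_q ;
  it_u : 'I_n -> 'rV[R]_q ;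
  it_h : 'I_n -> 'rV[R]_q }.

Record state (R : realType) (n p q : nat) := State {
  st_x : 'I_n -> 'rV[R]_p ;
  st_v : 'I_n -> 'rV[R]_p ;
  st_delta : 'I_n -> 'rV[R]_p ;
  st_y : 'I_n -> 'rV[R]_q ;
  st_uy : 'I_n -> 'rV[R]_q ;
  st_hy : 'I_n -> 'rV[R]_q ;
  st_z : 'I_n -> 'rV[R]_q ;
  st_uz : 'I_n -> 'rV[R]_q ;
  st_hz : 'I_n -> 'rV[R]_q }.

(* Samples are indexed by the outer iteration s, the inner iteration t when
   there is one, and the agent. The y-loop calls the oracles of f_i and g_i,
   the z-loop that of g_i, and the direction delta calls those of f_i and g_i,
   with one sample psi for both gradients of g_i. *)
Record samples (R : realType) (n : nat)
    (dO : measure_display) (O : measurableType dO)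
    (dX : measure_display) (X : measurableType dX)
    (dY : measure_display) (Y : measurableType dY) := Samples {
  xi_y : nat -> nat -> 'I_n -> {mfun O >-> X} ;
  psi_y : nat -> nat -> 'I_n -> {mfun O >-> Y} ;
  psi_z : nat -> nat -> 'I_n -> {mfun O >-> Y} ;
  xi_x : nat -> 'I_n -> {mfun O >-> X} ;
  psi_x : nat -> 'I_n -> {mfun O >-> Y} }.

Section Algorithm.
Context {R : realType} {n p q : nat}
  {dO : measure_display} {O : measurableType dO}
  {dX : measure_display} {X : measurableType dX}
  {dY : measure_display} {Y : measurableType dY}.
Variables (pb : problem R n p q X Y) (W : 'M[R]_n).

Definition mix m (v : 'I_n -> 'rV[R]_m) (i : 'I_n) : 'rV[R]_m :=
  \sum_j W i j *: v j.

(* [oracle t i theta] is the stochastic gradient of phi_i at theta used in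
   iteration t. *)
Fixpoint inner_loop (gamma : R) (oracle : nat -> 'I_n -> 'rV[R]_q -> 'rV[R]_q)
    (st : inner_state R n q) (T : nat) : inner_state R n q :=
  if T is t.+1 then
    let st' := inner_loop gamma oracle st t in
    let h i := oracle t i (it_theta st' i) in
    let u i := mix (it_u st') i + h i - it_h st' i in
    InnerState (fun i => mix (it_theta st') i - gamma *: u i) u h
  else st.

Definition init_state (d : init_data R n p q) : state R n p q :=
  State (fun=> x0 d) (fun=> 0) (fun=> 0)
        (fun=> y0 d) (u0y d) (h0y d) (fun=> z0 d) (u0z d) (h0z d).

Variable sm : samples R n O X Y.
Variables (alpha etax etay etaz : R) (T : nat).

Definition outer_step (s : nat) (w : O) (st : state R n p q) : state R n p q :=
  let oracle_y t i th :=
    rsubmx (grad_f pb i (st_x st i) th (xi_y sm s t i w)) +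
    alpha *: rsubmx (grad_g pb i (st_x st i) th (psi_y sm s t i w)) in
  let oracle_z t i th :=
    rsubmx (grad_g pb i (st_x st i) th (psi_z sm s t i w)) in
  let sy :=
    inner_loop etay oracle_y (InnerState (st_y st) (st_uy st) (st_hy st)) T in
  let sz :=
    inner_loop etaz oracle_z (InnerState (st_z st) (st_uz st) (st_hz st)) T in
  let delta i :=
    lsubmx (grad_f pb i (st_x st i) (st_y st i) (xi_x sm s i w)) +
    alpha *: (lsubmx (grad_g pb i (st_x st i) (st_y st i) (psi_x sm s i w)) -
              lsubmx (grad_g pb i (st_x st i) (st_z st i) (psi_x sm s i w))) in
  let v i := mix (st_v st) i + delta i - st_delta st i in
  State (fun i => mix (st_x st) i - etax *: v i) v delta
        (it_theta sy) (it_u sy) (it_h sy) (it_theta sz) (it_u sz) (it_h sz).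

Fixpoint dsgda_gt (d : init_data R n p q) (s : nat) (w : O) : state R n p q :=
  if s is s'.+1 then outer_step s' w (dsgda_gt d s' w) else init_state d.

End Algorithm.

Section Conditional.
Context {R : realType} {d : measure_display} {O : measurableType d}.
Variable P : probability O R.

(* Z is a version of E[V | G]. *)
Definition cond_exp (G : set (set O)) (V Z : O -> R) : Prop :=
  [/\ P.-integrable setT (EFin \o V),
      P.-integrable setT (EFin \o Z),
      forall B : set R, measurable B -> G (Z @^-1` B) &
      forall A, G A ->
        (\int[P]_(w in A) (V w)%:E = \int[P]_(w in A) (Z w)%:E)%E].

Definition cond_prob (G : set (set O)) (A : set O) (Z : O -> R) : Prop :=
  cond_exp G (\1_A) Z.

Definition cond_law (G : set (set O)) (d' : measure_display)
    (X : measurableType d') (V : O -> X) (mu : probability X R) : Prop :=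
  forall B, measurable B -> cond_prob G (V @^-1` B) (cst (fine (mu B))).

Definition cond_independent (G : set (set O)) (K : finType)
    (E : K -> set (set O)) : Prop :=
  forall (A : K -> set O) (Z : K -> O -> R),
    (forall k, E k (A k)) -> (forall k, cond_prob G (A k) (Z k)) ->
    cond_prob G (\bigcap_(k in [set: K]) A k) (fun w => \prod_k Z k w).

End Conditional.

Section Sampling.
Context {R : realType} {n p q : nat}
  {dO : measure_display} {O : measurableType dO}
  {dX : measure_display} {X : measurableType dX}
  {dY : measure_display} {Y : measurableType dY}.
Variables (P : probability O R) (pb : problem R n p q X Y).

Definition iterate_coords (run : nat -> O -> state R n p q) (s : nat) :
    set (O -> R) :=
  [set c | exists r i, (r <= s)%N /\
    ((exists k, [\/ c = (fun w => st_x (run r w) i 0 k),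
                    c = (fun w => st_v (run r w) i 0 k) |
                    c = (fun w => st_delta (run r w) i 0 k)]) \/
     (exists k, [\/ c = (fun w => st_y (run r w) i 0 k),
                    c = (fun w => st_uy (run r w) i 0 k) |
                    c = (fun w => st_hy (run r w) i 0 k)]) \/
     (exists k, [\/ c = (fun w => st_z (run r w) i 0 k),
                    c = (fun w => st_uz (run r w) i 0 k) |
                    c = (fun w => st_hz (run r w) i 0 k)]))].

(* F_s. *)
Definition history (run : nat -> O -> state R n p q) (s : nat) : set (set O) :=
  <<s \bigcup_(c in iterate_coords run s)
        preimage_set_system setT c (@measurable _ R) >>.

(* The oracle calls of one outer iteration: xi_y, psi_y, psi_z, xi_x, psi_x. *)
Definition call (T : nat) : finType :=
  ('I_T * 'I_n + 'I_T * 'I_n + 'I_T * 'I_n + 'I_n + 'I_n)%type.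

Definition call_events (sm : samples R n O X Y) (T s : nat) (k : call T) :
    set (set O) :=
  match k with
  | inl (inl (inl (inl a))) =>
      preimage_set_system setT (xi_y sm s a.1 a.2) measurable
  | inl (inl (inl (inr a))) =>
      preimage_set_system setT (psi_y sm s a.1 a.2) measurable
  | inl (inl (inr a)) =>
      preimage_set_system setT (psi_z sm s a.1 a.2) measurable
  | inl (inr i) => preimage_set_system setT (xi_x sm s i) measurable
  | inr i => preimage_set_system setT (psi_x sm s i) measurable
  end.

(* Given F_s, the samples drawn at outer iteration s follow the agents' laws
   and are independent. *)
Definition fresh_samples (sm : samples R n O X Y)
    (run : nat -> O -> state R n p q) (T S : nat) : Prop :=
  forall s, (s < S)%N ->
  [/\ forall t i, (t < T)%N ->
        [/\ cond_law P (history run s) (xi_y sm s t i) (lawf pb i),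
            cond_law P (history run s) (psi_y sm s t i) (lawg pb i) &
            cond_law P (history run s) (psi_z sm s t i) (lawg pb i)],
      forall i, cond_law P (history run s) (xi_x sm s i) (lawf pb i) /\
                cond_law P (history run s) (psi_x sm s i) (lawg pb i) &
      cond_independent P (history run s) (@call_events sm T s)].

Definition bounded_direction (run : nat -> O -> state R n p q)
    (S : nat) (cd alpha : R) : Prop :=
  forall s, (s < S)%N ->
  exists2 Z, cond_exp P (history run s)
               (fun w => fnorm (avg (st_delta (run s.+1 w))) ^+ 2) Z &
             {ae P, forall w, Z w <= cd * alpha ^+ 2}.

Definition admissible_init (d : init_data R n p q) : Prop :=
  avg (u0y d) = avg (h0y d) /\ avg (u0z d) = avg (h0z d).

(* Size, averaged over the agents, of the initial data entering the first
   iteration: the tracking variables and the gradients at the starting point. *)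
Definition init_size (d : init_data R n p q) : R :=
  n%:R^-1 * \sum_i
    (fnorm (u0y d i) ^+ 2 + fnorm (h0y d i) ^+ 2 +
     fnorm (u0z d i) ^+ 2 + fnorm (h0z d i) ^+ 2 +
     fnorm (grad (joint (fi pb i)) (row_mx (x0 d) (y0 d))) ^+ 2 +
     fnorm (grad (joint (gi pb i)) (row_mx (x0 d) (y0 d))) ^+ 2 +
     fnorm (grad (joint (gi pb i)) (row_mx (x0 d) (z0 d))) ^+ 2).

Definition warm_start (d : init_data R n p q) (alpha Cw : R) : Prop :=
  let st := init_state d in
  Num.max (fnorm (avg (st_y st) - penalty_sol pb alpha (avg (st_x st))) ^+ 2)
          (fnorm (avg (st_z st) - lower_sol pb (avg (st_x st))) ^+ 2)
    <= Cw * `|1 / alpha|.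

End Sampling.

(* Main.v *)
Require Import Defs.
From mathcomp Require Import all_boot all_order all_algebra.
From mathcomp Require Import all_classical all_reals all_analysis.
From mathcomp Require Import measurable_realfun complex spectral sesquilinear ring lra zify.

Set Implicit Arguments.
Unset Strict Implicit.
Unset Printing Implicit Defensive.

Import Order.TTheory GRing.Theory Num.Theory.
Import numFieldNormedType.Exports.

Local Open Scope classical_set_scope.
Local Open Scope ring_scope.

(** Each agent carries the joint state w_i = (x_i, y_i, z_i), and an iteration is a
    step of gradient tracking on the matrix w with rows w_i:
      H' = G(w) + noise,  U' = W U + H' - H,  w' = W w - U',
    where G acts on row i by the scaled direction of agent i ([Gst]: eta_x times the
    direction in x, eta_y and eta_z times the gradients in y and z). With
    A = (1 - rho^2)^(1/2) (nS)^(1/7) and B = (1 - rho^2)^(3/2) n^(3/7) / S^(4/7), the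
    multiplier alpha is of order A, the step eta_z of order B and eta_x, eta_y of order
    B / A. So G, its derivative and the noise are all of order B.

    Write g for the average of the fields G_i and wbar for the mean row. Then wbar moves
    by - (g(wbar) + b + mean noise), where the bias b is the average of the G_i at the
    agents' points minus their average at wbar ([mean_step]). Two estimates are
    combined.

    Descent. The potential V(x, y, z) = f(x, y) + a g(x, y) + a g(x, z) - 2 a min g(x, _),
    with a = alpha, decreases along the direction: its parts in y and z are gradients of
    V, and the error made in x by using z in place of the lower-level solution is paid
    for by the part in z, as eta_x is a small multiple of eta_z / a ([pot_descent]). V
    lies above the penalized value, hence is bounded below, and a warm start puts it
    within O(1) of that bound. So the sum of E|g(wbar)|^2 is bounded by the initial gap,
    the noise and the sum of E|b|^2, with the rate A / B ([descent_sum]).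

    Bias. The deviation of the rows from their mean is the response to past noise plus a
    drift. The drift is bounded path by path by contraction ([drift_sum]). Noise older
    than a window a little longer than 1 / (1 - rho^2) is forgotten. For the noise of
    the window, wbar is frozen at its beginning and the oracle calls are revealed one at
    a time: to first order each call changes the average of the G_i by an increment that
    is centered given the previous calls, so that the variances add up and the result
    has a factor 1 / n ([reveal_one], [near_bound]). The second-order terms are smaller.
    In the resulting bound on the sum of E|b|^2 the sum of E|g(wbar)|^2 reappears with a
    small factor ([bias_sum]).

    With the prescribed rates both estimates together give an average of E|g(wbar)|^2 of
    order B^2 / A^4 ([gradient_rate]). The gradient of the penalized value is at most a
    constant times A / B times |g(wbar)| ([Ga_le_mdir]), and it differs from grad Phi by
    O(1 / A) ([grad_Phi_close]). The latter holds because the gradients of the penalized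
    values form a Cauchy family of rate 1 / a, by an expansion of the stationarity
    conditions with the Hessian of g ([Ga_cauchy]); this also provides the derivatives
    of Phi, as limits ([grad_limit]). So some iterate has E|grad Phi(xbar)| = O(1 / A),
    which is the claimed rate.

    This needs A above a constant ([k_large]). Below it the rate is of order 1 and the
    initial point will do, since grad Phi is bounded where Phi can decrease by at most a
    constant ([grad_bounded]). As all agents start at the same point, the initial iterate
    also has consensus error 0. *)

(** * Euclidean inner product and norm of matrices *)

Section Euclid.
Context {R : realType}.

Definition dotp m n (A B : 'M[R]_(m, n)) : R := \sum_i \sum_j A i j * B i j.

Section Generic.
Variables m n : nat.
Implicit Types A B C : 'M[R]_(m, n).

Lemma dotpC A B : dotp A B = dotp B A.
Proof. by apply: eq_bigr => i _; apply: eq_bigr => j _; rewrite mulrC. Qed.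

Lemma dotpDl A B C : dotp (A + B) C = dotp A C + dotp B C.
Proof.
rewrite -big_split; apply: eq_bigr => i _; rewrite -big_split.
by apply: eq_bigr => j _; rewrite mxE mulrDl.
Qed.

Lemma dotpZl (a : R) A B : dotp (a *: A) B = a * dotp A B.
Proof.
rewrite mulr_sumr; apply: eq_bigr => i _; rewrite mulr_sumr.
by apply: eq_bigr => j _; rewrite mxE mulrA.
Qed.

Lemma dotpDr A B C : dotp A (B + C) = dotp A B + dotp A C.
Proof. by rewrite dotpC dotpDl !(dotpC A). Qed.
Lemma dotpZr (a : R) A B : dotp A (a *: B) = a * dotp A B.
Proof. by rewrite dotpC dotpZl (dotpC A). Qed.
Lemma dotpNl A B : dotp (- A) B = - dotp A B.
Proof. by rewrite -scaleN1r dotpZl mulN1r. Qed.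
Lemma dotpNr A B : dotp A (- B) = - dotp A B.
Proof. by rewrite dotpC dotpNl dotpC. Qed.
Lemma dotpBl A B C : dotp (A - B) C = dotp A C - dotp B C.
Proof. by rewrite dotpDl dotpNl. Qed.
Lemma dotp0l A : dotp 0 A = 0.
Proof. by rewrite -(scale0r A) dotpZl mul0r. Qed.
Lemma dotp0r A : dotp A 0 = 0.
Proof. by rewrite dotpC dotp0l. Qed.

Lemma dotp_suml (I : Type) (r : seq I) (Q : pred I) (F : I -> 'M[R]_(m, n)) A :
  dotp (\sum_(i <- r | Q i) F i) A = \sum_(i <- r | Q i) dotp (F i) A.
Proof.
exact: (big_morph (fun X => dotp X A) (fun x y => dotpDl x y A) (dotp0l A)).
Qed.

Lemma dotp_sumr (I : Type) (r : seq I) (Q : pred I) (F : I -> 'M[R]_(m, n)) A :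
  dotp A (\sum_(i <- r | Q i) F i) = \sum_(i <- r | Q i) dotp A (F i).
Proof. by rewrite dotpC dotp_suml; apply: eq_bigr => i _; rewrite dotpC. Qed.

Lemma fnorm_sq A : fnorm A ^+ 2 = dotp A A.
Proof.
rewrite /fnorm sqr_sqrtr; last by apply: sumr_ge0 => i _; apply: sumr_ge0 => j _; rewrite sqr_ge0.
by [].
Qed.

Lemma fnorm_ge0 A : 0 <= fnorm A. Proof. exact: sqrtr_ge0. Qed.
Hint Resolve fnorm_ge0 : core.

Lemma fnorm0 : fnorm (0 : 'M[R]_(m, n)) = 0.
Proof. by apply/eqP; rewrite -sqrf_eq0 fnorm_sq dotp0l. Qed.

Lemma entry_le_fnorm A i j : `|A i j| <= fnorm A.
Proof.
rewrite -(ler_pXn2r (n := 2)) ?nnegrE // fnorm_sq real_normK ?num_real //.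
rewrite /dotp (bigD1 i) //= (bigD1 j) //= -expr2 -addrA lerDl addr_ge0 //.
  by apply: sumr_ge0 => k _; rewrite -expr2 sqr_ge0.
by apply: sumr_ge0 => k _; apply: sumr_ge0 => l _; rewrite -expr2 sqr_ge0.
Qed.

Lemma fnorm_eq0 A : fnorm A = 0 -> A = 0.
Proof.
move=> h; apply/matrixP => i j; rewrite mxE; apply/eqP; rewrite -normr_le0.
by rewrite -h entry_le_fnorm.
Qed.

Lemma fnormZ (a : R) A : fnorm (a *: A) = `|a| * fnorm A.
Proof.
apply/eqP; rewrite -(eqrXn2 (n := 2)) ?mulr_ge0 //.
by rewrite exprMn real_normK ?num_real // !fnorm_sq dotpZl dotpZr mulrA expr2.
Qed.

Lemma fnormN A : fnorm (- A) = fnorm A.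
Proof. by rewrite -scaleN1r fnormZ normrN1 mul1r. Qed.

Lemma fnormC A B : fnorm (A - B) = fnorm (B - A).
Proof. by rewrite -fnormN opprB. Qed.

Lemma fnorm_sqD A B :
  fnorm (A + B) ^+ 2 = fnorm A ^+ 2 + 2 * dotp A B + fnorm B ^+ 2.
Proof. by rewrite !fnorm_sq dotpDl !dotpDr (dotpC B A); ring. Qed.

Lemma fnorm_sqB A B :
  fnorm (A - B) ^+ 2 = fnorm A ^+ 2 - 2 * dotp A B + fnorm B ^+ 2.
Proof. by rewrite fnorm_sqD dotpNr fnormN; ring. Qed.

Lemma dotp_le A B : dotp A B <= fnorm A * fnorm B.
Proof.
have [A0|A0] := eqVneq (fnorm A) 0; first by rewrite (fnorm_eq0 A0) dotp0l fnorm0 mul0r.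
have [B0|B0] := eqVneq (fnorm B) 0; first by rewrite (fnorm_eq0 B0) dotp0r fnorm0 mulr0.
have Ap : 0 < fnorm A by rewrite lt_def A0 fnorm_ge0.
have Bp : 0 < fnorm B by rewrite lt_def B0 fnorm_ge0.
have := sqr_ge0 (fnorm (fnorm B *: A - fnorm A *: B)).
rewrite fnorm_sqB !fnormZ !ger0_norm // dotpZl dotpZr !exprMn => h.
have : 0 <= 2 * (fnorm A * fnorm B) * (fnorm A * fnorm B - dotp A B) by nra.
by rewrite pmulr_rge0 ?subr_ge0 // mulr_gt0 // mulr_gt0.
Qed.

Lemma dotp_norm A B : `|dotp A B| <= fnorm A * fnorm B.
Proof.
rewrite ler_norml dotp_le andbT -(fnormN A) lerNl -dotpNl; exact: dotp_le.
Qed.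

Lemma ler_fnormD A B : fnorm (A + B) <= fnorm A + fnorm B.
Proof.
rewrite -(ler_pXn2r (n := 2)) ?nnegrE ?addr_ge0 // fnorm_sqD.
have := dotp_le A B; nra.
Qed.

Lemma ler_fnormB A B : fnorm (A - B) <= fnorm A + fnorm B.
Proof. by rewrite -(fnormN B) ler_fnormD. Qed.

Lemma ler_fnorm_dist A B : fnorm A - fnorm B <= fnorm (A - B).
Proof. by rewrite lerBlDr -{1}(subrK B A) ler_fnormD. Qed.

Lemma ler_dist_fnorm A B : `|fnorm A - fnorm B| <= fnorm (A - B).
Proof.
by rewrite ler_norml ler_fnorm_dist andbT lerNl opprB fnormC ler_fnorm_dist.
Qed.

Lemma ler_fnorm_sum (I : Type) (r : seq I) (Q : pred I) (F : I -> 'M[R]_(m, n)) :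
  fnorm (\sum_(i <- r | Q i) F i) <= \sum_(i <- r | Q i) fnorm (F i).
Proof.
apply: (big_ind2 (fun (X : 'M[R]_(m, n)) (y : R) => fnorm X <= y)) => //.
  by rewrite fnorm0.
by move=> x1 x2 y1 y2 h1 h2; apply: le_trans (ler_fnormD _ _) _; rewrite lerD.
Qed.

Lemma fnorm_sqD2 A B : fnorm (A + B) ^+ 2 <= 2 * fnorm A ^+ 2 + 2 * fnorm B ^+ 2.
Proof. have := sqr_ge0 (fnorm (A - B)); rewrite fnorm_sqB fnorm_sqD; lra. Qed.

Lemma fnorm_sqB2 A B : fnorm (A - B) ^+ 2 <= 2 * fnorm A ^+ 2 + 2 * fnorm B ^+ 2.
Proof. by rewrite -(fnormN B) fnorm_sqD2. Qed.

Lemma fnorm_sq_le A c : 0 <= c -> fnorm A ^+ 2 <= c ^+ 2 -> fnorm A <= c.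
Proof. by move=> c0; rewrite ler_pXn2r ?nnegrE. Qed.

Lemma fnorm_dual A c : 0 <= c -> (forall B, dotp A B <= c * fnorm B) -> fnorm A <= c.
Proof.
move=> c0 h; have [->//|A0] := eqVneq (fnorm A) 0.
have Ap : 0 < fnorm A by rewrite lt_def A0 fnorm_ge0.
by have := h A; rewrite -fnorm_sq expr2 ler_pM2r.
Qed.

Lemma fnorm_sqE A : fnorm A ^+ 2 = \sum_i \sum_j A i j ^+ 2.
Proof. by rewrite fnorm_sq. Qed.

Lemma fnorm_le_entries A : fnorm A <= \sum_i \sum_j `|A i j|.
Proof.
have -> : A = \sum_i \sum_j A i j *: delta_mx i j by exact: matrix_sum_delta.
apply: le_trans (ler_fnorm_sum _ _ _) _; rewrite -matrix_sum_delta; apply: ler_sum => i _.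
apply: le_trans (ler_fnorm_sum _ _ _) _; apply: ler_sum => j _; rewrite fnormZ.
rewrite ler_piMr // /fnorm (bigD1 i) //= (bigD1 j) //= !mxE !eqxx expr1n.
rewrite !big1 ?addr0 ?sqrtr1 // => [k /negbTE nk|k /negbTE nk].
  by rewrite big1 // => l _; rewrite mxE nk andFb expr0n.
by rewrite mxE nk andbF expr0n.
Qed.

End Generic.

Lemma fnorm_sq_rows m n (A : 'M[R]_(m, n)) : fnorm A ^+ 2 = \sum_i fnorm (row i A) ^+ 2.
Proof.
rewrite fnorm_sqE; apply: eq_bigr => i _; rewrite fnorm_sqE big_ord1.
by apply: eq_bigr => j _; rewrite mxE.
Qed.

Lemma dotp_mulmxl m n k (A : 'M[R]_(m, n)) (B : 'M[R]_(n, k)) C :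
  dotp (A *m B) C = dotp A (C *m B^T).
Proof.
apply: eq_bigr => i _.
transitivity (\sum_j \sum_l A i l * B l j * C i j).
  by apply: eq_bigr => j _; rewrite mxE mulr_suml.
rewrite exchange_big; apply: eq_bigr => l _; rewrite mxE mulr_sumr.
by apply: eq_bigr => j _; rewrite mxE; ring.
Qed.

Lemma dotp_row_mx m n1 n2 (A B : 'M[R]_(m, n1)) (A' B' : 'M[R]_(m, n2)) :
  dotp (row_mx A A') (row_mx B B') = dotp A B + dotp A' B'.
Proof.
rewrite -big_split; apply: eq_bigr => i _; rewrite big_split_ord /=.
by congr (_ + _); apply: eq_bigr => j _; rewrite ?row_mxEl ?row_mxEr.
Qed.

Lemma fnorm_row_mx m n1 n2 (A : 'M[R]_(m, n1)) (A' : 'M[R]_(m, n2)) :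
  fnorm (row_mx A A') ^+ 2 = fnorm A ^+ 2 + fnorm A' ^+ 2.
Proof. by rewrite !fnorm_sq dotp_row_mx. Qed.

Lemma fnorm_lsub m n1 n2 (A : 'M[R]_(m, n1 + n2)) : fnorm (lsubmx A) <= fnorm A.
Proof.
rewrite -(ler_pXn2r (n := 2)) ?nnegrE ?fnorm_ge0 // -[in leRHS](hsubmxK A) fnorm_row_mx.
by rewrite lerDl sqr_ge0.
Qed.

Lemma fnorm_rsub m n1 n2 (A : 'M[R]_(m, n1 + n2)) : fnorm (rsubmx A) <= fnorm A.
Proof.
rewrite -(ler_pXn2r (n := 2)) ?nnegrE ?fnorm_ge0 // -[in leRHS](hsubmxK A) fnorm_row_mx.
by rewrite lerDr sqr_ge0.
Qed.

Lemma fnorm_row_mxl0 m n1 n2 (A : 'M[R]_(m, n1)) :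
  fnorm (row_mx A (0 : 'M[R]_(m, n2))) = fnorm A.
Proof.
apply/eqP; rewrite -(eqrXn2 (n := 2)) ?fnorm_ge0 // fnorm_row_mx fnorm0.
by rewrite expr0n addr0.
Qed.
Lemma fnorm_row_mxr0 m n1 n2 (A : 'M[R]_(m, n2)) :
  fnorm (row_mx (0 : 'M[R]_(m, n1)) A) = fnorm A.
Proof.
apply/eqP; rewrite -(eqrXn2 (n := 2)) ?fnorm_ge0 // fnorm_row_mx fnorm0.
by rewrite expr0n add0r.
Qed.

Lemma fnorm_mulmx m n k (A : 'M[R]_(m, n)) (B : 'M[R]_(n, k)) :
  fnorm (A *m B) <= fnorm A * fnorm B.
Proof.
rewrite -(ler_pXn2r (n := 2)) ?nnegrE ?mulr_ge0 ?fnorm_ge0 //.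
rewrite exprMn !fnorm_sqE mulr_suml; apply: ler_sum => i _.
rewrite exchange_big /= mulr_sumr; apply: ler_sum => j _.
have := dotp_norm (row i A) (col j B)^T.
have -> : dotp (row i A) (col j B)^T = (A *m B) i j.
  by rewrite /dotp big_ord1 mxE; apply: eq_bigr => l _; rewrite !mxE.
move=> h; rewrite -real_normK ?num_real //.
apply: le_trans (_ : (fnorm (row i A) * fnorm (col j B)^T) ^+ 2 <= _).
  by rewrite ler_pXn2r // ?nnegrE ?mulr_ge0 ?fnorm_ge0.
rewrite exprMn.
rewrite !fnorm_sqE !big_ord1 le_eqVlt; apply/orP; left; apply/eqP.
by congr (_ * _); apply: eq_bigr => l _; rewrite !mxE.
Qed.

(** The topology on vectors is that of the max norm; these two bounds carry
    continuity over to it. *)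
Lemma fnorm_le_mxnorm m (A : 'rV[R]_m) : fnorm A <= m%:R * `|A|.
Proof.
apply: le_trans (fnorm_le_entries A) _; rewrite big_ord1.
rewrite -[X in X%:R * _]card_ord -sumr_const mulr_suml; apply: ler_sum => j _.
rewrite mul1r /Num.Def.normr /= mx_normrE.
by apply: (le_bigmax_cond _ (fun ij : 'I_1 * 'I_m => `|A ij.1 ij.2|) (j := (0, j))).
Qed.

Lemma mxnorm_le_fnorm m (A : 'rV[R]_m) : `|A| <= fnorm A.
Proof.
rewrite /Num.Def.normr /= mx_normrE; apply/bigmax_leP; split; first exact: fnorm_ge0.
by move=> ij _; exact: entry_le_fnorm.
Qed.

End Euclid.
#[export] Hint Extern 0 (is_true (_ <= fnorm _)) => exact: fnorm_ge0 : core.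
#[export] Hint Extern 0 (is_true (_ <= fnorm _ ^+ 2)) => exact: sqr_ge0 : core.

(** * Quadratic models and Lipschitz fields *)

Section Calculus.
Context {R : realType}.

(** First-order expansion with gradient field G and quadratic error: the form of
    smoothness that passes to values of partial minimizations ([value_qb]) without
    any differentiability argument. *)
Definition qb m (C : R) (h : 'rV[R]_m -> R) (G : 'rV[R]_m -> 'rV[R]_m) : Prop :=
  forall w v : 'rV[R]_m, `|h (w + v) - h w - dotp (G w) v| <= C * fnorm v ^+ 2.

(** Vectors are rows, so the derivative [J w] acts on the right. *)
Definition taylor m k (C : R) (G : 'rV[R]_m -> 'rV[R]_k) (J : 'rV[R]_m -> 'M[R]_(m, k)) : Prop :=
  forall w v : 'rV[R]_m, fnorm (G (w + v) - G w - v *m J w) <= C * fnorm v ^+ 2.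

Definition lip m k (L : R) (G : 'rV[R]_m -> 'rV[R]_k) : Prop :=
  forall w w' : 'rV[R]_m, fnorm (G w - G w') <= L * fnorm (w - w').

(** Replaces limits: inequalities are derived along a segment of length t, and
    the terms of higher order in t are then dropped. *)
Lemma le_lim0 (a b c : R) : (forall t, 0 < t <= 1 -> a <= b + t * c) -> a <= b.
Proof.
move=> h; rewrite leNgt; apply/negP => ba.
have e0 : 0 < a - b by rewrite subr_gt0.
have c0 : 0 < `|c| + 1 by rewrite ltr_wpDl.
pose t := Num.min 1 ((a - b) / (2 * (`|c| + 1))).
have t0 : 0 < t by rewrite lt_min ltr01 divr_gt0 // mulr_gt0.
have t1 : t <= 1 by rewrite ge_min lexx.
have := h t; rewrite t0 t1 => /(_ isT); apply/negP; rewrite -ltNge.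
have : t * c <= (a - b) / 2.
  apply: le_trans (_ : t * (`|c| + 1) <= _).
    by rewrite ler_wpM2l ?(ltW t0) // ler_wpDr // ler_norm.
  have -> : (a - b) / 2 = (a - b) / (2 * (`|c| + 1)) * (`|c| + 1).
    by field; rewrite gt_eqF // addr_gt0.
  by rewrite ler_wpM2r ?(ltW c0) // /t ge_min lexx orbT.
lra.
Qed.

Lemma fnorm_continuous_at m (f : 'rV[R]_m -> R) (w : 'rV[R]_m) (a b : R) :
  (forall v : 'rV[R]_m, `|f (w + v) - f w| <= a * fnorm v + b * fnorm v ^+ 2) -> {for w, continuous f}.
Proof.
move=> h A /nbhs_ballP[/= e e0 eA].
pose K := `|a| * m%:R + `|b| * m%:R ^+ 2 + 1.
have K0 : 0 < K by rewrite ltr_wpDl // addr_ge0 // mulr_ge0 // exprn_ge0.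
have d0 : 0 < Num.min 1 (e / K) by rewrite lt_min ltr01 divr_gt0.
apply/nbhs_ballP; exists (Num.min 1 (e / K)) => // x; rewrite -ball_normE /= distrC => hx.
apply: eA; rewrite -ball_normE /= distrC -{1}(subrKC w x); apply: le_lt_trans (h _) _.
move: hx; set z := `|x - w|; rewrite lt_min => /andP[/ltW z1 zK].
have z0 : 0 <= z by exact: normr_ge0.
have fz : fnorm (x - w) <= m%:R * z by exact: fnorm_le_mxnorm.
have m0 : 0 <= m%:R :> R by [].
apply: le_lt_trans (_ : K * z < e); last by rewrite mulrC -ltr_pdivlMr.
apply: le_trans (_ : `|a| * (m%:R * z) + `|b| * (m%:R * z) ^+ 2 <= _).
  apply: lerD.
    apply: le_trans (_ : `|a| * fnorm (x - w) <= _).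
      by apply: ler_wpM2r => //; exact: ler_norm.
    by rewrite ler_wpM2l.
  apply: le_trans (_ : `|b| * fnorm (x - w) ^+ 2 <= _).
    by apply: ler_wpM2r => //; exact: ler_norm.
  by rewrite ler_wpM2l // ler_pXn2r // nnegrE // mulr_ge0.
rewrite /K exprMn !mulrDl mul1r mulrA -addrA lerD2l.
have hb : 0 <= `|b| * m%:R ^+ 2 by rewrite mulr_ge0 // exprn_ge0.
have : `|b| * m%:R ^+ 2 * z ^+ 2 <= `|b| * m%:R ^+ 2 * z.
  by apply: ler_wpM2l => //; rewrite expr2 ler_piMl.
by rewrite mulrA; lra.
Qed.

Lemma lip_continuous m (f : 'rV[R]_m -> R) (L : R) :
  (forall w w' : 'rV[R]_m, `|f w - f w'| <= L * fnorm (w - w')) -> continuous f.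
Proof.
move=> h w; apply: (@fnorm_continuous_at _ _ _ L 0) => v.
by rewrite mul0r addr0; apply: le_trans (h _ _) _; rewrite addrAC subrr add0r.
Qed.

Lemma qb_incr m C h (G : 'rV[R]_m -> 'rV[R]_m) w v : qb C h G ->
  `|h (w + v) - h w| <= fnorm (G w) * fnorm v + C * fnorm v ^+ 2.
Proof.
move=> H; rewrite -(subrK (dotp (G w) v) (h (w + v) - h w)).
by apply: le_trans (ler_normD _ _) _; rewrite addrC lerD // dotp_norm.
Qed.

Lemma qb_continuous m C h (G : 'rV[R]_m -> 'rV[R]_m) : qb C h G -> continuous h.
Proof.
by move=> H w; apply: fnorm_continuous_at => v; exact: qb_incr H.
Qed.

Lemma dotp_continuous m (a : 'rV[R]_m) : continuous (fun x : 'rV[R]_m => dotp x a).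
Proof.
apply: (@lip_continuous _ _ (fnorm a)) => w w'.
by rewrite -dotpBl mulrC dotp_norm.
Qed.

Lemma line_is_derive m (f : 'rV[R]_m -> R) (w v : 'rV[R]_m) (t : R) :
  derivable f (w + t *: v) v ->
  is_derive t 1 (fun s : R => f (w + s *: v)) ('D_v f (w + t *: v)).
Proof.
move=> df.
have E : (fun h : R => h^-1 *: (((fun s : R => f (w + s *: v)) \o shift t) (h *: 1) - f (w + t *: v)))
   = (fun h : R => h^-1 *: ((f \o shift (w + t *: v)) (h *: v) - f (w + t *: v))).
  apply/funext => h /=; congr (_ *: (f _ - _)).
  by rewrite [h%:A]mulr1 scalerDl addrCA.
by apply: DeriveDef; rewrite ?/derivable ?/derive E.
Qed.

Lemma derive_grad m (h : 'rV[R]_m -> R) (w v : 'rV[R]_m) :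
  differentiable h w -> 'D_v h w = dotp (grad h w) v.
Proof.
move=> dh; rewrite deriveE // {1}(row_sum_delta v) linear_sum /dotp big_ord1.
by apply: eq_bigr => j _; rewrite linearZ /= mxE deriveE // mulrC.
Qed.

Lemma mvt01 (f df : R -> R) : (forall t : R, is_derive t (1 : R) f (df t)) ->
  exists2 c, 0 <= c <= 1 & f 1 - f 0 = df c.
Proof.
move=> H; have cf : {within `[0, 1], continuous f}.
  by apply: derivable_within_continuous => x _; exact: (@ex_derive _ _ _ _ _ _ _ (H x)).
have [c c01 ->] := @MVT R f df 0 1 ltr01 (fun x _ => H x) cf.
exists c; last by rewrite subr0 mulr1.
by move: c01; rewrite in_itv /= => /andP[/ltW -> /ltW ->].
Qed.

(** Mean value theorem on the segment from w to w + v. *)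
Lemma lipgrad_qb m (L : R) (h : 'rV[R]_m -> R) : 0 <= L ->
  lipschitz_gradient L h -> qb L h (grad h).
Proof.
move=> L0 [dh lh] w v.
have [c /andP[c0 c1]] := @mvt01 (fun s => h (w + s *: v)) (fun s => dotp (grad h (w + s *: v)) v)
   (fun t => is_derive_eq (line_is_derive (diff_derivable (dh _))) (derive_grad _ (dh _))).
rewrite scale1r scale0r addr0 => ->; rewrite -dotpBl.
apply: le_trans (dotp_norm _ _) _; rewrite expr2 mulrA ler_wpM2r //.
apply: le_trans (lh _ _) _; rewrite ler_wpM2l // addrAC subrr add0r fnormZ.
by rewrite ger0_norm // ler_piMl.
Qed.

(** Mean value theorem for the scalar function s |-> <grad h (w + s v), r>, where r
    is the very remainder to be estimated: this choice turns a vector estimate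
    into a scalar one without a factor depending on the dimension. *)
Lemma liphess_taylor m (L : R) (h : 'rV[R]_m -> R) : 0 <= L ->
  lipschitz_hessian L h -> taylor L (grad h) (hessian h).
Proof.
move=> L0 [dh lh] w v; set a := (X in fnorm X).
have der (t : R) : is_derive t 1 (fun s : R => dotp (grad h (w + s *: v)) a)
   (dotp (v *m hessian h (w + t *: v)) a).
  have dg := diff_derivable (v := v) (dh (w + t *: v)).
  have cvq : (fun s : R => s^-1 *: (((fun x => dotp (grad h x) a) \o shift (w + t *: v)) (s *: v)
      - dotp (grad h (w + t *: v)) a)) @ 0^' --> dotp (v *m hessian h (w + t *: v)) a.
    rewrite /hessian -deriveEjacobian //.
    rewrite (_ : (fun s : R => _) = (fun x => dotp x a) \o
      (fun s : R => s^-1 *: (((grad h) \o shift (w + t *: v)) (s *: v) - grad h (w + t *: v)))); last first.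
      by apply/funext => s /=; rewrite dotpZl dotpBl.
    by apply: continuous_cvg; [exact: dotp_continuous | exact: dg].
  have H1 : derivable (fun x => dotp (grad h x) a) (w + t *: v) v.
    by apply/cvg_ex; eexists; exact: cvq.
  apply: is_derive_eq (line_is_derive H1) _.
  by apply: (cvg_lim _ cvq); exact: norm_hausdorff.
have [c /andP[c0 c1]] := mvt01 der.
rewrite scale1r scale0r addr0 -dotpBl => E.
have Ea : fnorm a ^+ 2 = dotp (v *m (hessian h (w + c *: v) - hessian h w)) a.
  by rewrite fnorm_sq {1}/a dotpBl E mulmxBr dotpBl.
have le1 : fnorm a ^+ 2 <= L * fnorm v ^+ 2 * fnorm a.
  rewrite Ea; apply: le_trans (dotp_le _ _) _; rewrite ler_wpM2r //.
  apply: le_trans (fnorm_mulmx _ _) _; rewrite mulrC expr2 mulrA ler_wpM2r //.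
  apply: le_trans (lh _ _) _; rewrite ler_wpM2l // addrAC subrr add0r fnormZ.
  by rewrite ger0_norm // ler_piMl.
have [a0|a0] := eqVneq (fnorm a) 0; first by rewrite a0 mulr_ge0 // exprn_ge0.
by move: le1; rewrite expr2 ler_pM2r // lt_def a0 fnorm_ge0.
Qed.

Lemma lip_mono m k (L L' : R) (G : 'rV[R]_m -> 'rV[R]_k) : L <= L' -> lip L G -> lip L' G.
Proof. by move=> LL h w w'; apply: le_trans (h _ _) _; rewrite ler_wpM2r. Qed.

(** Compare w with w + t (w' - w), divide by t and let t tend to 0. *)
Lemma strconv_first m (mu C : R) (h : 'rV[R]_m -> R) G : qb C h G ->
  strongly_convex mu h -> forall w w' : 'rV[R]_m,
  h w + dotp (G w) (w' - w) + mu / 2 * fnorm (w' - w) ^+ 2 <= h w'.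
Proof.
move=> hq hc w w'; apply: (@le_lim0 _ _ ((C + mu / 2) * fnorm (w' - w) ^+ 2)) => t /andP[t0 t1].
have := hc w' w t; rewrite (ltW t0) t1 => /(_ isT).
have -> : t *: w' + (1 - t) *: w = w + t *: (w' - w).
  by rewrite scalerBl scale1r scalerBr addrC -addrA [- _ + _]addrC.
have := hq w (t *: (w' - w)); rewrite dotpZr fnormZ (ger0_norm (ltW t0)) exprMn.
set D := fnorm _ ^+ 2; rewrite ler_norml => /andP[h1 _] h2.
rewrite -(ler_pM2l t0); nra.
Qed.

(** The hypothesis makes h larger than h 0 outside a large box, which is compact. *)
Lemma exists_min m (h : 'rV[R]_m -> R) (a c : R) : continuous h -> 0 < c ->
  (forall w : 'rV[R]_m, h 0 - a * fnorm w + c * fnorm w ^+ 2 <= h w) ->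
  exists w, forall w', h w <= h w'.
Proof.
move=> ch c0 hh.
pose A := [set w : 'rV[R]_m | fnorm w <= `|a| / c].
have A0 : A 0 by rewrite /A /= fnorm0 divr_ge0 // ltW.
have cf : continuous (@fnorm R 1 m).
  by apply: (@lip_continuous _ _ 1) => w w'; rewrite mul1r ler_dist_fnorm.
have cA : compact A.
  apply: bounded_closed_compact.
    exists (`|a| / c); split; first exact: num_real.
    move=> x hx w Aw; apply: le_trans (mxnorm_le_fnorm _) _.
    exact: le_trans Aw (ltW hx).
  have -> : A = (@fnorm R 1 m) @^-1` [set y | y <= `|a| / c] by [].
  by apply: closed_comp; [move=> x _; exact: cf | exact: closed_le].
have [|w] := @EVT_min_rV R m h A (ex_intro _ 0 A0) cA.
  by apply: continuous_subspaceT.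
rewrite inE => Aw hw; exists w => w'.
have [w'A|w'A] := leP (fnorm w') (`|a| / c); first by apply: hw; rewrite inE.
apply: le_trans (hw 0 _) _; first by rewrite inE.
apply: le_trans (hh w'); rewrite -addrA lerDl.
move: w'A; rewrite ltr_pdivrMr // => w'A.
have f0 := fnorm_ge0 w'.
have := ler_norm a; nra.
Qed.

(** The derivative is a limit of difference quotients of a Lipschitz field. *)
Lemma taylor_bounded m k (L C : R) (G : 'rV[R]_m -> 'rV[R]_k) J : lip L G -> taylor C G J ->
  forall w v : 'rV[R]_m, fnorm (v *m J w) <= L * fnorm v.
Proof.
move=> hl ht w v; apply: (@le_lim0 _ _ (C * fnorm v ^+ 2)) => t /andP[t0 t1].
rewrite -(ler_pM2l t0).
have -> : t * fnorm (v *m J w) = fnorm ((t *: v) *m J w).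
  by rewrite -scalemxAl fnormZ (ger0_norm (ltW t0)).
have := ht w (t *: v); have := hl (w + t *: v) w.
rewrite addrAC subrr add0r fnormZ (ger0_norm (ltW t0)) => h1 h2.
have := ler_fnorm_dist ((t *: v) *m J w) (G (w + t *: v) - G w).
rewrite (fnormC (_ *m _)) => h3; lra.
Qed.

End Calculus.

(** * Differentiating a limit of penalized values *)

Section UniformLimit.
Context {R : realType}.

(** Cutting the segment from w to w + u into N pieces divides the quadratic term
    by N. *)
Lemma subdivision m (k : 'rV[R]_m -> R) (A B : R) :
  (forall w u : 'rV[R]_m, `|k (w + u) - k w| <= A * fnorm u + B * fnorm u ^+ 2) ->
  forall w u : 'rV[R]_m, `|k (w + u) - k w| <= A * fnorm u.
Proof.
move=> h w u; apply: (@le_lim0 _ _ _ (`|B| * fnorm u ^+ 2)) => t /andP[t0 t1].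
have [N hN] : exists N : nat, t^-1 <= N.+1%:R.
  exists (Num.truncn t^-1); apply: ltW; rewrite -truncn_lt_nat //=.
  by rewrite invr_ge0 ltW.
have N0 : 0 < N.+1%:R :> R by rewrite ltr0n.
pose s : R := N.+1%:R^-1.
have s0 : 0 <= s by rewrite invr_ge0 ltW.
have step (j : nat) : `|k (w + (j%:R * s) *: u) - k w| <= j%:R * (A * (s * fnorm u) + B * (s * fnorm u) ^+ 2).
  elim: j => [|j IH]; first by rewrite !mul0r scale0r addr0 subrr normr0.
  have -> : w + (j.+1%:R * s) *: u = (w + (j%:R * s) *: u) + s *: u.
    by rewrite -addrA -scalerDl -natr1 mulrDl mul1r.
  rewrite -(subrKA (k (w + (j%:R * s) *: u))) -natr1 [in leRHS]mulrDl mul1r addrC.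
  apply: le_trans (ler_normD _ _) _; apply: lerD => //.
  by apply: le_trans (h _ _) _; rewrite fnormZ ger0_norm.
have := step N.+1; rewrite /s mulfV ?gt_eqF // scale1r => /le_trans; apply.
have -> : N.+1%:R * (A * (N.+1%:R^-1 * fnorm u) + B * (N.+1%:R^-1 * fnorm u) ^+ 2) =
   A * fnorm u + N.+1%:R^-1 * (B * fnorm u ^+ 2).
  by field; rewrite gt_eqF.
rewrite lerD2l; apply: le_trans (_ : N.+1%:R^-1 * (`|B| * fnorm u ^+ 2) <= _).
  by rewrite ler_wpM2l // ler_wpM2r // ler_norm.
apply: ler_wpM2r; first by rewrite mulr_ge0.
by rewrite -(invrK t) lef_pV2 // posrE ?invr_gt0.
Qed.

(** The difference of two approximations is Lipschitz with the Cauchy rate of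
    their gradients, by [subdivision]; letting one of them tend to Phi, Phi - Pa a
    is Lipschitz with constant C / a. Hence Phi is expanded at x with error
    C / a |u| + C a |u|^2. As a is free, Phi has directional derivatives, and they
    are the limits of those of [Pa a]. *)
Lemma grad_limit m (Phi : 'rV[R]_m -> R) (Pa : R -> 'rV[R]_m -> R)
   (Ga : R -> 'rV[R]_m -> 'rV[R]_m) (a0 C : R) : 0 < a0 -> 0 <= C ->
  (forall a x, a0 <= a -> `|Phi x - Pa a x| <= C / a) ->
  (forall a, a0 <= a -> qb (C * a) (Pa a) (Ga a)) ->
  (forall a b x, a0 <= a -> a0 <= b -> fnorm (Ga a x - Ga b x) <= C * (a^-1 + b^-1)) ->
  forall a x, a0 <= a -> fnorm (grad Phi x - Ga a x) <= C / a.
Proof.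
move=> a0p C0 hP hq hG.
have pos a : a0 <= a -> 0 < a by exact: lt_le_trans.
have step1 a b (w u : 'rV[R]_m) : a0 <= a -> a0 <= b ->
    `|(Pa b (w + u) - Pa a (w + u)) - (Pa b w - Pa a w)| <= C * (a^-1 + b^-1) * fnorm u.
  move=> ha hb; apply: (@subdivision _ (fun w => Pa b w - Pa a w) _ (C * b + C * a)) => {}w {}u.
  have -> : Pa b (w + u) - Pa a (w + u) - (Pa b w - Pa a w) =
     (Pa b (w + u) - Pa b w - dotp (Ga b w) u) - (Pa a (w + u) - Pa a w - dotp (Ga a w) u)
       + dotp (Ga b w - Ga a w) u by rewrite dotpBl; ring.
  apply: le_trans (ler_normD _ _) _; rewrite addrC; apply: lerD.
    apply: le_trans (dotp_norm _ _) _; apply: ler_wpM2r => //.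
    by rewrite (addrC a^-1); exact: hG.
  by apply: le_trans (ler_normB _ _) _; rewrite mulrDl; apply: lerD; apply: hq.
have step2 a (w u : 'rV[R]_m) : a0 <= a ->
    `|(Phi (w + u) - Pa a (w + u)) - (Phi w - Pa a w)| <= C / a * fnorm u.
  move=> ha; have ap := pos _ ha.
  apply: (@le_lim0 _ _ _ (C / a * fnorm u + 2 * (C / a))) => t /andP[t0 t1].
  have hb : a0 <= a / t by apply: le_trans ha _; rewrite ler_pdivlMr // ler_piMr // ltW.
  have := step1 a (a / t) w u ha hb.
  have := hP (a / t) (w + u) hb; have := hP (a / t) w hb.
  set x1 := Pa (a / t) w; set x2 := Pa (a / t) (w + u).
  have -> : C / (a / t) = t * (C / a) by rewrite invf_div; ring.
  have -> : C * (a^-1 + (a / t)^-1) * fnorm u = C / a * fnorm u + t * (C / a * fnorm u).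
    by rewrite invf_div; ring.
  rewrite !ler_norml => /andP[h1 h2] /andP[h3 h4] /andP[h5 h6].
  by apply/andP; split; lra.
have step3 a (w u : 'rV[R]_m) : a0 <= a ->
    `|Phi (w + u) - Phi w - dotp (Ga a w) u| <= C / a * fnorm u + C * a * fnorm u ^+ 2.
  move=> ha.
  have -> : Phi (w + u) - Phi w - dotp (Ga a w) u =
    ((Phi (w + u) - Pa a (w + u)) - (Phi w - Pa a w)) + (Pa a (w + u) - Pa a w - dotp (Ga a w) u) by ring.
  by apply: le_trans (ler_normD _ _) _; apply: lerD; [exact: step2|exact: hq].
have der (x v : 'rV[R]_m) a : a0 <= a -> `|'D_v Phi x - dotp (Ga a x) v| <= C / a * fnorm v.
  (* the limit of the derivatives, as the supremum of their lower bounds *)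
  pose E := [set dotp (Ga a x) v - C / a * fnorm v | a in [set a | a0 <= a]].
  have ub b : a0 <= b -> ubound E (dotp (Ga b x) v + C / b * fnorm v).
    move=> hb _ [c hc <-].
    have h1 : dotp (Ga c x) v - dotp (Ga b x) v <= C * (c^-1 + b^-1) * fnorm v.
      by rewrite -dotpBl; apply: le_trans (dotp_le _ _) _; apply: ler_wpM2r => //; exact: hG.
    by lra.
  have E0 : E !=set0 by exists (dotp (Ga a0 x) v - C / a0 * fnorm v); exists a0 => //=.
  pose s := sup E.
  have hs b : a0 <= b -> `|s - dotp (Ga b x) v| <= C / b * fnorm v.
    move=> hb; rewrite ler_distl; apply/andP; split.
      by apply: ub_le_sup; [exists (dotp (Ga b x) v + C / b * fnorm v); exact: ub | exists b].
    by apply: ge_sup => //; exact: ub.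
  suff cvs : (fun h : R => h^-1 *: ((Phi \o shift x) (h *: v) - Phi x)) @ 0^' --> s.
    by move=> ha; rewrite (_ : 'D_v Phi x = s) ?hs //; apply: cvg_lim => //; exact: norm_hausdorff.
  apply/cvgrPdist_le => /= e e0.
  pose b := Num.max a0 (4 * C * fnorm v / e).
  have hb : a0 <= b by rewrite le_max lexx.
  have bp := pos _ hb.
  have b4 : C / b * fnorm v <= e / 4.
    rewrite mulrAC ler_pdivrMr // -ler_pdivrMl ?divr_gt0 //.
    by rewrite le_max; apply/orP; right; rewrite invf_div le_eqVlt; apply/orP; left; apply/eqP; field; rewrite gt_eqF.
  have d0 : 0 < e / 2 / (C * b * fnorm v ^+ 2 + 1).
    by rewrite !divr_gt0 // ltr_wpDl // mulr_ge0 // mulr_ge0 // ltW.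
  near=> t.
  have tn : t != 0 by near: t; exact: nbhs_dnbhs_neq.
  have ht : `|t| <= e / 2 / (C * b * fnorm v ^+ 2 + 1) by near: t; apply: dnbhs0_le.
  have tp : 0 < `|t| by rewrite normr_gt0.
  have h3 := step3 b x (t *: v) hb; rewrite dotpZr fnormZ in h3.
  rewrite distrC -(subrKA (dotp (Ga b x) v)).
  apply: le_trans (ler_normD _ _) _.
  have h4 : `|t^-1 *: (Phi (t *: v + x) - Phi x) - dotp (Ga b x) v| <= C / b * fnorm v + C * b * `|t| * fnorm v ^+ 2.
    rewrite -(ler_pM2l tp) -normrM mulrBr /GRing.scale /= mulVKf // [t *: v + x]addrC.
    by apply: le_trans h3 _; rewrite le_eqVlt; apply/orP; left; apply/eqP; ring.
  have h5 : C * b * `|t| * fnorm v ^+ 2 <= e / 2.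
    move: ht; rewrite ler_pdivlMr; last first.
      by rewrite ltr_wpDl // mulr_ge0 // mulr_ge0 // ltW.
    lra.
  have := hs b hb; rewrite distrC => h6.
  lra.
(* Bounding a vector by its coordinates costs a factor m. It is paid at the parameter
   a / t, where the rate C t / a makes it vanish with t. *)
move=> a x ha; have ap := pos _ ha.
apply: (@le_lim0 _ _ _ (m%:R * (C / a) + C / a)) => t /andP[t0 t1].
have hb : a0 <= a / t by apply: le_trans ha _; rewrite ler_pdivlMr // ler_piMr // ltW.
rewrite -(subrKA (Ga (a / t) x)); apply: le_trans (ler_fnormD _ _) _.
have h1 := hG (a / t) a x hb ha.
have h2 : fnorm (grad Phi x - Ga (a / t) x) <= m%:R * (C / (a / t)).
  apply: le_trans (fnorm_le_entries _) _; rewrite big_ord1.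
  rewrite -[X in X%:R * _]card_ord -sumr_const mulr_suml; apply: ler_sum => j _.
  have := der x (delta_mx 0 j) _ hb; rewrite !mxE mul1r.
  have -> : dotp (Ga (a / t) x) (delta_mx 0 j) = Ga (a / t) x 0 j.
    rewrite /dotp big_ord1 (bigD1 j) //= big1 ?addr0 ?mxE ?eqxx ?mulr1 // => i /negbTE ni.
    by rewrite mxE ni andbF mulr0.
  move=> h; apply: le_trans h _; apply: ler_piMr; first by rewrite divr_ge0 // divr_ge0 // ltW.
  rewrite /fnorm big_ord1 (bigD1 j) //= big1 ?addr0 ?mxE ?eqxx ?expr1n ?sqrtr1 // => i /negbTE ni.
  by rewrite mxE ni andbF expr0n.
have E1 : C / (a / t) = t * (C / a) by rewrite invf_div; ring.
rewrite E1 in h2.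
have E2 : C * ((a / t)^-1 + a^-1) = C / a + t * (C / a) by rewrite invf_div; ring.
rewrite E2 in h1; lra.
Unshelve. all: by end_near. Qed.

End UniformLimit.

(** * The penalized bilevel value *)

Section Param.
Context {R : realType} {p q : nat}.
Implicit Types (h : 'rV[R]_p -> 'rV[R]_q -> R) (x : 'rV[R]_p) (y : 'rV[R]_q).

Definition px (G : 'rV[R]_(p + q) -> 'rV[R]_(p + q)) x y : 'rV[R]_p := lsubmx (G (row_mx x y)).
Definition py (G : 'rV[R]_(p + q) -> 'rV[R]_(p + q)) x y : 'rV[R]_q := rsubmx (G (row_mx x y)).

Lemma joint_row_mx h x y : joint h (row_mx x y) = h x y.
Proof. by rewrite /joint row_mxKl row_mxKr. Qed.

Lemma qb_joint h G C x y x' y' : qb C (joint h) G ->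
  `|h x' y' - h x y - dotp (px G x y) (x' - x) - dotp (py G x y) (y' - y)|
   <= C * (fnorm (x' - x) ^+ 2 + fnorm (y' - y) ^+ 2).
Proof.
move=> H; have := H (row_mx x y) (row_mx (x' - x) (y' - y)).
rewrite add_row_mx !subrKC !joint_row_mx fnorm_row_mx.
by rewrite -[G _]hsubmxK dotp_row_mx opprD addrA.
Qed.

Lemma qb_partial_y h G C x : qb C (joint h) G -> qb C (h x) (py G x).
Proof.
move=> H y v; have := qb_joint x y x (y + v) H.
by rewrite subrr dotp0r subr0 fnorm0 expr0n add0r [y + v]addrC addrK.
Qed.

Lemma lip_px G L x y x' y' : lip L G -> 0 <= L ->
  fnorm (px G x y - px G x' y') <= L * (fnorm (x - x') + fnorm (y - y')).
Proof.
move=> H L0; rewrite -linearB /=; apply: le_trans (fnorm_lsub _) _.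
apply: le_trans (H _ _) _; apply: ler_wpM2l => //.
rewrite opp_row_mx add_row_mx; apply: fnorm_sq_le; first by rewrite addr_ge0.
by rewrite fnorm_row_mx; have := fnorm_ge0 (x - x'); have := fnorm_ge0 (y - y'); nra.
Qed.
Lemma lip_py G L x y x' y' : lip L G -> 0 <= L ->
  fnorm (py G x y - py G x' y') <= L * (fnorm (x - x') + fnorm (y - y')).
Proof.
move=> H L0; rewrite -linearB /=; apply: le_trans (fnorm_rsub _) _.
apply: le_trans (H _ _) _; apply: ler_wpM2l => //.
rewrite opp_row_mx add_row_mx; apply: fnorm_sq_le; first by rewrite addr_ge0.
by rewrite fnorm_row_mx; have := fnorm_ge0 (x - x'); have := fnorm_ge0 (y - y'); nra.
Qed.

Lemma argmin_stationary m C (k : 'rV[R]_m -> R) G w : qb C k G ->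
  (forall w', k w <= k w') -> G w = 0.
Proof.
move=> H hm; apply: fnorm_eq0; apply/eqP; rewrite -sqrf_eq0 eq_le sqr_ge0 andbT.
apply: (@le_lim0 _ _ _ (C * fnorm (G w) ^+ 2)) => t /andP[t0 t1].
rewrite add0r -(ler_pM2l t0).
have := H w ((- t) *: G w); have := hm (w + (- t) *: G w).
rewrite dotpZr fnormZ normrN (gtr0_norm t0) -fnorm_sq ler_norml => h1 /andP[_ h2].
lra.
Qed.

Variables (h : 'rV[R]_p -> 'rV[R]_q -> R) (G : 'rV[R]_(p + q) -> 'rV[R]_(p + q)) (C K mm : R).
Hypotheses (mm0 : 0 < mm) (K0 : 0 <= K) (C0 : 0 <= C) (hq : qb C (joint h) G) (hl : lip K G).
Hypothesis hsc : forall x y y',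
  h x y + dotp (py G x y) (y' - y) + mm * fnorm (y' - y) ^+ 2 <= h x y'.

Definition psol x := argmin (h x).

(** A minimizer exists since [h x] grows quadratically, so that [argmin] is one. *)
Lemma psol_min x y : h x (psol x) <= h x y.
Proof.
rewrite /psol /argmin; case: xgetP => [w -> hw|hn]; first exact: hw.
exfalso.
have [|w hw] := @exists_min R q (h x) (fnorm (py G x 0)) mm (qb_continuous (qb_partial_y x hq)) mm0.
  move=> w; apply: le_trans (hsc x 0 w); rewrite subr0 lerD2r lerD2l lerNl -dotpNl.
  by apply: le_trans (dotp_le _ _) _; rewrite fnormN.
by apply: (hn w).
Qed.

Lemma psol_stat x : py G x (psol x) = 0.
Proof. exact: (argmin_stationary (qb_partial_y x hq) (psol_min x)). Qed.

Lemma psol_upper x y : h x y <= h x (psol x) + C * fnorm (y - psol x) ^+ 2.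
Proof.
have := qb_partial_y x hq (psol x) (y - psol x).
by rewrite subrKC psol_stat dotp0l subr0 ler_norml => /andP[_]; rewrite lerBlDl.
Qed.

Lemma py_mono x y y' : 2 * mm * fnorm (y - y') ^+ 2 <= dotp (py G x y - py G x y') (y - y').
Proof.
have := hsc x y y'; have := hsc x y' y.
by rewrite -(opprB y y') fnormN dotpNr dotpBl; lra.
Qed.

Lemma py_strong x y y' : 2 * mm * fnorm (y - y') <= fnorm (py G x y - py G x y').
Proof.
have [->|n0] := eqVneq (fnorm (y - y')) 0; first by rewrite mulr0.
have np : 0 < fnorm (y - y') by rewrite lt_def n0 fnorm_ge0.
have hh := le_trans (py_mono x y y') (dotp_le _ _).
by move: hh; rewrite expr2 mulrA ler_pM2r.
Qed.

Lemma psol_dist x y : 2 * mm * fnorm (y - psol x) <= fnorm (py G x y).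
Proof. by have := py_strong x y (psol x); rewrite psol_stat subr0. Qed.

Lemma psol_lip x x' : 2 * mm * fnorm (psol x - psol x') <= K * fnorm (x - x').
Proof.
rewrite fnormC; apply: le_trans (psol_dist _ _) _.
rewrite -[py G x _]subr0 -(psol_stat x'); apply: le_trans (lip_py _ _ _ _ hl K0) _.
by rewrite subrr fnorm0 addr0.
Qed.

(** Envelope theorem. The minimizer moves by O(|v|), and near a minimizer this
    changes h only to second order. *)
Lemma value_qb : qb (C + K ^+ 2 / (2 * mm)) (fun x => h x (psol x)) (fun x => px G x (psol x)).
Proof.
move=> x v /=; set y := psol x; set y' := psol (x + v).
have m2 : 0 < 2 * mm by rewrite mulr_gt0.
have Kq : K ^+ 2 / (2 * mm) * fnorm v ^+ 2 >= 0.
  by rewrite mulr_ge0 // divr_ge0 ?sqr_ge0 // ltW.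
have h1 := psol_min (x + v) y; rewrite -/y' in h1.
have h2 := psol_min x y'; rewrite -/y in h2.
have q1 := qb_joint x y (x + v) y hq.
have q2 := qb_joint x y' (x + v) y' hq.
rewrite !subrr !dotp0r !subr0 !fnorm0 !expr0n /= !addr0 [x + v]addrC !addrK in q1 q2.
rewrite [v + x]addrC in q1 q2.
have d1 : `|dotp (px G x y' - px G x y) v| <= K ^+ 2 / (2 * mm) * fnorm v ^+ 2.
  apply: le_trans (dotp_norm _ _) _; rewrite [fnorm v ^+ 2]expr2 mulrA; apply: ler_wpM2r => //.
  apply: le_trans (lip_px _ _ _ _ hl K0) _; rewrite subrr fnorm0 add0r.
  have := psol_lip (x + v) x; rewrite -/y -/y' [x + v]addrC addrK => hh.
  rewrite expr2 -!mulrA; apply: ler_wpM2l => //.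
  by rewrite mulrCA -ler_pdivrMl ?invr_gt0 // invrK.
rewrite dotpBl in d1.
move: q1 q2 d1; rewrite !ler_norml mulrDl => /andP[a1 a2] /andP[a3 a4] /andP[a5 a6].
by apply/andP; split; lra.
Qed.

End Param.

Lemma Cphi_aux (R : realType) (L u v : R) : 1 <= L -> 0 <= u -> 0 <= v ->
  [/\ 0 <= 3 * L + 9 * u + u + v, u <= 3 * L + 9 * u + u + v,
      3 * L + 9 * u <= 3 * L + 9 * u + u + v & v <= 3 * L + 9 * u + u + v].
Proof. by move=> h1 h2 h3; split; lra. Qed.

Section Bilevel.
Context {R : realType} {p q : nat}.
Variables (f g : 'rV[R]_p -> 'rV[R]_q -> R) (Gf Gg : 'rV[R]_(p + q) -> 'rV[R]_(p + q))
  (Jg : 'rV[R]_(p + q) -> 'M[R]_(p + q)) (L mu : R).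
Hypotheses (L1 : 1 <= L) (mu0 : 0 < mu).
Hypotheses (qf : qb L (joint f) Gf) (qg : qb L (joint g) Gg) (lf : lip L Gf) (lg : lip L Gg)
  (tg : taylor L Gg Jg) (f0 : forall x y y', `|f x y - f x y'| <= L * fnorm (y - y'))
  (sc : forall x, strongly_convex mu (g x)).

Let L0 : 0 <= L. Proof. exact: le_trans L1. Qed.

Lemma g_first x y y' :
  g x y + dotp (py Gg x y) (y' - y) + mu / 2 * fnorm (y' - y) ^+ 2 <= g x y'.
Proof. exact: (strconv_first (qb_partial_y x qg) (sc x)). Qed.

Lemma mu2 : 0 < mu / 2. Proof. by rewrite divr_gt0. Qed.

Definition pen (a : R) x y : R := f x y + a * g x y.
Definition Gpen (a : R) w : 'rV[R]_(p + q) := Gf w + a *: Gg w.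

(** For a >= 4 L / mu the convexity of a g absorbs the curvature of f. *)
Lemma pen_first a x y y' : 4 * L / mu <= a ->
  pen a x y + dotp (py (Gpen a) x y) (y' - y) + a * mu / 4 * fnorm (y' - y) ^+ 2 <= pen a x y'.
Proof.
move=> ha; have a0 : 0 <= a by apply: le_trans ha; rewrite divr_ge0 ?mulr_ge0 // ltW.
have h1 := g_first x y y'.
have := qb_partial_y x qf y (y' - y); rewrite subrKC ler_norml => /andP[h2 _].
have -> : py (Gpen a) x y = py Gf x y + a *: py Gg x y by rewrite /py /Gpen linearD linearZ.
rewrite dotpDl dotpZl /pen.
have h3 : 4 * L <= a * mu by rewrite -ler_pdivrMr.
have h4 : a * (g x y + dotp (py Gg x y) (y' - y) + mu / 2 * fnorm (y' - y) ^+ 2) <= a * g x y'.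
  by apply: ler_wpM2l.
have h5 : 4 * L * fnorm (y' - y) ^+ 2 <= a * mu * fnorm (y' - y) ^+ 2 by apply: ler_wpM2r.
lra.
Qed.

Lemma pen_qb a : 1 <= a -> qb (2 * a * L) (joint (pen a)) (Gpen a).
Proof.
move=> a1 w v; rewrite /pen /Gpen dotpDl dotpZl.
have := qf w v; have := qg w v; rewrite /joint; set D := fnorm v ^+ 2.
set A := g _ _; set B := g _ _; set A' := f _ _; set B' := f _ _ => h1 h2.
rewrite (_ : _ - _ = (A' - B' - dotp (Gf w) v) + a * (A - B - dotp (Gg w) v)); last by ring.
apply: le_trans (ler_normD _ _) _; rewrite normrM (@ger0_norm _ a); last exact: le_trans a1.
have h3 : a * `|A - B - dotp (Gg w) v| <= a * (L * D) by apply: ler_wpM2l => //; exact: le_trans a1.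
have h4 : 1 * (L * D) <= a * (L * D) by apply: ler_wpM2r => //; rewrite mulr_ge0 // sqr_ge0.
lra.
Qed.

Lemma pen_lip a : 1 <= a -> lip (2 * a * L) (Gpen a).
Proof.
move=> a1 w w'; rewrite /Gpen opprD addrACA -scalerBr.
apply: le_trans (ler_fnormD _ _) _; rewrite fnormZ (@ger0_norm _ a); last exact: le_trans a1.
have h1 := lf w w'; have h2 := lg w w'.
have h3 : a * fnorm (Gg w - Gg w') <= a * (L * fnorm (w - w')) by apply: ler_wpM2l => //; exact: le_trans a1.
have h4 : 1 * (L * fnorm (w - w')) <= a * (L * fnorm (w - w')) by apply: ler_wpM2r => //; rewrite mulr_ge0.
lra.
Qed.

Definition zs x := psol g x.
Definition ya a x := psol (pen a) x.

Section Fixed.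
Variable a : R.
Hypotheses (a1 : 1 <= a) (ha : 4 * L / mu <= a).
Let a0 : 0 < a. Proof. exact: lt_le_trans a1. Qed.
Lemma am4 : 0 < a * mu / 4. Proof. by rewrite !divr_gt0 // mulr_gt0. Qed.
Lemma aL : 0 <= 2 * a * L. Proof. by rewrite !mulr_ge0 // ltW. Qed.

Lemma pyf_bound x y : fnorm (py Gf x y) <= L.
Proof.
apply: fnorm_dual => // v.
apply: (@le_lim0 _ _ _ (L * fnorm v ^+ 2)) => t /andP[t0 t1].
rewrite -(ler_pM2l t0) -dotpZr.
have := qb_partial_y x qf y (t *: v); have := f0 x (y + t *: v) y.
rewrite [y + _]addrC addrK fnormZ (gtr0_norm t0) !ler_norml => /andP[_ h1] /andP[h2 h3].
lra.
Qed.

(** Stationarity of f + a g says that a grad_y g = - grad_y f at [ya a x], and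
    grad_y f is bounded as f is Lipschitz in y. *)
Lemma pyg_ya x : fnorm (py Gg x (ya a x)) <= L / a.
Proof.
have := psol_stat am4 (pen_qb a1) (fun x y y' => pen_first x y y' ha) x.
rewrite /py /Gpen linearD linearZ /= -/(py Gf x _) -/(py Gg x _) => /eqP.
rewrite addr_eq0 -/(ya a x) => /eqP E.
rewrite ler_pdivlMr // mulrC; have <- : fnorm (a *: py Gg x (ya a x)) = a * fnorm (py Gg x (ya a x)).
  by rewrite fnormZ gtr0_norm.
by rewrite -fnormN -E; exact: pyf_bound.
Qed.

Lemma ya_zs x : fnorm (ya a x - zs x) <= L / (a * mu).
Proof.
rewrite invfM mulrA ler_pdivlMr // mulrC; apply: le_trans (pyg_ya x).
have := psol_dist mu2 qg g_first x (ya a x).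
by rewrite mulrCA mulfV ?mulr1 ?pnatr_eq0.
Qed.

(** The penalized value min (f + a g) - a min g, and its gradient according to
    the envelope theorem. *)
Definition Phia x : R := pen a x (ya a x) - a * g x (zs x).
Definition Ga x : 'rV[R]_p := px (Gpen a) x (ya a x) - a *: px Gg x (zs x).

Lemma Phia_close x : `|f x (zs x) - Phia x| <= L ^+ 2 / mu / a.
Proof.
have h1 := psol_min am4 (pen_qb a1) (fun x y y' => pen_first x y y' ha) x (zs x).
have h2 := psol_min mu2 qg g_first x (ya a x).
have h3 := f0 x (ya a x) (zs x).
have h4 := ya_zs x.
have h5 : L * fnorm (ya a x - zs x) <= L ^+ 2 / mu / a.
  apply: le_trans (_ : L * (L / (a * mu)) <= _); first by apply: ler_wpM2l.
  by rewrite invfM le_eqVlt; apply/orP; left; apply/eqP; ring.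
have h6 : a * g x (zs x) <= a * g x (ya a x) by rewrite ler_pM2l.
rewrite /Phia /pen -/(ya a x) in h1 *; rewrite ler_norml; move: h3; rewrite ler_norml => /andP[h7 h8].
by apply/andP; split; lra.
Qed.

Lemma Phia_qb : qb ((3 * L + 9 * L ^+ 2 / mu) * a) Phia Ga.
Proof.
move=> x v.
have h1 := value_qb am4 aL (pen_qb a1) (pen_lip a1) (fun x y y' => pen_first x y y' ha) x v.
have h2 := value_qb mu2 L0 qg lg g_first x v.
rewrite /= in h1 h2.
have -> : Phia (x + v) - Phia x - dotp (Ga x) v =
  (pen a (x + v) (psol (pen a) (x + v)) - pen a x (psol (pen a) x) - dotp (px (Gpen a) x (psol (pen a) x)) v)
   - a * (g (x + v) (psol g (x + v)) - g x (psol g x) - dotp (px Gg x (psol g x)) v).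
  by rewrite /Phia /Ga dotpBl dotpZl /ya /zs; ring.
apply: le_trans (ler_normB _ _) _; rewrite normrM (gtr0_norm a0).
have h3 := ler_wpM2l (ltW a0) h2.
apply: le_trans (lerD h1 h3) _.
rewrite le_eqVlt; apply/orP; left; apply/eqP; field.
by rewrite !gt_eqF.
Qed.

(** [Ga] can be computed from inexact minimizers y and z, which is how the
    algorithm estimates it. *)
Lemma Ga_close x y z : fnorm (Ga x - (px (Gpen a) x y - a *: px Gg x z))
  <= 2 * a * L * (fnorm (y - ya a x) + fnorm (z - zs x)).
Proof.
have -> : Ga x - (px (Gpen a) x y - a *: px Gg x z) =
   (px (Gpen a) x (ya a x) - px (Gpen a) x y) - a *: (px Gg x (zs x) - px Gg x z).
  by rewrite /Ga; apply/matrixP => i j; rewrite !mxE; ring.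
apply: le_trans (ler_fnormB _ _) _; rewrite fnormZ (gtr0_norm a0).
have h1 := lip_px x (ya a x) x y (pen_lip a1) aL.
have h2 := ler_wpM2l (ltW a0) (lip_px x (zs x) x z lg L0).
rewrite !subrr !fnorm0 !add0r (fnormC (ya _ _)) (fnormC (zs _)) in h1 h2.
have : 0 <= a * L * fnorm (z - zs x) by rewrite !mulr_ge0 // ltW.
lra.
Qed.

(** The two minimizers are at distance O(1 / a), so the linearization error is
    a O(1 / a^2). *)
Lemma expansion x : fnorm (a *: (Gg (row_mx x (ya a x)) - Gg (row_mx x (zs x))) -
    row_mx 0 (a *: (ya a x - zs x)) *m Jg (row_mx x (zs x))) <= L ^+ 3 / mu ^+ 2 / a.
Proof.
set r := ya a x - zs x.
have := tg (row_mx x (zs x)) (row_mx 0 r).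
rewrite add_row_mx addr0 subrKC.
have -> : row_mx 0 (a *: r) = a *: row_mx (0 : 'rV[R]_p) r by rewrite scale_row_mx scaler0.
rewrite -scalemxAl -scalerBr fnormZ (gtr0_norm a0) => h.
apply: le_trans (ler_wpM2l (ltW a0) h) _.
rewrite fnorm_row_mxr0.
have h2 : fnorm r ^+ 2 <= (L / (a * mu)) ^+ 2.
  have am : 0 <= L / (a * mu) by rewrite divr_ge0 // mulr_ge0 // ltW.
  have hz := ya_zs x.
  by rewrite ler_pXn2r // nnegrE.
apply: le_trans (_ : a * (L * (L / (a * mu)) ^+ 2) <= _).
  by apply: ler_wpM2l (ltW a0) _ _ _; apply: ler_wpM2l L0 _ _ _.
by rewrite le_eqVlt; apply/orP; left; apply/eqP; field; rewrite !gt_eqF.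
Qed.
End Fixed.

Lemma dotp_row0 n1 n2 (A : 'rV[R]_(n1 + n2)) (b : 'rV[R]_n2) :
  dotp A (row_mx 0 b) = dotp (rsubmx A) b.
Proof. by rewrite -{1}(hsubmxK A) dotp_row_mx dotp0r add0r. Qed.

(** The strong monotonicity [py_mono] at points t v apart, for t tending to 0. *)
Lemma hess_pos x y (v : 'rV[R]_q) : mu * fnorm v ^+ 2 <=
  dotp (row_mx (0 : 'rV[R]_p) v *m Jg (row_mx x y)) (row_mx 0 v).
Proof.
apply: (@le_lim0 _ _ _ (L * fnorm v ^+ 3)) => t /andP[t0 t1].
have t2 : 0 < t ^+ 2 by rewrite exprn_gt0.
rewrite -(ler_pM2l t2).
have h1 := py_mono g_first x (y + t *: v) y.
have Ev : y + t *: v - y = t *: v by rewrite [y + _]addrC addrK.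
rewrite Ev fnormZ (gtr0_norm t0) in h1.
have h2 := tg (row_mx x y) (row_mx 0 (t *: v)).
rewrite add_row_mx addr0 fnorm_row_mxr0 fnormZ (gtr0_norm t0) in h2.
set e := (X in fnorm X) in h2.
have E : py Gg x (y + t *: v) - py Gg x y = rsubmx (e + row_mx 0 (t *: v) *m Jg (row_mx x y)).
  by rewrite /e subrK linearB.
rewrite E -dotp_row0 dotpDl in h1.
have E2 : row_mx (0 : 'rV[R]_p) (t *: v) = t *: row_mx 0 v by rewrite scale_row_mx scaler0.
rewrite E2 -scalemxAl dotpZl !dotpZr in h1.
have h3 := dotp_le e (row_mx 0 v); rewrite fnorm_row_mxr0 in h3.
have h4 : fnorm e * fnorm v <= L * (t * fnorm v) ^+ 2 * fnorm v by apply: ler_wpM2r.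
have h5 : t * dotp e (row_mx 0 v) <= t * (L * (t * fnorm v) ^+ 2 * fnorm v).
  by apply: ler_wpM2l; [exact: ltW | exact: le_trans h3 h4].
lra.
Qed.

(** Put rho_a = a (ya a x - zs x), which stays bounded. By [expansion], up to
    O(1 / a), the gradient of f + a g at (x, ya a x) minus a grad g at (x, zs x) is
    grad f + (0, rho_a) H, where H is the Hessian of g at (x, zs x). Its y-part
    vanishes for every a, by stationarity. Subtracting the equations for a and b and
    pairing with rho_a - rho_b, [hess_pos] shows that rho_a - rho_b is
    O(1 / a + 1 / b), and so is the difference of the x-parts, which are [Ga]. *)
Lemma Ga_cauchy a b x : 1 <= a -> 4 * L / mu <= a -> 1 <= b -> 4 * L / mu <= b ->
  fnorm (Ga a x - Ga b x) <= (1 + L / mu) * (L ^+ 2 / mu + L ^+ 3 / mu ^+ 2) * (a^-1 + b^-1).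
Proof.
move=> a1 ha b1 hb.
have a0 : 0 < a by exact: lt_le_trans a1.
have b0 : 0 < b by exact: lt_le_trans b1.
set H := Jg (row_mx x (zs x)).
pose rho (c : R) := c *: (ya c x - zs x).
pose e c := c *: (Gg (row_mx x (ya c x)) - Gg (row_mx x (zs x))) - row_mx 0 (rho c) *m H.
have ea : fnorm (e a) <= L ^+ 3 / mu ^+ 2 * a^-1 by exact: expansion.
have eb : fnorm (e b) <= L ^+ 3 / mu ^+ 2 * b^-1 by exact: expansion.
have yab : fnorm (ya a x - ya b x) <= L / mu * (a^-1 + b^-1).
  rewrite -(subrKA (zs x)); apply: le_trans (ler_fnormD _ _) _; rewrite [fnorm (zs x - _)]fnormC.
  have h1 := ya_zs a1 ha x; have h2 := ya_zs b1 hb x.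
  have es c : L / (c * mu) = L / mu * c^-1 by rewrite invfM [c^-1 * _]mulrC mulrA.
  by rewrite es in h1; rewrite es in h2; rewrite mulrDr; exact: lerD.
pose d := Gf (row_mx x (ya a x)) - Gf (row_mx x (ya b x)) + (e a - e b).
have dn : fnorm d <= (L ^+ 2 / mu + L ^+ 3 / mu ^+ 2) * (a^-1 + b^-1).
  apply: le_trans (ler_fnormD _ _) _.
  have h1 : fnorm (Gf (row_mx x (ya a x)) - Gf (row_mx x (ya b x))) <= L * (L / mu * (a^-1 + b^-1)).
    apply: le_trans (lf _ _) _; apply: ler_wpM2l => //.
    by rewrite opp_row_mx add_row_mx subrr fnorm_row_mxr0.
  rewrite [leRHS]mulrDl; apply: lerD; first by rewrite expr2 -(mulrA L L) -mulrA.
  by rewrite mulrDr; apply: le_trans (ler_fnormB _ _) (lerD ea eb).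
have Gpd : Gpen a (row_mx x (ya a x)) - a *: Gg (row_mx x (zs x)) -
      (Gpen b (row_mx x (ya b x)) - b *: Gg (row_mx x (zs x))) = d + row_mx 0 (rho a - rho b) *m H.
  have -> : row_mx (0 : 'rV[R]_p) (rho a - rho b) = row_mx 0 (rho a) - row_mx 0 (rho b).
    by rewrite opp_row_mx add_row_mx subr0.
  rewrite /d /e /Gpen mulmxBl !scalerBr.
  set X := row_mx _ _ *m H; set Y := row_mx _ _ *m H.
  by apply/matrixP => i j; rewrite !mxE; ring.
have st c : 1 <= c -> 4 * L / mu <= c ->
   rsubmx (Gpen c (row_mx x (ya c x)) - c *: Gg (row_mx x (zs x))) = 0.
  move=> c1 hc; have c0 : 0 < c by exact: lt_le_trans c1.
  rewrite linearB linearZ /= -/(py _ _ _) -/(py _ _ _).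
  have -> := psol_stat (am4 c1) (pen_qb c1) (fun x y y' => pen_first x y y' hc) x.
  by have -> := psol_stat mu2 qg g_first x; rewrite scaler0 subr0.
have rn : fnorm (rho a - rho b) <= ((L ^+ 2 / mu + L ^+ 3 / mu ^+ 2) * (a^-1 + b^-1)) / mu.
  rewrite ler_pdivlMr // mulrC; apply: le_trans dn.
  have [->|n0] := eqVneq (fnorm (rho a - rho b)) 0; first by rewrite mulr0.
  have np : 0 < fnorm (rho a - rho b) by rewrite lt_def n0 fnorm_ge0.
  suff : mu * fnorm (rho a - rho b) ^+ 2 <= fnorm d * fnorm (rho a - rho b).
    by rewrite expr2 mulrA ler_pM2r.
  apply: le_trans (hess_pos x (zs x) _) _.
  have : rsubmx (d + row_mx 0 (rho a - rho b) *m H) = 0.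
    by rewrite -Gpd linearB /= !st // subrr.
  move=> /(congr1 (fun z => dotp z (rho a - rho b))).
  rewrite dotp0l -dotp_row0 dotpDl => /eqP; rewrite addrC addr_eq0 => /eqP ->.
  rewrite -dotpNr; apply: le_trans (dotp_le _ _) _.
  by rewrite fnormN fnorm_row_mxr0.
have -> : Ga a x - Ga b x = lsubmx (d + row_mx 0 (rho a - rho b) *m H).
  by rewrite -Gpd /Ga /px !linearB /= !linearZ.
apply: le_trans (fnorm_lsub _) _; apply: le_trans (ler_fnormD _ _) _.
have h1 : fnorm (row_mx 0 (rho a - rho b) *m H) <= L * fnorm (rho a - rho b).
  by apply: le_trans (taylor_bounded lg tg _ _) _; rewrite fnorm_row_mxr0.
rewrite -mulrA [leRHS]mulrDl mul1r; apply: lerD dn _; apply: le_trans h1 _.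
by apply: le_trans (ler_wpM2l L0 rn) _; rewrite le_eqVlt; apply/orP; left; apply/eqP; ring.
Qed.

(** One constant above those of [Phia_close], [Phia_qb] and [Ga_cauchy], as
    [grad_limit] asks for a single one. *)
Definition Cphi : R := 3 * L + 9 * L ^+ 2 / mu + L ^+ 2 / mu + (1 + L / mu) * (L ^+ 2 / mu + L ^+ 3 / mu ^+ 2).
Definition a_min : R := 1 + 4 * L / mu.

Lemma a_min_ge a : a_min <= a -> 1 <= a /\ 4 * L / mu <= a.
Proof.
have : 0 <= 4 * L / mu by rewrite divr_ge0 ?mulr_ge0 // ltW.
by rewrite /a_min => h1 h2; split; lra.
Qed.

Lemma Cphi_parts : [/\ 0 <= Cphi, L ^+ 2 / mu <= Cphi, 3 * L + 9 * L ^+ 2 / mu <= Cphi &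
   (1 + L / mu) * (L ^+ 2 / mu + L ^+ 3 / mu ^+ 2) <= Cphi].
Proof.
have h1 : 0 <= L ^+ 2 / mu by rewrite divr_ge0 ?exprn_ge0 // ltW.
have h2 : 0 <= (1 + L / mu) * (L ^+ 2 / mu + L ^+ 3 / mu ^+ 2).
  by rewrite mulr_ge0 // addr_ge0 // divr_ge0 ?exprn_ge0 // ltW.
have h3 : 9 * L ^+ 2 / mu = 9 * (L ^+ 2 / mu) by rewrite mulrA.
move: h1 h2; rewrite /Cphi h3; set u := L ^+ 2 / mu; set v := (1 + _) * _ => h1 h2.
exact: Cphi_aux.
Qed.

Lemma grad_Phi_close a x : a_min <= a ->
  fnorm (grad (fun x => f x (zs x)) x - Ga a x) <= Cphi / a.
Proof.
have [C0 C1 C2 C3] := Cphi_parts.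
have am0 : 0 < a_min by apply: ltr_pwDl => //; rewrite divr_ge0 ?mulr_ge0 // ltW.
apply: (grad_limit (Pa := Phia)) => //.
- move=> {}a {}x /a_min_ge[a1 ha]; apply: le_trans (Phia_close a1 ha x) _.
  by apply: ler_wpM2r => //; rewrite invr_ge0; exact: le_trans a1.
- move=> {}a /a_min_ge[a1 ha] w v; apply: le_trans (Phia_qb a1 ha w v) _.
  by apply: ler_wpM2r => //; apply: ler_wpM2r => //; exact: le_trans a1.
- move=> {}a b {}x /a_min_ge[a1 ha] /a_min_ge[b1 hb].
  apply: le_trans (Ga_cauchy x a1 ha b1 hb) _; apply: ler_wpM2r => //.
  by rewrite addr_ge0 // invr_ge0; [exact: le_trans a1|exact: le_trans b1].
Qed.

End Bilevel.

(** * Contraction of the mixing matrix *)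

Section Spectral.
Context {R : realType}.
Local Open Scope complex_scope.
Local Open Scope sesquilinear_scope.
Local Notation C := (R[i]).
Local Notation f := (real_complex R).

Lemma char_poly_diagonalized n (P : 'M[C]_n) (s : 'rV[C]_n) : P \in unitmx ->
  char_poly (invmx P *m diag_mx s *m P) = \prod_i ('X - (s 0 i)%:P).
Proof.
move=> uP.
pose Q := map_mx (@polyC C) P; pose Qi := map_mx (@polyC C) (invmx P).
have QQ : Qi *m Q = 1%:M by rewrite -map_mxM mulVmx // map_mx1.
have E : char_poly_mx (invmx P *m diag_mx s *m P) = Qi *m char_poly_mx (diag_mx s) *m Q.
  rewrite /char_poly_mx !map_mxM -/Q -/Qi mulmxBr mulmxBl; congr (_ - _).
  by rewrite mul_mx_scalar -scalemxAl QQ scalemx1.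
rewrite /char_poly E !det_mulmx mulrAC -det_mulmx QQ det1 mul1r -/(char_poly _).
rewrite char_poly_trig ?diag_mx_is_trig //.
by apply: eq_bigr => i _; rewrite mxE eqxx.
Qed.

Lemma cnorm_real (x : R) : `|f x| ^+ 2 = f (x ^+ 2) :> C.
Proof. by rewrite sqr_normc conjc_real -rmorphM expr2. Qed.

(** W is normal over the complex numbers, hence diagonal in a unitary basis, with
    the given eigenvalues. The head 1 of their list is one diagonal entry, say
    number i0; the others are bounded by rho < 1, so the eigenvector 1 of W lies on
    axis i0, and v, being orthogonal to it, has no component there. *)
Lemma mixing_contract_col n (W : 'M[R]_n) rho (v : 'cV[R]_n) : mixing_matrix W rho ->
  \sum_i v i 0 = 0 -> \sum_i (W *m v) i 0 ^+ 2 <= rho ^+ 2 * \sum_i v i 0 ^+ 2.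
Proof.
move=> [Wsym Wge [Wr Wc] [lam [slam srt chW lam0 rhoE]] rho1] v0.
pose A := map_mx f W.
have AT : A ^t* = A.
  apply/matrixP => i j; rewrite !mxE -[in RHS]Wsym mxE.
  exact: conjc_real.
have nA : A \is normalmx by apply/normalmxP; rewrite AT.
pose P := spectralmx A; pose s := spectral_diag A.
have uP : P \is unitarymx := spectral_unitarymx A.
have uP' : P \in unitmx := unitarymx_unit uP.
have AE : A = invmx P *m diag_mx s *m P by apply/orthomx_spectralP.
have chA : \prod_i ('X - (s 0 i)%:P) = \prod_(l <- lam) ('X - (f l)%:P).
  rewrite -(char_poly_diagonalized _ uP') -AE -map_char_poly chW rmorph_prod /=.
  by apply: eq_bigr => l _; rewrite rmorphB /= map_polyX map_polyC.
case: lam slam srt chW lam0 rhoE chA => [|l0 lam] /= slam srt chW lam0 rhoE chA.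
  by move: (lam0) => /eqP; rewrite eq_sym oner_eq0.
subst l0; rewrite big_cons rmorph1 in chA.
have [i0 si0] : exists i0, s 0 i0 = 1.
  have : root (\prod_i ('X - (s 0 i)%:P)) 1 by rewrite chA rootM root_XsubC eqxx.
  rewrite -(big_map (fun i => s 0 i) xpredT (fun x => 'X - x%:P)) root_prod_XsubC.
  by case/mapP => i _ ->; exists i.
(* cancel the factor of the eigenvalue 1 on both sides *)
have chA' : \prod_(i | i != i0) ('X - (s 0 i)%:P) = \prod_(l <- lam) ('X - (f l)%:P).
  move: chA; rewrite (bigD1 i0) //= si0; apply: mulfI.
  by rewrite polyXsubC_eq0.
have srho i : i != i0 -> `|s 0 i| ^+ 2 <= f (rho ^+ 2).
  move=> ii0.
  have : root (\prod_(l <- lam) ('X - (f l)%:P)) (s 0 i).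
    by rewrite -chA' (bigD1 i) //= rootM root_XsubC eqxx.
  rewrite -(big_map f xpredT (fun x => 'X - x%:P)) root_prod_XsubC => /mapP[l ll ->].
  rewrite cnorm_real lecR -(real_normK (num_real l)).
  rewrite ler_pXn2r ?nnegrE //; last by rewrite rhoE le_max normr_ge0.
  have srt' : sorted (fun a b => b <= a) lam by apply: path_sorted srt.
  have tr : transitive (fun a b : R => b <= a) by move=> y x z h1 h2; exact: le_trans h2 h1.
  have sz : (0 < size lam)%N by case: (lam) ll.
  have ub : l <= lam`_0.
    have [j jl <-] := nthP 0 ll.
    have [->//|j0] := posnP j.
    exact: (sorted_ltn_nth tr 0 srt' 0%N j sz jl j0).
  have lb : lam`_(size lam).-1 <= l.
    have [j jl <-] := nthP 0 ll.
    have js : (j <= (size lam).-1)%N by case: (size lam) jl.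
    have [->//|jn] := eqVneq j (size lam).-1.
    apply: (sorted_ltn_nth tr 0 srt' j _ jl); last by rewrite ltn_neqAle jn.
    by rewrite inE prednK.
  have nE : (n.-1 = (size lam).-1.+1)%N by rewrite -slam /= prednK.
  rewrite rhoE nE /= ler_norml le_max; apply/andP; split.
    rewrite lerNl le_max; apply/orP; right.
    by apply: le_trans (_ : - lam`_(size lam).-1 <= _); [rewrite lerN2|rewrite -normrN ler_norm].
  by apply/orP; left; apply: le_trans ub _; rewrite ler_norm.
pose u : 'cV[C]_n := const_mx 1.
have Au : A *m u = u.
  apply/matrixP => i j; rewrite !mxE -[RHS](rmorph1 f) -(Wr i) rmorph_sum.
  by apply: eq_bigr => k _; rewrite !mxE mulr1.
have PA : P *m A = diag_mx s *m P by rewrite AE !mulmxA mulmxV // mul1mx.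
(* off axis i0 the diagonal entries differ from 1, so a fixed vector has no coordinate *)
have Pu i : i != i0 -> (P *m u) i 0 = 0.
  move=> ii0; have : (P *m A *m u) i 0 = (P *m u) i 0 by rewrite -mulmxA Au.
  rewrite PA -mulmxA mul_diag_mx mxE => /eqP; rewrite -subr_eq0 -{2}[(P *m u) i 0]mul1r -mulrBl mulf_eq0.
  case/orP => [|/eqP//]; rewrite subr_eq0 => /eqP s1.
  have := srho i ii0; rewrite s1 normr1 expr1n -[1](rmorph1 f) lecR => h.
  exfalso; move: h; apply/negP; rewrite -ltNge expr_lt1 //.
  by rewrite rhoE le_max normr_ge0.
have PP : P ^t* *m P = 1%:M.
  by rewrite -invmx_unitary // mulVmx.
have Pu0 : (P *m u) i0 0 != 0.
  apply/eqP => h; have : P *m u = 0.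
    by apply/matrixP => i j; rewrite (ord1 j) [RHS]mxE; have [->//|/Pu->] := eqVneq i i0.
  move=> /(congr1 (mulmx (P ^t*))); rewrite mulmxA PP mul1mx mulmx0 => /matrixP/(_ i0 0).
  by rewrite !mxE => /eqP; rewrite oner_eq0.
pose c := P *m map_mx f v.
have tc (x : 'cV[C]_n) k : (x ^t*) 0 k = (x k 0)^* by rewrite !mxE.
have ci0 : c i0 0 = 0.
  have : ((P *m u) ^t* *m c) 0 0 = 0.
    rewrite trmx_mul map_mxM /= -mulmxA (mulmxA _ P) PP mul1mx mxE -[RHS](rmorph0 f) -v0 rmorph_sum.
    by apply: eq_bigr => k _; rewrite !mxE rmorph1 mul1r.
  rewrite mxE (bigD1 i0) //= big1 ?addr0; last first.
    by move=> i ii0; rewrite tc Pu // rmorph0 mul0r.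
  rewrite tc => /eqP; rewrite mulf_eq0 conjC_eq0 => /orP[|/eqP //].
  by move/negbTE: Pu0 => ->.
have nE (x : 'cV[C]_n) : \sum_i `|(P *m x) i 0| ^+ 2 = \sum_i `|x i 0| ^+ 2.
  have : ((P *m x) ^t* *m (P *m x)) 0 0 = (x ^t* *m x) 0 0.
    by rewrite trmx_mul map_mxM /= -mulmxA (mulmxA _ P) PP mul1mx.
  rewrite !mxE => h.
  transitivity (\sum_j (P *m x) ^t* 0 j * (P *m x) j 0).
    by apply: eq_bigr => i _; rewrite sqr_normc !mxE mulrC.
  by rewrite h; apply: eq_bigr => i _; rewrite sqr_normc !mxE mulrC.
rewrite -lecR rmorphM !rmorph_sum /=.
have -> : \sum_i f (v i 0 ^+ 2) = \sum_i `|c i 0| ^+ 2.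
  by rewrite nE; apply: eq_bigr => i _; rewrite mxE cnorm_real.
have -> : \sum_i f ((W *m v) i 0 ^+ 2) = \sum_i `|(s 0 i) * c i 0| ^+ 2.
  transitivity (\sum_i `|(P *m (A *m map_mx f v)) i 0| ^+ 2).
    by rewrite nE; apply: eq_bigr => i _; rewrite -map_mxM [X in `|X|]mxE cnorm_real.
  by rewrite mulmxA PA -mulmxA mul_diag_mx; apply: eq_bigr => i _; rewrite mxE.
rewrite mulr_sumr; apply: ler_sum => i _; rewrite normrM exprMn.
have [->|ii0] := eqVneq i i0; first by rewrite ci0 normr0 expr0n !mulr0.
by apply: ler_wpM2r; [rewrite exprn_ge0 | exact: srho].
Qed.

Lemma rho_ge0 n (W : 'M[R]_n) rho : mixing_matrix W rho -> 0 <= rho.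
Proof. by move=> [_ _ _ [lam [_ _ _ _ ->]] _]; rewrite le_max normr_ge0. Qed.

Lemma mixing_contract n (W : 'M[R]_n) rho m (M : 'M[R]_(n, m)) : mixing_matrix W rho ->
  (forall j, \sum_i M i j = 0) -> fnorm (W *m M) <= rho * fnorm M.
Proof.
move=> hW M0; have r0 := rho_ge0 hW.
apply: fnorm_sq_le; first by rewrite mulr_ge0.
rewrite exprMn !fnorm_sqE exchange_big [X in _ <= _ * X]exchange_big /= mulr_sumr.
apply: ler_sum => j _.
have h0 : \sum_i (col j M) i 0 = 0 by rewrite -[RHS](M0 j); apply: eq_bigr => i _; rewrite mxE.
have := mixing_contract_col hW h0.
have -> : \sum_i (W *m col j M) i 0 ^+ 2 = \sum_(i < n) (W *m M) i j ^+ 2.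
  by apply: eq_bigr => i _; rewrite !mxE; congr (_ ^+ 2); apply: eq_bigr => k _; rewrite mxE.
by have -> : \sum_i (col j M) i 0 ^+ 2 = \sum_(i < n) M i j ^+ 2 by apply: eq_bigr => i _; rewrite mxE.
Qed.

(** For n = 1 the last eigenvalue is the first one, so rho = 1. *)
Lemma mixing_size n (W : 'M[R]_n) rho : mixing_matrix W rho -> (1 < n)%N.
Proof.
move=> [_ _ _ [lam [sl _ _ l0 re]] r1].
case: n sl re W => [|[|n]] // sl re W.
  by move: l0; rewrite nth_default ?sl // => /eqP; rewrite eq_sym oner_eq0.
by move: r1; rewrite re /= l0 normr1 gt_max ltxx andbF.
Qed.

End Spectral.

(** * Square-integrable vectors *)

Section MeasVec.
Context {R : realType}.

(** An open set is a countable union of boxes with rational centers and radii 1/k. *)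
Lemma measurable_rV d (T : measurableType d) m (X : T -> 'rV[R]_m) :
  (forall j, measurable_fun setT (fun t => X t 0 j)) ->
  measurable_fun setT (X : T -> g_sigma_algebraType (@open 'rV[R]_m)).
Proof.
move=> mX _ B sB; rewrite setTI; move: B sB.
suff H : <<s @open 'rV[R]_m >> `<=` [set B | measurable (X @^-1` B)] by move=> B /H.
apply: smallest_sub.
  split => /=.
  - by rewrite preimage_set0.
  - by move=> A mA; rewrite setTD preimage_setC; exact: measurableC.
  - by move=> F mF; rewrite preimage_bigcup; apply: bigcup_measurable.
move=> U oU /=.
pose box (c : 'rV[rat]_m * nat) : set 'rV[R]_m :=
  [set x | forall j, `|x 0 j - ratr (c.1 0 j)| < c.2.+1%:R^-1].
pose D := [set c : 'rV[rat]_m * nat | box c `<=` U].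
have UE : U = \bigcup_(c in D) box c.
  apply/seteqP; split => [x Ux|x [c Dc bx]]; last exact: Dc.
  have /nbhs_ballP[e /= e0 eU] : nbhs x U by exact: open_nbhs_nbhs.
  pose k := Num.truncn (2 / e).
  have k0 : 0 < k.+1%:R :> R by rewrite ltr0n.
  have ke : 2 * k.+1%:R^-1 < e.
    rewrite ltr_pdivrMr // mulrC -ltr_pdivrMr //.
    by rewrite -truncn_lt_nat // divr_ge0 // ltW.
  have ex (j : 'I_m) : exists r : rat, `|x 0 j - ratr r| < k.+1%:R^-1.
    have hlt : x 0 j - k.+1%:R^-1 < x 0 j + k.+1%:R^-1.
      by rewrite ltrBlDr -addrA ltrDl addr_gt0 // invr_gt0.
    have [r] := rat_in_itvoo hlt.
    by rewrite in_itv /= => hr; exists r; rewrite distrC ltr_distl.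
  pose c : 'rV[rat]_m := \row_j sval (cid (ex j)).
  exists (c, k).
    move=> y hy; apply: eU; rewrite -ball_normE /= /Num.Def.normr /= mx_normrE.
    apply/bigmax_ltP; split => // -[i j] _ /=; rewrite (ord1 i) !mxE.
    have h1 := hy j; have h2 := svalP (cid (ex j)); rewrite /= mxE in h1.
    rewrite distrC in h1.
    rewrite -(subrKA (ratr (sval (cid (ex j))))).
    apply: le_lt_trans (ler_normD _ _) _; apply: lt_trans ke; rewrite mulr_natl mulr2n.
    by apply: ltrD.
  by move=> j; rewrite /= mxE; exact: (svalP (cid (ex j))).
rewrite UE preimage_bigcup.
rewrite bigcup_mkcond; apply: countable_bigcupT_measurable.
  exact: countableP.
move=> c; case: ifPn => // _.
have -> : X @^-1` box c = \bigcap_(j in [set: 'I_m]) [set t | `|X t 0 j - ratr (c.1 0 j)| < c.2.+1%:R^-1].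
  by apply/seteqP; split => [t h j _|t h j]; [exact: h|exact: h].
apply: fin_bigcap_measurable; first exact: finite_finset.
move=> j _.
rewrite (_ : [set t | _] = (fun t => `|X t 0 j - ratr (c.1 0 j)|) @^-1` `]-oo, c.2.+1%:R^-1[%classic); last first.
  by apply/seteqP; split => t /=; rewrite in_itv.
rewrite -[X in measurable X]setTI.
have mf : measurable_fun setT (fun t => `|X t 0 j - ratr (c.1 0 j)|).
  by apply: measurableT_comp => //; apply: measurable_funB.
by apply: mf => //; exact: measurable_itv.
Qed.

Lemma measurable_continuous_rV d (T : measurableType d) m (X : T -> 'rV[R]_m) (h : 'rV[R]_m -> R) :
  (forall j, measurable_fun setT (fun t => X t 0 j)) -> continuous h ->
  measurable_fun setT (fun t => h (X t)).
Proof.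
move=> mX ch.
have mh : measurable_fun setT (h : g_sigma_algebraType (@open 'rV[R]_m) -> R).
  apply: (measurability _ (RGenOpens.measurableE R)).
  move=> _ [U oU <-]; rewrite setTI; apply: sub_sigma_algebra.
  move/continuousP: ch; apply.
  by case: oU => a [b ->]; exact: interval_open.
exact: (measurableT_comp mh (measurable_rV mX)).
Qed.

End MeasVec.

Section Expect.
Context {R : realType} {d : measure_display} {O : measurableType d}.
Variable P : probability O R.
Implicit Types f g : O -> R.

Definition intg f := P.-integrable setT (EFin \o f).
Definition Ex f : R := (\int[P]_(w in setT) f w)%R.

Lemma intg_meas f : intg f -> measurable_fun setT f.
Proof. by move=> /integrableP[/measurable_EFinP]. Qed.
Lemma intg_cst (c : R) : intg (fun=> c).
Proof. exact: finite_measure_integrable_cst. Qed.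
Lemma intgD f g : intg f -> intg g -> intg (fun w => f w + g w).
Proof. by move=> hf hg; have := integrableD measurableT hf hg. Qed.
Lemma intgZ (c : R) f : intg f -> intg (fun w => c * f w).
Proof. by move=> hf; have := integrableZl measurableT c hf. Qed.
Lemma intgN f : intg f -> intg (fun w => - f w).
Proof. by move=> /(intgZ (-1)); under eq_fun do rewrite mulN1r. Qed.
Lemma intgB f g : intg f -> intg g -> intg (fun w => f w - g w).
Proof. by move=> hf hg; apply: intgD => //; exact: intgN. Qed.
Lemma intg_sum (I : Type) (r : seq I) (Q : pred I) (F : I -> O -> R) :
  (forall i, Q i -> intg (F i)) -> intg (fun w => \sum_(i <- r | Q i) F i w).
Proof.
move=> h; elim: r => [|i r IH]; first by under eq_fun do rewrite big_nil; exact: intg_cst.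
have [qi|nq] := boolP (Q i).
  by under eq_fun do rewrite big_cons qi; apply: intgD => //; exact: h.
by under eq_fun do rewrite big_cons (negbTE nq).
Qed.
Lemma intg_le f g : measurable_fun setT f -> (forall w, `|f w| <= g w) -> intg g -> intg f.
Proof.
move=> mf fg; apply: le_integrable => //; first exact/measurable_EFinP.
by move=> w _ /=; rewrite lee_fin (le_trans (fg w)) // ler_norm.
Qed.
Lemma ExD f g : intg f -> intg g -> Ex (fun w => f w + g w) = Ex f + Ex g.
Proof. by move=> hf hg; exact: RintegralD. Qed.
Lemma ExZ (c : R) f : intg f -> Ex (fun w => c * f w) = c * Ex f.
Proof. by move=> hf; exact: RintegralZl. Qed.
Lemma ExB f g : intg f -> intg g -> Ex (fun w => f w - g w) = Ex f - Ex g.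
Proof. by move=> hf hg; exact: RintegralB. Qed.
Lemma Ex_cst (c : R) : Ex (fun=> c) = c.
Proof. by transitivity (c * fine (P setT)); [exact: Rintegral_cst | rewrite probability_setT mulr1]. Qed.
Lemma Ex_sum (I : Type) (r : seq I) (Q : pred I) (F : I -> O -> R) :
  (forall i, Q i -> intg (F i)) -> Ex (fun w => \sum_(i <- r | Q i) F i w) = \sum_(i <- r | Q i) Ex (F i).
Proof.
move=> h; elim: r => [|i r IH].
  by rewrite big_nil -[RHS](Ex_cst 0); congr Ex; apply/funext => w; rewrite big_nil.
rewrite big_cons -IH; have [qi|nq] := boolP (Q i).
  rewrite -ExD; [|exact: h|exact: intg_sum].
  by congr Ex; apply/funext => w; rewrite big_cons qi.
by congr Ex; apply/funext => w; rewrite big_cons (negbTE nq).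
Qed.
Lemma Ex_le f g : intg f -> intg g -> (forall w, f w <= g w) -> Ex f <= Ex g.
Proof. by move=> hf hg h; apply: le_Rintegral. Qed.
Lemma Ex_ge0 f : (forall w, 0 <= f w) -> 0 <= Ex f.
Proof. by move=> h; apply: Rintegral_ge0. Qed.
Lemma Ex_eq f g : (forall w, f w = g w) -> Ex f = Ex g.
Proof. by move=> h; congr Ex; apply/funext. Qed.
Lemma intg_eq f g : (forall w, f w = g w) -> intg f -> intg g.
Proof. by move=> /funext ->. Qed.

Definition L2 f := measurable_fun setT f /\ intg (fun w => f w ^+ 2).

Lemma L2_le f g : measurable_fun setT f -> (forall w, `|f w| <= `|g w|) -> L2 g -> L2 f.
Proof.
move=> mf fg [mg ig]; split => //; apply: intg_le ig; first exact: measurable_funX.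
by move=> w; rewrite normrX -[leRHS]real_normK ?num_real // ler_pXn2r // nnegrE.
Qed.
Lemma L2_mul f g : L2 f -> L2 g -> intg (fun w => f w * g w).
Proof.
move=> [mf hf] [mg hg]; apply: intg_le (intgD hf hg); first exact: measurable_funM.
move=> w; rewrite normrM.
have h1 := sqr_ge0 (`|f w| - `|g w|); have h2 := normr_ge0 (f w); have h3 := normr_ge0 (g w).
by rewrite -(real_normK (num_real (f w))) -(real_normK (num_real (g w))); nra.
Qed.
Lemma L2_cst (c : R) : L2 (fun=> c).
Proof. by split; [exact: measurable_cst | exact: intg_cst]. Qed.
Lemma L2_intg f : L2 f -> intg f.
Proof. by move=> /(L2_mul (L2_cst 1)); apply: intg_eq => w; rewrite mul1r. Qed.
Lemma L2D f g : L2 f -> L2 g -> L2 (fun w => f w + g w).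
Proof.
move=> hf hg; have hfg := L2_mul hf hg; case: hf hg => mf hf [mg hg].
split; first exact: measurable_funD.
apply: (intg_eq (f := fun w => f w ^+ 2 + 2 * (f w * g w) + g w ^+ 2)) => [w|].
  by rewrite sqrrD; ring.
by apply: intgD => //; apply: intgD => //; exact: intgZ.
Qed.
Lemma L2Z (c : R) f : L2 f -> L2 (fun w => c * f w).
Proof.
move=> [mf hf]; split; first exact: measurable_funM.
by under eq_fun do rewrite exprMn; exact: intgZ.
Qed.
Lemma L2N f : L2 f -> L2 (fun w => - f w).
Proof. by move=> /(L2Z (-1)); under eq_fun do rewrite mulN1r. Qed.
Lemma L2_sum (I : Type) (r : seq I) (Q : pred I) (F : I -> O -> R) :
  (forall i, Q i -> L2 (F i)) -> L2 (fun w => \sum_(i <- r | Q i) F i w).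
Proof.
move=> h; elim: r => [|i r IH]; first by under eq_fun do rewrite big_nil; exact: L2_cst.
have [qi|nq] := boolP (Q i).
  by under eq_fun do rewrite big_cons qi; apply: L2D => //; exact: h.
by under eq_fun do rewrite big_cons (negbTE nq).
Qed.

(** The variance is nonnegative. *)
Lemma Ex_jensen f : L2 f -> (Ex f) ^+ 2 <= Ex (fun w => f w ^+ 2).
Proof.
move=> hf; have h := @Ex_ge0 (fun w => (f w - Ex f) ^+ 2) (fun w => sqr_ge0 _).
have E : Ex (fun w => (f w - Ex f) ^+ 2) = Ex (fun w => f w ^+ 2) - (Ex f) ^+ 2.
  rewrite (Ex_eq (g := fun w => (f w ^+ 2 - 2 * Ex f * f w) + Ex f ^+ 2)); last by move=> w; ring.
  have i1 := L2_intg hf.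
  rewrite ExD; [|by apply: intgB; [exact: hf.2|exact: intgZ]|exact: intg_cst].
  by rewrite ExB; [|exact: hf.2|exact: intgZ]; rewrite ExZ // Ex_cst; ring.
by rewrite -subr_ge0 -E.
Qed.

Definition L2m m n (X : O -> 'M[R]_(m, n)) := forall i j, L2 (fun w => X w i j).

Section Mx.
Variables m n : nat.
Implicit Types X Y : O -> 'M[R]_(m, n).
Lemma L2mD X Y : L2m X -> L2m Y -> L2m (fun w => X w + Y w).
Proof. by move=> hX hY i j; under eq_fun do rewrite mxE; exact: L2D. Qed.
Lemma L2mZ (c : R) X : L2m X -> L2m (fun w => c *: X w).
Proof. by move=> hX i j; under eq_fun do rewrite mxE; exact: L2Z. Qed.
Lemma L2mN X : L2m X -> L2m (fun w => - X w).
Proof. by move=> hX i j; under eq_fun do rewrite mxE; exact: L2N. Qed.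
Lemma L2mB X Y : L2m X -> L2m Y -> L2m (fun w => X w - Y w).
Proof. by move=> hX hY; apply: L2mD => //; exact: L2mN. Qed.
Lemma L2m_cst (A : 'M[R]_(m, n)) : L2m (fun=> A).
Proof. by move=> i j; exact: L2_cst. Qed.
Lemma L2m_sum (I : Type) (r : seq I) (Q : pred I) (F : I -> O -> 'M[R]_(m, n)) :
  (forall i, Q i -> L2m (F i)) -> L2m (fun w => \sum_(i <- r | Q i) F i w).
Proof.
by move=> h i j; under eq_fun do rewrite summxE; apply: L2_sum => k qk; exact: h.
Qed.
Lemma intg_dotp X Y : L2m X -> L2m Y -> intg (fun w => dotp (X w) (Y w)).
Proof. by move=> hX hY; apply: intg_sum => i _; apply: intg_sum => j _; exact: L2_mul. Qed.
Lemma intg_fnorm2 X : L2m X -> intg (fun w => fnorm (X w) ^+ 2).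
Proof. by move=> hX; under eq_fun do rewrite fnorm_sq; exact: intg_dotp. Qed.
Lemma meas_fnorm d' (T : measurableType d') (X : T -> 'M[R]_(m, n)) :
  (forall i j, measurable_fun setT (fun t => X t i j)) -> measurable_fun setT (fun t => fnorm (X t)).
Proof.
move=> mX; rewrite /fnorm; apply: measurableT_comp.
  by apply: continuous_measurable_fun; exact: sqrt_continuous.
by apply: measurable_sum => i; apply: measurable_sum => j; exact: measurable_funX.
Qed.
Lemma L2_fnorm X : L2m X -> L2 (fun w => fnorm (X w)).
Proof.
by move=> hX; split; [apply: meas_fnorm => i j; exact: (hX i j).1|exact: intg_fnorm2].
Qed.
End Mx.

Lemma L2m_mull m n k (A : 'M[R]_(m, n)) (X : O -> 'M[R]_(n, k)) : L2m X -> L2m (fun w => A *m X w).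
Proof.
move=> hX i j; under eq_fun do rewrite mxE.
by apply: L2_sum => l _; exact: L2Z.
Qed.
Lemma L2m_row m n (X : O -> 'M[R]_(m, n)) i : L2m X -> L2m (fun w => row i (X w)).
Proof. by move=> hX k j; under eq_fun do rewrite mxE; exact: hX. Qed.

Lemma lip_coord_continuous m k L (G : 'rV[R]_m -> 'rV[R]_k) j : lip L G ->
  continuous (fun x => G x 0 j).
Proof.
move=> hl; apply: (@lip_continuous _ _ _ L) => w w'.
by have := entry_le_fnorm (G w - G w') 0 j; rewrite !mxE => /le_trans; apply.
Qed.

Lemma L2m_lip m k L (G : 'rV[R]_m -> 'rV[R]_k) (X : O -> 'rV[R]_m) : lip L G ->
  L2m X -> L2m (fun w => G (X w)).
Proof.
move=> hl hX i j; rewrite (ord1 i).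
apply: (@L2_le _ (fun w => fnorm (G 0) + L * fnorm (X w))).
- apply: (measurable_continuous_rV (h := fun x => G x 0 j)); last exact: lip_coord_continuous hl.
  by move=> l; exact: (hX 0 l).1.
- move=> w; apply: le_trans (entry_le_fnorm _ _ _) _; apply: le_trans (ler_norm _).
  rewrite -[G (X w)](subrKC (G 0)); apply: le_trans (ler_fnormD _ _) _; rewrite lerD2l.
  by apply: le_trans (hl _ _) _; rewrite subr0.
- by apply: L2D; [exact: L2_cst|apply: L2Z; exact: L2_fnorm].
Qed.

End Expect.

(** * Freezing the past *)

Definition mk_mfun d1 d2 (T1 : measurableType d1) (T2 : measurableType d2) (f : T1 -> T2)
  (mf : measurable_fun setT f) : {mfun T1 >-> T2} :=
  MeasurableFun.Pack (MeasurableFun.Class (isMeasurableFun.Build _ _ _ _ f mf)).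

Section Freeze.
Context {R : realType} {d : measure_display} {O : measurableType d}.
Variable P : probability O R.

Section SubSigma.
Variable G : set (set O).
Hypothesis hG : G `<=` @measurable _ O.
Local Notation T := (g_sigma_algebraType G).

Lemma sub_sigma_meas (A : set O) : <<s G >> A -> measurable A.
Proof. by move=> h; apply: (smallest_sub (sigma_algebra_measurable O) hG). Qed.

Lemma past_meas d' (Y : measurableType d') (f : O -> Y) :
  measurable_fun setT (f : T -> Y) -> measurable_fun setT f.
Proof.
by move=> mf _ B mB; rewrite setTI; apply: sub_sigma_meas; have := mf measurableT B mB; rewrite setTI.
Qed.

Lemma id_meas : measurable_fun setT (fun w : O => (w : T)).
Proof. by move=> _ B mB; rewrite setTI preimage_id; exact: sub_sigma_meas. Qed.

Context {dX : measure_display} {X : measurableType dX}.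
Variables (V : O -> X) (mV : measurable_fun setT V) (mu : probability X R).
Hypothesis indep : forall A B, <<s G >> A -> measurable B -> P (A `&` V @^-1` B) = (P A * mu B)%E.

Let idT : O -> T := fun w => w.
Let idm : {mfun O >-> T} := mk_mfun (f := idT) id_meas.
Let jointT : O -> (T * X)%type := fun w => (idT w, V w).
Lemma jointT_meas : measurable_fun setT jointT.
Proof. by apply: measurable_fun_pair => //; exact: id_meas. Qed.
Let jm : {mfun O >-> (T * X)%type} := mk_mfun jointT_meas.

Let PT : probability T R := distribution P idm.
Let PJ : probability (T * X)%type R := distribution P jm.

(** Independence of V from G says that o |-> (o, V o) is distributed as a product.
    The first component keeps the whole sample point but sees only the events
    generated by G, so that functions of the past and of V are functions of it. *)
Lemma joint_law A : measurable A -> (PT \x mu)%E A = PJ A.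
Proof.
move=> mA; apply: (@product_measure_unique _ _ _ _ _ PT mu PJ); [exact: indep | exact: mA].
Qed.

(** Tonelli for the product law: V is integrated first, with the past frozen. *)
Lemma freeze_ge0 (h : T * X -> \bar R) : measurable_fun setT h -> (forall z, (0 <= h z)%E) ->
  (\int[P]_w h (w, V w) = \int[P]_w \int[mu]_v h (w, v))%E.
Proof.
move=> mh h0.
transitivity (\int[PJ]_z h z)%E; first by rewrite ge0_integral_distribution.
rewrite -(eq_measure_integral PJ (m1 := (PT \x mu)%E)); last by move=> A mA _; exact: joint_law.
rewrite fubini_tonelli1 //.
by rewrite ge0_integral_distribution //; [exact: measurable_fun_fubini_tonelli_F|move=> y; exact: integral_ge0].
Qed.

Lemma freeze_zero (h : T * X -> R) : measurable_fun setT h ->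
  intg P (fun w => h (w, V w)) -> (forall w, (\int[mu]_v (h (w, v))%:E = 0)%E) ->
  Ex P (fun w => h (w, V w)) = 0.
Proof.
move=> mh ih h0.
have mhE : measurable_fun setT (EFin \o h) by exact/measurable_EFinP.
have iPJ : PJ.-integrable setT (EFin \o h).
  by apply: (integrable_pushforward jointT_meas).
have iPTmu : (PT \x mu)%E.-integrable setT (EFin \o h).
  move/integrableP: iPJ => [_ hf]; apply/integrableP; split => //.
  by rewrite (eq_measure_integral PJ) // => A mA _; exact: joint_law.
rewrite /Ex /Rintegral.
have -> : (\int[P]_w (h (w, V w))%:E = \int[PJ]_z (EFin \o h) z)%E.
  by rewrite integral_distribution.
rewrite -(eq_measure_integral PJ (m1 := (PT \x mu)%E)); last by move=> A mA _; exact: joint_law.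
rewrite -integral12_prod_meas1 // (eq_integral (cst 0%E)) ?integral0 // => w _.
exact: h0.
Qed.

Section Noise.
Variables (m : nat) (eps : T -> X -> 'rV[R]_m) (s2 : R).
Hypothesis meps : forall k, measurable_fun setT (fun z : T * X => eps z.1 z.2 0 k).
Hypothesis eps_mean : forall w k, (\int[mu]_v (eps w v 0 k)%:E = 0)%E.
Hypothesis eps_var : forall w, (\int[mu]_v (fnorm (eps w v) ^+ 2)%:E <= s2%:E)%E.
Hypothesis s20 : 0 <= s2.

Lemma noise_meas k : measurable_fun setT (fun w : O => eps w (V w) 0 k).
Proof. exact: (measurableT_comp (meps k) jointT_meas). Qed.

(** With the past frozen, the variance bound applies for each value of it. *)
Lemma noise_var (y : O -> R) : measurable_fun setT (y : T -> R) -> (forall w, 0 <= y w) ->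
  intg P y -> intg P (fun w => y w * fnorm (eps w (V w)) ^+ 2) /\
  Ex P (fun w => y w * fnorm (eps w (V w)) ^+ 2) <= s2 * Ex P y.
Proof.
move=> my y0 iy.
pose h (z : T * X) := (y z.1 * fnorm (eps z.1 z.2) ^+ 2)%:E.
have mn : measurable_fun setT (fun z : T * X => fnorm (eps z.1 z.2)).
  by apply: meas_fnorm => i j; rewrite (ord1 i).
have mh : measurable_fun setT h.
  apply/measurable_EFinP; apply: measurable_funM; last exact: measurable_funX.
  exact: (measurableT_comp my measurable_fst).
have h0 z : (0 <= h z)%E by rewrite lee_fin mulr_ge0 // sqr_ge0.
have le1 : (\int[P]_w h (w, V w) <= s2%:E * \int[P]_w (y w)%:E)%E.
  have E : (\int[P]_w (s2%:E * (y w)%:E) = s2%:E * \int[P]_w (y w)%:E)%E.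
    have mE : measurable_fun setT (EFin \o y) by apply/measurable_EFinP; exact: past_meas my.
    by apply: (@ge0_integralZl _ _ _ P setT measurableT _ mE s2%:E); [move=> w _; rewrite lee_fin | rewrite lee_fin].
  rewrite freeze_ge0 // -E.
  apply: ge0_le_integral => //.
  - by move=> w _; exact: integral_ge0.
  - apply: (past_meas (f := fun w => (\int[mu]_v h (w, v))%E)).
    exact: measurable_fun_fubini_tonelli_F.
  - apply/measurable_EFinP; apply: measurable_funM => //; exact: past_meas my.
  - move=> w _; rewrite /h /=.
    under eq_integral do rewrite EFinM.
    rewrite ge0_integralZl //; last 3 first.
    + apply/measurable_EFinP; apply: measurable_funX.
      apply: meas_fnorm => i j; rewrite (ord1 i).
      exact: (measurableT_comp (meps j) (pair1_measurable (w : T))).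
    + by move=> v _; rewrite lee_fin sqr_ge0.
    + by rewrite lee_fin.
    by rewrite muleC; apply: lee_wpmul2r => //; rewrite lee_fin.
have fy : (\int[P]_w (y w)%:E)%E \is a fin_num by exact: integrable_fin_num.
have m1 : measurable_fun setT (fun w => y w * fnorm (eps w (V w)) ^+ 2).
  by apply/measurable_EFinP; exact: (measurableT_comp mh jointT_meas).
have lty : (\int[P]_w h (w, V w) < +oo)%E.
  by apply: le_lt_trans le1 _; rewrite ltey_eq fin_numM.
have ih : intg P (fun w => y w * fnorm (eps w (V w)) ^+ 2).
  apply/integrableP; split; first exact/measurable_EFinP.
  rewrite (eq_integral (fun w => h (w, V w))) // => w _ /=.
  by rewrite ger0_norm // mulr_ge0 // sqr_ge0.
split => //; rewrite /Ex /Rintegral.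
have fh := integrable_fin_num measurableT ih.
rewrite -lee_fin EFinM fineK // fineK //.
Qed.

Lemma noise_L2 : L2m P (fun w : O => eps w (V w)).
Proof.
have [ii _] := @noise_var (fun=> 1) (measurable_cst _) (fun _ => ler01) (intg_cst _ _).
move=> i k; rewrite (ord1 i); split; first exact: noise_meas.
apply: intg_le ii; first by apply: measurable_funX; exact: noise_meas.
move=> w; rewrite mul1r normrX -(ger0_norm (fnorm_ge0 _)) ler_pXn2r ?nnegrE //.
by rewrite (ger0_norm (fnorm_ge0 _)) entry_le_fnorm.
Qed.

(** The noise is conditionally centered, hence orthogonal to the past. *)
Lemma noise_orth (y : O -> R) k : measurable_fun setT (y : T -> R) -> L2 P y ->
  Ex P (fun w => y w * eps w (V w) 0 k) = 0.
Proof.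
move=> my hy.
apply: (@freeze_zero (fun z => y z.1 * eps z.1 z.2 0 k)).
- by apply: measurable_funM => //; exact: (measurableT_comp my measurable_fst).
- by apply: L2_mul => //; exact: noise_L2.
move=> w /=; under eq_integral do rewrite EFinM.
have ie : mu.-integrable setT (EFin \o (fun v => eps w v 0 k)).
  have mk : measurable_fun setT (fun v => eps w v 0 k).
    exact: (measurableT_comp (meps k) (pair1_measurable (w : T))).
  have i2 : intg mu (fun v => eps w v 0 k ^+ 2).
    apply: (@intg_le _ _ _ mu _ (fun v => fnorm (eps w v) ^+ 2)).
    - exact: measurable_funX.
    - move=> v; rewrite normrX -(ger0_norm (fnorm_ge0 (eps w v))) ler_pXn2r ?nnegrE //.
      by rewrite (ger0_norm (fnorm_ge0 _)) entry_le_fnorm.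
    apply/integrableP; split.
      apply/measurable_EFinP; apply: measurable_funX; apply: meas_fnorm => i j; rewrite (ord1 i).
      exact: (measurableT_comp (meps j) (pair1_measurable (w : T))).
    apply: le_lt_trans (_ : s2%:E < +oo)%E; last exact: ltry.
    rewrite (eq_integral (fun v => (fnorm (eps w v) ^+ 2)%:E)) ?eps_var // => v _ /=.
    by rewrite ger0_norm // sqr_ge0.
  by apply: L2_intg; split.
by rewrite integralZl // eps_mean mule0.
Qed.
End Noise.

End SubSigma.
End Freeze.

(** * From mutual to successive independence *)

Section MutualIndependence.
Context {R : realType} {d : measure_display} {O : measurableType d}.
Variable P : probability O R.
Variables (H : set (set O)) (K : finType) (E : K -> set (set O)).
Hypothesis HM : H `<=` @measurable _ O.
Hypothesis EM : forall k, E k `<=` @measurable _ O.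
Hypothesis HI : setI_closed H.
Hypothesis HT : H setT.
Hypothesis EI : forall k, setI_closed (E k).
Hypothesis ET : forall k, E k setT.
Hypothesis ind : forall A (B : K -> set O), H A -> (forall k, E k (B k)) ->
  P (A `&` \bigcap_(k in [set: K]) B k) = (P A * \prod_k P (B k))%E.

(** What is known once the calls in [pre] are revealed. *)
Definition gen (pre : seq K) : set (set O) :=
  H `|` \bigcup_(k in [set k | k \in pre]) E k.

Lemma gen_meas pre : gen pre `<=` @measurable _ O.
Proof. by move=> A [/HM//|[k _ /EM]]. Qed.

Lemma gen_cons k pre : gen pre `<=` gen (k :: pre).
Proof.
by move=> A [hA|[j hj EA]]; [left|right; exists j => //=; rewrite inE; apply/orP; right].
Qed.

(** Events of the past intersected with one event of each revealed call: a
    family closed under intersection that generates [gen pre]. *)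
Let cyl (pre : seq K) : set (set O) :=
  [set C | exists A, exists B : K -> set O, [/\ H A, forall k, E k (B k),
    (forall k, k \notin pre -> B k = setT) & C = A `&` \bigcap_(k in [set: K]) B k]].

Lemma cyl_setI pre : setI_closed (cyl pre).
Proof.
move=> C1 C2 [A1 [B1 [hA1 hB1 n1 ->]]] [A2 [B2 [hA2 hB2 n2 ->]]].
exists (A1 `&` A2), (fun k => B1 k `&` B2 k); split.
- exact: HI.
- by move=> k; exact: EI.
- by move=> k hk; rewrite n1 // n2 // setTI.
apply/seteqP; split => w.
  by move=> [[a1 b1] [a2 b2]]; split => // k _; split; [exact: b1|exact: b2].
by move=> [[a1 a2] b]; split; split => // k _; have [] := b k I.
Qed.

Lemma gen_cyl pre : gen pre `<=` cyl pre.
Proof.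
move=> A [hA|[k hk EA]].
  exists A, (fun=> setT); split => //.
  by apply/seteqP; split => w // -[].
exists setT, (fun j => if j == k then A else setT); split => //.
- by move=> j; case: eqP => [->//|_]; exact: ET.
- by move=> j hj; case: eqP => // jk; move: hj; rewrite jk (_ : k \in pre).
rewrite setTI; apply/seteqP; split => w.
  by move=> Aw j _; case: eqP.
by move=> /(_ k I); rewrite eqxx.
Qed.

Lemma cyl_meas pre : cyl pre `<=` @measurable _ O.
Proof.
move=> C [A [B [hA hB _ ->]]]; apply: measurableI; first exact: HM.
apply: fin_bigcap_measurable; first exact: finite_finset.
by move=> k _; exact: EM (hB k).
Qed.

Lemma cyl_indep pre k C B : k \notin pre -> cyl pre C -> E k B -> P (C `&` B) = (P C * P B)%E.
Proof.
move=> hk [A [D [hA hD nD ->]]] EB.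
pose D' j := if j == k then B else D j.
have hD' j : E j (D' j) by rewrite /D'; case: eqP => [->|_].
have -> : A `&` \bigcap_(k in [set: K]) D k `&` B = A `&` \bigcap_(k in [set: K]) D' k.
  apply/seteqP; split => w.
    by move=> [[a b] c]; split => // j _; rewrite /D'; case: eqP => // _; exact: b.
  move=> [a b]; split; first split => // j _.
    have := b j I; rewrite /D'; case: eqP => // -> _; rewrite nD //.
  by have := b k I; rewrite /D' eqxx.
rewrite !ind // (bigD1 k) //= [in RHS](bigD1 k) //= {1}/D' eqxx nD // probability_setT mul1e.
rewrite (eq_bigr (fun j => P (D j))); last by move=> j /negbTE jk; rewrite /D' jk.
by rewrite -muleA; congr (_ * _)%E; rewrite muleC.
Qed.

(** On [cyl pre] this is the product rule; Dynkin's theorem extends it. *)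
Lemma gen_indep pre k C B : k \notin pre -> <<s gen pre >> C -> E k B ->
  P (C `&` B) = (P C * P B)%E.
Proof.
move=> hk hC EB.
have mB : measurable B by exact: EM EB.
have {}hC : <<s cyl pre >> C by apply: sub_sigma_algebra2 hC; exact: gen_cyl.
have cm := sub_sigma_meas (@cyl_meas pre).
apply: (@dynkin_induction _ (g_sigma_algebraType (cyl pre)) (cyl pre)
  (fun C => P (C `&` B) = (P C * P B)%E)) hC => //.
- exact: cyl_setI.
- by rewrite setTI probability_setT mul1e.
- by move=> A hA; exact: cyl_indep hA EB.
- move=> A /cm mA hA.
  have fA : P A \is a fin_num by exact: fin_num_measure.
  have fB : P B \is a fin_num by exact: fin_num_measure.
  have -> : ~` A `&` B = B `\` (A `&` B) by apply/seteqP; split => w; [move=> [a b]; split => // -[]|move=> [b a]; split => // wA; exact: a].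
  rewrite measureD //; last by rewrite ltey_eq fB.
    rewrite probability_setC // muleBl ?fin_num_adde_defr // mul1e -hA.
    by congr (_ - P _)%E; apply/seteqP; split => w; [move=> []|move=> [a b]].
  exact: measurableI.
- move=> F mF tF hF.
  have mF' n : @measurable _ O (F n) := cm _ (mF n).
  rewrite setI_bigcupl measure_bigcup //; last 2 first.
  + by move=> n _; exact: measurableI.
  + by apply/trivIsetP => i j _ _ ij; move/trivIsetP: tF => /(_ i j I I ij) e; rewrite setIACA e set0I.
  have PB : P B = (fine (P B))%:E by rewrite fineK // fin_num_measure.
  rewrite measure_bigcup // [RHS]muleC PB -nneseriesZl //.
  have hF' n : n \in [set: nat] -> P (F n `&` B) = ((fine (P B))%:E * P (F n))%E.
    by move=> _; rewrite -PB muleC; exact: hF.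
  exact: (eq_eseriesr hF').
Qed.

End MutualIndependence.

(** * Displaced averages and noise revealed call by call *)

Section Past.
Context {R : realType} {d : measure_display} {O : measurableType d}.
Variable G : set (set O).
Local Notation T := (g_sigma_algebraType G).

Definition past (f : O -> R) := measurable_fun setT (f : T -> R).
Definition pastm m n (X : O -> 'M[R]_(m, n)) := forall i j, past (fun w => X w i j).

Lemma past_cst (c : R) : past (fun=> c).
Proof. exact: measurable_cst. Qed.
Lemma pastD f g : past f -> past g -> past (fun w => f w + g w).
Proof. by move=> hf hg; exact: (@measurable_funD _ T R setT f g hf hg). Qed.
Lemma pastM f g : past f -> past g -> past (fun w => f w * g w).
Proof. by move=> hf hg; exact: (@measurable_funM _ T R setT f g hf hg). Qed.

Lemma pastmD m n (X Y : O -> 'M[R]_(m, n)) : pastm X -> pastm Y -> pastm (fun w => X w + Y w).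
Proof. by move=> hX hY i j; rewrite /past; under eq_fun do rewrite mxE; apply: pastD; [exact: hX|exact: hY]. Qed.
Lemma pastmZ m n (c : R) (X : O -> 'M[R]_(m, n)) : pastm X -> pastm (fun w => c *: X w).
Proof. by move=> hX i j; rewrite /past; under eq_fun do rewrite mxE; apply: pastM; [exact: past_cst|exact: hX]. Qed.
Lemma pastmB m n (X Y : O -> 'M[R]_(m, n)) : pastm X -> pastm Y -> pastm (fun w => X w - Y w).
Proof.
move=> hX hY; apply: pastmD => //.
by rewrite (_ : (fun w => _) = (fun w => (-1) *: Y w)); [exact: pastmZ|apply/funext => w; rewrite scaleN1r].
Qed.
Lemma pastm_cst m n (A : 'M[R]_(m, n)) : pastm (fun=> A).
Proof. by move=> i j; exact: measurable_cst. Qed.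
Lemma past_sum (I : Type) (r : seq I) (F : I -> O -> R) :
  (forall i, past (F i)) -> past (fun w => \sum_(i <- r) F i w).
Proof. by move=> h; exact: measurable_sum. Qed.
Lemma pastm_sum m n (I : Type) (r : seq I) (F : I -> O -> 'M[R]_(m, n)) :
  (forall i, pastm (F i)) -> pastm (fun w => \sum_(i <- r) F i w).
Proof. by move=> h i j; rewrite /past; under eq_fun do rewrite summxE; apply: past_sum => k; exact: h. Qed.
Lemma pastm_mull m n k (A : 'M[R]_(m, n)) (X : O -> 'M[R]_(n, k)) : pastm X -> pastm (fun w => A *m X w).
Proof.
move=> hX i j; rewrite /past; under eq_fun do rewrite mxE.
by apply: past_sum => l; apply: pastM; [exact: past_cst|exact: hX].
Qed.
Lemma pastm_row m n (X : O -> 'M[R]_(m, n)) i : pastm X -> pastm (fun w => row i (X w)).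
Proof. by move=> hX k j; rewrite /past; under eq_fun do rewrite mxE; exact: hX. Qed.
Lemma past_continuous m (X : O -> 'rV[R]_m) (h : 'rV[R]_m -> R) : pastm X -> continuous h ->
  past (fun w => h (X w)).
Proof. by move=> hX ch; apply: (@measurable_continuous_rV R _ T) => // j; exact: hX. Qed.
Lemma pastm_lip m k L (F : 'rV[R]_m -> 'rV[R]_k) (X : O -> 'rV[R]_m) : lip L F -> pastm X ->
  pastm (fun w => F (X w)).
Proof.
move=> hl hX i j; rewrite (ord1 i).
by apply: (past_continuous (h := fun x => F x 0 j)) => //; exact: lip_coord_continuous hl.
Qed.
Lemma past_fnorm m n (X : O -> 'M[R]_(m, n)) : pastm X -> past (fun w => fnorm (X w)).
Proof. by move=> hX; apply: (@meas_fnorm _ _ _ _ T). Qed.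

End Past.

Lemma past_mono (R : realType) d (O : measurableType d) (G G' : set (set O)) (f : O -> R) :
  G `<=` G' -> past G f -> past G' f.
Proof.
move=> GG hf _ B mB; rewrite setTI.
have h : <<s G >> (f @^-1` B) by have := hf measurableT B mB; rewrite setTI.
have : <<s G' >> (f @^-1` B) by apply: sub_sigma_algebra2 h.
by [].
Qed.

Section Reveal.
Context {R : realType} {d : measure_display} {O : measurableType d}.
Variables (P : probability O R) (n m : nat) (G : 'I_n -> 'rV[R]_m -> 'rV[R]_m)
  (J : 'I_n -> 'rV[R]_m -> 'M[R]_m) (ell ell2 sg : R).
Hypotheses (ell0 : 0 <= ell) (ell20 : 0 <= ell2).
Hypotheses (Glip : forall i, lip ell (G i)) (Gtaylor : forall i, taylor ell2 (G i) (J i))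
  (Jcont : forall i k l, continuous (fun x => J i x k l)).

(** With wb the mean of the agents and N their deviation from it, this is the bias of
    the averaged direction. *)
Definition disp (wb : 'rV[R]_m) (N : 'M[R]_(n, m)) : 'rV[R]_m :=
  n%:R^-1 *: \sum_i (G i (wb + row i N) - G i wb).

(** By [taylor_bounded]. Measurability and integrability of the linear term in
    [reveal_one] rest on this and on continuity. *)
Lemma J_entry i x k l : `|J i x k l| <= ell.
Proof.
have h := taylor_bounded (Glip i) (@Gtaylor i) x (delta_mx 0 k).
have d1 : fnorm (delta_mx 0 k : 'rV[R]_m) = 1.
  rewrite /fnorm big_ord1 (bigD1 k) //= big1 ?addr0 ?mxE ?eqxx ?expr1n ?sqrtr1 // => j /negbTE jk.
  by rewrite mxE jk andbF expr0n.
rewrite d1 mulr1 -rowE in h; apply: le_trans h.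
by have := entry_le_fnorm (row k (J i x)) 0 l; rewrite mxE.
Qed.

Lemma disp_L2 (wb : O -> 'rV[R]_m) (N : O -> 'M[R]_(n, m)) : L2m P wb -> L2m P N ->
  L2m P (fun w => disp (wb w) (N w)).
Proof.
move=> hw hN; apply: L2mZ; apply: L2m_sum => i _; apply: L2mB.
  by apply: (L2m_lip (Glip i)); apply: L2mD => //; exact: L2m_row.
exact: (L2m_lip (Glip i)).
Qed.

Lemma disp_past H (wb : O -> 'rV[R]_m) (N : O -> 'M[R]_(n, m)) : pastm H wb -> pastm H N ->
  pastm H (fun w => disp (wb w) (N w)).
Proof.
move=> hw hN; apply: pastmZ; apply: pastm_sum => i; apply: pastmB.
  by apply: (pastm_lip (Glip i)); apply: pastmD => //; exact: pastm_row.
exact: (pastm_lip (Glip i)).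
Qed.

(** One call displaces agent i further by a_i e. Its effect on the average is
    linear in e, with a coefficient known from the past, up to ell2 a2 |e|^2 / n. The
    linear part is orthogonal to the past and costs its variance, of order
    (ell a1 / n)^2; the quadratic part is charged against the increment already
    present. Bounding the whole effect by its size would lose a factor n. *)
Lemma reveal_one (H : set (set O)) (wb : O -> 'rV[R]_m) (N : O -> 'M[R]_(n, m))
   (e : O -> 'rV[R]_m) (a : 'cV[R]_n) (a1 a2 : R) :
  H `<=` @measurable _ O ->
  pastm H wb -> pastm H N -> L2m P wb -> L2m P N -> L2m P e ->
  (forall y k, past H y -> L2 P y -> Ex P (fun w => y w * e w 0 k) = 0) ->
  (forall y, past H y -> (forall w, 0 <= y w) -> intg P y ->
     intg P (fun w => y w * fnorm (e w) ^+ 2) /\ Ex P (fun w => y w * fnorm (e w) ^+ 2) <= sg ^+ 2 * Ex P y) ->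
  \sum_i `|a i 0| <= a1 -> \sum_i a i 0 ^+ 2 <= a2 ->
  Ex P (fun w => fnorm (disp (wb w) (N w + a *m e w)) ^+ 2) <=
    Ex P (fun w => fnorm (disp (wb w) (N w)) ^+ 2)
    + 2 * (n%:R^-1 * ell2 * a2 * sg ^+ 2) * Ex P (fun w => fnorm (disp (wb w) (N w)))
    + (n%:R^-1 * ell * a1) ^+ 2 * sg ^+ 2.
Proof.
move=> HM pw pN lw lN le O1 O2 ha1 ha2.
have n0 : 0 <= n%:R^-1 :> R by rewrite invr_ge0.
have a10 : 0 <= a1 by apply: le_trans ha1; apply: sumr_ge0.
have a20 : 0 <= a2 by apply: le_trans ha2; apply: sumr_ge0 => i _; exact: sqr_ge0.
pose F w := disp (wb w) (N w); pose F' w := disp (wb w) (N w + a *m e w).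
pose p i w := wb w + row i (N w).
have pp i : pastm H (p i) by apply: pastmD => //; exact: pastm_row.
have rowE' i w : wb w + row i (N w + a *m e w) = p i w + a i 0 *: e w.
  rewrite linearD /= addrA; congr (_ + _); apply/rowP => j.
  by rewrite !mxE big_ord1.
(* coefficient of the k-th coordinate of e in the pairing with the old increment *)
pose y k w := n%:R^-1 * \sum_i a i 0 * (F w *m (J i (p i w))^T) 0 k.
have FL2 : L2m P F by exact: disp_L2.
have Fp : pastm H F by exact: disp_past.
have Jp i k l : past H (fun w => J i (p i w) k l).
  by apply: (past_continuous (h := fun x => J i x k l)).
have FJp i k : past H (fun w => (F w *m (J i (p i w))^T) 0 k).
  rewrite /past; under eq_fun do rewrite mxE; apply: past_sum => q.
  under eq_fun do rewrite [X in _ * X]mxE; apply: measurable_funM; [exact: Fp|exact: Jp].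
have FJL i k : L2 P (fun w => (F w *m (J i (p i w))^T) 0 k).
  under eq_fun do rewrite mxE; apply: L2_sum => q _.
  under eq_fun do rewrite [X in _ * X]mxE.
  apply: (@L2_le _ _ _ _ _ (fun w => ell * F w 0 q)); last by apply: L2Z; exact: FL2.
    by apply: measurable_funM; [exact: (FL2 0 q).1|exact: (past_meas HM (Jp i k q))].
  by move=> w; rewrite !normrM mulrC (ger0_norm ell0) ler_wpM2r // J_entry.
have yp k : past H (y k).
  by apply: measurable_funM; [exact: measurable_cst|apply: past_sum => i; apply: measurable_funM => //; exact: FJp].
have yL k : L2 P (y k).
  by apply: L2Z; apply: L2_sum => i _; apply: L2Z.
have key w : fnorm (F' w) ^+ 2 <= fnorm (F w) ^+ 2 + 2 * (\sum_k y k w * e w 0 k)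
   + 2 * (n%:R^-1 * ell2 * a2) * (fnorm (F w) * fnorm (e w) ^+ 2)
   + (n%:R^-1 * ell * a1) ^+ 2 * fnorm (e w) ^+ 2.
  pose D := n%:R^-1 *: \sum_i (G i (p i w + a i 0 *: e w) - G i (p i w)).
  have F'E : F' w = F w + D.
    rewrite /F' /F /disp /D -scalerDr -big_split; congr (_ *: _); apply: eq_bigr => i _.
    by rewrite rowE' /= -/(p i w) [RHS]addrC subrKA.
  pose lin := n%:R^-1 *: \sum_i (a i 0 *: (e w *m J i (p i w))).
  have linE : dotp (F w) lin = \sum_k y k w * e w 0 k.
    rewrite dotpZr dotp_sumr.
    transitivity (n%:R^-1 * \sum_i a i 0 * \sum_k e w 0 k * (F w *m (J i (p i w))^T) 0 k).
      by congr (_ * _); apply: eq_bigr => i _; rewrite dotpZr dotpC dotp_mulmxl /dotp big_ord1.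
    under [RHS]eq_bigr do rewrite /y -mulrA mulr_suml.
    rewrite -mulr_sumr exchange_big /=; congr (_ * _); apply: eq_bigr => i _.
    by rewrite mulr_sumr; apply: eq_bigr => k _; ring.
  have remB : fnorm (D - lin) <= n%:R^-1 * ell2 * a2 * fnorm (e w) ^+ 2.
    rewrite /D /lin -scalerBr -sumrB fnormZ (ger0_norm n0) -!mulrA ler_wpM2l //.
    apply: le_trans (ler_fnorm_sum _ _ _) _.
    apply: le_trans (_ : \sum_i ell2 * (a i 0 ^+ 2 * fnorm (e w) ^+ 2) <= _).
      apply: ler_sum => i _; rewrite scalemxAl; apply: le_trans (Gtaylor _ _ _) _.
      by rewrite fnormZ exprMn real_normK ?num_real.
    by rewrite -mulr_sumr ler_wpM2l // -mulr_suml ler_wpM2r.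
  have DB : fnorm D <= n%:R^-1 * ell * a1 * fnorm (e w).
    rewrite /D fnormZ (ger0_norm n0) -!mulrA ler_wpM2l //.
    apply: le_trans (ler_fnorm_sum _ _ _) _.
    apply: le_trans (_ : \sum_i ell * (`|a i 0| * fnorm (e w)) <= _).
      apply: ler_sum => i _; apply: le_trans (Glip _ _ _) _.
      by rewrite addrAC subrr add0r fnormZ.
    by rewrite -mulr_sumr ler_wpM2l // -mulr_suml ler_wpM2r.
  rewrite F'E fnorm_sqD -linE.
  have -> : dotp (F w) D = dotp (F w) lin + dotp (F w) (D - lin) by rewrite -dotpDr subrKC.
  have h1 := le_trans (dotp_le (F w) (D - lin)) (ler_wpM2l (fnorm_ge0 (F w)) remB).
  have h2 : fnorm D ^+ 2 <= (n%:R^-1 * ell * a1 * fnorm (e w)) ^+ 2.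
    by rewrite ler_pXn2r ?nnegrE // !mulr_ge0.
  rewrite exprMn in h2.
  have -> : 2 * (n%:R^-1 * ell2 * a2) * (fnorm (F w) * fnorm (e w) ^+ 2) =
     2 * (fnorm (F w) * (n%:R^-1 * ell2 * a2 * fnorm (e w) ^+ 2)) by ring.
  move: h1 h2; set u1 := dotp _ _; set u2 := dotp _ _; set u3 := fnorm (F w) * _.
  set u4 := _ * fnorm (e w) ^+ 2; set u5 := fnorm D ^+ 2; set u6 := fnorm (F w) ^+ 2.
  by move=> h1 h2; lra.
have iFe : intg P (fun w => fnorm (F w) * fnorm (e w) ^+ 2) /\
    Ex P (fun w => fnorm (F w) * fnorm (e w) ^+ 2) <= sg ^+ 2 * Ex P (fun w => fnorm (F w)).
  by apply: O2 => //; [exact: past_fnorm|apply: L2_intg; exact: L2_fnorm].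
have ie : intg P (fun w => fnorm (e w) ^+ 2) /\ Ex P (fun w => fnorm (e w) ^+ 2) <= sg ^+ 2.
  have pc : past H (fun _ : O => 1 : R) by exact: past_cst.
  have [i1 i2] := O2 _ pc (fun _ => ler01) (intg_cst P 1).
  rewrite Ex_cst mulr1 in i2; split.
    by apply: intg_eq i1 => w; rewrite mul1r.
  by apply: le_trans i2; rewrite le_eqVlt; apply/orP; left; apply/eqP; apply: Ex_eq => w; rewrite mul1r.
have iF : intg P (fun w => fnorm (F w) ^+ 2) by exact: intg_fnorm2.
have iy k : intg P (fun w => y k w * e w 0 k) by apply: L2_mul.
have iys : intg P (fun w => \sum_k y k w * e w 0 k) by exact: intg_sum.
have F'L : L2m P F'.
  by apply: disp_L2 => //; apply: L2mD => //; apply: L2m_mull.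
have i1 : intg P (fun w => fnorm (F w) ^+ 2 + 2 * (\sum_k y k w * e w 0 k)).
  by apply: intgD => //; exact: intgZ.
have i2 := intgZ (2 * (n%:R^-1 * ell2 * a2)) iFe.1.
have i3 := intgZ ((n%:R^-1 * ell * a1) ^+ 2) ie.1.
apply: le_trans (Ex_le (intg_fnorm2 F'L) (intgD (intgD i1 i2) i3) key) _.
rewrite (ExD (intgD i1 i2) i3) (ExD i1 i2) (ExD iF (intgZ 2 iys)) (ExZ 2 iys) (ExZ _ iFe.1) (ExZ _ ie.1).
rewrite Ex_sum // big1 ?mulr0 ?addr0; last by move=> k _; exact: O1.
have c1 : 0 <= 2 * (n%:R^-1 * ell2 * a2) by rewrite !mulr_ge0.
have c2 : 0 <= (n%:R^-1 * ell * a1) ^+ 2 by exact: sqr_ge0.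
have := ler_wpM2l c1 iFe.2; have := ler_wpM2l c2 ie.2.
rewrite -/F; set A := Ex P _; set B := Ex P _; set C := Ex P _; set D := Ex P _.
by move=> g1 g2; rewrite -!addrA lerD2l; lra.
Qed.

Variables (K : finType) (gen : seq K -> set (set O)) (e : K -> O -> 'rV[R]_m).

(** The oracle errors of one iteration, revealed one at a time in any order: each
    is centered, with variance at most sg^2, given the calls revealed before it. *)
Record fresh_noise : Prop := FreshNoise {
  fn_meas : forall pre, gen pre `<=` @measurable _ O ;
  fn_mono : forall k pre, gen pre `<=` gen (k :: pre) ;
  fn_orth : forall k pre y j, k \notin pre -> past (gen pre) y -> L2 P y ->
     Ex P (fun w => y w * e k w 0 j) = 0 ;
  fn_var : forall k pre y, k \notin pre -> past (gen pre) y -> (forall w, 0 <= y w) -> intg P y ->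
     intg P (fun w => y w * fnorm (e k w) ^+ 2) /\
     Ex P (fun w => y w * fnorm (e k w) ^+ 2) <= sg ^+ 2 * Ex P y ;
  fn_past : forall k pre, pastm (gen (k :: pre)) (e k) ;
  fn_L2 : forall k, L2m P (e k) }.

Hypothesis FN : fresh_noise.

Lemma noise_second_moment k : Ex P (fun w => fnorm (e k w) ^+ 2) <= sg ^+ 2.
Proof.
have pc : past (gen [::]) (fun _ : O => 1 : R) by exact: past_cst.
have [_ i2] := fn_var FN (isT : k \notin [::]) pc (fun _ => ler01) (intg_cst P 1).
rewrite Ex_cst mulr1 in i2; apply: le_trans i2.
by rewrite le_eqVlt; apply/orP; left; apply/eqP; apply: Ex_eq => w; rewrite mul1r.
Qed.

Lemma gen_nil_sub pre : gen [::] `<=` gen pre.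
Proof. by elim: pre => [//|k pre IH]; apply: subset_trans IH _; exact: fn_mono. Qed.

Lemma pastm_mono G1 G2 p q (X : O -> 'M[R]_(p, q)) : G1 `<=` G2 -> pastm G1 X -> pastm G2 X.
Proof. by move=> h hX i j; apply: past_mono h _; exact: hX. Qed.

Definition noise_sum p (c : K -> 'cV[R]_p) (r : seq K) w : 'M[R]_(p, m) :=
  \sum_(k <- r) c k *m e k w.

Lemma noise_sum_cons p (c : K -> 'cV[R]_p) k r w :
  noise_sum c (k :: r) w = noise_sum c r w + c k *m e k w.
Proof. by rewrite /noise_sum big_cons addrC. Qed.

Lemma noise_sum_past p (c : K -> 'cV[R]_p) r : pastm (gen r) (noise_sum c r).
Proof.
elim: r => [|k r IH].
  by rewrite (_ : noise_sum c [::] = fun=> 0); [exact: pastm_cst|apply/funext => w; rewrite /noise_sum big_nil].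
rewrite (_ : noise_sum c (k :: r) = fun w => noise_sum c r w + c k *m e k w); last first.
  by apply/funext => w; exact: noise_sum_cons.
apply: pastmD; first by apply: pastm_mono IH; exact: fn_mono.
by apply: pastm_mull; exact: fn_past.
Qed.

Lemma noise_sum_L2 p (c : K -> 'cV[R]_p) r : L2m P (noise_sum c r).
Proof. by apply: L2m_sum => k _; apply: L2m_mull; exact: fn_L2. Qed.

Lemma noise_sum_var p (c : K -> 'cV[R]_p) r : uniq r ->
  Ex P (fun w => fnorm (noise_sum c r w) ^+ 2) <= sg ^+ 2 * \sum_(k <- r) fnorm (c k) ^+ 2.
Proof.
elim: r => [_|k r IH /= /andP[kr ur]].
  rewrite big_nil mulr0 -[leRHS](Ex_cst P 0) le_eqVlt; apply/orP; left; apply/eqP; apply: Ex_eq => w.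
  by rewrite /noise_sum big_nil fnorm0 expr0n.
pose X := noise_sum c r.
have XL : L2m P X by exact: noise_sum_L2.
pose y j w := ((c k)^T *m X w) 0 j.
have yL j : L2 P (y j) by apply: L2m_mull.
have yp j : past (gen r) (y j) by apply: pastm_mull; exact: noise_sum_past.
have iy j : intg P (fun w => y j w * e k w 0 j) by apply: L2_mul => //; exact: fn_L2.
have key w : fnorm (noise_sum c (k :: r) w) ^+ 2 <=
   fnorm (X w) ^+ 2 + 2 * (\sum_j y j w * e k w 0 j) + fnorm (c k) ^+ 2 * fnorm (e k w) ^+ 2.
  rewrite noise_sum_cons fnorm_sqD.
  have -> : dotp (noise_sum c r w) (c k *m e k w) = \sum_j y j w * e k w 0 j.
    rewrite dotpC /dotp exchange_big /=; apply: eq_bigr => j _.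
    rewrite /y mxE mulr_suml; apply: eq_bigr => i _; rewrite !mxE big_ord1; ring.
  rewrite lerD2l -exprMn ler_pXn2r ?nnegrE ?mulr_ge0 //; exact: fnorm_mulmx.
have i1 := intg_fnorm2 XL.
have iys : intg P (fun w => \sum_j y j w * e k w 0 j) by exact: intg_sum.
have i2 := intgZ 2 iys.
have i3 := intgZ (fnorm (c k) ^+ 2) (intg_fnorm2 (fn_L2 FN k)).
apply: le_trans (Ex_le (intg_fnorm2 (noise_sum_L2 _ _)) (intgD (intgD i1 i2) i3) key) _.
rewrite (ExD (intgD i1 i2) i3) (ExD i1 i2) (ExZ 2 iys) (ExZ _ (intg_fnorm2 (fn_L2 FN k))).
rewrite Ex_sum // big1 ?mulr0 ?addr0; last by move=> j _; exact: fn_orth kr (yp j) (yL j).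
rewrite big_cons mulrDr [leRHS]addrC; apply: lerD; first exact: IH.
by rewrite mulrC ler_wpM2r //; exact: noise_second_moment.
Qed.

(** In the recursion of [reveal_one] the variances add up while the quadratic
    parts add up as norms; the form (sqrt V + M)^2 keeps both. *)
Lemma sqrt_step (Z Z' F V M v mu : R) : 0 <= V -> 0 <= M -> 0 <= v -> 0 <= mu ->
  F ^+ 2 <= Z -> Z <= (Num.sqrt V + M) ^+ 2 -> Z' <= Z + 2 * mu * F + v ->
  Z' <= (Num.sqrt (V + v) + (M + mu)) ^+ 2.
Proof.
move=> V0 M0 v0 mu0 FZ ZV h.
have s0 := sqrtr_ge0 V; have t0 := sqrtr_ge0 (V + v).
have s2 := sqr_sqrtr V0; have t2 := sqr_sqrtr (addr_ge0 V0 v0).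
have st : Num.sqrt V <= Num.sqrt (V + v) by rewrite ler_wsqrtr // lerDl.
move: s0 t0 s2 t2 st ZV; set s := Num.sqrt V; set t := Num.sqrt (V + v) => s0 t0 s2 t2 st ZV.
have Fs : F <= s + M.
  have h1 := le_trans FZ ZV; have [F0|F0] := leP 0 F.
    by rewrite -(ler_pXn2r (n := 2)) // nnegrE // addr_ge0.
  by apply: le_trans (ltW F0) _; exact: addr_ge0.
have h2 : 2 * mu * F <= 2 * mu * (s + M) by rewrite ler_wpM2l // mulr_ge0.
have h3 : 0 <= (t - s) * (M + mu) by rewrite mulr_ge0 // ?subr_ge0 // addr_ge0.
have h4 := sqr_ge0 mu.
rewrite expr2 in s2; rewrite expr2 in t2; rewrite !expr2 in ZV h4 *.
lra.
Qed.

(** Call k acts on the agents through column [ag k] of A. *)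
Lemma reveal_seq (wb : O -> 'rV[R]_m) (N : O -> 'M[R]_(n, m)) (ag : K -> 'I_n) (A : 'M[R]_n)
   (a1 a2 V0 M0 : R) r : uniq r ->
  pastm (gen [::]) wb -> pastm (gen [::]) N -> L2m P wb -> L2m P N ->
  (forall j, \sum_i `|A i j| <= a1) -> (forall j, \sum_i A i j ^+ 2 <= a2) -> 0 <= a2 ->
  0 <= V0 -> 0 <= M0 ->
  Ex P (fun w => fnorm (disp (wb w) (N w)) ^+ 2) <= (Num.sqrt V0 + M0) ^+ 2 ->
  Ex P (fun w => fnorm (disp (wb w) (N w + noise_sum (fun k => col (ag k) A) r w)) ^+ 2) <=
   (Num.sqrt (V0 + (size r)%:R * ((n%:R^-1 * ell * a1) ^+ 2 * sg ^+ 2))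
     + (M0 + (size r)%:R * (n%:R^-1 * ell2 * a2 * sg ^+ 2))) ^+ 2.
Proof.
move=> ur pw pN lw lN ha1 ha2 a20 hV hM h0.
have v0 : 0 <= (n%:R^-1 * ell * a1) ^+ 2 * sg ^+ 2 by rewrite mulr_ge0 // sqr_ge0.
have mu0 : 0 <= n%:R^-1 * ell2 * a2 * sg ^+ 2 by apply: mulr_ge0; [rewrite !mulr_ge0 ?invr_ge0|exact: sqr_ge0].
elim: r ur => [_|k r IH /= /andP[kr ur]].
  rewrite !mul0r !addr0; apply: le_trans h0; rewrite le_eqVlt; apply/orP; left; apply/eqP.
  by apply: Ex_eq => w; rewrite /noise_sum big_nil addr0.
have {}IH := IH ur.
pose N' w := N w + noise_sum (fun k => col (ag k) A) r w.
have N'p : pastm (gen r) N'.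
  by apply: pastmD; [exact: pastm_mono (gen_nil_sub r) pN|exact: noise_sum_past].
have N'L : L2m P N' by apply: L2mD => //; exact: noise_sum_L2.
have wp : pastm (gen r) wb by exact: pastm_mono (gen_nil_sub r) pw.
have dL := disp_L2 lw N'L.
have Ej := Ex_jensen (L2_fnorm dL).
have hc1 : \sum_i `|(col (ag k) A) i 0| <= a1 by under eq_bigr do rewrite mxE.
have hc2 : \sum_i (col (ag k) A) i 0 ^+ 2 <= a2 by under eq_bigr do rewrite mxE.
have step := reveal_one (@fn_meas FN r) wp N'p lw N'L (fn_L2 FN k)
   (fun y j => @fn_orth FN k r y j kr) (fun y => @fn_var FN k r y kr) hc1 hc2.
have -> : Ex P (fun w => fnorm (disp (wb w) (N w + noise_sum (fun k => col (ag k) A) (k :: r) w)) ^+ 2)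
   = Ex P (fun w => fnorm (disp (wb w) (N' w + col (ag k) A *m e k w)) ^+ 2).
  by apply: Ex_eq => w; rewrite noise_sum_cons addrA.
have V1 := addr_ge0 hV (mulr_ge0 (ler0n R (size r)) v0).
have M1 := addr_ge0 hM (mulr_ge0 (ler0n R (size r)) mu0).
apply: le_trans (sqrt_step V1 M1 v0 mu0 Ej IH step) _.
by rewrite -natr1 !mulrDl !mul1r !addrA.
Qed.

End Reveal.

(** * Impulse response of gradient tracking *)

Section Consensus.
Context {R : realType} {n : nat}.
Variables (W : 'M[R]_n) (rho : R).
Hypothesis hW : mixing_matrix W rho.

Definition Wit m k (M : 'M[R]_(n, m)) : 'M[R]_(n, m) := iter k (mulmx W) M.

(** Rows are agents: the mean row, and the deviation of the rows from it. *)
Definition mrow m (M : 'M[R]_(n, m)) : 'rV[R]_m := n%:R^-1 *: (const_mx 1 *m M).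
Definition dev m (M : 'M[R]_(n, m)) : 'M[R]_(n, m) := M - const_mx 1 *m mrow M.

Lemma n_gt1 : (1 < n)%N. Proof. exact: mixing_size hW. Qed.
Lemma nR0 : 0 < n%:R :> R. Proof. by rewrite ltr0n ltnW // n_gt1. Qed.
Lemma rho_bounds : 0 <= rho < 1.
Proof. by rewrite (rho_ge0 hW); case: hW. Qed.

Lemma col1W : (const_mx 1 : 'rV[R]_n) *m W = const_mx 1.
Proof.
case: hW => _ _ [_ Wc] _ _; apply/rowP => j; rewrite !mxE -[RHS](Wc j).
by apply: eq_bigr => i _; rewrite mxE mul1r.
Qed.
Lemma W1col : W *m (const_mx 1 : 'cV[R]_n) = const_mx 1.
Proof.
case: hW => _ _ [Wr _] _ _; apply/colP => i; rewrite !mxE -[RHS](Wr i).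
by apply: eq_bigr => j _; rewrite mxE mulr1.
Qed.

Lemma mrow_mul m k (M : 'M[R]_(n, m)) (A : 'M[R]_(m, k)) : mrow (M *m A) = mrow M *m A.
Proof. by rewrite /mrow mulmxA scalemxAl. Qed.
Lemma mrowD m (M N : 'M[R]_(n, m)) : mrow (M + N) = mrow M + mrow N.
Proof. by rewrite /mrow mulmxDr scalerDr. Qed.
Lemma mrowZ m c (M : 'M[R]_(n, m)) : mrow (c *: M) = c *: mrow M.
Proof. by rewrite /mrow -scalemxAr !scalerA mulrC. Qed.
Lemma mrowN m (M : 'M[R]_(n, m)) : mrow (- M) = - mrow M.
Proof. by rewrite -scaleN1r mrowZ scaleN1r. Qed.
Lemma mrowB m (M N : 'M[R]_(n, m)) : mrow (M - N) = mrow M - mrow N.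
Proof. by rewrite mrowD mrowN. Qed.
Lemma mrow_W m (M : 'M[R]_(n, m)) : mrow (W *m M) = mrow M.
Proof. by rewrite /mrow mulmxA col1W. Qed.
Lemma mrow_const m (v : 'rV[R]_m) : mrow (const_mx 1 *m v : 'M[R]_(n, m)) = v.
Proof.
rewrite /mrow mulmxA; have -> : (const_mx 1 : 'rV[R]_n) *m (const_mx 1 : 'cV[R]_n) = n%:R%:M.
  apply/matrixP => i j; rewrite !ord1 !mxE eqxx mulr1n.
  by under eq_bigr do rewrite !mxE mul1r; rewrite sumr_const card_ord.
by rewrite mul_scalar_mx scalerA mulVf ?gt_eqF ?nR0 // scale1r.
Qed.
Lemma mrow_dev m (M : 'M[R]_(n, m)) : mrow (dev M) = 0.
Proof. by rewrite /dev mrowB mrow_const subrr. Qed.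
Lemma mrow_eq0_sum m (M : 'M[R]_(n, m)) : mrow M = 0 -> forall j, \sum_i M i j = 0.
Proof.
move=> h j; have := congr1 (fun v : 'rV[R]_m => n%:R * v 0 j) h; rewrite !mxE mulr0.
rewrite mulrA mulfV ?gt_eqF ?nR0 // mul1r => h2; rewrite -[RHS]h2.
by apply: eq_bigr => i _; rewrite mxE mul1r.
Qed.
Lemma mrowE m (M : 'M[R]_(n, m)) : mrow M = n%:R^-1 *: \sum_i row i M.
Proof.
congr (_ *: _); apply/rowP => j; rewrite mxE summxE.
by apply: eq_bigr => i _; rewrite !mxE mul1r.
Qed.

Lemma devD m (M N : 'M[R]_(n, m)) : dev (M + N) = dev M + dev N.
Proof. by rewrite /dev mrowD mulmxDr opprD addrACA. Qed.
Lemma devZ m c (M : 'M[R]_(n, m)) : dev (c *: M) = c *: dev M.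
Proof. by rewrite /dev mrowZ -scalemxAr scalerBr. Qed.
Lemma devN m (M : 'M[R]_(n, m)) : dev (- M) = - dev M.
Proof. by rewrite -scaleN1r devZ scaleN1r. Qed.
Lemma devB m (M N : 'M[R]_(n, m)) : dev (M - N) = dev M - dev N.
Proof. by rewrite devD devN. Qed.
Lemma dev0 m : dev (0 : 'M[R]_(n, m)) = 0.
Proof. by rewrite -[X in dev X](scale0r (0 : 'M[R]_(n, m))) devZ scale0r. Qed.
Lemma dev_sum m (I : Type) (r : seq I) (F : I -> 'M[R]_(n, m)) :
  dev (\sum_(i <- r) F i) = \sum_(i <- r) dev (F i).
Proof. exact: (big_morph (@dev m) (@devD m) (@dev0 m)). Qed.
Lemma dev_W m (M : 'M[R]_(n, m)) : dev (W *m M) = W *m dev M.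
Proof. by rewrite /dev mrow_W mulmxBr mulmxA W1col. Qed.
Lemma dev_mul m k (M : 'M[R]_(n, m)) (A : 'M[R]_(m, k)) : dev (M *m A) = dev M *m A.
Proof. by rewrite /dev mrow_mul mulmxBl mulmxA. Qed.
Lemma dev_const m (v : 'rV[R]_m) : dev (const_mx 1 *m v : 'M[R]_(n, m)) = 0.
Proof. by rewrite /dev mrow_const subrr. Qed.

Lemma const_mul_entry m (v : 'rV[R]_m) i j : (const_mx 1 *m v : 'M[R]_(n, m)) i j = v 0 j.
Proof. by rewrite mxE big_ord1 mxE mul1r. Qed.

Lemma fnorm_dev_split m (M : 'M[R]_(n, m)) :
  fnorm M ^+ 2 = fnorm (dev M) ^+ 2 + n%:R * fnorm (mrow M) ^+ 2.
Proof.
have -> : fnorm M ^+ 2 = fnorm (dev M + const_mx 1 *m mrow M) ^+ 2 by rewrite /dev subrK.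
rewrite fnorm_sqD.
have -> : dotp (dev M) (const_mx 1 *m mrow M) = 0.
  rewrite /dotp exchange_big big1 // => j _.
  under eq_bigr do rewrite const_mul_entry.
  by rewrite -mulr_suml mrow_eq0_sum ?mul0r // mrow_dev.
rewrite mulr0 addr0; congr (_ + _).
rewrite !fnorm_sqE big_ord1.
under eq_bigr do under eq_bigr do rewrite const_mul_entry.
by rewrite sumr_const card_ord mulr_natl.
Qed.

Lemma fnorm_dev m (M : 'M[R]_(n, m)) : fnorm (dev M) <= fnorm M.
Proof.
apply: fnorm_sq_le => //; rewrite (fnorm_dev_split M) lerDl mulr_ge0 ?sqr_ge0 //.
Qed.
Lemma W_contract m (M : 'M[R]_(n, m)) : mrow M = 0 -> fnorm (W *m M) <= rho * fnorm M.
Proof. by move=> h; apply: mixing_contract => //; exact: mrow_eq0_sum. Qed.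

Lemma Wit_mrow m k (M : 'M[R]_(n, m)) : mrow (Wit k M) = mrow M.
Proof. by elim: k => //= k IH; rewrite mrow_W IH. Qed.
Lemma Wit_dev m k (M : 'M[R]_(n, m)) : dev (Wit k M) = Wit k (dev M).
Proof. by elim: k => //= k IH; rewrite dev_W IH. Qed.
Lemma Wit_contract m k (M : 'M[R]_(n, m)) : mrow M = 0 -> fnorm (Wit k M) <= rho ^+ k * fnorm M.
Proof.
have /andP[r0 _] := rho_bounds.
move=> h; elim: k => [|k IH]; first by rewrite mul1r.
apply: le_trans (W_contract _) _; first by rewrite Wit_mrow.
by rewrite exprS -mulrA ler_wpM2l.
Qed.
Lemma Wit_mul m p k (M : 'M[R]_(n, m)) (A : 'M[R]_(m, p)) : Wit k (M *m A) = Wit k M *m A.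
Proof. by elim: k => //= k IH; rewrite IH mulmxA. Qed.

(** Responses of w (up to sign) and of U to an impulse in H, k steps later. The
    factor k + 1 of [ker] counts the ways to spend k mixing steps, first in U and
    then in w; the difference is there because U tracks the increments of H. *)
Definition ker m k (M : 'M[R]_(n, m)) := k.+1%:R *: Wit k M - k%:R *: Wit k.-1 M.
Definition kerU m k (M : 'M[R]_(n, m)) := Wit k M - (k != 0%N)%:R *: Wit k.-1 M.

Lemma ker0 m (M : 'M[R]_(n, m)) : ker 0 M = M.
Proof. by rewrite /ker scale0r subr0 scale1r. Qed.
Lemma kerU0 m (M : 'M[R]_(n, m)) : kerU 0 M = M.
Proof. by rewrite /kerU scale0r subr0. Qed.
Lemma kerUS m k (M : 'M[R]_(n, m)) : W *m kerU k.+1 M = kerU k.+2 M.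
Proof. by rewrite /kerU /= !scale1r mulmxBr. Qed.
Lemma kerS m k (M : 'M[R]_(n, m)) : ker k.+1 M = W *m ker k M + kerU k.+1 M.
Proof.
rewrite /ker /kerU /= scale1r mulmxBr -!scalemxAr.
case: k => [|k] /=.
  by rewrite scale0r subr0 !scale1r addrA -mulr2n scaler_nat.
rewrite -/(Wit k M) -!/(Wit _ M); set X := W *m (W *m _); set Y := W *m _.
by apply/matrixP => i j; rewrite !mxE -!natr1; ring.
Qed.
Lemma ker_mul m p k (M : 'M[R]_(n, m)) (A : 'M[R]_(m, p)) : ker k (M *m A) = ker k M *m A.
Proof. by rewrite /ker !Wit_mul mulmxBl -!scalemxAl. Qed.
Lemma ker_dev m k (M : 'M[R]_(n, m)) : dev (ker k M) = ker k (dev M).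
Proof. by rewrite /ker devB !devZ !Wit_dev. Qed.

(** The recursions of U and w started at 0 and driven by the impulses I alone. *)
Fixpoint respU m (I : nat -> 'M[R]_(n, m)) s := 
  if s is s'.+1 then W *m respU I s' + I s'.+1 - I s' else 0.
Fixpoint respY m (I : nat -> 'M[R]_(n, m)) s := 
  if s is s'.+1 then W *m respY I s' - respU I s'.+1 else 0.

Lemma respU_ker m (I : nat -> 'M[R]_(n, m)) s : I 0%N = 0 ->
  respU I s = \sum_(k < s) kerU (s.-1 - k) (I k.+1).
Proof.
move=> I0; elim: s => [|s IH]; first by rewrite big_ord0.
rewrite /= -/(respU I s) IH big_ord_recr /= subnn kerU0.
rewrite addrAC; congr (_ + _).
case: s IH => [|s] IH; first by rewrite !big_ord0 mulmx0 I0 subr0.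
rewrite !big_ord_recr /= subnn kerU0 mulmxDr mulmx_sumr -addrA; congr (_ + _).
  apply: eq_bigr => k _; have ks := ltn_ord k; have -> : (s.+1 - k = (s - k.+1).+2)%N by lia.
  by rewrite -kerUS; congr (_ *m kerU _ _); lia.
by rewrite subSnn /kerU /= scale1r.
Qed.

Lemma respY_ker m (I : nat -> 'M[R]_(n, m)) s : I 0%N = 0 ->
  respY I s = - \sum_(k < s) ker (s.-1 - k) (I k.+1).
Proof.
move=> I0; elim: s => [|s IH]; first by rewrite big_ord0 oppr0.
have -> : respY I s.+1 = W *m respY I s - respU I s.+1 by [].
rewrite IH respU_ker // mulmxN -opprD; congr (- _).
rewrite !big_ord_recr /= subnn kerU0 ker0 addrA; congr (_ + _).
rewrite mulmx_sumr -big_split; apply: eq_bigr => k _ /=.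
have -> : (s - k = (s.-1 - k).+1)%N by have := ltn_ord k; lia.
by rewrite kerS.
Qed.

(** W is doubly stochastic. The l1 norm of a column is the total weight with which
    one call acts on the agents. *)
Lemma l1_W (x : 'cV[R]_n) : \sum_i `|(W *m x) i 0| <= \sum_i `|x i 0|.
Proof.
case: hW => _ Wge [_ Wc] _ _.
apply: le_trans (_ : \sum_i \sum_j W i j * `|x j 0| <= _).
  apply: ler_sum => i _; rewrite mxE; apply: le_trans (ler_norm_sum _ _ _) _.
  by apply: ler_sum => j _; rewrite normrM ger0_norm.
by rewrite exchange_big; apply: ler_sum => j _; rewrite -mulr_suml Wc mul1r.
Qed.
Lemma l1_Wit k (x : 'cV[R]_n) : \sum_i `|Wit k x i 0| <= \sum_i `|x i 0|.
Proof. by elim: k => //= k IH; apply: le_trans (l1_W _) IH. Qed.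
Lemma l1_dev (x : 'cV[R]_n) : \sum_i `|dev x i 0| <= 2 * \sum_i `|x i 0|.
Proof.
have h : `|mrow x 0 0| <= n%:R^-1 * \sum_i `|x i 0|.
  rewrite !mxE normrM ger0_norm ?invr_ge0 // ler_wpM2l ?invr_ge0 //.
  apply: le_trans (ler_norm_sum _ _ _) _; apply: ler_sum => i _.
  by rewrite mxE mul1r.
apply: le_trans (_ : \sum_i (`|x i 0| + n%:R^-1 * \sum_i `|x i 0|) <= _).
  apply: ler_sum => i _; rewrite /dev 2!mxE [in X in _ - X]mxE big_ord1 mxE mul1r.
  by apply: le_trans (ler_normB _ _) _; rewrite lerD2l.
rewrite big_split /= sumr_const card_ord -[_ *+ n]mulr_natl mulrA mulfV ?gt_eqF ?nR0 // mul1r; lra.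
Qed.

(** No decay in k is gained here, unlike in [ker_contract], but the bound carries
    no dependence on n. *)
Lemma l1_ker k (x : 'cV[R]_n) : \sum_i `|dev (ker k x) i 0| <= 2 * (2 * k + 1)%:R * \sum_i `|x i 0|.
Proof.
apply: le_trans (l1_dev _) _; rewrite -mulrA ler_wpM2l //.
apply: le_trans (_ : \sum_i (k.+1%:R * `|Wit k x i 0| + k%:R * `|Wit k.-1 x i 0|) <= _).
  apply: ler_sum => i _; rewrite /ker !mxE; apply: le_trans (ler_normB _ _) _.
  by rewrite !normrM !(ger0_norm (ler0n _ _)).
rewrite big_split /= -!mulr_sumr.
have h1 := ler_wpM2l (ler0n R k.+1) (l1_Wit k x).
have h2 := ler_wpM2l (ler0n R k) (l1_Wit k.-1 x).
apply: le_trans (lerD h1 h2) _; rewrite -mulrDl -natrD.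
by rewrite (_ : (k.+1 + k = 2 * k + 1)%N) //; lia.
Qed.

(** The ratio [tht] exceeds the square root of rho, and the margin absorbs the factor
    k + 1 of the kernel, at the price of a factor 1 / [lam] ([kthtk]). *)
Definition lam : R := 1 - rho ^+ 2.
Definition tht : R := 1 - lam / 4.

Lemma lam_bounds : 0 < lam <= 1.
Proof. have /andP[r0 r1] := rho_bounds; rewrite /lam; apply/andP; split; nra. Qed.
Lemma tht_bounds : 3 / 4 <= tht < 1.
Proof. have /andP[l0 l1] := lam_bounds; rewrite /tht; apply/andP; split; lra. Qed.
Lemma rho_tht : rho <= tht ^+ 2.
Proof.
have /andP[r0 r1] := rho_bounds; rewrite /tht /lam.
have : 0 <= (1 - rho) ^+ 2 by exact: sqr_ge0.
have := sqr_ge0 (1 - rho ^+ 2); rewrite !expr2; nra.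
Qed.
Lemma lam_rho : lam / 2 <= 1 - rho.
Proof. have /andP[r0 r1] := rho_bounds; rewrite /lam; nra. Qed.

Lemma geom_le (t : R) k : 0 <= t < 1 -> \sum_(j < k) t ^+ j <= (1 - t)^-1.
Proof.
move=> /andP[t0 t1]; have h : \sum_(j < k) t ^+ j * (1 - t) = 1 - t ^+ k.
  elim: k => [|k IH]; first by rewrite big_ord0 expr0 subrr.
  by rewrite big_ord_recr /= IH exprS; ring.
rewrite -[leRHS]mul1r ler_pdivlMr ?subr_gt0 // mulr_suml h gerBl exprn_ge0 //.
Qed.

(** The left-hand side is k + 1 times the least term of a geometric sum. *)
Lemma kthtk k : k.+1%:R * tht ^+ k <= 4 / lam.
Proof.
have /andP[t0 t1] := tht_bounds; have /andP[l0 l1] := lam_bounds.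
have tp : 0 <= tht by lra.
have -> : 4 / lam = (1 - tht)^-1 by rewrite /tht; field; rewrite gt_eqF //; lra.
apply: le_trans (_ : \sum_(j < k.+1) tht ^+ j <= _); last by apply: geom_le; rewrite tp.
rewrite -[X in X%:R * _]card_ord mulr_natl -sumr_const; apply: ler_sum => j _.
by rewrite ler_wiXn2l // ?(ltW t1) // -ltnS.
Qed.

Lemma ker_contract m k (M : 'M[R]_(n, m)) : mrow M = 0 ->
  fnorm (ker k M) <= 10 / lam * tht ^+ k * fnorm M.
Proof.
have /andP[r0 r1] := rho_bounds; have /andP[t0 t1] := tht_bounds; have /andP[l0 l1] := lam_bounds.
have tp : 0 <= tht by lra.
move=> h; have M0 := fnorm_ge0 M.
have rk j : rho ^+ j <= tht ^+ j * tht ^+ j.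
  by rewrite -exprD addnn -mul2n exprM; apply: lerXn2r; rewrite ?nnegrE ?exprn_ge0 // rho_tht.
have bd j : j.+1%:R * (tht ^+ j * tht ^+ j * fnorm M) <= 4 / lam * (tht ^+ j * fnorm M).
  rewrite -mulrA mulrA; apply: ler_wpM2r; last exact: kthtk.
  by rewrite mulr_ge0 // exprn_ge0.
have h1 : fnorm (k.+1%:R *: Wit k M) <= 4 / lam * (tht ^+ k * fnorm M).
  rewrite fnormZ (ger0_norm (ler0n _ _)); apply: le_trans (ler_wpM2l (ler0n _ _) (Wit_contract k h)) _.
  apply: le_trans (ler_wpM2l (ler0n _ _) (ler_wpM2r M0 (rk k))) _.
  exact: bd.
have h2 : fnorm (k%:R *: Wit k.-1 M) <= 6 / lam * (tht ^+ k * fnorm M).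
  case: k {h1} => [|k]; first by rewrite scale0r fnorm0 !mulr_ge0 // ?exprn_ge0 // invr_ge0 ltW.
  rewrite fnormZ (ger0_norm (ler0n _ _)) /=; apply: le_trans (ler_wpM2l (ler0n _ _) (Wit_contract k h)) _.
  apply: le_trans (ler_wpM2l (ler0n _ _) (ler_wpM2r M0 (rk k))) _.
  apply: le_trans (_ : 4 / lam * (tht ^+ k * fnorm M) <= _).
    exact: bd.
  rewrite exprS -!mulrA (mulrCA lam^-1 tht).
  by rewrite [leRHS]mulrA ler_wpM2r ?mulr_ge0 ?exprn_ge0 ?invr_ge0 ?(ltW l0) //; lra.
apply: le_trans (ler_fnormB _ _) _; apply: le_trans (lerD h1 h2) _.
by rewrite -mulrDl -mulrDl -natrD mulrA.
Qed.

Definition cker k : R := 10 / lam * tht ^+ k.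

Lemma cker_ge0 k : 0 <= cker k.
Proof.
have /andP[t0 t1] := tht_bounds; have /andP[l0 l1] := lam_bounds.
by rewrite /cker !mulr_ge0 ?exprn_ge0 ?invr_ge0 ?(ltW l0) //; lra.
Qed.

Lemma cker_sum k : \sum_(j < k) cker j <= 40 / lam ^+ 2.
Proof.
have /andP[t0 t1] := tht_bounds; have /andP[l0 l1] := lam_bounds.
rewrite /cker -mulr_sumr; apply: le_trans (ler_wpM2l _ (geom_le k _)) _.
- by rewrite mulr_ge0 // invr_ge0 ltW.
- by apply/andP; split; lra.
- by rewrite le_eqVlt; apply/orP; left; apply/eqP; rewrite /tht; field; rewrite gt_eqF.
Qed.

Lemma cker_sum2 k : \sum_(j < k) cker j ^+ 2 <= 400 / lam ^+ 3.
Proof.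
have /andP[t0 t1] := tht_bounds; have /andP[l0 l1] := lam_bounds.
apply: le_trans (_ : \sum_(j < k) 10 / lam * cker j <= _).
  apply: ler_sum => j _; rewrite expr2 ler_wpM2r ?cker_ge0 // /cker -[leRHS]mulr1 ler_wpM2l //.
    by rewrite mulr_ge0 // invr_ge0 ltW.
  by apply: exprn_ile1; lra.
rewrite -mulr_sumr; apply: le_trans (ler_wpM2l _ (cker_sum k)) _; first by rewrite mulr_ge0 // invr_ge0 ltW.
by rewrite le_eqVlt; apply/orP; left; apply/eqP; field; rewrite gt_eqF.
Qed.

End Consensus.

(** * The recursion along one path *)

Section Recursions.
Context {R : realType}.

Lemma geometric_sum (r : R) (a c : nat -> R) S : r <= 1 -> (forall s, 0 <= a s) ->
  0 <= r -> (forall s, a s.+1 <= r * a s + c s) ->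
  (1 - r) * \sum_(s < S.+1) a s <= a 0%N + \sum_(s < S) c s.
Proof.
move=> r1 a0 r0 h.
suff: (1 - r) * \sum_(s < S.+1) a s <= a 0%N + \sum_(s < S) c s - r * a S.
  by move=> h1; apply: le_trans h1 _; rewrite gerBl mulr_ge0.
elim: S => [|S IH]; first by rewrite big_ord1 big_ord0 addr0; lra.
rewrite big_ord_recr mulrDr [X in _ <= _ + X - _]big_ord_recr /=.
have := h S; lra.
Qed.

(** Convexity of the square at the points a and b / (1 - r), with weights r and 1 - r. *)
Lemma contract_sq (r a b c : R) : 0 <= r < 1 -> 0 <= a -> 0 <= b -> 0 <= c -> c <= r * a + b ->
  c ^+ 2 <= r * a ^+ 2 + b ^+ 2 / (1 - r).
Proof.
move=> /andP[r0 r1] a0 b0 c0 h.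
have h1 : c ^+ 2 <= (r * a + b) ^+ 2 by rewrite ler_pXn2r ?nnegrE // addr_ge0 // mulr_ge0.
apply: le_trans h1 _.
have -> : b ^+ 2 / (1 - r) = b ^+ 2 + r / (1 - r) * b ^+ 2.
  by field; rewrite subr_eq0 gt_eqF.
have d0 : 0 < 1 - r by rewrite subr_gt0.
have -> : (r * a + b) ^+ 2 = r * a ^+ 2 + (b ^+ 2 + r / (1 - r) * b ^+ 2) - r / (1 - r) * ((1 - r) * a - b) ^+ 2.
  by field; rewrite gt_eqF.
by rewrite gerBl mulr_ge0 ?sqr_ge0 // divr_ge0 // ltW.
Qed.

End Recursions.

Section Path.
Context {R : realType} {n m : nat}.
Variables (W : 'M[R]_n) (rho : R) (G : 'I_n -> 'rV[R]_m -> 'rV[R]_m) (ell : R).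
Hypothesis hW : mixing_matrix W rho.
Hypothesis ell0 : 0 <= ell.
Hypothesis Glip : forall i, lip ell (G i).

Definition rowwise (w : 'M[R]_(n, m)) : 'M[R]_(n, m) := \matrix_(i, j) G i (row i w) 0 j.
Definition meanG (x : 'rV[R]_m) : 'rV[R]_m := n%:R^-1 *: \sum_i G i x.

Lemma row_rowwise w i : row i (rowwise w) = G i (row i w).
Proof. by apply/rowP => j; rewrite !mxE. Qed.

Lemma rowwise_lip w w' : fnorm (rowwise w - rowwise w') <= ell * fnorm (w - w').
Proof.
apply: fnorm_sq_le; first by rewrite mulr_ge0.
rewrite exprMn !fnorm_sq_rows mulr_sumr; apply: ler_sum => i _.
rewrite !linearB /= !row_rowwise -exprMn ler_pXn2r ?nnegrE ?mulr_ge0 //; exact: Glip.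
Qed.

Variables (w U H : nat -> 'M[R]_(n, m)).
Hypothesis Urec : forall s, U s.+1 = W *m U s + H s.+1 - H s.
Hypothesis wrec : forall s, w s.+1 = W *m w s - U s.+1.
Hypothesis UH0 : mrow (U 0%N) = mrow (H 0%N).
Hypothesis w0 : dev (w 0%N) = 0.

(** The deviation of the rows is split into the response to the noise alone,
    [nresp], and a remainder [drift] driven by the start and by the variation of the
    gradients. The noise of step s enters H at step s + 1, whence [impulse]. *)
Definition noise s := H s.+1 - rowwise (w s).
Definition impulse s := if s is k.+1 then noise k else 0.
Definition nresp s := dev (respY W impulse s).
Definition drift s := dev (w s) - nresp s.
Let du s := dev (U s) - dev (respU W impulse s).

Lemma mrow_U s : mrow (U s) = mrow (H s).
Proof. by elim: s => // s IH; rewrite Urec mrowB mrowD (mrow_W hW) IH addrAC subrr add0r. Qed.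

Lemma row_split s i : row i (w s) = mrow (w s) + row i (dev (w s)).
Proof.
by rewrite /dev linearB /= row_mul; have -> : row i (const_mx 1 : 'cV[R]_n) = 1%:M;
  [apply/matrixP => a b; rewrite !ord1 !mxE|rewrite mul1mx subrKC].
Qed.

Lemma mrow_rowwise s : mrow (rowwise (w s)) = meanG (mrow (w s)) + disp G (mrow (w s)) (dev (w s)).
Proof.
rewrite mrowE /meanG /disp -scalerDr -big_split; congr (_ *: _); apply: eq_bigr => i _ /=.
by rewrite row_rowwise -row_split subrKC.
Qed.

(** Mixing preserves means and U has the mean of H, so the mean row follows a
    gradient step perturbed by the disagreement and by the mean noise. *)
Lemma mean_step s : mrow (w s.+1) =
  mrow (w s) - (meanG (mrow (w s)) + disp G (mrow (w s)) (dev (w s)) + mrow (noise s)).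
Proof.
rewrite wrec mrowB (mrow_W hW) mrow_U; congr (_ - _).
by rewrite -mrow_rowwise /noise mrowB subrKC.
Qed.

Lemma drift0 : drift 0 = 0.
Proof. by rewrite /drift /nresp /= w0 dev0 subrr. Qed.

Lemma drift_step s : drift s.+1 = W *m drift s - du s.+1.
Proof.
have alg (a b c d : 'M[R]_(n, m)) : a - b - (c - d) = a - c - (b - d).
  by apply/matrixP => i j; rewrite !mxE; ring.
have e : respY W impulse s.+1 = W *m respY W impulse s - respU W impulse s.+1 by [].
rewrite /drift /nresp /du wrec e.
rewrite [dev (_ - U _)]devB [dev (_ - respU _ _ _)]devB !(dev_W hW) [W *m (_ - dev _)]mulmxBr.
exact: alg.
Qed.

Lemma du_step s : du s.+2 = W *m du s.+1 + dev (rowwise (w s.+1) - rowwise (w s)).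
Proof.
have alg (a b c d e f : 'M[R]_(n, m)) : a + b - c - (d + (b - e) - (c - f)) = a - d + (e - f).
  by apply/matrixP => i j; rewrite !mxE; ring.
have e : respU W impulse s.+2 = W *m respU W impulse s.+1 + noise s.+1 - noise s by [].
rewrite /du Urec e /noise.
rewrite [dev (_ - H s.+1)]devB [dev (_ + H s.+2)]devD [dev (_ - (_ - _))]devB [dev (_ + (_ - _))]devD.
rewrite !(dev_W hW) !(devB _ (rowwise _)) [W *m (_ - dev _)]mulmxBr.
exact: alg.
Qed.

Lemma du_first : du 1 = W *m dev (U 0%N) + dev (rowwise (w 0%N) - H 0%N).
Proof.
have alg (a b c d : 'M[R]_(n, m)) : a + b - c - (b - d) = a + (d - c).
  by apply/matrixP => i j; rewrite !mxE; ring.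
have e : respU W impulse 1 = noise 0 by rewrite /= mulmx0 add0r subr0.
rewrite /du Urec e /noise [dev (_ - H 0%N)]devB [dev (_ + H 1%N)]devD (dev_W hW) !(devB _ (rowwise _)) devB.
exact: alg.
Qed.

Lemma mrow_drift s : mrow (drift s) = 0.
Proof. by rewrite /drift /nresp mrowB !(mrow_dev hW) subrr. Qed.
Lemma mrow_du s : mrow (du s) = 0.
Proof. by rewrite /du mrowB !(mrow_dev hW) subrr. Qed.

(** Two cascaded contractions of ratio rho, first for the drift of U and then for
    that of w, each multiplying sums of squares by (1 - rho)^-2. The source is
    Lipschitz in w (s + 1) - w s, which contains the drift again; since ell is small
    against (1 - rho^2)^2, that part is absorbed by the left-hand side. *)
Lemma drift_sum u1 S :
  fnorm (W *m dev (U 0%N) + dev (rowwise (w 0%N) - H 0%N)) ^+ 2 <= u1 ->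
  256 * ell ^+ 2 <= lam rho ^+ 4 ->
  \sum_(s < S.+1) fnorm (drift s) ^+ 2 <=
    16 / lam rho ^+ 3 * u1 + 256 / lam rho ^+ 4 * ell ^+ 2 * \sum_(s < S.+1) fnorm (nresp s) ^+ 2
    + 32 / lam rho ^+ 4 * ell ^+ 2 * n%:R * \sum_(s < S) fnorm (mrow (w s.+1) - mrow (w s)) ^+ 2.
Proof.
move=> hu1 hsmall.
have /andP[r0 r1] := rho_bounds hW; have /andP[l0 l1] := lam_bounds hW.
have hr : 0 <= rho < 1 by rewrite r0.
have lr := lam_rho hW; have d0 : 0 < 1 - rho by rewrite subr_gt0.
set Y := \sum_(s < S.+1) fnorm (drift s) ^+ 2.
set X := \sum_(s < S.+1) fnorm (nresp s) ^+ 2; set Z := \sum_(s < S) _.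
have hy s : fnorm (drift s.+1) ^+ 2 <= rho * fnorm (drift s) ^+ 2 + fnorm (du s.+1) ^+ 2 / (1 - rho).
  apply: contract_sq => //; rewrite drift_step; apply: le_trans (ler_fnormB _ _) _.
  by rewrite lerD2r; apply: (W_contract hW); exact: mrow_drift.
have hu s : fnorm (du s.+2) ^+ 2 <= rho * fnorm (du s.+1) ^+ 2 + (ell * fnorm (w s.+1 - w s)) ^+ 2 / (1 - rho).
  apply: contract_sq => //; first by rewrite mulr_ge0.
  rewrite du_step; apply: le_trans (ler_fnormD _ _) _; apply: lerD.
    by apply: (W_contract hW); exact: mrow_du.
  by apply: le_trans (fnorm_dev hW _) _; exact: rowwise_lip.
have sy := geometric_sum S (ltW r1) (fun s => sqr_ge0 (fnorm (drift s))) r0 hy.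
have su := geometric_sum S (ltW r1) (fun s => sqr_ge0 (fnorm (du s.+1))) r0 hu.
rewrite drift0 fnorm0 expr0n add0r -mulr_suml in sy.
rewrite -mulr_suml in su.
have {}su : (1 - rho) * \sum_(s < S) fnorm (du s.+1) ^+ 2 <=
    u1 + (\sum_(s < S) (ell * fnorm (w s.+1 - w s)) ^+ 2) / (1 - rho).
  rewrite du_first in su; apply: le_trans (le_trans su _); last by rewrite lerD2r.
  by rewrite ler_wpM2l ?(ltW d0) // big_ord_recr /= lerDl sqr_ge0.
have hd : \sum_(s < S) (ell * fnorm (w s.+1 - w s)) ^+ 2 <= ell ^+ 2 * (8 * Y + 8 * X + n%:R * Z).
  under eq_bigr do rewrite exprMn.
  rewrite -mulr_sumr ler_wpM2l ?sqr_ge0 //.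
  have dv s : fnorm (dev (w s)) ^+ 2 <= 2 * fnorm (drift s) ^+ 2 + 2 * fnorm (nresp s) ^+ 2.
    by have := fnorm_sqD2 (drift s) (nresp s); rewrite /drift subrK.
  apply: le_trans (_ : \sum_(s < S) (2 * fnorm (dev (w s.+1)) ^+ 2 + 2 * fnorm (dev (w s)) ^+ 2
      + n%:R * fnorm (mrow (w s.+1) - mrow (w s)) ^+ 2) <= _).
    apply: ler_sum => s _; rewrite (fnorm_dev_split hW (w s.+1 - w s)) mrowB lerD2r devB; exact: fnorm_sqB2.
  rewrite big_split -mulr_sumr lerD2r.
  rewrite big_split /= -!mulr_sumr.
  have YX : \sum_(s < S.+1) fnorm (dev (w s)) ^+ 2 <= 2 * Y + 2 * X.
    by rewrite /Y /X !mulr_sumr -big_split; apply: ler_sum => s _; exact: dv.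
  have h1 : \sum_(s < S) fnorm (dev (w s)) ^+ 2 <= 2 * Y + 2 * X.
    by apply: le_trans YX; rewrite big_ord_recr /= lerDl sqr_ge0.
  have h2 : \sum_(s < S) fnorm (dev (w s.+1)) ^+ 2 <= 2 * Y + 2 * X.
    by apply: le_trans YX; rewrite [leRHS]big_ord_recl /= lerDr sqr_ge0.
  lra.
set q := (1 - rho)^-1 in sy su *.
have q0 : 0 <= q by rewrite invr_ge0 ltW.
have ql : q <= 2 / lam rho.
  by rewrite -[2 / _]invrK invf_div lef_pV2 // posrE // divr_gt0.
have Y0 : 0 <= Y by apply: sumr_ge0 => s _; exact: sqr_ge0.
have X0 : 0 <= X by apply: sumr_ge0 => s _; exact: sqr_ge0.
have Z0 : 0 <= Z by apply: sumr_ge0 => s _; exact: sqr_ge0.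
have u10 : 0 <= u1 by apply: le_trans hu1; exact: sqr_ge0.
have e1 : Y <= q ^+ 2 * \sum_(s < S) fnorm (du s.+1) ^+ 2.
  have := ler_wpM2l q0 sy; rewrite mulrA /q mulVf ?gt_eqF // mul1r -/q -/Y => h.
  by apply: le_trans h _; rewrite le_eqVlt; apply/orP; left; apply/eqP; ring.
have e2 : \sum_(s < S) fnorm (du s.+1) ^+ 2 <= q * (u1 + ell ^+ 2 * (8 * Y + 8 * X + n%:R * Z) * q).
  have := ler_wpM2l q0 su; rewrite mulrA /q mulVf ?gt_eqF // mul1r -/q => h.
  by apply: le_trans h _; rewrite ler_wpM2l // lerD2l ler_wpM2r.
have e3 : Y <= q ^+ 3 * u1 + q ^+ 4 * (ell ^+ 2 * (8 * Y + 8 * X + n%:R * Z)).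
  apply: le_trans e1 _; apply: le_trans (ler_wpM2l (sqr_ge0 q) e2) _.
  by rewrite le_eqVlt; apply/orP; left; apply/eqP; ring.
have q3 : q ^+ 3 <= 8 / lam rho ^+ 3.
  have -> : 8 / lam rho ^+ 3 = (2 / lam rho) ^+ 3 by rewrite exprMn exprVn; congr (_ * _); ring.
  by rewrite ler_pXn2r ?nnegrE // ?divr_ge0 // ltW.
have q4 : q ^+ 4 <= 16 / lam rho ^+ 4.
  have -> : 16 / lam rho ^+ 4 = (2 / lam rho) ^+ 4 by rewrite exprMn exprVn; congr (_ * _); ring.
  by rewrite ler_pXn2r ?nnegrE // ?divr_ge0 // ltW.
have s0 : 0 <= ell ^+ 2 * (8 * Y + 8 * X + n%:R * Z).
  by rewrite mulr_ge0 ?sqr_ge0 // !addr_ge0 // mulr_ge0.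
have e4 : Y <= 8 / lam rho ^+ 3 * u1 + 16 / lam rho ^+ 4 * (ell ^+ 2 * (8 * Y + 8 * X + n%:R * Z)).
  by apply: le_trans e3 _; apply: lerD; rewrite ler_wpM2r.
(* the drift on the right-hand side is at most half of the one on the left *)
have e5 : 16 / lam rho ^+ 4 * (ell ^+ 2 * (8 * Y)) <= Y / 2.
  have -> : 16 / lam rho ^+ 4 * (ell ^+ 2 * (8 * Y)) = (256 * ell ^+ 2 / lam rho ^+ 4) * (Y / 2).
    by field; rewrite gt_eqF.
  rewrite -[leRHS]mul1r ler_wpM2r ?divr_ge0 // ler_pdivrMr ?mul1r // exprn_gt0 //.
set a := 16 / lam rho ^+ 4 in e4 e5 *.
have -> : 16 / lam rho ^+ 3 * u1 = 2 * (8 / lam rho ^+ 3 * u1) by ring.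
have -> : 256 / lam rho ^+ 4 * ell ^+ 2 * X = 2 * (a * (ell ^+ 2 * (8 * X))) by rewrite /a; ring.
have -> : 32 / lam rho ^+ 4 * ell ^+ 2 * n%:R * Z = 2 * (a * (ell ^+ 2 * (n%:R * Z))) by rewrite /a; ring.
have : a * (ell ^+ 2 * (8 * Y + 8 * X + n%:R * Z)) =
  a * (ell ^+ 2 * (8 * Y)) + a * (ell ^+ 2 * (8 * X)) + a * (ell ^+ 2 * (n%:R * Z)) by ring.
lra.
Qed.

(** Used with x' the mean at an earlier time and B the response to the noise since
    then: only the increment from x' along B needs a probabilistic estimate. *)
Lemma disp_shift (x x' : 'rV[R]_m) (A B : 'M[R]_(n, m)) :
  fnorm (disp G x (A + B)) ^+ 2 <= 2 * fnorm (disp G x' B) ^+ 2 + 16 * ell ^+ 2 * fnorm (x - x') ^+ 2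
    + 4 * ell ^+ 2 / n%:R * fnorm A ^+ 2.
Proof.
have n0 := nR0 hW.
have -> : disp G x (A + B) = disp G x' B + (disp G x (A + B) - disp G x' B) by rewrite subrKC.
apply: le_trans (fnorm_sqD2 _ _) _; rewrite -addrA lerD2l.
set E := _ - _.
have h : fnorm E <= 2 * ell * fnorm (x - x') + ell * (n%:R^-1 * \sum_i fnorm (row i A)).
  rewrite /E /disp -scalerBr -sumrB fnormZ ger0_norm ?invr_ge0 ?(ltW n0) //.
  apply: le_trans (ler_wpM2l _ (ler_fnorm_sum _ _ _)) _; first by rewrite invr_ge0 ltW.
  apply: le_trans (ler_wpM2l _ (_ : _ <= \sum_i (2 * ell * fnorm (x - x') + ell * fnorm (row i A)))) _.
  - by rewrite invr_ge0 ltW.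
  - apply: ler_sum => i _.
    have alg (a b c d : 'rV[R]_m) : a - b - (c - d) = (d - b) + (a - c).
      by apply/rowP => j; rewrite !mxE; ring.
    have -> : G i (x + row i (A + B)) - G i x - (G i (x' + row i B) - G i x') =
      (G i x' - G i x) + (G i (x + row i (A + B)) - G i (x' + row i B)).
      exact: alg.
    apply: le_trans (ler_fnormD _ _) _.
    have g1 := Glip i x' x; have g2 := Glip i (x + row i (A + B)) (x' + row i B).
    have e : x + row i (A + B) - (x' + row i B) = (x - x') + row i A.
      by apply/rowP => j; rewrite !mxE; ring.
    rewrite e in g2; have g3 := ler_wpM2l ell0 (ler_fnormD (x - x') (row i A)).
    rewrite -fnormN opprB in g1; rewrite -(fnormN (x' - x)) opprB in g1.
    rewrite -(fnormN (G i x' - _)) opprB; lra.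
  - rewrite big_split /= sumr_const card_ord -mulr_sumr mulrDr -[_ * fnorm (x - x') *+ n]mulr_natl.
    by rewrite [_ * (n%:R * _)]mulrA mulVf ?gt_eqF // mul1r lerD2l mulrCA.
have c : (n%:R^-1 * \sum_i fnorm (row i A)) ^+ 2 <= n%:R^-1 * fnorm A ^+ 2.
  have q : (\sum_i fnorm (row i A)) ^+ 2 <= n%:R * fnorm A ^+ 2.
    have := dotp_norm (const_mx 1 : 'rV[R]_n) (\row_i fnorm (row i A)).
    have -> : dotp (const_mx 1 : 'rV[R]_n) (\row_i fnorm (row i A)) = \sum_i fnorm (row i A).
      by rewrite /dotp big_ord1; apply: eq_bigr => i _; rewrite !mxE mul1r.
    have s0 : 0 <= \sum_i fnorm (row i A) by apply: sumr_ge0.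
    rewrite ger0_norm // => h1.
    have : (\sum_i fnorm (row i A)) ^+ 2 <= (fnorm (const_mx 1 : 'rV[R]_n) * fnorm (\row_i fnorm (row i A))) ^+ 2.
      by rewrite ler_pXn2r ?nnegrE ?mulr_ge0.
    have c1 : fnorm (const_mx 1 : 'rV[R]_n) ^+ 2 = n%:R.
      rewrite fnorm_sqE big_ord1 (eq_bigr (fun=> 1)); first by rewrite sumr_const card_ord.
      by move=> j _; rewrite mxE expr1n.
    have c2 : fnorm (\row_i fnorm (row i A)) ^+ 2 = fnorm A ^+ 2.
      by rewrite fnorm_sqE big_ord1 fnorm_sq_rows; apply: eq_bigr => i _; rewrite mxE.
    by rewrite exprMn c1 c2.
  rewrite exprMn expr2 -mulrA; apply: ler_wpM2l; first by rewrite invr_ge0 ltW.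
  by rewrite ler_pdivrMl.
have a0 : 0 <= n%:R^-1 * \sum_i fnorm (row i A) by rewrite mulr_ge0 ?invr_ge0 ?(ltW n0) ?sumr_ge0.
move: h c a0; set v := _ * \sum_i _; set z := fnorm (x - x').
have -> : 4 * ell ^+ 2 / n%:R * fnorm A ^+ 2 = 4 * (ell ^+ 2 * (n%:R^-1 * fnorm A ^+ 2)) by ring.
set t := _ * fnorm A ^+ 2 => h c a0.
have z0 : 0 <= z by exact: fnorm_ge0.
have : fnorm E ^+ 2 <= (2 * ell * z + ell * v) ^+ 2.
  have E0 : 0 <= fnorm E by exact: fnorm_ge0.
  have r0 : 0 <= 2 * ell * z + ell * v by apply: addr_ge0; [apply: mulr_ge0 => //; exact: mulr_ge0|exact: mulr_ge0].
  by rewrite ler_pXn2r.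
have := ler_wpM2l (sqr_ge0 ell) c; have := sqr_ge0 (2 * ell * z - ell * v); rewrite !expr2; lra.
Qed.

End Path.

(** * Mean-square bias of the averaged direction, and descent *)

Section Sums.
Context {R : realType}.

Lemma sum_nat_mono (a : nat -> R) i j : (forall k, 0 <= a k) -> (i <= j)%N ->
  \sum_(k < i) a k <= \sum_(k < j) a k.
Proof.
move=> a0; elim: j => [|j IH]; first by rewrite leqn0 => /eqP ->.
rewrite leq_eqVlt => /orP[/eqP -> //|]; rewrite ltnS => /IH h.
by rewrite big_ord_recr /= (le_trans h) // lerDl.
Qed.

Lemma sum_cst N (c : R) : \sum_(s < N) c = N%:R * c.
Proof. by rewrite sumr_const card_ord mulr_natl. Qed.

Lemma sq_mono (a b : R) : 0 <= a -> a <= b -> a ^+ 2 <= b ^+ 2.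
Proof. by move=> a0 ab; rewrite ler_pXn2r ?nnegrE // (le_trans a0). Qed.

Lemma shifted_sum (a : nat -> R) K S : (forall k, 0 <= a k) ->
  \sum_(s < S.+1) (if (K < s)%N then a (s - K.+1)%N else 0) <= \sum_(k < S) a k.
Proof.
move=> a0; suff -> : \sum_(s < S.+1) (if (K < s)%N then a (s - K.+1)%N else 0) = \sum_(k < S - K) a k.
  by apply: sum_nat_mono => //; exact: leq_subr.
elim: S => [|S IH]; first by rewrite big_ord1 /= big_ord0.
rewrite big_ord_recr /= IH ltnS; case: (leqP K S) => h.
  by rewrite subSS subSn // big_ord_recr.
by rewrite addr0; have -> : (S.+1 - K = S - K)%N by lia.
Qed.

(** Each term enters at most K windows. *)
Lemma window_sum (a : nat -> R) K S : (forall k, 0 <= a k) ->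
  \sum_(s < S.+1) \sum_(s - K <= k < s) a k <= K%:R * \sum_(k < S) a k.
Proof.
move=> a0; elim: K => [|K IH].
  by rewrite mul0r big1 // => s _; rewrite subn0 big_geq.
rewrite -natr1 mulrDl mul1r; apply: le_trans (lerD IH (shifted_sum K S a0)).
rewrite -big_split; apply: ler_sum => s _ /=; case: ltnP => h.
  rewrite big_ltn; last by lia.
  by rewrite addrC; have -> : ((s - K.+1).+1 = s - K)%N by lia.
by rewrite addr0; have -> : (s - K.+1 = s - K)%N by lia.
Qed.

Lemma sum_sq_weighted (I : Type) (r : seq I) (c x : I -> R) : (forall i, 0 <= c i) ->
  (\sum_(i <- r) c i * x i) ^+ 2 <= (\sum_(i <- r) c i) * \sum_(i <- r) c i * x i ^+ 2.
Proof.
move=> c0; elim: r => [|i r IH]; first by rewrite !big_nil expr0n mul0r.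
rewrite !big_cons; move: IH.
set A := \sum_(j <- r) c j * x j; set B := \sum_(j <- r) c j; set C := \sum_(j <- r) _.
have B0 : 0 <= B by apply: sumr_ge0 => j _.
have C0 : 0 <= C by apply: sumr_ge0 => j _; rewrite mulr_ge0 ?sqr_ge0.
move=> h; have h2 : 2 * x i * A <= C + B * x i ^+ 2.
  have [B1|B1] := leP B 0.
    have B2 : B = 0 by apply/eqP; rewrite eq_le B1.
    rewrite B2 mul0r in h; have A2 : A = 0 by apply/eqP; rewrite -sqrf_eq0 eq_le h sqr_ge0.
    by rewrite A2 B2 mulr0 mul0r addr0.
  rewrite -(ler_pM2l B1); have := sqr_ge0 (A - B * x i); rewrite !expr2 in h *; lra.
have := ler_wpM2l (c0 i) h2; rewrite !expr2 in h *; lra.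
Qed.

Lemma telescoped_descent (v g b : nat -> R) (k c z v0 vinf : R) S : v 0%N <= v0 -> vinf <= v S ->
  (forall s, (s < S)%N -> v s.+1 <= v s - k * g s + c * b s + z) ->
  k * \sum_(s < S) g s <= v0 - vinf + c * \sum_(s < S) b s + S%:R * z.
Proof.
move=> h0 hS h; suff key t : (t <= S)%N -> v t + k * \sum_(s < t) g s <= v0 + c * \sum_(s < t) b s + t%:R * z.
  by have := key S (leqnn S); lra.
elim: t => [_|t IH tS]; first by rewrite !big_ord0 !mulr0 mul0r !addr0.
have {}IH := IH (ltnW tS); have := h t tS.
rewrite !big_ord_recr -natr1 /=; move: IH; set x := \sum_(s < t) _; set y := \sum_(s < t) _; lra.
Qed.

(** Elimination of the summed drift Sy and of the summed moves of the mean Sw from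
    three coupled estimates, for the summed bias Sb in terms of the summed squared
    gradient Sg. *)
Lemma bias_algebra (nr ell ell2 sg l N1 Kr u1 Sb Sg Sw Sy c1 cT cP th : R) : 0 < l -> 0 <= N1 -> 1 <= Kr ->
  0 <= Sw -> 0 < nr ->
  102 * ell ^+ 2 * Kr ^+ 2 <= 1 -> 256 * ell ^+ 2 <= l ^+ 4 ->
  c1 = 160 * Kr ^+ 3 * ell ^+ 2 * sg ^+ 2 / nr + (8 * 10 ^+ 6) * ell2 ^+ 2 * sg ^+ 4 / l ^+ 6 ->
  cT = (8 * 10 ^+ 3) * nr * sg ^+ 2 * th ^+ 2 / l ^+ 4 -> cP = (8 * 10 ^+ 3) * nr * sg ^+ 2 / l ^+ 4 ->
  Sb <= N1 * (2 * c1) + 16 * ell ^+ 2 * (Kr * (Kr * Sw)) + 8 * ell ^+ 2 / nr * (Sy + N1 * cT) ->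
  Sy <= 16 / l ^+ 3 * u1 + 256 / l ^+ 4 * ell ^+ 2 * (N1 * cP) + 32 / l ^+ 4 * ell ^+ 2 * nr * Sw ->
  Sw <= 3 * (Sg + Sb + N1 * (5 / nr * sg ^+ 2)) -> 0 <= Sb ->
  Sb <= 102 * ell ^+ 2 * Kr ^+ 2 * Sg + 256 * ell ^+ 2 * u1 / (nr * l ^+ 3) +
    N1 * (640 * Kr ^+ 3 * ell ^+ 2 * sg ^+ 2 / nr + (32 * 10 ^+ 6) * ell2 ^+ 2 * sg ^+ 4 / l ^+ 6
      + (128 * 10 ^+ 3) * ell ^+ 2 * sg ^+ 2 * th ^+ 2 / l ^+ 4 + 510 * ell ^+ 2 * Kr ^+ 2 * sg ^+ 2 / nr
      + (2 ^+ 15 * 10 ^+ 3) * ell ^+ 4 * sg ^+ 2 / l ^+ 8).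
Proof.
move=> l0 N0 K1 Sw0 n0 hs1 hs2 -> -> -> h1 h2 h3 Sb0.
have lN : l != 0 by rewrite gt_eqF.
have nN : nr != 0 by rewrite gt_eqF.
have q0 : 0 <= 8 * ell ^+ 2 / nr by rewrite divr_ge0 ?(ltW n0) // mulr_ge0 ?sqr_ge0.
have k0 : 0 <= 51 * (ell ^+ 2 * Kr ^+ 2) by apply: mulr_ge0 => //; rewrite mulr_ge0 ?sqr_ge0.
have h4 : 8 * ell ^+ 2 / nr * (32 / l ^+ 4 * ell ^+ 2 * nr * Sw) <= ell ^+ 2 * Kr ^+ 2 * Sw.
  have -> : 8 * ell ^+ 2 / nr * (32 / l ^+ 4 * ell ^+ 2 * nr * Sw) =
    (256 * ell ^+ 2 / l ^+ 4) * (ell ^+ 2 * Sw) by field; rewrite lN.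
  apply: le_trans (_ : 1 * (ell ^+ 2 * Sw) <= _).
    apply: ler_wpM2r; first by rewrite mulr_ge0 ?sqr_ge0.
    by rewrite ler_pdivrMr ?exprn_gt0 // mul1r.
  rewrite mul1r ler_wpM2r // ler_peMr ?sqr_ge0 //; exact: exprn_ege1.
have h5 := ler_wpM2l q0 h2.
have h6 := ler_wpM2l k0 h3.
have h7 : 51 * (ell ^+ 2 * Kr ^+ 2) * Sb <= 1 / 2 * Sb by rewrite ler_wpM2r //; lra.
have h8 : Sb <= 2 * (N1 * (2 * (160 * Kr ^+ 3 * ell ^+ 2 * sg ^+ 2 / nr + (8 * 10 ^+ 6) * ell2 ^+ 2 * sg ^+ 4 / l ^+ 6))
   + 8 * ell ^+ 2 / nr * (16 / l ^+ 3 * u1)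
   + 8 * ell ^+ 2 / nr * (256 / l ^+ 4 * ell ^+ 2 * (N1 * ((8 * 10 ^+ 3) * nr * sg ^+ 2 / l ^+ 4)))
   + 8 * ell ^+ 2 / nr * (N1 * ((8 * 10 ^+ 3) * nr * sg ^+ 2 * th ^+ 2 / l ^+ 4))
   + 51 * (ell ^+ 2 * Kr ^+ 2) * (Sg + N1 * (5 / nr * sg ^+ 2))).
  move: h1 h4 h5 h6 h7; rewrite !mulrDr.
  have -> : 16 * ell ^+ 2 * (Kr * (Kr * Sw)) = 16 * (ell ^+ 2 * Kr ^+ 2 * Sw) by ring.
  have -> : 51 * (ell ^+ 2 * Kr ^+ 2) * Sw = 51 * (ell ^+ 2 * Kr ^+ 2 * Sw) by ring.
  have e3 a : 51 * (ell ^+ 2 * Kr ^+ 2) * (3 * a) = 3 * (51 * (ell ^+ 2 * Kr ^+ 2) * a) by ring.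
  rewrite !e3.
  set A1 := N1 * _; set A2 := N1 * _; set t1 := ell ^+ 2 * Kr ^+ 2 * Sw.
  set t2 := _ * Sy; set t3 := _ * (N1 * _); set t4 := _ * (16 / _ * _); set t5 := _ * (256 / _ * _ * _).
  set t6 := _ * (32 / _ * _ * _ * _); set t7 := _ * Sg; set t8 := _ * Sb; set t9 := _ * (N1 * _).
  lra.
apply: le_trans h8 _; rewrite le_eqVlt; apply/orP; left; apply/eqP; field; rewrite lN nN //.
Qed.

End Sums.

Section Process.
Context {R : realType} {d : measure_display} {O : measurableType d}.
Variables (P : probability O R) (n m : nat) (W : 'M[R]_n) (rho : R).
Hypothesis hW : mixing_matrix W rho.
Variables (G : 'I_n -> 'rV[R]_m -> 'rV[R]_m) (J : 'I_n -> 'rV[R]_m -> 'M[R]_m) (ell ell2 sg : R).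
Hypotheses (ell0 : 0 <= ell) (ell20 : 0 <= ell2).
Hypotheses (Glip : forall i, lip ell (G i)) (Gtaylor : forall i, taylor ell2 (G i) (J i))
  (Jcont : forall i k l, continuous (fun x => J i x k l)).
Variables (K : finType) (ag : K -> 'I_n) (gen : nat -> seq K -> set (set O)) (e : nat -> K -> O -> 'rV[R]_m).
(* each agent makes five calls per iteration *)
Hypothesis cK : #|K| = (5 * n)%N.
Variables (w U H : nat -> O -> 'M[R]_(n, m)).
Hypothesis Urec : forall s o, U s.+1 o = W *m U s o + H s.+1 o - H s o.
Hypothesis wrec : forall s o, w s.+1 o = W *m w s o - U s.+1 o.
Hypothesis Hrec : forall s o, H s.+1 o = rowwise G (w s o) + noise_sum (e s) (fun k => delta_mx (ag k) 0) (enum K) o.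
Hypothesis UH0 : forall o, mrow (U 0%N o) = mrow (H 0%N o).
Hypothesis w0 : forall o, dev (w 0%N o) = 0.
Variable S : nat.
Hypothesis FN : forall s, (s < S)%N -> fresh_noise P sg (gen s) (e s).
Hypothesis wpast : forall r s, (r <= s)%N -> pastm (gen s [::]) (w r).
Hypothesis Hpast : forall r s, (r <= s)%N -> pastm (gen s [::]) (H r).
Hypotheses (wL0 : L2m P (w 0%N)) (UL0 : L2m P (U 0%N)) (HL0 : L2m P (H 0%N)).

Lemma rowwise_L2 (X : O -> 'M[R]_(n, m)) : L2m P X -> L2m P (fun o => rowwise G (X o)).
Proof.
move=> hX i j; have h := L2m_lip (Glip i) (L2m_row i hX).
have hij := h 0 j; move: hij; congr L2; apply/funext => o; rewrite mxE //.
Qed.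
Lemma rowwise_past F (X : O -> 'M[R]_(n, m)) : pastm F X -> pastm F (fun o => rowwise G (X o)).
Proof.
move=> hX i j; have h := pastm_lip (Glip i) (pastm_row i hX).
have hij := h 0 j; move: hij; congr past; apply/funext => o; rewrite mxE //.
Qed.

(** Square integrability goes from step to step, as the fields are Lipschitz. *)
Lemma state_L2 s : (s <= S)%N -> [/\ L2m P (w s), L2m P (U s) & L2m P (H s)].
Proof.
elim: s => // s IH sS; have [h1 h2 h3] := IH (ltnW sS).
have hH : L2m P (H s.+1).
  rewrite (_ : H s.+1 = fun o => rowwise G (w s o) + noise_sum (e s) (fun k => delta_mx (ag k) 0) (enum K) o).
    by apply: L2mD; [exact: rowwise_L2|exact: (noise_sum_L2 (FN sS))].
  by apply/funext => o.
have hU : L2m P (U s.+1).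
  rewrite (_ : U s.+1 = fun o => W *m U s o + H s.+1 o - H s o); last exact/funext.
  by apply: L2mB => //; apply: L2mD => //; exact: L2m_mull.
split => //; rewrite (_ : w s.+1 = fun o => W *m w s o - U s.+1 o); last exact/funext.
by apply: L2mB => //; exact: L2m_mull.
Qed.

Let wp o s := w s o.
Let Hp o s := H s o.
Let B s o := noise G (wp o) (Hp o) s.
Let wb s o := mrow (w s o).
Let Am k : 'M[R]_n := dev (ker W k (1%:M : 'M[R]_n)).

Lemma BE s o : B s o = noise_sum (e s) (fun k => delta_mx (ag k) 0) (enum K) o.
Proof. by rewrite /B /noise /Hp /wp Hrec addrAC subrr add0r. Qed.

Lemma B_L2 s : (s < S)%N -> L2m P (B s).
Proof.
move=> sS; rewrite (_ : B s = noise_sum (e s) (fun k => delta_mx (ag k) 0) (enum K)).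
  exact: (noise_sum_L2 (FN sS)).
by apply/funext => o; exact: BE.
Qed.

Lemma B_past r s : (r < s)%N -> pastm (gen s [::]) (B r).
Proof.
by move=> rs; apply: pastmB; [exact: Hpast|apply: rowwise_past; apply: wpast; exact: ltnW].
Qed.

Lemma Am_mul k q (M : 'M[R]_(n, q)) : Am k *m M = dev (ker W k M).
Proof. by rewrite /Am -dev_mul -ker_mul mul1mx. Qed.

Lemma Am_norm k q (M : 'M[R]_(n, q)) : fnorm (Am k *m M) <= cker rho k * fnorm M.
Proof.
rewrite Am_mul (ker_dev hW); apply: le_trans (ker_contract hW k (mrow_dev hW M)) _.
by rewrite ler_wpM2l ?(fnorm_dev hW) //; exact: (cker_ge0 hW).
Qed.

Lemma colE' (A : 'M[R]_n) j i : A i j = (A *m delta_mx j (0 : 'I_1)) i 0.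
Proof. by rewrite -colE mxE. Qed.

Lemma delta_norm j : fnorm (delta_mx j 0 : 'cV[R]_n) = 1.
Proof.
rewrite /fnorm (bigD1 j) //= big_ord1 mxE !eqxx expr1n big1 ?addr0 ?sqrtr1 // => i /negbTE ij.
by rewrite big_ord1 mxE ij expr0n.
Qed.

Lemma Am_col1 k j : \sum_i `|Am k i j| <= 2 * (2 * k + 1)%:R.
Proof.
under eq_bigr do rewrite colE' Am_mul.
apply: le_trans (l1_ker hW k _) _; rewrite -[leRHS]mulr1 ler_wpM2l ?mulr_ge0 //.
rewrite (bigD1 j) //= mxE !eqxx normr1 big1 ?addr0 // => i /negbTE ij.
by rewrite mxE ij normr0.
Qed.

Lemma Am_col2 k j : \sum_i Am k i j ^+ 2 <= cker rho k ^+ 2.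
Proof.
have -> : \sum_i Am k i j ^+ 2 = fnorm (Am k *m (delta_mx j 0 : 'cV[R]_n)) ^+ 2.
  by rewrite fnorm_sqE; apply: eq_bigr => i _; rewrite big_ord1 -colE'.
by rewrite ler_pXn2r ?nnegrE ?(cker_ge0 hW) //; have := Am_norm k (delta_mx j 0 : 'cV[R]_n); rewrite delta_norm mulr1.
Qed.

Lemma Am_noise (A : 'M[R]_n) s o : A *m B s o = noise_sum (e s) (fun k => col (ag k) A) (enum K) o.
Proof. by rewrite BE /noise_sum mulmx_sumr; apply: eq_bigr => k _; rewrite mulmxA -colE. Qed.

Lemma nrespE s o : nresp W G (wp o) (Hp o) s = - \sum_(0 <= k < s) Am (s.-1 - k) *m B k o.
Proof.
rewrite /nresp respY_ker // devN dev_sum big_mkord; congr (- _).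
by apply: eq_bigr => k _; rewrite Am_mul.
Qed.

(** Response at time s to the noise of the steps from r to t - 1. *)
Let near s r t o := - \sum_(r <= k < t) Am (s.-1 - k) *m B k o.

Lemma near_L2 s r t : (t <= S)%N -> L2m P (near s r t).
Proof.
move=> tS; apply: L2mN; rewrite /near.
have h k : (k < t)%N -> L2m P (fun o => Am (s.-1 - k) *m B k o).
  by move=> kt; apply: L2m_mull; apply: B_L2; exact: leq_trans kt tS.
under eq_fun do rewrite big_nat.
by apply: L2m_sum => k /andP[_ kt]; exact: h.
Qed.

Lemma near_past s r t : pastm (gen t [::]) (near s r t).
Proof.
rewrite (_ : near s r t = fun o => 0 - \sum_(r <= k < t) (if (k < t)%N then Am (s.-1 - k) *m B k o else 0)).
  apply: pastmB; first exact: pastm_cst.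
  apply: pastm_sum => k; case: ltnP => h; last exact: pastm_cst.
  by apply: pastm_mull; exact: B_past.
apply/funext => o; rewrite /near sub0r; congr (- _).
by apply: eq_big_nat => k /andP[_ ->].
Qed.

Lemma near_step s r t o : (r <= t)%N -> near s r t.+1 o = near s r t o +
   noise_sum (e t) (fun k => col (ag k) (- Am (s.-1 - t))) (enum K) o.
Proof.
by move=> rt; rewrite -Am_noise mulNmx -opprD; congr (- _); rewrite big_nat_recr.
Qed.

(** The steps are taken in their order and in each step the calls one by one, with
    the mean point frozen at time r, the beginning of the window. *)
Lemma near_bound s r t Kw : (s < S.+1)%N -> (s - r <= Kw)%N -> (r <= t)%N -> (t <= s)%N ->
  Ex P (fun o => fnorm (disp G (wb r o) (near s r t o)) ^+ 2) <=
   (Num.sqrt ((t - r)%:R * ((5 * n)%:R * ((n%:R^-1 * ell * (4 * Kw)%:R) ^+ 2 * sg ^+ 2)))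
    + \sum_(r <= k < t) (5 * n)%:R * (n%:R^-1 * ell2 * cker rho (s.-1 - k) ^+ 2 * sg ^+ 2)) ^+ 2.
Proof.
move=> sS srK; elim: t => [|t IH].
  rewrite leqn0 => /eqP -> _; rewrite subnn mul0r sqrtr0 add0r big_geq // expr0n.
  rewrite -[leRHS](Ex_cst P 0) le_eqVlt; apply/orP; left; apply/eqP; apply: Ex_eq => o.
  rewrite /near big_geq // oppr0 /disp big1 ?scaler0 ?fnorm0 ?expr0n // => i _.
  by rewrite linear0 addr0 subrr.
rewrite leq_eqVlt => /orP[/eqP rt|rt] ts.
  rewrite -rt subnn mul0r sqrtr0 add0r big_geq // expr0n.
  rewrite -[leRHS](Ex_cst P 0) le_eqVlt; apply/orP; left; apply/eqP; apply: Ex_eq => o.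
  rewrite /near big_geq // oppr0 /disp big1 ?scaler0 ?fnorm0 ?expr0n // => i _.
  by rewrite linear0 addr0 subrr.
rewrite ltnS in rt; have {}IH := IH rt (ltnW ts).
have tS : (t < S)%N by lia.
have n0 : 0 <= n%:R^-1 :> R by rewrite invr_ge0.
have v0 : 0 <= (n%:R^-1 * ell * (4 * Kw)%:R) ^+ 2 * sg ^+ 2 by rewrite mulr_ge0 ?sqr_ge0.
have mu0 k : 0 <= n%:R^-1 * ell2 * cker rho k ^+ 2 * sg ^+ 2.
  by apply: mulr_ge0; [apply: mulr_ge0; [exact: mulr_ge0|exact: sqr_ge0]|exact: sqr_ge0].
have [wL _ _] := state_L2 (ltnW (leq_ltn_trans rt tS)).
have wbL : L2m P (wb r) by apply: L2mZ; exact: L2m_mull.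
have wbP : pastm (gen t [::]) (wb r) by apply: pastmZ; apply: pastm_mull; exact: wpast.
have a1 j : \sum_i `|(- Am (s.-1 - t)) i j| <= (4 * Kw)%:R.
  under eq_bigr do rewrite mxE normrN.
  apply: le_trans (Am_col1 _ _) _; rewrite -natrM ler_nat; lia.
have a2 j : \sum_i (- Am (s.-1 - t)) i j ^+ 2 <= cker rho (s.-1 - t) ^+ 2.
  by under eq_bigr do rewrite mxE sqrrN; exact: Am_col2.
have V0 : 0 <= (t - r)%:R * ((5 * n)%:R * ((n%:R^-1 * ell * (4 * Kw)%:R) ^+ 2 * sg ^+ 2)).
  by apply: mulr_ge0 => //; apply: mulr_ge0.
have M0 : 0 <= \sum_(r <= k < t) (5 * n)%:R * (n%:R^-1 * ell2 * cker rho (s.-1 - k) ^+ 2 * sg ^+ 2).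
  by apply: sumr_ge0 => k _; rewrite mulr_ge0.
have h := reveal_seq ell0 ell20 Glip Gtaylor Jcont (FN tS) ag (enum_uniq K) wbP (near_past s r (t:=t)) wbL
   (near_L2 s r (ltnW tS)) a1 a2 (sqr_ge0 _) V0 M0 IH.
rewrite -cardE cK in h.
rewrite (Ex_eq P (g := fun o => fnorm (disp G (wb r o) (near s r t o +
   noise_sum (e t) (fun k => col (ag k) (- Am (s.-1 - t))) (enum K) o)) ^+ 2)); last first.
  by move=> o; rewrite near_step.
apply: le_trans h _; rewrite le_eqVlt; apply/orP; left; apply/eqP.
rewrite [in RHS]big_nat_recr //=; congr ((Num.sqrt _ + _) ^+ 2).
by rewrite subSn // -natr1 [in RHS]mulrDl mul1r.
Qed.

Lemma B_var s : (s < S)%N -> Ex P (fun o => fnorm (B s o) ^+ 2) <= (5 * n)%:R * sg ^+ 2.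
Proof.
move=> sS; rewrite (Ex_eq P (g := fun o => fnorm (noise_sum (e s) (fun k => delta_mx (ag k) 0) (enum K) o) ^+ 2)).
  apply: le_trans (noise_sum_var (FN sS) _ (enum_uniq K)) _; rewrite mulrC ler_wpM2r ?sqr_ge0 //.
  under eq_bigr do rewrite delta_norm expr1n.
  by rewrite big_enum /= sumr_const cK.
by move=> o; rewrite BE.
Qed.

Lemma Bmean_var s : (s < S)%N -> Ex P (fun o => fnorm (mrow (B s o)) ^+ 2) <= 5 / n%:R * sg ^+ 2.
Proof.
have n0 := nR0 hW.
move=> sS; pose c k : 'cV[R]_1 := n%:R^-1 *: (const_mx 1 *m (delta_mx (ag k) 0 : 'cV[R]_n)).
rewrite (Ex_eq P (g := fun o => fnorm (noise_sum (e s) c (enum K) o) ^+ 2)).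
  apply: le_trans (noise_sum_var (FN sS) _ (enum_uniq K)) _; rewrite mulrC ler_wpM2r ?sqr_ge0 //.
  have ck k : fnorm (c k) ^+ 2 = n%:R^-1 ^+ 2.
    rewrite fnorm_sqE !big_ord1 !mxE (bigD1 (ag k)) //= !mxE !eqxx mulr1 big1 ?addr0 ?mulr1 //.
    by move=> i /negbTE ij; rewrite !mxE ij mulr0.
  under eq_bigr do rewrite ck.
  rewrite big_enum /= sumr_const cK -[_ *+ (5 * n)]mulr_natl natrM le_eqVlt; apply/orP; left; apply/eqP.
  by field; rewrite gt_eqF.
move=> o; congr (fnorm _ ^+ 2); rewrite BE /mrow /noise_sum mulmx_sumr scaler_sumr.
by apply: eq_bigr => k _; rewrite mulmxA scalemxAl.
Qed.

Lemma resp_bound s r t : (t <= S)%N ->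
  Ex P (fun o => fnorm (near s r t o) ^+ 2) <=
   (\sum_(r <= k < t) cker rho (s.-1 - k)) ^+ 2 * ((5 * n)%:R * sg ^+ 2).
Proof.
move=> tS; set c := \sum_(r <= k < t) cker rho (s.-1 - k).
have c0 k : 0 <= cker rho k by exact: (cker_ge0 hW).
have c00 : 0 <= c by apply: sumr_ge0.
have key o : fnorm (near s r t o) ^+ 2 <= c * \sum_(r <= k < t) cker rho (s.-1 - k) * fnorm (B k o) ^+ 2.
  apply: le_trans (sum_sq_weighted _ _ _) => //; rewrite ler_pXn2r ?nnegrE //; last first.
    by apply: sumr_ge0 => k _; rewrite mulr_ge0.
  rewrite fnormN; apply: le_trans (ler_fnorm_sum _ _ _) _; apply: ler_sum => k _; exact: Am_norm.
have iB k : (r <= k < t)%N -> intg P (fun o => cker rho (s.-1 - k) * fnorm (B k o) ^+ 2).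
  by move=> /andP[_ kt]; apply: intgZ; apply: intg_fnorm2; apply: B_L2; exact: leq_trans kt tS.
have iS : intg P (fun o => \sum_(r <= k < t) cker rho (s.-1 - k) * fnorm (B k o) ^+ 2).
  by under eq_fun do rewrite big_nat; exact: intg_sum.
apply: le_trans (Ex_le (intg_fnorm2 (near_L2 s r tS)) (intgZ c iS) key) _.
rewrite ExZ // expr2 -mulrA ler_wpM2l //.
rewrite (Ex_eq P (g := fun o => \sum_(r <= k < t | (r <= k < t)%N) cker rho (s.-1 - k) * fnorm (B k o) ^+ 2)).
  rewrite Ex_sum // -big_nat mulr_suml; apply: ler_sum_nat => k /andP[_ kt].
  have kS : (k < S)%N by exact: leq_trans kt tS.
  rewrite ExZ; last by apply: intg_fnorm2; exact: B_L2.
  by rewrite ler_wpM2l // B_var.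
by move=> o; rewrite big_nat.
Qed.

Let bb s o := disp G (wb s o) (dev (w s o)).
Let dw s o := fnorm (wb s.+1 o - wb s o) ^+ 2.
Let D s o := drift W G (wp o) (Hp o) s.

Lemma dev_split s r o : (r <= s)%N -> dev (w s o) = (D s o + near s 0 r o) + near s r s o.
Proof.
move=> rs; rewrite -addrA /near -opprD -big_cat_nat //= -/(near s 0 s o).
by rewrite /D /drift nrespE subrK.
Qed.

Lemma window_move s r o : (r <= s)%N -> fnorm (wb s o - wb r o) ^+ 2 <= (s - r)%:R * \sum_(r <= k < s) dw k o.
Proof.
move=> rs; rewrite -(telescope_sumr (fun k => wb k o)) //.
have h := @sum_sq_weighted R nat (index_iota r s) (fun=> 1) (fun k => fnorm (wb k.+1 o - wb k o)) (fun=> ler01).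
have h2 : fnorm (\sum_(r <= k < s) (wb k.+1 o - wb k o)) ^+ 2 <= (\sum_(r <= k < s) 1 * fnorm (wb k.+1 o - wb k o)) ^+ 2.
  rewrite ler_pXn2r ?nnegrE //; last by apply: sumr_ge0 => k _; rewrite mul1r.
  by apply: le_trans (ler_fnorm_sum _ _ _) _; apply: ler_sum => k _; rewrite mul1r.
apply: le_trans h2 (le_trans h _); rewrite sumr_const_nat; under eq_bigr do rewrite mul1r.
exact: lexx.
Qed.

(** At time s the mean is replaced by the mean at the beginning of a window of
    length Kw, and the deviation by the response to the noise of the window. *)
Lemma bias_split s Kw o : fnorm (bb s o) ^+ 2 <=
  2 * fnorm (disp G (wb (s - Kw)%N o) (near s (s - Kw) s o)) ^+ 2
  + 16 * ell ^+ 2 * (Kw%:R * \sum_(s - Kw <= k < s) dw k o)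
  + 8 * ell ^+ 2 / n%:R * (fnorm (D s o) ^+ 2 + fnorm (near s 0 (s - Kw) o) ^+ 2).
Proof.
have n0 := nR0 hW; have rs := leq_subr Kw s.
rewrite /bb (dev_split o rs).
apply: le_trans (disp_shift hW ell0 Glip _ (wb (s - Kw)%N o) _ _) _.
apply: lerD; first rewrite lerD2l.
  rewrite ler_wpM2l ?mulr_ge0 ?sqr_ge0 //; apply: le_trans (window_move o rs) _.
  rewrite ler_wpM2r ?ler_nat; [by []|by apply: sumr_ge0 => k _; exact: sqr_ge0|lia].
have -> : 8 * ell ^+ 2 / n%:R = 4 * ell ^+ 2 / n%:R * 2 by ring.
rewrite -[_ * 2 * _]mulrA; apply: ler_wpM2l; first by rewrite divr_ge0 ?(ltW n0) // mulr_ge0 ?sqr_ge0.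
by apply: le_trans (fnorm_sqD2 _ _) _; rewrite mulrDr.
Qed.

Lemma cker_rev (f : nat -> R) s : \sum_(0 <= k < s) f (s.-1 - k)%N = \sum_(k < s) f k.
Proof.
rewrite big_nat_rev /= big_mkord; apply: eq_bigr => k _; congr f; have := ltn_ord k; lia.
Qed.

(** With Kw Kw^2 / n from the variances, and [cker_sum2] from the quadratic parts. *)
Lemma near_E s Kw : (s <= S)%N ->
  Ex P (fun o => fnorm (disp G (wb (s - Kw)%N o) (near s (s - Kw) s o)) ^+ 2) <=
    160 * Kw%:R ^+ 3 * ell ^+ 2 * sg ^+ 2 / n%:R + (8 * 10 ^+ 6) * ell2 ^+ 2 * sg ^+ 4 / lam rho ^+ 6.
Proof.
move=> sS; have n0 := nR0 hW; have /andP[l0 l1] := lam_bounds hW.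
have sK : (s - (s - Kw) <= Kw)%N by lia.
have c0 k : 0 <= cker rho k by exact: (cker_ge0 hW).
apply: le_trans (near_bound _ sK (leq_subr _ _) (leqnn s)) _; first by rewrite ltnS.
set V := _ * (_ * _); set M := \sum_(_ <= _ < _) _.
have V0 : 0 <= V by apply: mulr_ge0 => //; apply: mulr_ge0 => //; rewrite mulr_ge0 ?sqr_ge0.
have M0 : 0 <= M.
  apply: sumr_ge0 => k _; apply: mulr_ge0 => //; apply: mulr_ge0; last exact: sqr_ge0.
  by rewrite mulr_ge0 ?sqr_ge0 // mulr_ge0 // invr_ge0 ltW.
have hV : V <= 80 * Kw%:R ^+ 3 * ell ^+ 2 * sg ^+ 2 / n%:R.
  have -> : 80 * Kw%:R ^+ 3 * ell ^+ 2 * sg ^+ 2 / n%:R =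
      Kw%:R * ((5 * n)%:R * ((n%:R^-1 * ell * (4 * Kw)%:R) ^+ 2 * sg ^+ 2)).
    by rewrite !natrM; field; rewrite gt_eqF.
  rewrite ler_wpM2r ?ler_nat //; apply: mulr_ge0 => //; rewrite mulr_ge0 ?sqr_ge0 //.
have hM : M <= 2000 * ell2 * sg ^+ 2 / lam rho ^+ 3.
  have -> : M = 5 * ell2 * sg ^+ 2 * \sum_(s - Kw <= k < s) cker rho (s.-1 - k) ^+ 2.
    by rewrite mulr_sumr; apply: eq_bigr => k _; rewrite natrM; field; rewrite gt_eqF.
  have -> : 2000 * ell2 * sg ^+ 2 / lam rho ^+ 3 = 5 * ell2 * sg ^+ 2 * (400 / lam rho ^+ 3) by ring.
  apply: ler_wpM2l; first by rewrite mulr_ge0 ?sqr_ge0 // mulr_ge0.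
  apply: le_trans (cker_sum2 hW s).
  rewrite -(cker_rev (fun k => cker rho k ^+ 2)) [leRHS](@big_cat_nat _ _ _ (s - Kw)%N) //= ?leq_subr //.
  by rewrite lerDr; apply: sumr_ge0 => k _; exact: sqr_ge0.
have hM2 : M ^+ 2 <= (4 * 10 ^+ 6) * ell2 ^+ 2 * sg ^+ 4 / lam rho ^+ 6.
  have -> : (4 * 10 ^+ 6) * ell2 ^+ 2 * sg ^+ 4 / lam rho ^+ 6 = (2000 * ell2 * sg ^+ 2 / lam rho ^+ 3) ^+ 2.
    by field; rewrite gt_eqF.
  exact: sq_mono M0 hM.
have : (Num.sqrt V + M) ^+ 2 <= 2 * V + 2 * M ^+ 2.
  have := sqr_sqrtr V0; have := sqr_ge0 (Num.sqrt V - M); rewrite !expr2; lra.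
move/le_trans; apply.
set X := _ / n%:R in hV *; set Y := _ / lam rho ^+ 6 in hM2 *.
have -> : 160 * Kw%:R ^+ 3 * ell ^+ 2 * sg ^+ 2 / n%:R = 2 * X by rewrite /X; ring.
have -> : (8 * 10 ^+ 6) * ell2 ^+ 2 * sg ^+ 4 / lam rho ^+ 6 = 2 * Y by rewrite /Y; ring.
lra.
Qed.

(** Noise older than the window has decayed by tht^Kw. *)
Lemma far_E s Kw : (s <= S)%N -> Ex P (fun o => fnorm (near s 0 (s - Kw) o) ^+ 2) <=
  (8 * 10 ^+ 3) * n%:R * sg ^+ 2 * (tht rho ^+ Kw) ^+ 2 / lam rho ^+ 4.
Proof.
move=> sS; have n0 := nR0 hW; have /andP[l0 l1] := lam_bounds hW; have /andP[t0 t1] := tht_bounds hW.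
have tp : 0 <= tht rho ^+ Kw by apply: exprn_ge0; lra.
have c0 k : 0 <= cker rho k by exact: (cker_ge0 hW).
apply: le_trans (resp_bound _ _ (leq_trans (leq_subr _ _) sS)) _.
have h : \sum_(0 <= k < s - Kw) cker rho (s.-1 - k) <= tht rho ^+ Kw * (40 / lam rho ^+ 2).
  have -> : \sum_(0 <= k < s - Kw) cker rho (s.-1 - k) = tht rho ^+ Kw * \sum_(k < s - Kw) cker rho k.
    rewrite -(cker_rev (cker rho)) mulr_sumr; apply: eq_big_nat => k /andP[_ kr].
    have -> : (s.-1 - k = Kw + ((s - Kw).-1 - k))%N by lia.
    by rewrite /cker exprD; ring.
  by rewrite ler_wpM2l // (cker_sum hW).
have -> : (8 * 10 ^+ 3) * n%:R * sg ^+ 2 * (tht rho ^+ Kw) ^+ 2 / lam rho ^+ 4 =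
   (tht rho ^+ Kw * (40 / lam rho ^+ 2)) ^+ 2 * ((5 * n)%:R * sg ^+ 2).
  by rewrite natrM; field; rewrite gt_eqF.
rewrite ler_wpM2r //; first by rewrite mulr_ge0 ?sqr_ge0.
rewrite ler_pXn2r ?nnegrE //; first by apply: sumr_ge0.
by rewrite mulr_ge0 // divr_ge0 // exprn_ge0 // ltW.
Qed.

Lemma nresp_E s : (s <= S)%N -> Ex P (fun o => fnorm (near s 0 s o) ^+ 2) <=
  (8 * 10 ^+ 3) * n%:R * sg ^+ 2 / lam rho ^+ 4.
Proof. by move=> sS; have := far_E 0 sS; rewrite subn0 expr0 expr1n mulr1. Qed.

Lemma dw_L2 s : (s < S)%N -> intg P (dw s).
Proof.
move=> sS; have [h1 _ _] := state_L2 sS; have [h2 _ _] := state_L2 (ltnW sS).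
by apply: intg_fnorm2; apply: L2mB; apply: L2mZ; exact: L2m_mull.
Qed.

Lemma wb_L2 s : (s <= S)%N -> L2m P (wb s).
Proof. by move=> sS; have [h1 _ _] := state_L2 sS; apply: L2mZ; exact: L2m_mull. Qed.

Lemma meanG_L2 s : (s <= S)%N -> L2m P (fun o => meanG G (wb s o)).
Proof. by move=> sS; apply: L2mZ; apply: L2m_sum => i _; apply: (L2m_lip (Glip i)); exact: wb_L2. Qed.

Lemma dev_L2 (X : O -> 'M[R]_(n, m)) : L2m P X -> L2m P (fun o => dev (X o)).
Proof. by move=> h; apply: L2mB => //; apply: L2m_mull; apply: L2mZ; exact: L2m_mull. Qed.

Lemma bb_L2 s : (s <= S)%N -> L2m P (bb s).
Proof.
by move=> sS; have [h1 _ _] := state_L2 sS; apply: (disp_L2 Glip); [exact: wb_L2|exact: dev_L2].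
Qed.

Lemma D_L2 s : (s <= S)%N -> L2m P (D s).
Proof.
move=> sS; have [h1 _ _] := state_L2 sS.
rewrite (_ : D s = fun o => dev (w s o) - near s 0 s o); last by apply/funext => o; rewrite /D /drift nrespE.
by apply: L2mB; [exact: dev_L2|exact: near_L2].
Qed.

Lemma mean_stepE s o : wb s.+1 o = wb s o - (meanG G (wb s o) + bb s o + mrow (B s o)).
Proof. exact: (mean_step G hW (fun s => Urec s o) (fun s => wrec s o) (UH0 o) s). Qed.

Lemma dw_E s : (s < S)%N -> Ex P (dw s) <=
  3 * (Ex P (fun o => fnorm (meanG G (wb s o)) ^+ 2) + Ex P (fun o => fnorm (bb s o) ^+ 2) + 5 / n%:R * sg ^+ 2).
Proof.
move=> sS; have i1 := intg_fnorm2 (meanG_L2 (ltnW sS)); have i2 := intg_fnorm2 (bb_L2 (ltnW sS)).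
have bL : L2m P (fun o => mrow (B s o)) by apply: L2mZ; apply: L2m_mull; exact: B_L2.
have i3 := intg_fnorm2 bL; have i12 := intgD i1 i2.
apply: le_trans (Ex_le (dw_L2 sS) (intgZ 3 (intgD i12 i3)) _) _.
  move=> o; rewrite /dw mean_stepE addrAC subrr add0r fnormN.
  have h1 := ler_fnormD (meanG G (wb s o) + bb s o) (mrow (B s o)).
  have h2 := ler_fnormD (meanG G (wb s o)) (bb s o).
  move: h1 h2; set X := fnorm (_ + _ + _); set a := fnorm (meanG _ _); set b := fnorm (bb _ _); set c := fnorm (mrow _).
  move=> h1 h2; have h : X ^+ 2 <= (a + b + c) ^+ 2.
    by rewrite ler_pXn2r ?nnegrE ?addr_ge0 // ?fnorm_ge0 //; lra.
  have := sqr_ge0 (a - b); have := sqr_ge0 (b - c); have := sqr_ge0 (a - c); rewrite !expr2 in h *; lra.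
rewrite (ExZ 3 (intgD i12 i3)) (ExD i12 i3) (ExD i1 i2) ler_wpM2l // lerD2l; exact: Bmean_var.
Qed.

(** The averaged direction at the agents' points against the direction at their
    mean. Its mean square is of order sg^2 ell^2 Kw^3 / n per step: the factor 1 / n
    comes from revealing the recent noise call by call. The other terms come from the
    quadratic parts, from the old noise, from the moves of the mean within a window
    and from the drift; the moves bring back the squared gradient itself. *)
Theorem bias_sum u1 Kw : (0 < Kw)%N ->
  (forall o, fnorm (W *m dev (U 0%N o) + dev (rowwise G (w 0%N o) - H 0%N o)) ^+ 2 <= u1) ->
  102 * ell ^+ 2 * Kw%:R ^+ 2 <= 1 -> 256 * ell ^+ 2 <= lam rho ^+ 4 ->
  \sum_(s < S.+1) Ex P (fun o => fnorm (bb s o) ^+ 2) <=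
    102 * ell ^+ 2 * Kw%:R ^+ 2 * \sum_(s < S.+1) Ex P (fun o => fnorm (meanG G (wb s o)) ^+ 2)
    + 256 * ell ^+ 2 * u1 / (n%:R * lam rho ^+ 3)
    + S.+1%:R * (640 * Kw%:R ^+ 3 * ell ^+ 2 * sg ^+ 2 / n%:R + (32 * 10 ^+ 6) * ell2 ^+ 2 * sg ^+ 4 / lam rho ^+ 6
      + (128 * 10 ^+ 3) * ell ^+ 2 * sg ^+ 2 * (tht rho ^+ Kw) ^+ 2 / lam rho ^+ 4 + 510 * ell ^+ 2 * Kw%:R ^+ 2 * sg ^+ 2 / n%:R
      + (2 ^+ 15 * 10 ^+ 3) * ell ^+ 4 * sg ^+ 2 / lam rho ^+ 8).
Proof.
move=> Kw0 hu1 hs1 hs2; have n0 := nR0 hW; have /andP[l0 l1] := lam_bounds hW.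
have dw0 k : 0 <= Ex P (dw k) by apply: Ex_ge0 => o; exact: sqr_ge0.
have ls (s : 'I_S.+1) : (s <= S)%N by rewrite -ltnS.
have q4 : 0 <= 256 / lam rho ^+ 4 * ell ^+ 2.
  exact: mulr_ge0 (divr_ge0 (ler0n R 256) (exprn_ge0 _ (ltW l0))) (sqr_ge0 ell).
set Sb := \sum_(s < S.+1) Ex P (fun o => fnorm (bb s o) ^+ 2).
set Sg := \sum_(s < S.+1) Ex P _.
pose Sw := \sum_(s < S) Ex P (dw s).
pose Sy := \sum_(s < S.+1) Ex P (fun o => fnorm (D s o) ^+ 2).
have iD (s : 'I_S.+1) : intg P (fun o => fnorm (D s o) ^+ 2) by apply: intg_fnorm2; exact: D_L2.
have iN (s : 'I_S.+1) : intg P (fun o => fnorm (near s 0 s o) ^+ 2) by apply: intg_fnorm2; exact: near_L2.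
have iw (s : 'I_S) : intg P (dw s) by exact: dw_L2.
apply: (bias_algebra (c1 := _) (cT := _) (cP := _) (Sw := Sw) (Sy := Sy) l0 _ _ _ n0 hs1 hs2 erefl erefl erefl) => //.
- by rewrite ler1n.
- by apply: sumr_ge0 => k _.
- have st (s : 'I_S.+1) : Ex P (fun o => fnorm (bb s o) ^+ 2) <=
     2 * (160 * Kw%:R ^+ 3 * ell ^+ 2 * sg ^+ 2 / n%:R + (8 * 10 ^+ 6) * ell2 ^+ 2 * sg ^+ 4 / lam rho ^+ 6)
     + 16 * ell ^+ 2 * (Kw%:R * \sum_(s - Kw <= k < s) Ex P (dw k))
     + 8 * ell ^+ 2 / n%:R * (Ex P (fun o => fnorm (D s o) ^+ 2) +
         (8 * 10 ^+ 3) * n%:R * sg ^+ 2 * (tht rho ^+ Kw) ^+ 2 / lam rho ^+ 4).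
    have sS := ls s; have rS := leq_trans (leq_subr Kw s) sS.
    have iF : intg P (fun o => fnorm (disp G (wb (s - Kw)%N o) (near s (s - Kw) s o)) ^+ 2).
      by apply: intg_fnorm2; apply: (disp_L2 Glip); [exact: wb_L2|exact: near_L2].
    have iT : intg P (fun o => fnorm (near s 0 (s - Kw) o) ^+ 2) by apply: intg_fnorm2; exact: near_L2.
    have iW : intg P (fun o => \sum_(s - Kw <= k < s) dw k o).
      under eq_fun do rewrite big_nat; apply: intg_sum => k /andP[_ ks]; apply: dw_L2; exact: leq_trans ks sS.
    have iKW := intgZ Kw%:R iW.
    have i1 := intgZ 2 iF; have i2 := intgZ (16 * ell ^+ 2) iKW.
    have i3 := intgZ (8 * ell ^+ 2 / n%:R) (intgD (iD s) iT).
    apply: le_trans (Ex_le (intg_fnorm2 (bb_L2 sS)) (intgD (intgD i1 i2) i3) (bias_split s Kw)) _.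
    rewrite (ExD (intgD i1 i2) i3) (ExD i1 i2) (ExZ _ iF) (ExZ _ iKW) (ExZ _ iW) (ExZ _ (intgD (iD s) iT)) (ExD (iD s) iT).
    have -> : Ex P (fun o => \sum_(s - Kw <= k < s) dw k o) = \sum_(s - Kw <= k < s) Ex P (dw k).
      rewrite (Ex_eq P (g := fun o => \sum_(s - Kw <= k < s | (s - Kw <= k < s)%N) dw k o)); last by move=> o; rewrite big_nat.
      by rewrite Ex_sum -?big_nat // => k /andP[_ ks]; apply: dw_L2; exact: leq_trans ks sS.
    apply: lerD; first apply: lerD => //.
      by rewrite ler_wpM2l // near_E.
    rewrite ler_wpM2l ?divr_ge0 ?mulr_ge0 ?sqr_ge0 ?(ltW n0) // lerD2l; exact: far_E.
  apply: le_trans (ler_sum _ (fun s _ => st s)) _.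
  rewrite big_split big_split /= sum_cst -!mulr_sumr big_split /= sum_cst.
  apply: lerD => //; apply: lerD => //.
  rewrite ler_wpM2l ?mulr_ge0 ?sqr_ge0 // ler_wpM2l //; exact: window_sum.
- have hp o := drift_sum hW ell0 Glip (fun s => Urec s o) (fun s => wrec s o) (w0 o) S (hu1 o) hs2.
  have iDS : intg P (fun o => \sum_(s < S.+1) fnorm (D s o) ^+ 2) by apply: intg_sum.
  have iNS : intg P (fun o => \sum_(s < S.+1) fnorm (near s 0 s o) ^+ 2) by apply: intg_sum.
  have iwS : intg P (fun o => \sum_(s < S) dw s o) by apply: intg_sum.
  have ic := intg_cst P (16 / lam rho ^+ 3 * u1).
  have i1 := intgZ (256 / lam rho ^+ 4 * ell ^+ 2) iNS.
  have i2 := intgZ (32 / lam rho ^+ 4 * ell ^+ 2 * n%:R) iwS.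
  have hE := Ex_le iDS (intgD (intgD ic i1) i2) _.
  have {}hE := hE (fun o => _).
  have {hE} : Ex P (fun o => \sum_(s < S.+1) fnorm (D s o) ^+ 2) <=
     Ex P (fun o => 16 / lam rho ^+ 3 * u1
       + 256 / lam rho ^+ 4 * ell ^+ 2 * \sum_(s < S.+1) fnorm (near s 0 s o) ^+ 2
       + 32 / lam rho ^+ 4 * ell ^+ 2 * n%:R * \sum_(s < S) dw s o).
    apply: hE => o; apply: le_trans (hp o) _; rewrite lerD2r lerD2l.
    apply: (ler_wpM2l q4).
    by apply: ler_sum => s _; rewrite nrespE.
  rewrite (ExD (intgD ic i1) i2) (ExD ic i1) (ExZ _ iNS) (ExZ _ iwS) Ex_cst.
  rewrite Ex_sum // Ex_sum // Ex_sum // => h; apply: le_trans h _.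
  rewrite lerD2r lerD2l; apply: (ler_wpM2l q4).
  apply: le_trans (ler_sum _ (fun s _ => nresp_E (ls s))) _.
  by rewrite sum_cst.
- apply: le_trans (_ : \sum_(s < S) 3 * (Ex P (fun o => fnorm (meanG G (wb s o)) ^+ 2)
      + Ex P (fun o => fnorm (bb s o) ^+ 2) + 5 / n%:R * sg ^+ 2) <= _).
    by apply: ler_sum => s _; exact: dw_E.
  rewrite -mulr_sumr ler_wpM2l // /Sb /Sg.
  pose Ef k := Ex P (fun o => fnorm (meanG G (wb k o)) ^+ 2) + Ex P (fun o => fnorm (bb k o) ^+ 2) + 5 / n%:R * sg ^+ 2.
  have Ef0 k : 0 <= Ef k.
    apply: addr_ge0; last by rewrite mulr_ge0 ?sqr_ge0 // divr_ge0 // ltW.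
    by apply: addr_ge0; apply: Ex_ge0 => o; exact: sqr_ge0.
  apply: le_trans (sum_nat_mono Ef0 (leqnSn S)) _.
  by rewrite !big_split /= sum_cst.
- by apply: sumr_ge0 => k _; apply: Ex_ge0 => o; exact: sqr_ge0.
Qed.

(** The mean noise is a multiple of a sum of calls, each centered given the past. *)
Lemma mean_orth s (Y : O -> 'rV[R]_m) : (s < S)%N -> pastm (gen s [::]) Y -> L2m P Y ->
  Ex P (fun o => dotp (Y o) (mrow (B s o))) = 0.
Proof.
move=> sS pY lY.
have mB o : mrow (B s o) = n%:R^-1 *: \sum_(k <- enum K) e s k o.
  have -> : B s o = noise_sum (e s) (fun k => delta_mx (ag k) 0) (enum K) o by exact: BE.
  rewrite /mrow /noise_sum mulmx_sumr; congr (_ *: _); apply: eq_bigr => k _.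
  rewrite mulmxA; have -> : (const_mx 1 : 'rV[R]_n) *m delta_mx (ag k) 0 = 1%:M :> 'M[R]_1.
    apply/matrixP => a b; rewrite !ord1 !mxE eqxx (bigD1 (ag k)) //= !mxE !eqxx mulr1 big1 ?addr0 //.
    by move=> i /negbTE ij; rewrite !mxE ij mulr0.
  by rewrite mul1mx.
have iYe k j : intg P (fun o => Y o 0 j * e s k o 0 j).
  by apply: L2_mul; [exact: lY|exact: (fn_L2 (FN sS) k 0 j)].
rewrite (Ex_eq P (g := fun o => n%:R^-1 * \sum_(k <- enum K) \sum_j Y o 0 j * e s k o 0 j)); last first.
  by move=> o; rewrite mB dotpZr dotp_sumr; congr (_ * _); apply: eq_bigr => k _; rewrite /dotp big_ord1.
have i1 k : intg P (fun o => \sum_j Y o 0 j * e s k o 0 j) by apply: intg_sum.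
rewrite ExZ; last by apply: intg_sum => k _; exact: i1.
rewrite Ex_sum => [|k _]; last exact: i1.
rewrite big1 ?mulr0 // => k _; rewrite Ex_sum // big1 // => j _.
exact: (@fn_orth _ _ _ _ _ _ _ _ _ (FN sS) k [::]).
Qed.

Lemma qb_L1 (V : 'rV[R]_m -> R) Vg Cv (X : O -> 'rV[R]_m) : qb Cv V Vg -> 0 <= Cv -> L2m P X -> intg P (fun o => V (X o)).
Proof.
move=> hV C0 hX.
have iX := intg_fnorm2 hX.
apply: (@intg_le _ _ _ _ _ (fun o => (`|V 0| + fnorm (Vg 0) ^+ 2) + (Cv + 1) * fnorm (X o) ^+ 2)).
- apply: (@measurable_continuous_rV R _ O) => [j|]; first exact: (hX 0 j).1.
  exact: qb_continuous hV.
- move=> o; have := hV 0 (X o); rewrite add0r => h.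
  have h2 : `|dotp (Vg 0) (X o)| <= fnorm (Vg 0) * fnorm (X o) by exact: dotp_norm.
  have h3 : `|V (X o)| <= `|V 0| + `|dotp (Vg 0) (X o)| + `|V (X o) - V 0 - dotp (Vg 0) (X o)|.
    apply: le_trans (_ : `|(V 0 + dotp (Vg 0) (X o)) + (V (X o) - V 0 - dotp (Vg 0) (X o))| <= _).
      by rewrite le_eqVlt; apply/orP; left; apply/eqP; congr `|_|; ring.
    by apply: le_trans (ler_normD _ _) _; rewrite lerD2r ler_normD.
  have := sqr_ge0 (fnorm (Vg 0) - fnorm (X o)); have := sqr_ge0 (fnorm (Vg 0)); have := sqr_ge0 (fnorm (X o)).
  rewrite !expr2 in h *; nra.
- by apply: intgD; [exact: intg_cst|exact: intgZ].
Qed.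

Variables (V : 'rV[R]_m -> R) (Vg : 'rV[R]_m -> 'rV[R]_m) (Cv LV kap cb Vinf V0 : R).
Hypotheses (Cv0 : 0 <= Cv) (hV : qb Cv V Vg) (lV : lip LV Vg) (Vlow : forall x, Vinf <= V x).
Hypothesis Vstart : forall o, V (mrow (w 0%N o)) <= V0.
Hypothesis kapC : 24 * Cv <= kap.
Hypothesis Vdesc : forall x b, 3 / 8 * kap * fnorm (meanG G x) ^+ 2 - cb * fnorm b ^+ 2 <= dotp (Vg x) (meanG G x) + dotp (Vg x) b.

(** [Vdesc] gives 3/8 of the descent; a third of it is given up to the curvature
    term 3 Cv |g|^2, which [kapC] bounds by kap |g|^2 / 8. *)
Lemma descent_path s o : V (wb s.+1 o) <= V (wb s o) - kap / 4 * fnorm (meanG G (wb s o)) ^+ 2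
   + (cb + 3 * Cv) * fnorm (bb s o) ^+ 2 - dotp (Vg (wb s o)) (mrow (B s o)) + 3 * Cv * fnorm (mrow (B s o)) ^+ 2.
Proof.
have -> : wb s.+1 o = wb s o - (meanG G (wb s o) + bb s o + mrow (B s o)) by exact: mean_stepE.
set dx := _ + _ + _.
have h1 := hV (wb s o) (- dx); rewrite fnormN dotpNr in h1.
have h1' := le_trans (ler_norm _) h1.
have h2 := Vdesc (wb s o) (bb s o).
have h3 : fnorm dx ^+ 2 <= 3 * (fnorm (meanG G (wb s o)) ^+ 2 + fnorm (bb s o) ^+ 2 + fnorm (mrow (B s o)) ^+ 2).
  have g1 := ler_fnormD (meanG G (wb s o) + bb s o) (mrow (B s o)).
  have g2 := ler_fnormD (meanG G (wb s o)) (bb s o).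
  move: g1 g2; rewrite -/dx; set X := fnorm dx; set a := fnorm (meanG _ _); set b := fnorm (bb _ _); set c := fnorm (mrow _).
  move=> g1 g2; have h : X ^+ 2 <= (a + b + c) ^+ 2.
    by apply: sq_mono; [exact: fnorm_ge0|lra].
  have := sqr_ge0 (a - b); have := sqr_ge0 (b - c); have := sqr_ge0 (a - c); rewrite !expr2 in h *; lra.
have h4 := ler_wpM2l Cv0 h3.
have h5 : dotp (Vg (wb s o)) dx = dotp (Vg (wb s o)) (meanG G (wb s o)) + dotp (Vg (wb s o)) (bb s o) + dotp (Vg (wb s o)) (mrow (B s o)).
  by rewrite /dx !dotpDr.
rewrite h5 in h1'.
have h6 : 24 * Cv * fnorm (meanG G (wb s o)) ^+ 2 <= kap * fnorm (meanG G (wb s o)) ^+ 2 by rewrite ler_wpM2r ?sqr_ge0.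
lra.
Qed.

Theorem descent_sum : kap / 4 * \sum_(s < S) Ex P (fun o => fnorm (meanG G (wb s o)) ^+ 2) <=
  V0 - Vinf + (cb + 3 * Cv) * (\sum_(s < S) Ex P (fun o => fnorm (bb s o) ^+ 2)) + S%:R * (15 * Cv / n%:R * sg ^+ 2).
Proof.
have iV s : (s <= S)%N -> intg P (fun o => V (wb s o)) by move=> sS; apply: qb_L1 hV Cv0 (wb_L2 sS).
apply: (telescoped_descent (v := fun s => Ex P (fun o => V (wb s o)))
  (g := fun s => Ex P (fun o => fnorm (meanG G (wb s o)) ^+ 2)) (b := fun s => Ex P (fun o => fnorm (bb s o) ^+ 2))).
- by rewrite -(Ex_cst P V0); apply: Ex_le; [exact: iV|exact: intg_cst|exact: Vstart].
- by rewrite -(Ex_cst P Vinf); apply: Ex_le; [exact: intg_cst|exact: iV|].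
move=> t tS; have tS' := ltnW tS.
have BL : L2m P (fun o => mrow (B t o)) by apply: L2mZ; apply: L2m_mull; exact: B_L2.
have VgL : L2m P (fun o => Vg (wb t o)) by apply: (L2m_lip lV); exact: wb_L2.
have j2 := intg_fnorm2 (meanG_L2 tS'); have i2 := intgZ (kap / 4) j2.
have j3 := intg_fnorm2 (bb_L2 tS'); have i3 := intgZ (cb + 3 * Cv) j3.
have i4 := intg_dotp VgL BL; have j5 := intg_fnorm2 BL; have i5 := intgZ (3 * Cv) j5.
have orth : Ex P (fun o => dotp (Vg (wb t o)) (mrow (B t o))) = 0.
  apply: mean_orth => //; apply: (pastm_lip lV); apply: pastmZ; apply: pastm_mull; exact: wpast.
have i1 := intgB (intgD (intgB (iV _ tS') i2) i3) i4.
apply: le_trans (Ex_le (iV _ tS) (intgD i1 i5) (descent_path t)) _.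
rewrite (ExD i1 i5) (ExB (intgD (intgB (iV _ tS') i2) i3) i4) (ExD (intgB (iV _ tS') i2) i3) (ExB (iV _ tS') i2).
rewrite orth (ExZ _ j2) (ExZ _ j3) (ExZ _ j5) subr0 lerD2l.
have -> : 15 * Cv / n%:R * sg ^+ 2 = 3 * Cv * (5 / n%:R * sg ^+ 2) by ring.
by rewrite ler_wpM2l ?mulr_ge0 //; exact: Bmean_var.
Qed.

End Process.

(** * The joint state of one agent *)

Section Sandwich.
Context {R : realType}.

(** A field of the joint state is a field of part of it between two constant
    matrices, and its regularity is read off the middle factor. *)
Lemma lip_sandwich m1 m2 k1 k2 (L c : R) (G : 'rV[R]_m2 -> 'rV[R]_k1) (A : 'M[R]_(m1, m2)) (F : 'M[R]_(k1, k2)) :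
  lip L G -> (forall v : 'rV[R]_m1, fnorm (v *m A) <= fnorm v) ->
  (forall u : 'rV[R]_k1, fnorm (u *m F) <= c * fnorm u) -> 0 <= L -> 0 <= c ->
  lip (c * L) (fun w => G (w *m A) *m F).
Proof.
move=> hG hA hF L0 c0 w w'; rewrite -mulmxBl; apply: le_trans (hF _) _.
rewrite -mulrA ler_wpM2l //; apply: le_trans (hG _ _) _; rewrite -mulmxBl ler_wpM2l //.
Qed.

Lemma taylor_sandwich m1 m2 k1 k2 (C c : R) (G : 'rV[R]_m2 -> 'rV[R]_k1) J (A : 'M[R]_(m1, m2)) (F : 'M[R]_(k1, k2)) :
  taylor C G J -> (forall v : 'rV[R]_m1, fnorm (v *m A) <= fnorm v) ->
  (forall u : 'rV[R]_k1, fnorm (u *m F) <= c * fnorm u) -> 0 <= C -> 0 <= c ->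
  taylor (c * C) (fun w => G (w *m A) *m F) (fun w => A *m J (w *m A) *m F).
Proof.
move=> hG hA hF C0 c0 w v; rewrite !mulmxA -mulmxBl -mulmxBl; apply: le_trans (hF _) _.
rewrite -mulrA ler_wpM2l // mulmxDl; apply: le_trans (hG _ _) _.
by rewrite ler_wpM2l // ler_pXn2r ?nnegrE.
Qed.

Lemma lipD m k (L L' : R) (G G' : 'rV[R]_m -> 'rV[R]_k) : lip L G -> lip L' G' -> lip (L + L') (fun w => G w + G' w).
Proof.
by move=> h h' w w'; rewrite opprD addrACA mulrDl; apply: le_trans (ler_fnormD _ _) (lerD (h _ _) (h' _ _)).
Qed.

Lemma taylorD m k (C C' : R) (G G' : 'rV[R]_m -> 'rV[R]_k) J J' : taylor C G J -> taylor C' G' J' ->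
  taylor (C + C') (fun w => G w + G' w) (fun w => J w + J' w).
Proof.
move=> h h' w v; rewrite mulmxDr mulrDl; apply: le_trans (lerD (h w v) (h' w v)).
apply: le_trans (ler_fnormD _ _); rewrite le_eqVlt; apply/orP; left; apply/eqP; congr fnorm.
by rewrite !opprD !addrA; congr (_ - _); rewrite addrAC; congr (_ + _); rewrite -!addrA; congr (_ + _);
  rewrite addrC -!addrA; congr (_ + _); rewrite addrC.
Qed.

Lemma qb_sandwich m1 m2 (C : R) (h : 'rV[R]_m2 -> R) G (A : 'M[R]_(m1, m2)) :
  qb C h G -> (forall v : 'rV[R]_m1, fnorm (v *m A) <= fnorm v) -> 0 <= C ->
  qb C (fun w => h (w *m A)) (fun w => G (w *m A) *m A^T).
Proof.
move=> hq hA C0 w v; rewrite dotp_mulmxl trmxK mulmxDl; apply: le_trans (hq _ _) _.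
by rewrite ler_wpM2l // ler_pXn2r ?nnegrE.
Qed.

Lemma qbD m (C C' : R) (h h' : 'rV[R]_m -> R) G G' : qb C h G -> qb C' h' G' ->
  qb (C + C') (fun w => h w + h' w) (fun w => G w + G' w).
Proof.
move=> H H' w v; rewrite dotpDl mulrDl; apply: le_trans (lerD (H w v) (H' w v)).
apply: le_trans (ler_normD _ _); rewrite le_eqVlt; apply/orP; left; apply/eqP; congr `|_|; ring.
Qed.

Lemma qbZ m (C a : R) (h : 'rV[R]_m -> R) G : qb C h G -> qb (`|a| * C) (fun w => a * h w) (fun w => a *: G w).
Proof.
by move=> H w v; rewrite dotpZl -!mulrBr normrM -mulrA ler_wpM2l.
Qed.

Lemma lipZ m k (L a : R) (G : 'rV[R]_m -> 'rV[R]_k) : lip L G -> lip (`|a| * L) (fun w => a *: G w).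
Proof. by move=> h w w'; rewrite -scalerBr fnormZ -mulrA ler_wpM2l. Qed.

Lemma sandwich_continuous m1 m2 k1 k2 (L : R) (J : 'rV[R]_m2 -> 'M[R]_(m2, k1)) (A : 'M[R]_(m1, m2)) (F : 'M[R]_(k1, k2)) i j :
  (forall w w', fnorm (J w - J w') <= L * fnorm (w - w')) ->
  continuous (fun w : 'rV[R]_m1 => (A *m J (w *m A) *m F) i j).
Proof.
move=> hJ; have [L0|L0] := leP 0 L; last first.
  have e w w' : J w = J w'.
    apply/eqP; rewrite -subr_eq0; apply/eqP; apply: fnorm_eq0; apply/eqP; rewrite eq_le fnorm_ge0 andbT.
    by apply: le_trans (hJ w w') _; rewrite mulr_le0_ge0 // ltW.
  by rewrite (_ : (fun w => _) = fun=> (A *m J 0 *m F) i j); [exact: cst_continuous|apply/funext => w; rewrite (e _ 0)].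
apply: (@lip_continuous _ _ _ (fnorm A * (L * fnorm A) * fnorm F)) => w w'.
have -> : (A *m J (w *m A) *m F) i j - (A *m J (w' *m A) *m F) i j = (A *m (J (w *m A) - J (w' *m A)) *m F) i j.
  by rewrite mulmxBr mulmxBl [in RHS]mxE [X in _ = _ + X]mxE.
apply: le_trans (entry_le_fnorm _ _ _) _; apply: le_trans (fnorm_mulmx _ _) _.
rewrite mulrAC ler_wpM2r //; apply: le_trans (fnorm_mulmx _ _) _.
rewrite -!mulrA ler_wpM2l //; apply: le_trans (hJ _ _) _; rewrite ler_wpM2l //.
by rewrite -mulmxBl mulrC; exact: fnorm_mulmx.
Qed.

End Sandwich.

Section StateSpace.
Context {R : realType} {p q : nat}.

(** The joint state is (x, (y, z)). These select (x, y), (x, z) and x, and [spread]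
    places the multiples c1 u_x, c2 u_y, c3 u_y of the parts of a gradient u. *)
Definition selY : 'M[R]_(p + (q + q), p + q) := block_mx 1%:M 0 0 (col_mx 1%:M 0).
Definition selZ : 'M[R]_(p + (q + q), p + q) := block_mx 1%:M 0 0 (col_mx 0 1%:M).
Definition selX : 'M[R]_(p + (q + q), p) := col_mx 1%:M 0.
Definition spread (c1 c2 c3 : R) : 'M[R]_(p + q, p + (q + q)) := block_mx c1%:M 0 0 (row_mx c2%:M c3%:M).

Implicit Types (x : 'rV[R]_p) (y z : 'rV[R]_q).

Definition st3 x y z : 'rV[R]_(p + (q + q)) := row_mx x (row_mx y z).

Lemma st3_selY x y z : st3 x y z *m selY = row_mx x y.
Proof. by rewrite /st3 /selY mul_row_block !mulmx0 !mulmx1 add0r addr0 mul_row_col mulmx1 mulmx0 addr0. Qed.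
Lemma st3_selZ x y z : st3 x y z *m selZ = row_mx x z.
Proof. by rewrite /st3 /selZ mul_row_block !mulmx0 !mulmx1 add0r addr0 mul_row_col mulmx1 mulmx0 add0r. Qed.
Lemma st3_selX x y z : st3 x y z *m selX = x.
Proof. by rewrite /st3 /selX mul_row_col mulmx1 mulmx0 addr0. Qed.
Lemma mul_spread c1 c2 c3 x y : row_mx x y *m spread c1 c2 c3 = st3 (c1 *: x) (c2 *: y) (c3 *: y).
Proof.
by rewrite /spread mul_row_block !mulmx0 add0r addr0 mul_mx_row !mul_mx_scalar.
Qed.
Lemma mul_spreadE c1 c2 c3 (u : 'rV[R]_(p + q)) :
  u *m spread c1 c2 c3 = st3 (c1 *: lsubmx u) (c2 *: rsubmx u) (c3 *: rsubmx u).
Proof. by rewrite -{1}(hsubmxK u) mul_spread. Qed.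
Lemma selYT : selY^T = spread 1 1 0.
Proof. by rewrite /selY /spread tr_block_mx tr_col_mx !trmx0 !trmx1 [0%:M]raddf0. Qed.
Lemma selZT : selZ^T = spread 1 0 1.
Proof. by rewrite /selZ /spread tr_block_mx tr_col_mx !trmx0 !trmx1 [0%:M]raddf0. Qed.
Lemma mul_selXT x : x *m selX^T = st3 x 0 0.
Proof. by rewrite /selX tr_col_mx trmx0 trmx1 mul_mx_row mulmx1 mulmx0 /st3 row_mx0. Qed.

Lemma st3P (w : 'rV[R]_(p + (q + q))) : w = st3 (lsubmx w) (lsubmx (rsubmx w)) (rsubmx (rsubmx w)).
Proof. by rewrite /st3 !hsubmxK. Qed.

Lemma fnorm_st3 x y z : fnorm (st3 x y z) ^+ 2 = fnorm x ^+ 2 + fnorm y ^+ 2 + fnorm z ^+ 2.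
Proof. by rewrite /st3 !fnorm_row_mx addrA. Qed.
Lemma dotp_st3 x y z x' y' z' : dotp (st3 x y z) (st3 x' y' z') = dotp x x' + dotp y y' + dotp z z'.
Proof. by rewrite /st3 !dotp_row_mx addrA. Qed.
Lemma st3D x y z x' y' z' : st3 x y z + st3 x' y' z' = st3 (x + x') (y + y') (z + z').
Proof. by rewrite /st3 !add_row_mx. Qed.
Lemma st3Z c x y z : c *: st3 x y z = st3 (c *: x) (c *: y) (c *: z).
Proof. by rewrite /st3 !scale_row_mx. Qed.

Lemma selY_norm (w : 'rV[R]_(p + (q + q))) : fnorm (w *m selY) <= fnorm w.
Proof.
rewrite (st3P w) st3_selY; apply: fnorm_sq_le => //; rewrite fnorm_st3 fnorm_row_mx lerDl sqr_ge0 //.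
Qed.
Lemma selZ_norm (w : 'rV[R]_(p + (q + q))) : fnorm (w *m selZ) <= fnorm w.
Proof.
rewrite (st3P w) st3_selZ; apply: fnorm_sq_le => //; rewrite fnorm_st3 fnorm_row_mx lerD2r lerDl sqr_ge0 //.
Qed.
Lemma selX_norm (w : 'rV[R]_(p + (q + q))) : fnorm (w *m selX) <= fnorm w.
Proof.
rewrite (st3P w) st3_selX; apply: fnorm_sq_le => //; rewrite fnorm_st3 -addrA lerDl addr_ge0 ?sqr_ge0 //.
Qed.
Lemma spread_norm c c1 c2 c3 (u : 'rV[R]_(p + q)) : 0 <= c -> c1 ^+ 2 <= c ^+ 2 -> c2 ^+ 2 + c3 ^+ 2 <= c ^+ 2 ->
  fnorm (u *m spread c1 c2 c3) <= c * fnorm u.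
Proof.
move=> c0 h1 h2; rewrite -(hsubmxK u) mul_spread; apply: fnorm_sq_le; first by rewrite mulr_ge0.
rewrite fnorm_st3 !fnormZ !exprMn fnorm_row_mx !real_normK ?num_real // mulrDr -addrA -mulrDl.
by apply: lerD; rewrite ler_wpM2r ?sqr_ge0.
Qed.

Section Directions.
Variables (n : nat) (Gf Gg : 'I_n -> 'rV[R]_(p + q) -> 'rV[R]_(p + q)) (Jf Jg : 'I_n -> 'rV[R]_(p + q) -> 'M[R]_(p + q)).
Variables (L L2 LJ B a ex ey ez : R).
Hypotheses (L0 : 0 <= L) (L20 : 0 <= L2) (B0 : 0 <= B).
Hypotheses (lf : forall i, lip L (Gf i)) (lg : forall i, lip L (Gg i)).
Hypotheses (tf : forall i, taylor L2 (Gf i) (Jf i)) (tg : forall i, taylor L2 (Gg i) (Jg i)).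
Hypotheses (cf : forall i w w', fnorm (Jf i w - Jf i w') <= LJ * fnorm (w - w'))
  (cg : forall i w w', fnorm (Jg i w - Jg i w') <= LJ * fnorm (w - w')).
Hypotheses (ex0 : 0 <= ex) (ey0 : 0 <= ey) (ez0 : 0 <= ez) (a0 : 0 <= a).
Hypotheses (exB : ex <= 4 * B) (eyB : ey <= 4 * B) (ezB : ez <= 4 * B) (axB : a * ex <= 4 * B) (ayB : a * ey <= 4 * B).

(** The scaled direction of one agent. Scaling by the step sizes gives its three
    blocks one common recursion, and one common order of magnitude B. *)
Definition Gst i w := Gf i (w *m selY) *m spread ex ey 0 + Gg i (w *m selY) *m spread (a * ex) (a * ey) 0
   + Gg i (w *m selZ) *m spread (- (a * ex)) 0 ez.
Definition Jst i w := selY *m Jf i (w *m selY) *m spread ex ey 0 + selY *m Jg i (w *m selY) *m spread (a * ex) (a * ey) 0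
   + selZ *m Jg i (w *m selZ) *m spread (- (a * ex)) 0 ez.

Let B4 : 0 <= 4 * B. Proof. by rewrite mulr_ge0. Qed.
Let sq c : 0 <= c -> c <= 4 * B -> c ^+ 2 <= (4 * B) ^+ 2.
Proof. by move=> c0 h; rewrite ler_pXn2r ?nnegrE. Qed.
Let n1 (u : 'rV[R]_(p + q)) : fnorm (u *m spread ex ey 0) <= 4 * B * fnorm u.
Proof. by apply: spread_norm => //; rewrite ?expr0n ?addr0; exact: sq. Qed.
Let n2 (u : 'rV[R]_(p + q)) : fnorm (u *m spread (a * ex) (a * ey) 0) <= 4 * B * fnorm u.
Proof. by apply: spread_norm => //; rewrite ?expr0n ?addr0; apply: sq => //; rewrite mulr_ge0. Qed.
Let n3 (u : 'rV[R]_(p + q)) : fnorm (u *m spread (- (a * ex)) 0 ez) <= 4 * B * fnorm u.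
Proof. by apply: spread_norm => //; rewrite ?sqrrN ?expr0n ?add0r; apply: sq => //; rewrite mulr_ge0. Qed.

Lemma Gst_lip i : lip (12 * B * L) (Gst i).
Proof.
have -> : 12 * B * L = 4 * B * L + 4 * B * L + 4 * B * L by ring.
by apply: lipD; [apply: lipD|]; [exact: lip_sandwich (lf i) selY_norm n1 L0 B4|exact: lip_sandwich (lg i) selY_norm n2 L0 B4|exact: lip_sandwich (lg i) selZ_norm n3 L0 B4].
Qed.
Lemma Gst_taylor i : taylor (12 * B * L2) (Gst i) (Jst i).
Proof.
have -> : 12 * B * L2 = 4 * B * L2 + 4 * B * L2 + 4 * B * L2 by ring.
by apply: taylorD; [apply: taylorD|]; [exact: taylor_sandwich (@tf i) selY_norm n1 L20 B4|exact: taylor_sandwich (@tg i) selY_norm n2 L20 B4|exact: taylor_sandwich (@tg i) selZ_norm n3 L20 B4].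
Qed.
Lemma Jst_continuous i k l : continuous (fun w => Jst i w k l).
Proof.
have c1 := @sandwich_continuous R _ _ _ _ LJ (Jf i) selY (spread ex ey 0) k l (@cf i).
have c2 := @sandwich_continuous R _ _ _ _ LJ (Jg i) selY (spread (a * ex) (a * ey) 0) k l (@cg i).
have c3 := @sandwich_continuous R _ _ _ _ LJ (Jg i) selZ (spread (- (a * ex)) 0 ez) k l (@cg i).
move=> w; rewrite (_ : (fun w => Jst i w k l) = (fun w => (selY *m Jf i (w *m selY) *m spread ex ey 0) k l
   + (selY *m Jg i (w *m selY) *m spread (a * ex) (a * ey) 0) k l + (selZ *m Jg i (w *m selZ) *m spread (- (a * ex)) 0 ez) k l)); last first.
  by apply/funext => v; rewrite /Jst mxE [in LHS]mxE.
exact: (cvgD (cvgD (c1 w) (c2 w)) (c3 w)).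
Qed.

Lemma Gst_st3 i x y z : Gst i (st3 x y z) =
  st3 (ex *: (px (Gf i) x y + a *: (px (Gg i) x y - px (Gg i) x z)))
      (ey *: (py (Gf i) x y + a *: py (Gg i) x y)) (ez *: py (Gg i) x z).
Proof.
rewrite /Gst !st3_selY st3_selZ /px /py.
rewrite !mul_spreadE !st3D !scale0r !addr0 !add0r; congr st3.
  by rewrite scalerDr scalerA mulrC scalerBr addrA scaleNr.
by rewrite scalerDr scalerA mulrC.
Qed.

End Directions.
End StateSpace.

(** * A potential for the three blocks *)

Section Potential.
Context {R : realType} {p q : nat}.
Variables (f g : 'rV[R]_p -> 'rV[R]_q -> R) (Gf Gg : 'rV[R]_(p + q) -> 'rV[R]_(p + q)) (L mu : R).
Hypotheses (L1 : 1 <= L) (mu0 : 0 < mu).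
Hypotheses (qf : qb L (joint f) Gf) (qg : qb L (joint g) Gg) (lf : lip L Gf) (lg : lip L Gg)
  (sc : forall x, strongly_convex mu (g x)).
Variable a : R.
Hypotheses (a1 : 1 <= a) (ha : 4 * L / mu <= a).

Let L0 : 0 <= L. Proof. exact: le_trans L1. Qed.
Let a0 : 0 < a. Proof. exact: lt_le_trans a1. Qed.
Let m2 : 0 < mu / 2. Proof. exact: mu2. Qed.
Let gF : forall x y y', g x y + dotp (py Gg x y) (y' - y) + mu / 2 * fnorm (y' - y) ^+ 2 <= g x y'.
Proof. by move=> x y y'; exact: (g_first qg sc). Qed.
Let pF : forall x y y', pen f g a x y + dotp (py (Gpen Gf Gg a) x y) (y' - y) + a * mu / 4 * fnorm (y' - y) ^+ 2 <= pen f g a x y'.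
Proof. by move=> x y y'; apply: (pen_first L1 mu0 qf qg sc x y y' ha). Qed.
Let pQ : qb (2 * a * L) (joint (pen f g a)) (Gpen Gf Gg a). Proof. exact: pen_qb. Qed.
Let pL : lip (2 * a * L) (Gpen Gf Gg a). Proof. exact: pen_lip. Qed.
Let m4 : 0 < a * mu / 4. Proof. exact: am4. Qed.

Definition gstar x := g x (zs g x).
Definition Ggstar x := px Gg x (zs g x).

(** f + a g at (x, y), plus a g at (x, z), minus 2 a min g(x, _). It exceeds the
    penalized value by the two lower-level gaps, that of z being weighted by a. *)
Definition pot (w : 'rV[R]_(p + (q + q))) : R :=
  joint (pen f g a) (w *m selY) + a * joint g (w *m selZ) + - (2 * a) * gstar (w *m selX).
Definition Gpot (w : 'rV[R]_(p + (q + q))) : 'rV[R]_(p + (q + q)) :=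
  Gpen Gf Gg a (w *m selY) *m selY^T + a *: (Gg (w *m selZ) *m selZ^T) + - (2 * a) *: (Ggstar (w *m selX) *m selX^T).

Lemma gstar_qb : qb (L + L ^+ 2 / mu) gstar Ggstar.
Proof.
have h := value_qb m2 L0 qg lg gF.
by have -> : L + L ^+ 2 / mu = L + L ^+ 2 / (2 * (mu / 2)) by congr (_ + _ / _); field.
Qed.

Lemma zs_lip x x' : fnorm (zs g x - zs g x') <= L / mu * fnorm (x - x').
Proof.
have := psol_lip m2 L0 qg lg gF x x'; rewrite mulrC mulrA => h.
by rewrite mulrAC ler_pdivlMr // (le_trans _ h) // le_eqVlt; apply/orP; left; apply/eqP; field.
Qed.

Lemma Ggstar_lip : lip (L * (1 + L / mu)) Ggstar.
Proof.
move=> x x'; apply: le_trans (lip_px _ _ _ _ lg L0) _; rewrite -mulrA ler_wpM2l //.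
by rewrite mulrDl mul1r lerD2l zs_lip.
Qed.

Lemma pot_qb : qb (a * (5 * L + 2 * L ^+ 2 / mu)) pot Gpot.
Proof.
have e : a * (5 * L + 2 * L ^+ 2 / mu) = 2 * a * L + `|a| * L + `|- (2 * a)| * (L + L ^+ 2 / mu).
  by rewrite normrN (ger0_norm (ltW a0)) ger0_norm ?mulr_ge0 ?(ltW a0) //; ring.
rewrite e; apply: qbD; first apply: qbD.
- by apply: qb_sandwich => //; [exact: selY_norm|rewrite !mulr_ge0 // ltW].
- by apply: qbZ; apply: qb_sandwich => //; exact: selZ_norm.
- apply: qbZ; apply: (qb_sandwich gstar_qb); first exact: selX_norm.
  by rewrite addr_ge0 // divr_ge0 ?sqr_ge0 // ltW.
Qed.

Lemma selYT_norm (u : 'rV[R]_(p + q)) : fnorm (u *m selY^T) <= 1 * fnorm u.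
Proof. by rewrite selYT; apply: spread_norm => //; rewrite !expr1n ?expr0n ?addr0. Qed.
Lemma selZT_norm (u : 'rV[R]_(p + q)) : fnorm (u *m selZ^T) <= 1 * fnorm u.
Proof. by rewrite selZT; apply: spread_norm => //; rewrite !expr1n ?expr0n ?add0r. Qed.
Lemma selXT_norm (x : 'rV[R]_p) : fnorm (x *m (selX : 'M[R]_(p + (q + q), p))^T) <= 1 * fnorm x.
Proof. by rewrite mul_selXT mul1r /st3 row_mx0 fnorm_row_mxl0. Qed.

(** A crude constant: it serves integrability, while the rates rest on [pot_qb]. *)
Lemma Gpot_lip : exists LV, lip LV Gpot.
Proof.
exists (1 * (2 * a * L) + `|a| * (1 * L) + `|- (2 * a)| * (1 * (L * (1 + L / mu)))).
have q1 : 0 <= L * (1 + L / mu) by rewrite mulr_ge0 // addr_ge0 // divr_ge0 // ltW.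
have q2 : 0 <= 2 * a * L by rewrite !mulr_ge0 // ltW.
apply: lipD; first apply: lipD.
- exact: (lip_sandwich pL selY_norm selYT_norm q2 ler01).
- by apply: lipZ; exact: (lip_sandwich lg selZ_norm selZT_norm L0 ler01).
- by apply: lipZ; exact: (lip_sandwich Ggstar_lip selX_norm selXT_norm q1 ler01).
Qed.

(** The x-direction that the algorithm follows, and its difference with the
    x-gradient of the potential, which vanishes when z solves the lower level. *)
Definition dhat x y z := px (Gpen Gf Gg a) x y - a *: px Gg x z.
Definition qgap x z := (2 * a) *: (px Gg x z - px Gg x (zs g x)).

Lemma Gpot_st3 x y z : Gpot (st3 x y z) = st3 (dhat x y z + qgap x z) (py (Gpen Gf Gg a) x y) (a *: py Gg x z).
Proof.
rewrite /Gpot st3_selY st3_selZ st3_selX mul_selXT selYT selZT !mul_spreadE !st3Z !st3D.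
rewrite !scale0r !scale1r !scaler0 !addr0 add0r; congr st3.
have alg (A B C : 'rV[R]_p) : A + a *: B + - (2 * a) *: C = A - a *: B + (2 * a) *: (B - C).
  by apply/rowP => j; rewrite !mxE; ring.
exact: alg.
Qed.

Lemma pot_st3 x y z : pot (st3 x y z) = Phia f g a x + (pen f g a x y - pen f g a x (ya f g a x))
   + a * (g x z - g x (zs g x)).
Proof.
rewrite /pot st3_selY st3_selZ st3_selX !joint_row_mx /Phia /gstar; ring.
Qed.

Lemma pot_lower x y z : Phia f g a x <= pot (st3 x y z).
Proof.
rewrite pot_st3 -addrA lerDl addr_ge0 //.
  by rewrite subr_ge0; exact: (psol_min m4 pQ pF x y).
by rewrite mulr_ge0 ?(ltW a0) // subr_ge0; exact: (psol_min m2 qg gF x z).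
Qed.

Lemma pot_upper x y z : pot (st3 x y z) <= Phia f g a x
  + 2 * a * L * fnorm (y - ya f g a x) ^+ 2 + a * L * fnorm (z - zs g x) ^+ 2.
Proof.
rewrite pot_st3; apply: lerD; first rewrite lerD2l lerBlDl.
  by have := psol_upper m4 pQ pF x y.
rewrite -mulrA ler_pM2l // lerBlDl; exact: (psol_upper m2 qg gF x z).
Qed.

Variables (ex ey ez kap cb : R).
Hypotheses (ex0 : 0 < ex) (ey0 : 0 < ey) (ez0 : 0 < ez).
Hypotheses (kx : kap * ex <= 1) (ky : kap * ey <= 1) (kz : kap * ez <= a).
Hypotheses (cx : 2 / ex <= cb) (cy : 1 / ey <= cb) (cz : 2 * a / ez <= cb).
Hypothesis xz : 16 * a * L ^+ 2 * ex <= mu ^+ 2 * ez.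

Definition mdir (w : 'rV[R]_(p + (q + q))) : 'rV[R]_(p + (q + q)) :=
  let x := lsubmx w in let y := lsubmx (rsubmx w) in let z := rsubmx (rsubmx w) in
  st3 (ex *: dhat x y z) (ey *: py (Gpen Gf Gg a) x y) (ez *: py Gg x z).

Lemma qgap_norm x z : fnorm (qgap x z) <= 2 * a * L / mu * fnorm (py Gg x z).
Proof.
rewrite /qgap fnormZ ger0_norm ?mulr_ge0 ?(ltW a0) //.
have h1 := lip_px x z x (zs g x) lg L0; rewrite subrr fnorm0 add0r in h1.
have h2 := psol_dist m2 qg gF x z.
have h3 : fnorm (z - zs g x) <= fnorm (py Gg x z) / mu.
  rewrite ler_pdivlMr // mulrC; apply: le_trans h2.
  by rewrite le_eqVlt; apply/orP; left; apply/eqP; congr (_ * _); field.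
have -> : 2 * a * L / mu * fnorm (py Gg x z) = 2 * a * (L * (fnorm (py Gg x z) / mu)) by ring.
rewrite ler_wpM2l ?mulr_ge0 ?(ltW a0) //; apply: le_trans h1 _; rewrite ler_wpM2l //.
Qed.

Lemma young (c u v : R) : 0 < c -> u * v <= c * u ^+ 2 / 4 + v ^+ 2 / c.
Proof.
move=> c0; rewrite -subr_ge0.
have -> : c * u ^+ 2 / 4 + v ^+ 2 / c - u * v = (c * u / 2 - v) ^+ 2 / c by field; rewrite gt_eqF.
by rewrite divr_ge0 ?sqr_ge0 // ltW.
Qed.

(** The y- and z-parts of the direction are multiples of the partial gradients of
    the potential. The x-part is off by [qgap], which is bounded by grad_y g at
    (x, z); hypothesis [xz], that ex is small against ez / a, lets the z-part pay
    for it. *)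
Lemma pot_descent w b : 3 / 8 * kap * fnorm (mdir w) ^+ 2 - cb * fnorm b ^+ 2 <=
  dotp (Gpot w) (mdir w) + dotp (Gpot w) b.
Proof.
rewrite (st3P b); set bx := lsubmx b; set by' := lsubmx (rsubmx b); set bz := rsubmx (rsubmx b).
rewrite /mdir [in Gpot _](st3P w); set x := lsubmx w; set y := lsubmx (rsubmx w); set z := rsubmx (rsubmx w).
rewrite Gpot_st3 !dotp_st3 !fnorm_st3 !fnormZ !exprMn !real_normK ?num_real //.
set dh := dhat x y z; set qq := qgap x z; set hy := py _ x y; set hz := py _ x z.
rewrite !dotpZr !dotpZl !(dotpDl dh) -!fnorm_sq.
have hq2 : ex * fnorm qq ^+ 2 <= a * ez / 4 * fnorm hz ^+ 2.
  have h1 : fnorm qq ^+ 2 <= (2 * a * L / mu * fnorm hz) ^+ 2.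
    have r0 : 0 <= 2 * a * L / mu * fnorm hz.
      by apply: mulr_ge0 => //; apply: divr_ge0; [rewrite !mulr_ge0 // ltW|exact: ltW].
    by rewrite ler_pXn2r ?nnegrE //; exact: qgap_norm.
  apply: le_trans (ler_wpM2l (ltW ex0) h1) _.
  have -> : ex * (2 * a * L / mu * fnorm hz) ^+ 2 = (16 * a * L ^+ 2 * ex) * (a / mu ^+ 2 / 4 * fnorm hz ^+ 2).
    by field; rewrite gt_eqF.
  apply: le_trans (_ : (mu ^+ 2 * ez) * (a / mu ^+ 2 / 4 * fnorm hz ^+ 2) <= _).
    by rewrite ler_wpM2r // mulr_ge0 ?sqr_ge0 // !divr_ge0 ?(ltW a0) ?sqr_ge0.
  by rewrite le_eqVlt; apply/orP; left; apply/eqP; field; rewrite gt_eqF.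
have n1 := dotp_le (- qq) dh; have n2 := dotp_le (- dh) bx; have n3 := dotp_le (- qq) bx.
have n4 := dotp_le (- hy) by'; have n5 := dotp_le (- hz) bz.
rewrite !dotpNl !fnormN in n1 n2 n3 n4 n5.
have y1 := young (fnorm dh) (fnorm qq) ltr01; rewrite mul1r divr1 in y1.
have y2 := young (fnorm dh) (fnorm bx) ex0; have y3 := young (fnorm qq) (fnorm bx) ex0.
have y4 := young (fnorm hy) (fnorm by') ey0.
have y5 : a * (fnorm hz * fnorm bz) <= a * ez / 8 * fnorm hz ^+ 2 + 2 * a / ez * fnorm bz ^+ 2.
  have e0 : 0 < ez / 2 by rewrite divr_gt0.
  apply: le_trans (ler_wpM2l (ltW a0) (young (fnorm hz) (fnorm bz) e0)) _.
  by rewrite le_eqVlt; apply/orP; left; apply/eqP; field; rewrite gt_eqF.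
have c1 : 2 / ex * fnorm bx ^+ 2 <= cb * fnorm bx ^+ 2 by rewrite ler_wpM2r ?sqr_ge0.
have c2 : 1 / ey * fnorm by' ^+ 2 <= cb * fnorm by' ^+ 2 by rewrite ler_wpM2r ?sqr_ge0.
have c3 : 2 * a / ez * fnorm bz ^+ 2 <= cb * fnorm bz ^+ 2 by rewrite ler_wpM2r ?sqr_ge0.
have k1 : kap * ex * (ex * fnorm dh ^+ 2) <= 1 * (ex * fnorm dh ^+ 2).
  by rewrite ler_wpM2r // mulr_ge0 ?sqr_ge0 // ltW.
have k2 : kap * ey * (ey * fnorm hy ^+ 2) <= 1 * (ey * fnorm hy ^+ 2).
  by rewrite ler_wpM2r // mulr_ge0 ?sqr_ge0 // ltW.
have k3 : kap * ez * (ez * fnorm hz ^+ 2) <= a * (ez * fnorm hz ^+ 2).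
  by rewrite ler_wpM2r // mulr_ge0 ?sqr_ge0 // ltW.
have x1 := ler_wpM2l (ltW ex0) n1; have x1' := ler_wpM2l (ltW ex0) y1.
have x5 := ler_wpM2l (ltW a0) n5.
have p1 : 0 <= ex * fnorm dh ^+ 2 by rewrite mulr_ge0 ?sqr_ge0 // ltW.
have p2 : 0 <= ey * fnorm hy ^+ 2 by rewrite mulr_ge0 ?sqr_ge0 // ltW.
have p3 : 0 <= a * ez * fnorm hz ^+ 2 by rewrite mulr_ge0 ?sqr_ge0 // mulr_ge0 // ltW.
have e1 : ex * (fnorm qq * fnorm dh) = ex * (fnorm dh * fnorm qq) by rewrite [fnorm qq * _]mulrC.
rewrite e1 in x1.
have ex1 : fnorm bx ^+ 2 / ex = (2 / ex * fnorm bx ^+ 2) / 2 by field; rewrite gt_eqF.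
have ey1 : fnorm by' ^+ 2 / ey = 1 / ey * fnorm by' ^+ 2 by ring.
rewrite ex1 in y2 y3; rewrite ey1 in y4.
move: c1 c2 c3 y2 y3 y4 y5; set u1 := 2 / ex * _; set u2 := 1 / ey * _; set u3 := 2 * a / ez * _.
move: k1 k2 k3 x1 x1' x5 p1 p2 p3 hq2 n1 n2 n3 n4 n5.
set d1 := fnorm dh; set d2 := fnorm qq; set d3 := fnorm hy; set d4 := fnorm hz.
rewrite !expr2 => k1 k2 k3 x1 x1' x5 p1 p2 p3 hq2 n1 n2 n3 n4 n5 c1 c2 c3 y2 y3 y4 y5.
clear - k1 k2 k3 x1 x1' x5 p1 p2 p3 hq2 n1 n2 n3 n4 n5 c1 c2 c3 y2 y3 y4 y5.
lra.
Qed.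

(** The direction bounds the distances of y and z to their targets, hence the error
    of [dhat] as an estimate of the gradient of the penalized value. *)
Lemma Ga_le_mdir w : fnorm (Ga f g Gf Gg a (lsubmx w)) <= cb * (1 + 5 * L / mu) * fnorm (mdir w).
Proof.
set x := lsubmx w; set y := lsubmx (rsubmx w); set z := rsubmx (rsubmx w).
have sq3 := fnorm_st3 (ex *: dhat x y z) (ey *: py (Gpen Gf Gg a) x y) (ez *: py Gg x z).
have M0 := fnorm_ge0 (mdir w).
have h1 : ex * fnorm (dhat x y z) <= fnorm (mdir w).
  rewrite -[X in X * _](ger0_norm (ltW ex0)) -fnormZ; apply: fnorm_sq_le => //.
  by rewrite sq3 -addrA lerDl addr_ge0 ?sqr_ge0.
have h2 : ey * fnorm (py (Gpen Gf Gg a) x y) <= fnorm (mdir w).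
  rewrite -[X in X * _](ger0_norm (ltW ey0)) -fnormZ; apply: fnorm_sq_le => //.
  by rewrite sq3 addrAC lerDr addr_ge0 ?sqr_ge0.
have h3 : ez * fnorm (py Gg x z) <= fnorm (mdir w).
  rewrite -[X in X * _](ger0_norm (ltW ez0)) -fnormZ; apply: fnorm_sq_le => //.
  by rewrite sq3 lerDr addr_ge0 ?sqr_ge0.
have cb0 : 0 <= cb by apply: le_trans cx; rewrite divr_ge0 // ltW.
have g1 : fnorm (dhat x y z) <= cb * fnorm (mdir w).
  apply: le_trans (_ : 1 / ex * fnorm (mdir w) <= _); first by rewrite mul1r ler_pdivlMl.
  rewrite ler_wpM2r //; apply: le_trans cx; rewrite ler_wpM2r ?invr_ge0 ?(ltW ex0) // ler1n //.
have g2 : fnorm (py (Gpen Gf Gg a) x y) <= cb * fnorm (mdir w).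
  apply: le_trans (_ : 1 / ey * fnorm (mdir w) <= _); first by rewrite mul1r ler_pdivlMl.
  by rewrite ler_wpM2r.
have g3 : 2 * a * fnorm (py Gg x z) <= cb * fnorm (mdir w).
  apply: le_trans (_ : 2 * a / ez * fnorm (mdir w) <= _); last by rewrite ler_wpM2r.
  by rewrite -[leRHS]mulrA ler_pM2l ?mulr_gt0 // ler_pdivlMl.
have r1 := py_strong pF x y (ya f g a x).
have r1' : py (Gpen Gf Gg a) x (ya f g a x) = 0 by exact: (psol_stat m4 pQ pF x).
rewrite r1' subr0 in r1.
have r2 := psol_dist m2 qg gF x z.
have cl := Ga_close f g L1 lf lg a1 x y z.
have t1 : 2 * a * L * fnorm (y - ya f g a x) <= 4 * L / mu * fnorm (py (Gpen Gf Gg a) x y).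
  have -> : 2 * a * L * fnorm (y - ya f g a x) = 4 * L / mu * (2 * (a * mu / 4) * fnorm (y - ya f g a x)).
    by field; rewrite gt_eqF.
  by rewrite ler_wpM2l // divr_ge0 ?mulr_ge0 // ltW.
have t2 : 2 * a * L * fnorm (z - zs g x) <= L / mu * (2 * a * fnorm (py Gg x z)).
  have -> : 2 * a * L * fnorm (z - zs g x) = L / mu * (2 * a * (2 * (mu / 2) * fnorm (z - zs g x))).
    by field; rewrite gt_eqF.
  by apply: ler_wpM2l; [rewrite divr_ge0 // ltW|apply: ler_wpM2l => //; rewrite mulr_ge0 // ltW].
have t3 : fnorm (Ga f g Gf Gg a x) <= fnorm (dhat x y z) + 2 * a * L * (fnorm (y - ya f g a x) + fnorm (z - zs g x)).
  have := ler_fnormD (dhat x y z) (Ga f g Gf Gg a x - dhat x y z); rewrite subrKC => h.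
  by apply: le_trans h _; rewrite lerD2l.
have lm : 0 <= L / mu by rewrite divr_ge0 // ltW.
have s1 : 4 * L / mu * fnorm (py (Gpen Gf Gg a) x y) <= 4 * (L / mu * (cb * fnorm (mdir w))).
  by rewrite -!mulrA ler_wpM2l //; rewrite mulrA [leRHS]mulrA; apply: ler_wpM2l.
have s2 := ler_wpM2l lm g3.
rewrite mulrDr in t3.
have -> : cb * (1 + 5 * L / mu) * fnorm (mdir w) = cb * fnorm (mdir w) + 5 * (L / mu * (cb * fnorm (mdir w))) by ring.
lra.
Qed.

End Potential.

(** * Orders of magnitude *)

Section Rates.
Context {R : realType}.
Variables (r u v c : R).
Hypotheses (r0 : 0 < r) (r1 : r <= 1) (u1 : 1 <= u) (v0 : 0 < v) (uv : u ^+ 4 <= v ^+ 3) (c1 : 1 <= c) (cu : c ^+ 9 = u ^+ 7).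

(** With u = n^(1/7), v = S^(1/7) and r = (1 - rho^2)^(1/2), these are the orders of
    alpha, eta_z and eta_x; [uv] says S >= n^(4/3). The root c = n^(1/9) serves to
    choose the window. *)
Definition rA := r * (u * v).
Definition rB := r ^+ 3 * u ^+ 3 / v ^+ 4.
Definition rE := r ^+ 2 * u ^+ 2 / v ^+ 5.
Let l := r ^+ 2.

Let sqm (x y : R) : 0 <= x -> x <= y -> x ^+ 2 <= y ^+ 2.
Proof. by move=> x0 xy; rewrite ler_pXn2r ?nnegrE // (le_trans x0). Qed.
Let u0 : 0 < u. Proof. exact: lt_le_trans u1. Qed.
Let c0 : 0 < c. Proof. exact: lt_le_trans c1. Qed.
Let l0 : 0 < l. Proof. exact: exprn_gt0. Qed.
Let l1 : l <= 1. Proof. by apply: exprn_ile1; rewrite ?(ltW r0). Qed.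

Let vN : v != 0. Proof. by rewrite gt_eqF. Qed.

Lemma rA_gt0 : 0 < rA. Proof. by rewrite !mulr_gt0. Qed.
Lemma rB_gt0 : 0 < rB. Proof. by rewrite divr_gt0 ?exprn_gt0 // mulr_gt0 ?exprn_gt0. Qed.
Lemma rE_gt0 : 0 < rE. Proof. by rewrite divr_gt0 ?exprn_gt0 // mulr_gt0 ?exprn_gt0. Qed.

Lemma rB_AE : rB = rA * rE. Proof. by rewrite /rB /rA /rE; field. Qed.
Lemma rA3 : rA ^+ 3 = rB * v ^+ 7. Proof. by rewrite /rB /rA; field. Qed.
Lemma rA4B : rA ^+ 4 * rB = r ^+ 7 * u ^+ 7. Proof. by rewrite /rB /rA; field. Qed.
Lemma rA4B_le : rA ^+ 4 * rB <= u ^+ 7.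
Proof. by rewrite rA4B ler_piMl ?exprn_ge0 ?(ltW u0) // exprn_ile1 // ltW. Qed.
Lemma rAB : rA * rB <= l ^+ 2.
Proof.
have -> : rA * rB = r ^+ 4 * (u ^+ 4 / v ^+ 3) by rewrite /rB /rA; field.
rewrite /l -exprM ler_piMr ?exprn_ge0 ?(ltW r0) // ler_pdivrMr ?exprn_gt0 // mul1r //.
Qed.
Lemma rBc : rB * c ^+ 3 <= r ^+ 3.
Proof.
rewrite -(ler_pXn2r (n := 3)) ?nnegrE ?exprn_ge0 ?(ltW r0) //; last by rewrite mulr_ge0 ?exprn_ge0 ?(ltW rB_gt0) ?(ltW c0).
have -> : (rB * c ^+ 3) ^+ 3 = r ^+ 9 * ((u ^+ 4) ^+ 4 / (v ^+ 3) ^+ 4).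
  have -> : (rB * c ^+ 3) ^+ 3 = rB ^+ 3 * c ^+ 9 by ring.
  by rewrite cu /rB; field.
rewrite -[X in _ <= X]exprM ler_piMr ?exprn_ge0 ?(ltW r0) //.
by rewrite ler_pdivrMr ?exprn_gt0 ?exprn_gt0 // mul1r ler_pXn2r ?nnegrE ?exprn_ge0 ?(ltW u0) ?(ltW v0).
Qed.
Lemma rB_le : rB <= r ^+ 3.
Proof. by apply: le_trans rBc; rewrite ler_peMr ?(ltW rB_gt0) // exprn_ege1. Qed.
Lemma rB_le1 : rB <= 1.
Proof. by apply: le_trans rB_le _; rewrite exprn_ile1 // ltW. Qed.

(** A window of length c / l is short against 1 / B once A is large. *)
Lemma rBcl3 : (rB * c / l) ^+ 3 <= 1 / rA ^+ 2.
Proof.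
have A0 := rA_gt0; have B0 := rB_gt0.
have h1 : rB ^+ 2 <= l ^+ 4 / rA ^+ 2.
  rewrite ler_pdivlMr ?exprn_gt0 // -exprMn mulrC.
  have -> : l ^+ 4 = (l ^+ 2) ^+ 2 by rewrite -exprM.
  have ab : 0 <= rA * rB by rewrite mulr_ge0 // ltW.
  exact: sqm ab rAB.
have -> : (rB * c / l) ^+ 3 = rB ^+ 2 * (rB * c ^+ 3) / l ^+ 3 by field; rewrite gt_eqF.
apply: le_trans (_ : (l ^+ 4 / rA ^+ 2) * 1 / l ^+ 3 <= _).
  apply: ler_wpM2r; first by rewrite invr_ge0 exprn_ge0 // ltW.
  apply: ler_pM => //.
  - by rewrite exprn_ge0 // ltW.
  - by rewrite mulr_ge0 ?exprn_ge0 ?(ltW B0) ?(ltW c0).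
  - by apply: le_trans rBc _; rewrite exprn_ile1 // ltW.
have -> : l ^+ 4 / rA ^+ 2 * 1 / l ^+ 3 = l * (1 / rA ^+ 2) by field; rewrite !gt_eqF.
by rewrite ler_piMl // divr_ge0 // exprn_ge0 // ltW.
Qed.

Lemma rBcl_small (eps : R) : 0 < eps -> 1 <= rA -> eps ^- 3 <= rA -> rB * c / l <= eps.
Proof.
move=> e0 A1 hA; have A0 := rA_gt0; have B0 := rB_gt0.
have y0 : 0 <= rB * c / l by rewrite divr_ge0 ?(ltW l0) // mulr_ge0 // ltW.
rewrite -(ler_pXn2r (n := 3)) ?nnegrE ?(ltW e0) //.
apply: le_trans rBcl3 _; rewrite ler_pdivrMr ?exprn_gt0 // expr2 mulrA.
have : 1 <= eps ^+ 3 * rA by rewrite mulrC -ler_pdivrMr ?exprn_gt0 // div1r.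
by move=> h; apply: le_trans h _; rewrite ler_peMr // mulr_ge0 ?exprn_ge0 ?(ltW e0) ?(ltW A0).
Qed.

Lemma rB_small : rB <= l ^+ 2 / rA.
Proof. by rewrite ler_pdivlMr ?rA_gt0 // mulrC rAB. Qed.

(** Multiples of 1 / l are needed for the geometric decay to act. Six times c / l
    makes tht^(2 window) smaller than c^-6 up to a constant, which [term_forget]
    needs, already by Bernoulli's inequality. *)
Definition window : nat := (6 * (Num.truncn (c / l)).+1)%N.

Lemma window_bounds : [/\ (0 < window)%N, window%:R <= 12 * c / l & c / l <= (Num.truncn (c / l)).+1%:R].
Proof.
have cl : 1 <= c / l by rewrite ler_pdivlMr // mul1r (le_trans l1).
have cl0 : 0 <= c / l by exact: le_trans cl.
have /andP[t1 t2] := truncn_itv cl0.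
split=> //; last exact: ltW.
rewrite /window natrM -natr1; lra.
Qed.

Lemma window_forget (t : R) : 0 < t -> t <= 1 - l / 4 -> (t ^+ window) ^+ 2 * c ^+ 6 <= 64.
Proof.
move=> t0 tl; have [_ _ cK] := window_bounds; set k := (Num.truncn (c / l)).+1 in cK *.
have bern j : 1 + j%:R * (l / 4) <= t^-1 ^+ j.
  elim: j => [|j IH]; first by rewrite mul0r addr0 expr0.
  have ti : 1 + l / 4 <= t^-1.
    rewrite -[t^-1]mul1r ler_pdivlMr //; have := sqr_ge0 l; rewrite expr2 => l2.
    have : (1 + l / 4) * t <= (1 + l / 4) * (1 - l / 4) by rewrite ler_wpM2l // addr_ge0 // divr_ge0 // ltW.
    lra.
  rewrite exprS; apply: le_trans (_ : (1 + l / 4) * (1 + j%:R * (l / 4)) <= _).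
    have l4 : 0 <= l / 4 by rewrite divr_ge0 // ltW.
    have j0 : 0 <= j%:R * (l / 4) * (l / 4) by apply: mulr_ge0 => //; exact: mulr_ge0.
    rewrite -natr1; lra.
  have j0 : 0 <= j%:R * (l / 4) by rewrite mulr_ge0 ?divr_ge0 ?(ltW l0).
  by apply: ler_pM => //; rewrite addr_ge0 // divr_ge0 // ltW.
have h1 : c / 2 <= t^-1 ^+ (2 * k).
  apply: le_trans (bern (2 * k)%N); rewrite natrM.
  have : c <= k%:R * l by rewrite -ler_pdivrMr.
  lra.
have h2 : (c / 2) ^+ 6 <= t^-1 ^+ (2 * k) ^+ 6 by rewrite ler_pXn2r ?nnegrE ?exprn_ge0 ?invr_ge0 ?divr_ge0 ?(ltW t0) ?(ltW c0).
have e : (t ^+ window) ^+ 2 = (t^-1 ^+ (2 * k) ^+ 6)^-1.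
  by rewrite exprVn exprVn invrK -!exprM; congr (t ^+ _); rewrite /window -/k mulnC (mulnC 6%N) mulnA.
rewrite e; have p0 : 0 < t^-1 ^+ (2 * k) ^+ 6 by rewrite !exprn_gt0 // invr_gt0.
rewrite mulrC ler_pdivrMr //.
have -> : c ^+ 6 = 64 * (c / 2) ^+ 6 by field.
by rewrite ler_pM2l.
Qed.

Let A := rA. Let B := rB. Let N := u ^+ 7. Let Sn := v ^+ 7.
Let A0 : 0 < A. Proof. exact: rA_gt0. Qed.
Let B0 : 0 < B. Proof. exact: rB_gt0. Qed.
Let N0 : 0 < N. Proof. exact: exprn_gt0. Qed.
Let S0 : 0 < Sn. Proof. exact: exprn_gt0. Qed.

(** B^2 / A^4 per step, the square of the size of the scaled direction for which
    the gradient, of order A / B times it, is of order 1 / A. *)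
Definition target := Sn * B ^+ 2 / A ^+ 4.

Lemma le_target (x k : R) : x * A ^+ 4 <= k * B ^+ 2 -> Sn * x <= k * target.
Proof.
move=> h; rewrite /target mulrA ler_pdivlMr ?exprn_gt0 //.
have -> : k * (Sn * B ^+ 2) = Sn * (k * B ^+ 2) by ring.
by rewrite -mulrA ler_pM2l.
Qed.

(** So an initial gap of order 1, once divided by the descent rate A / B, is within
    the target: this fixes the relation A^3 = B S between the rates. *)
Lemma target_BA : B / A = target.
Proof.
rewrite /target; have h : Sn = A ^+ 3 / B by rewrite /A rA3 -/B -/Sn mulrC mulKf // gt_eqF.
by rewrite h; field; rewrite !gt_eqF.
Qed.

Lemma term_variance (K : R) : 1 <= K -> K <= 12 * c / l -> B ^+ 4 * K ^+ 3 / N * A ^+ 4 <= 12 ^+ 3 * B ^+ 2.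
Proof.
move=> K1 hK; have -> : B ^+ 4 * K ^+ 3 / N * A ^+ 4 = (A ^+ 4 * B) / N * (B * K ^+ 3) * B ^+ 2 by ring.
rewrite ler_wpM2r ?sqr_ge0 //.
have k0 : 0 <= K by exact: le_trans K1.
have h1 : K ^+ 3 <= (12 * c / l) ^+ 3 by rewrite ler_pXn2r ?nnegrE // (le_trans k0).
have -> : A ^+ 4 * B / N = r ^+ 7 by rewrite /A /B rA4B -/N mulfK // gt_eqF.
apply: le_trans (_ : r ^+ 7 * (B * (12 * c / l) ^+ 3) <= _).
  by rewrite ler_wpM2l ?exprn_ge0 ?(ltW r0) // ler_wpM2l // ltW.
have -> : r ^+ 7 * (B * (12 * c / l) ^+ 3) = 12 ^+ 3 * (r * (B * c ^+ 3)).
  by rewrite /l; field; rewrite gt_eqF.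
rewrite -[leRHS]mulr1; apply: ler_wpM2l; first exact: exprn_ge0.
have b0 : 0 <= B * c ^+ 3 by rewrite mulr_ge0 ?exprn_ge0 ?(ltW B0) ?(ltW c0).
have b1 : B * c ^+ 3 <= 1 by apply: le_trans rBc _; rewrite exprn_ile1 // ltW.
by apply: mulr_ile1 => //; exact: ltW.
Qed.

Lemma term_variance2 (K : R) : 1 <= K -> K <= 12 * c / l -> B ^+ 4 * K ^+ 2 / N * A ^+ 4 <= 12 ^+ 3 * B ^+ 2.
Proof.
move=> K1 hK; apply: le_trans (term_variance K1 hK).
rewrite ler_wpM2r ?exprn_ge0 ?(ltW A0) // ler_wpM2r ?invr_ge0 ?(ltW N0) // ler_wpM2l ?exprn_ge0 ?(ltW B0) //.
by rewrite [leRHS]exprS ler_peMl // exprn_ge0 // (le_trans _ K1).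
Qed.

Lemma AB4 : A ^+ 4 * B ^+ 4 <= l ^+ 8.
Proof.
have ab : 0 <= A * B by rewrite mulr_ge0 // ltW.
have -> : A ^+ 4 * B ^+ 4 = ((A * B) ^+ 2) ^+ 2 by ring.
have -> : l ^+ 8 = ((l ^+ 2) ^+ 2) ^+ 2 by ring.
exact: (sqm (sqr_ge0 _) (sqm ab rAB)).
Qed.

Lemma term_small8 : B ^+ 6 / l ^+ 8 * A ^+ 4 <= 1 * B ^+ 2.
Proof.
have -> : B ^+ 6 / l ^+ 8 * A ^+ 4 = (A ^+ 4 * B ^+ 4) / l ^+ 8 * B ^+ 2 by ring.
by rewrite ler_wpM2r ?sqr_ge0 // ler_pdivrMr ?exprn_gt0 // mul1r AB4.
Qed.

Lemma term_small6 : B ^+ 6 / l ^+ 6 * A ^+ 4 <= 1 * B ^+ 2.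
Proof.
apply: le_trans term_small8; rewrite ler_wpM2r ?exprn_ge0 ?(ltW A0) //.
rewrite ler_wpM2l ?exprn_ge0 ?(ltW B0) // lef_pV2 ?posrE ?exprn_gt0 //.
by rewrite ler_wiXn2l // ltW.
Qed.

Lemma term_forget (t2 : R) : t2 * c ^+ 6 <= 64 -> B ^+ 4 * t2 / l ^+ 4 * A ^+ 4 <= 64 * B ^+ 2.
Proof.
move=> ht; have -> : B ^+ 4 * t2 / l ^+ 4 * A ^+ 4 = (A ^+ 4 * B) * (B * t2) / l ^+ 4 * B ^+ 2 by ring.
rewrite ler_wpM2r ?sqr_ge0 // ler_pdivrMr ?exprn_gt0 // /A /B rA4B -cu.
have -> : r ^+ 7 * c ^+ 9 * (rB * t2) = r ^+ 7 * (rB * c ^+ 3) * (t2 * c ^+ 6) by ring.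
have e0 : 0 <= r ^+ 7 * (rB * c ^+ 3) by rewrite mulr_ge0 ?exprn_ge0 ?(ltW r0) // mulr_ge0 ?exprn_ge0 ?(ltW c0) // ltW.
apply: le_trans (ler_wpM2l e0 ht) _; rewrite mulrC ler_pM2l //.
apply: le_trans (_ : r ^+ 7 * r ^+ 3 <= _); first by rewrite ler_wpM2l ?exprn_ge0 ?(ltW r0) // rBc.
by rewrite -exprD /l -exprM ler_wiXn2l // ltW.
Qed.

Lemma term_init : B ^+ 4 / l ^+ 3 <= target.
Proof.
rewrite -target_BA ler_pdivrMr ?exprn_gt0 // mulrAC ler_pdivlMr //.
have -> : B ^+ 4 * A = (A * B) * B ^+ 2 * B by ring.
have -> : B * l ^+ 3 = l ^+ 3 * B by ring.
rewrite ler_pM2r //.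
apply: le_trans (_ : l ^+ 2 * 1 * B ^+ 2 <= _); first by rewrite mulr1 ler_wpM2r ?sqr_ge0 // rAB.
have h : B ^+ 2 <= l.
  apply: le_trans (_ : (r ^+ 3) ^+ 2 <= _).
    by rewrite ler_pXn2r ?nnegrE ?exprn_ge0 ?(ltW B0) ?(ltW r0) // rB_le.
  by rewrite -exprM /l ler_wiXn2l // ltW.
by rewrite mulr1 [leRHS]exprSr ler_wpM2l ?sqr_ge0.
Qed.

Lemma term_noise : B ^+ 3 / N * A ^+ 4 <= 1 * B ^+ 2.
Proof.
have -> : B ^+ 3 / N * A ^+ 4 = (A ^+ 4 * B) / N * B ^+ 2 by ring.
by rewrite ler_wpM2r ?sqr_ge0 // ler_pdivrMr // mul1r; exact: rA4B_le.
Qed.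

Variables (L CL cn cw cp D1 : R).
Hypotheses (L1 : 1 <= L) (CL0 : 0 <= CL) (cw0 : 0 <= cw) (cp0 : 0 < cp) (D10 : 0 <= D1).

Definition rc2 : R := 4 / cp + 6 * CL.
Definition rc3 : R := 256 * (12 * L) ^+ 2 * cw + 12 ^+ 3 * (640 * (12 * L) ^+ 2 * cn ^+ 2)
  + 32 * 10 ^+ 6 * (12 * L) ^+ 2 * cn ^+ 4 + 64 * (128 * 10 ^+ 3 * (12 * L) ^+ 2 * cn ^+ 2)
  + 12 ^+ 3 * (510 * (12 * L) ^+ 2 * cn ^+ 2) + 2 ^+ 15 * 10 ^+ 3 * (12 * L) ^+ 4 * cn ^+ 2.
Definition rcC : R := 2 * (8 * D1 + 240 * CL * cn ^+ 2 + 8 * rc2 * rc3).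

Lemma rc2_ge0 : 0 <= rc2.
Proof. by apply: addr_ge0; [apply: divr_ge0 => //; exact: ltW|exact: mulr_ge0]. Qed.

(** The terms of [bias_sum] are within the target one by one, from [term_variance]
    to [term_init]. *)
Lemma bias_rate (Sg Sb K t2 : R) : 1 <= K -> K <= 12 * c / l -> t2 * c ^+ 6 <= 64 ->
  Sb <= 102 * (12 * B * L) ^+ 2 * K ^+ 2 * Sg + 256 * (12 * B * L) ^+ 2 * (cw * N * B ^+ 2) / (N * l ^+ 3)
    + Sn * (640 * K ^+ 3 * (12 * B * L) ^+ 2 * (cn * B) ^+ 2 / N + 32 * 10 ^+ 6 * (12 * B * L) ^+ 2 * (cn * B) ^+ 4 / l ^+ 6
      + 128 * 10 ^+ 3 * (12 * B * L) ^+ 2 * (cn * B) ^+ 2 * t2 / l ^+ 4 + 510 * (12 * B * L) ^+ 2 * K ^+ 2 * (cn * B) ^+ 2 / N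
      + 2 ^+ 15 * 10 ^+ 3 * (12 * B * L) ^+ 4 * (cn * B) ^+ 2 / l ^+ 8) ->
  Sb <= 102 * (12 * B * L) ^+ 2 * K ^+ 2 * Sg + rc3 * target.
Proof.
move=> K1 hK ht h; apply: le_trans h _; rewrite -addrA lerD2l.
have q1 := term_init; have q2 := le_target (term_variance K1 hK); have q3 := le_target term_small6.
have q4 := le_target (term_forget ht); have q5 := le_target (term_variance2 K1 hK); have q6 := le_target term_small8.
rewrite mul1r in q3; rewrite mul1r in q6.
have cn2 := sqr_ge0 cn; have L2 := sqr_ge0 (12 * L).
have cn4 : 0 <= cn ^+ 4 by exact: exprn_even_ge0.
have L4 : 0 <= (12 * L) ^+ 4 by exact: exprn_even_ge0.
have k1 : 0 <= 256 * (12 * L) ^+ 2 * cw := mulr_ge0 (mulr_ge0 (ler0n R 256) L2) cw0.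
have k2 : 0 <= 640 * (12 * L) ^+ 2 * cn ^+ 2 := mulr_ge0 (mulr_ge0 (ler0n R 640) L2) cn2.
have e10 k : 0 <= 10 ^+ k :> R := exprn_ge0 k (ler0n R 10).
have e2 k : 0 <= 2 ^+ k :> R := exprn_ge0 k (ler0n R 2).
have k3 : 0 <= 32 * 10 ^+ 6 * (12 * L) ^+ 2 * cn ^+ 4 := mulr_ge0 (mulr_ge0 (mulr_ge0 (ler0n R 32) (e10 6%N)) L2) cn4.
have k4 : 0 <= 128 * 10 ^+ 3 * (12 * L) ^+ 2 * cn ^+ 2 := mulr_ge0 (mulr_ge0 (mulr_ge0 (ler0n R 128) (e10 3%N)) L2) cn2.
have k5 : 0 <= 510 * (12 * L) ^+ 2 * cn ^+ 2 := mulr_ge0 (mulr_ge0 (ler0n R 510) L2) cn2.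
have k6 : 0 <= 2 ^+ 15 * 10 ^+ 3 * (12 * L) ^+ 4 * cn ^+ 2 := mulr_ge0 (mulr_ge0 (mulr_ge0 (e2 15%N) (e10 3%N)) L4) cn2.
have NN : N != 0 by rewrite gt_eqF.
have lN : l != 0 by rewrite gt_eqF.
have -> : 256 * (12 * B * L) ^+ 2 * (cw * N * B ^+ 2) / (N * l ^+ 3) = (256 * (12 * L) ^+ 2 * cw) * (B ^+ 4 / l ^+ 3).
  by field; rewrite lN NN.
rewrite /rc3; move: q1 q2 q3 q4 q5 q6 k1 k2 k3 k4 k5 k6.
set z1 := 256 * _ * cw; set z2 := 640 * _ * _; set z3 := 32 * _ * _ * _; set z4 := 128 * _ * _ * _.
set z5 := 510 * _ * _; set z6 := 2 ^+ 15 * _ * _ * _.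
move=> q1 q2 q3 q4 q5 q6 k1 k2 k3 k4 k5 k6.
have -> : 640 * K ^+ 3 * (12 * B * L) ^+ 2 * (cn * B) ^+ 2 / N = z2 * (B ^+ 4 * K ^+ 3 / N) by rewrite /z2; field.
have -> : 32 * 10 ^+ 6 * (12 * B * L) ^+ 2 * (cn * B) ^+ 4 / l ^+ 6 = z3 * (B ^+ 6 / l ^+ 6) by rewrite /z3; field.
have -> : 128 * 10 ^+ 3 * (12 * B * L) ^+ 2 * (cn * B) ^+ 2 * t2 / l ^+ 4 = z4 * (B ^+ 4 * t2 / l ^+ 4) by rewrite /z4; field.
have -> : 510 * (12 * B * L) ^+ 2 * K ^+ 2 * (cn * B) ^+ 2 / N = z5 * (B ^+ 4 * K ^+ 2 / N) by rewrite /z5; field.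
have -> : 2 ^+ 15 * 10 ^+ 3 * (12 * B * L) ^+ 4 * (cn * B) ^+ 2 / l ^+ 8 = z6 * (B ^+ 6 / l ^+ 8) by rewrite /z6; field.
have p1 := ler_wpM2l k1 q1; have p2 := ler_wpM2l k2 q2; have p3 := ler_wpM2l k3 q3.
have p4 := ler_wpM2l k4 q4; have p5 := ler_wpM2l k5 q5; have p6 := ler_wpM2l k6 q6.
move: p1 p2 p3 p4 p5 p6.
set y1 := B ^+ 4 / l ^+ 3; set y2 := B ^+ 4 * K ^+ 3 / N; set y3 := B ^+ 6 / l ^+ 6.
set y4 := B ^+ 4 * t2 / l ^+ 4; set y5 := B ^+ 4 * K ^+ 2 / N; set y6 := B ^+ 6 / l ^+ 8.
move: (target) => E; clearbody z1 z2 z3 z4 z5 z6 y1 y2 y3 y4 y5 y6.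
move=> p1 p2 p3 p4 p5 p6; lra.
Qed.

(** The bias estimate is inserted into the descent estimate; as its coefficient of
    Sg is small, Sg is then bounded by the target. *)
Lemma gradient_rate (Sg Sb K Cv : R) : 0 <= Sg -> 0 <= Sb -> 1 <= A -> Cv <= 2 * A * CL ->
  8 * rc2 * (102 * (12 * B * L) ^+ 2 * K ^+ 2) <= 1 / 2 ->
  Sb <= 102 * (12 * B * L) ^+ 2 * K ^+ 2 * Sg + rc3 * target ->
  A / (2 * B) / 4 * Sg <= D1 + (4 / cp * (A / B) + 3 * Cv) * Sb + Sn * (15 * Cv / N * (cn * B) ^+ 2) ->
  Sg <= rcC * target.
Proof.
move=> Sg0 Sb0 A1 hCv hs hb hd.
have c20 := rc2_ge0; have B1 : B <= 1 by exact: rB_le1.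
have h1 : Sn * (15 * Cv / N * (cn * B) ^+ 2) <= A / (2 * B) / 4 * (240 * CL * cn ^+ 2 * target).
  have q := le_target term_noise; rewrite mul1r in q.
  apply: le_trans (_ : 30 * CL * cn ^+ 2 * (A / B) * (Sn * (B ^+ 3 / N)) <= _).
    have -> : Sn * (15 * Cv / N * (cn * B) ^+ 2) = 15 * Cv * (cn ^+ 2 * (Sn * B ^+ 2 / N)) by ring.
    have -> : 30 * CL * cn ^+ 2 * (A / B) * (Sn * (B ^+ 3 / N)) = 15 * (2 * A * CL) * (cn ^+ 2 * (Sn * B ^+ 2 / N)).
      by field; rewrite !gt_eqF.
    apply: ler_wpM2r; last by rewrite ler_pM2l.
    by rewrite mulr_ge0 ?sqr_ge0 // divr_ge0 ?(ltW N0) // mulr_ge0 ?sqr_ge0 // ltW.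
  have -> : A / (2 * B) / 4 * (240 * CL * cn ^+ 2 * target) = 30 * CL * cn ^+ 2 * (A / B) * target.
    by field; rewrite gt_eqF.
  apply: ler_wpM2l => //; apply: mulr_ge0; last by rewrite divr_ge0 // ltW.
  by rewrite mulr_ge0 ?sqr_ge0 // mulr_ge0.
have h2 : (4 / cp * (A / B) + 3 * Cv) * Sb <= A / (2 * B) / 4 * (8 * rc2 * Sb).
  have -> : A / (2 * B) / 4 * (8 * rc2 * Sb) = (4 / cp * (A / B) + 6 * CL * (A / B)) * Sb.
    by rewrite /rc2; field; rewrite !gt_eqF.
  apply: ler_wpM2r => //; rewrite lerD2l.
  have : A * CL <= CL * (A / B).
    rewrite mulrC; apply: ler_wpM2l => //; rewrite ler_pdivlMr // -[leRHS]mulr1.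
    by rewrite ler_pM2l.
  lra.
have AB0 : 0 < A / (2 * B) / 4 by rewrite !divr_gt0 // mulr_gt0.
have h3 : D1 <= A / (2 * B) / 4 * (8 * D1 * target).
  rewrite -target_BA le_eqVlt; apply/orP; left; apply/eqP; field; rewrite !gt_eqF //.
have h4 : Sg <= 8 * D1 * target + 8 * rc2 * Sb + 240 * CL * cn ^+ 2 * target.
  rewrite -(ler_pM2l AB0) [leRHS]mulrDr [X in _ <= X + _]mulrDr; apply: le_trans hd _.
  by apply: lerD => //; exact: lerD.
have c8 : 0 <= 8 * rc2 by exact: mulr_ge0.
have h5 := ler_wpM2l c8 hb; rewrite [leRHS]mulrDr [X in _ <= X + _]mulrA in h5.
have h6 := ler_wpM2r Sg0 hs.
rewrite /rcC; move: h4 h5 h6; move: (target) => E; set z1 := 8 * rc2 * _ * Sg; set z2 := 8 * rc2 * Sb; set z3 := 8 * rc2 * (rc3 * E).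
have -> : 2 * (8 * D1 + 240 * CL * cn ^+ 2 + 8 * rc2 * rc3) * E = 2 * (8 * D1 * E + 240 * CL * cn ^+ 2 * E + z3) by rewrite /z3; ring.
set z4 := 8 * D1 * E; set z5 := 240 * _ * _ * E; move=> h4 h5 h6; lra.
Qed.

End Rates.

(** * The error of one oracle call *)

Section Oracle.
Context {R : realType} {d : measure_display} {O : measurableType d} {dX : measure_display} {X : measurableType dX}.
Variables (P : probability O R) (mu : probability X R) (k m : nat).
Variables (Gr : 'rV[R]_k -> X -> 'rV[R]_k) (M : 'rV[R]_k -> 'rV[R]_k) (L s2 : R).
Local Notation BV := (g_sigma_algebraType (@open 'rV[R]_k)).
Hypothesis Gmeas : forall j, measurable_fun setT (fun a : BV * X => Gr (a.1 : 'rV[R]_k) a.2 0 j).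
Hypothesis Gint : forall w j, mu.-integrable setT (fun v => (Gr w v 0 j)%:E).
Hypothesis Gmean : forall w j, (\int[mu]_v (Gr w v 0 j)%:E = (M w 0 j)%:E)%E.
Hypothesis Gvar : forall w, (\int[mu]_v (fnorm (Gr w v - M w) ^+ 2)%:E <= s2%:E)%E.
Hypothesis Mlip : lip L M.

Definition err w v := Gr w v - M w.

Variables (gen : set (set O)) (V : O -> X) (w1 w2 : O -> 'rV[R]_k) (F1 F2 : 'M[R]_(k, m)) (c sg : R).
Hypothesis genM : gen `<=` @measurable _ O.
Hypothesis mV : measurable_fun setT V.
Hypotheses (pw1 : pastm gen w1) (pw2 : pastm gen w2).
Hypotheses (hF1 : forall u : 'rV[R]_k, fnorm (u *m F1) <= c * fnorm u)
  (hF2 : forall u : 'rV[R]_k, fnorm (u *m F2) <= c * fnorm u).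
Hypotheses (c0 : 0 <= c) (csg : 4 * c ^+ 2 * s2 <= sg ^+ 2).
Local Notation T := (g_sigma_algebraType gen).

(** A call may return two gradients at w1 and w2 with one sample, which F1 and F2
    place in the joint state. *)
Definition eps (o : O) (v : X) : 'rV[R]_m := err (w1 o) v *m F1 + err (w2 o) v *m F2.

Lemma err_meas dT (T' : measurableType dT) (w : T' -> 'rV[R]_k) j : (forall i, measurable_fun setT (fun t => w t 0 i)) ->
  measurable_fun setT (fun z : T' * X => err (w z.1) z.2 0 j).
Proof.
move=> hw; under eq_fun do rewrite /err mxE [X in _ + X]mxE.
have mw : measurable_fun setT (w : T' -> BV) by exact: measurable_rV.
apply: measurable_funB.
  apply: (measurableT_comp (Gmeas j) (g := fun z : T' * X => ((w z.1 : BV), z.2))).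
  by apply: measurable_fun_pair => //; exact: (measurableT_comp mw measurable_fst).
apply: (@measurable_continuous_rV R _ (T' * X)%type _ (fun z => w z.1) (fun x => M x 0 j)).
  by move=> i; exact: (measurableT_comp (hw i) measurable_fst).
exact: lip_coord_continuous Mlip.
Qed.

Lemma eps_meas_gen dT (T' : measurableType dT) (a1 a2 : T' -> 'rV[R]_k) j :
  (forall i, measurable_fun setT (fun t => a1 t 0 i)) -> (forall i, measurable_fun setT (fun t => a2 t 0 i)) ->
  measurable_fun setT (fun z : T' * X => (err (a1 z.1) z.2 *m F1 + err (a2 z.1) z.2 *m F2) 0 j).
Proof.
move=> h1 h2; under eq_fun do rewrite mxE mxE [X in _ + X]mxE.
apply: measurable_funD; apply: measurable_sum => i; apply: measurable_funM => //; exact: err_meas.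
Qed.

Lemma eps_meas j : measurable_fun setT (fun z : T * X => eps z.1 z.2 0 j).
Proof.
by apply: (eps_meas_gen (T' := T) (a1 := w1) (a2 := w2)) => i; [exact: pw1|exact: pw2].
Qed.

Lemma err_int w j : intg mu (fun v => err w v 0 j).
Proof.
have h : intg mu (fun v => Gr w v 0 j) by exact: Gint.
by apply: intg_eq (intgB h (intg_cst mu (M w 0 j))) => v; rewrite /err !mxE.
Qed.

Lemma err_mean w j : Ex mu (fun v => err w v 0 j) = 0.
Proof.
have h : intg mu (fun v => Gr w v 0 j) by exact: Gint.
rewrite (Ex_eq mu (g := fun v => Gr w v 0 j - M w 0 j)); last by move=> v; rewrite /err !mxE.
rewrite (ExB h (intg_cst mu _)) Ex_cst /Ex /Rintegral Gmean /= subrr //.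
Qed.

Lemma eps_mean o j : (\int[mu]_v (eps o v 0 j)%:E = 0)%E.
Proof.
have i1 : intg mu (fun v => \sum_i F1 i j * err (w1 o) v 0 i) by apply: intg_sum => i _; apply: intgZ; exact: err_int.
have i2 : intg mu (fun v => \sum_i F2 i j * err (w2 o) v 0 i) by apply: intg_sum => i _; apply: intgZ; exact: err_int.
have E v : eps o v 0 j = (\sum_i F1 i j * err (w1 o) v 0 i) + (\sum_i F2 i j * err (w2 o) v 0 i).
  by rewrite /eps !mxE; congr (_ + _); apply: eq_bigr => i _; rewrite mulrC.
have z : Ex mu (fun v => eps o v 0 j) = 0.
  rewrite (Ex_eq mu E) (ExD i1 i2) !Ex_sum; first last.
  - by move=> i _; apply: intgZ; exact: err_int.
  - by move=> i _; apply: intgZ; exact: err_int.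
  by rewrite !big1 ?addr0 // => i _; rewrite (ExZ _ (err_int _ _)) err_mean mulr0.
have ie : intg mu (fun v => eps o v 0 j) by apply: intg_eq (intgD i1 i2) => v; rewrite E.
by rewrite -(fineK (integrable_fin_num measurableT ie)) -/(Rintegral mu setT _) -[X in X%:E]/(Ex mu (fun v => eps o v 0 j)) z.
Qed.

Lemma eps_var o : (\int[mu]_v (fnorm (eps o v) ^+ 2)%:E <= (sg ^+ 2)%:E)%E.
Proof.
have me w j : measurable_fun setT (fun v => err w v 0 j) by exact: intg_meas (err_int w j).
have mn w : measurable_fun setT (fun v => fnorm (err w v) ^+ 2).
  by apply: measurable_funX; apply: meas_fnorm => i j; rewrite (ord1 i).
have key v : fnorm (eps o v) ^+ 2 <= 2 * c ^+ 2 * fnorm (err (w1 o) v) ^+ 2 + 2 * c ^+ 2 * fnorm (err (w2 o) v) ^+ 2.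
  have sq (u F : R) : 0 <= u -> u <= F -> u ^+ 2 <= F ^+ 2 by move=> u0 uF; rewrite ler_pXn2r ?nnegrE // (le_trans u0).
  apply: le_trans (fnorm_sqD2 _ _) _.
  have e w : 2 * c ^+ 2 * fnorm (err w v) ^+ 2 = 2 * (c * fnorm (err w v)) ^+ 2 by ring.
  by rewrite !e; apply: lerD; rewrite ler_wpM2l //; apply: sq.
have bound w : (\int[mu]_v ((2 * c ^+ 2)%:E * (fnorm (err w v) ^+ 2)%:E) <= (2 * c ^+ 2 * s2)%:E)%E.
  rewrite ge0_integralZl ?lee_fin ?mulr_ge0 ?sqr_ge0 //; last 2 first.
  - exact/measurable_EFinP.
  - by move=> v _; rewrite lee_fin sqr_ge0.
  have k2 : 0 <= 2 * c ^+ 2 by rewrite mulr_ge0 ?sqr_ge0.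
  by rewrite [leRHS]EFinM; apply: lee_wpmul2l; [rewrite lee_fin|exact: Gvar].
apply: le_trans (_ : (\int[mu]_v ((2 * c ^+ 2)%:E * (fnorm (err (w1 o) v) ^+ 2)%:E + (2 * c ^+ 2)%:E * (fnorm (err (w2 o) v) ^+ 2)%:E) <= _)%E).
  apply: ge0_le_integral => //.
  - by move=> v _; rewrite lee_fin sqr_ge0.
  - apply/measurable_EFinP; apply: measurable_funX; apply: meas_fnorm => i j; rewrite (ord1 i) /eps.
    under eq_fun do rewrite mxE mxE [X in _ + X]mxE.
    by apply: measurable_funD; apply: measurable_sum => l; exact: measurable_funM.
  - by apply/measurable_EFinP; apply: measurable_funD; apply: measurable_funM.
  - by move=> v _; rewrite -!EFinM -EFinD lee_fin.
rewrite ge0_integralD //; last 4 first.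
- by move=> v _; rewrite -EFinM lee_fin mulr_ge0 ?sqr_ge0 // mulr_ge0 ?sqr_ge0.
- by apply/measurable_EFinP; apply: measurable_funM.
- by move=> v _; rewrite -EFinM lee_fin mulr_ge0 ?sqr_ge0 // mulr_ge0 ?sqr_ge0.
- by apply/measurable_EFinP; apply: measurable_funM.
apply: le_trans (leeD (bound _) (bound _)) _; rewrite -EFinD lee_fin; apply: le_trans csg.
by rewrite le_eqVlt; apply/orP; left; apply/eqP; ring.
Qed.

Hypothesis indep : forall A B, <<s gen >> A -> measurable B -> P (A `&` V @^-1` B) = (P A * mu B)%E.

Lemma eps_orth (y : O -> R) j : past gen y -> L2 P y -> Ex P (fun o => y o * eps o (V o) 0 j) = 0.
Proof.
exact: (@noise_orth _ _ _ P gen genM _ _ V mV mu indep _ (fun o : T => eps o) (sg ^+ 2) eps_meas eps_mean eps_var (sqr_ge0 sg)).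
Qed.

Lemma eps_second (y : O -> R) : past gen y -> (forall o, 0 <= y o) -> intg P y ->
  intg P (fun o => y o * fnorm (eps o (V o)) ^+ 2) /\
  Ex P (fun o => y o * fnorm (eps o (V o)) ^+ 2) <= sg ^+ 2 * Ex P y.
Proof.
exact: (@noise_var _ _ _ P gen genM _ _ V mV mu indep _ (fun o : T => eps o) (sg ^+ 2) eps_meas eps_var (sqr_ge0 sg)).
Qed.

Lemma eps_L2 : L2m P (fun o => eps o (V o)).
Proof.
exact: (@noise_L2 _ _ _ P gen genM _ _ V mV mu indep _ (fun o : T => eps o) (sg ^+ 2) eps_meas eps_var (sqr_ge0 sg)).
Qed.

Lemma eps_past gen' : pastm gen' w1 -> pastm gen' w2 -> preimage_set_system setT V measurable `<=` gen' ->
  pastm gen' (fun o => eps o (V o)).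
Proof.
move=> h1 h2 hV i j; rewrite (ord1 i).
pose T' := g_sigma_algebraType gen'.
have mV' : measurable_fun setT (V : T' -> X).
  move=> _ B mB; rewrite setTI; apply: sub_gen_smallest; apply: hV; exists B => //.
  by rewrite setTI.
have h := eps_meas_gen (T' := T') j (fun i => h1 0 i) (fun i => h2 0 i).
apply: (measurableT_comp h (g := fun o : T' => (o, V o))).
by apply: measurable_fun_pair.
Qed.

End Oracle.

(** * The run in matrix form *)

Section CondLaw.
Context {R : realType} {d : measure_display} {O : measurableType d}.
Variable P : probability O R.

Lemma int_indic A D : measurable A -> measurable D -> (\int[P]_(w in A) (\1_D w)%:E = P (D `&` A))%E.
Proof. by move=> mA mD; rewrite integral_indic. Qed.

(** A constant conditional probability is the unconditional one, and expresses
    independence. *)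
Lemma cond_prob_cst (G : set (set O)) D (c : R) : G `<=` measurable -> G setT -> measurable D -> cond_prob P G D (cst c) ->
  c = fine (P D) /\ forall A, G A -> P (A `&` D) = (P A * P D)%E.
Proof.
move=> GM GT mD [_ _ _ h].
have e A : G A -> P (A `&` D) = (c%:E * P A)%E.
  move=> GA; have := h A GA; rewrite int_indic //; last exact: GM.
  by rewrite setIC => ->; exact: (integral_cst P (GM _ GA) c%:E).
have eT : P D = c%:E by have := e setT GT; rewrite setTI probability_setT mule1.
by rewrite eT; split => // A GA; rewrite e // muleC.
Qed.

End CondLaw.

Section Rows.
Context {R : realType} {n : nat}.

Definition rows k (v : 'I_n -> 'rV[R]_k) : 'M[R]_(n, k) := \matrix_(i, j) v i 0 j.

Lemma row_rows k (v : 'I_n -> 'rV[R]_k) i : row i (rows v) = v i.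
Proof. by apply/rowP => j; rewrite !mxE. Qed.

Lemma row_mix k (W : 'M[R]_n) (v : 'I_n -> 'rV[R]_k) i : row i (W *m rows v) = mix W v i.
Proof.
apply/rowP => j; rewrite !mxE summxE; apply: eq_bigr => l _; by rewrite !mxE.
Qed.

Lemma mrow_rows k (v : 'I_n -> 'rV[R]_k) : mrow (rows v) = avg v.
Proof. by rewrite mrowE /avg; congr (_ *: _); apply: eq_bigr => i _; rewrite row_rows. Qed.

Lemma mixZ k (W : 'M[R]_n) c (v : 'I_n -> 'rV[R]_k) i : mix W (fun i => c *: v i) i = c *: mix W v i.
Proof. by rewrite /mix scaler_sumr; apply: eq_bigr => j _; rewrite !scalerA mulrC. Qed.

Lemma st3_sum p q (I : Type) (r : seq I) (Q : pred I) (a : I -> 'rV[R]_p) (b c : I -> 'rV[R]_q) :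
  \sum_(i <- r | Q i) st3 (a i) (b i) (c i) =
  st3 (\sum_(i <- r | Q i) a i) (\sum_(i <- r | Q i) b i) (\sum_(i <- r | Q i) c i).
Proof.
elim: r => [|i r IH]; first by rewrite !big_nil /st3 !row_mx0.
by rewrite !big_cons; case: (Q i) => //; rewrite IH st3D.
Qed.

Lemma mix_st3 p q (W : 'M[R]_n) (a : 'I_n -> 'rV[R]_p) (b c : 'I_n -> 'rV[R]_q) i :
  mix W (fun i => st3 (a i) (b i) (c i)) i = st3 (mix W a i) (mix W b i) (mix W c i).
Proof. by rewrite /mix -st3_sum; apply: eq_bigr => j _; rewrite st3Z. Qed.

Lemma avg_st3 p q (a : 'I_n -> 'rV[R]_p) (b c : 'I_n -> 'rV[R]_q) :
  avg (fun i => st3 (a i) (b i) (c i)) = st3 (avg a) (avg b) (avg c).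
Proof. by rewrite /avg st3_sum st3Z. Qed.

Lemma avgZ k c (v : 'I_n -> 'rV[R]_k) : avg (fun i => c *: v i) = c *: avg v.
Proof. by rewrite /avg -scaler_sumr !scalerA mulrC. Qed.

End Rows.

Section Run.
Context {R : realType} {n p q : nat}
  {dO : measure_display} {O : measurableType dO}
  {dX : measure_display} {X : measurableType dX}
  {dY : measure_display} {Y : measurableType dY}.
Variables (P : probability O R) (pb : problem R n p q X Y) (W : 'M[R]_n) (sm : samples R n O X Y)
  (d : init_data R n p q) (alpha etax etay etaz : R).
Let run := dsgda_gt pb W sm alpha etax etay etaz 1 d.

(** The iterates, trackers and directions of all agents, in the scaling for which
    the three blocks follow one recursion. *)
Definition wS s o : 'M[R]_(n, p + (q + q)) :=
  rows (fun i => st3 (st_x (run s o) i) (st_y (run s o) i) (st_z (run s o) i)).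
Definition US s o : 'M[R]_(n, p + (q + q)) :=
  rows (fun i => st3 (etax *: st_v (run s o) i) (etay *: st_uy (run s o) i) (etaz *: st_uz (run s o) i)).
Definition HS s o : 'M[R]_(n, p + (q + q)) :=
  rows (fun i => st3 (etax *: st_delta (run s o) i) (etay *: st_hy (run s o) i) (etaz *: st_hz (run s o) i)).

Lemma st3N (x : 'rV[R]_p) (y z : 'rV[R]_q) : - st3 x y z = st3 (- x) (- y) (- z).
Proof. by rewrite /st3 !opp_row_mx. Qed.

Lemma US_rec s o : US s.+1 o = W *m US s o + HS s.+1 o - HS s o.
Proof.
apply/row_matrixP => i; rewrite linearB linearD /= row_mix !row_rows mix_st3 !mixZ st3N !st3D.
by rewrite -!scalerDr -!scalerBr.
Qed.

Lemma wS_rec s o : wS s.+1 o = W *m wS s o - US s.+1 o.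
Proof.
by apply/row_matrixP => i; rewrite linearB /= row_mix !row_rows mix_st3 st3N st3D.
Qed.

Definition Gf i := grad (joint (fi pb i)).
Definition Gg i := grad (joint (gi pb i)).
Definition Of i (w : 'rV[R]_(p + q)) xi := grad_f pb i (lsubmx w) (rsubmx w) xi.
Definition Og i (w : 'rV[R]_(p + q)) psi := grad_g pb i (lsubmx w) (rsubmx w) psi.
Definition xyS s i o : 'rV[R]_(p + q) := row_mx (st_x (run s o) i) (st_y (run s o) i).
Definition xzS s i o : 'rV[R]_(p + q) := row_mx (st_x (run s o) i) (st_z (run s o) i).

Local Notation calls := (@call n 1%N).

Definition agent (k : calls) : 'I_n :=
  match k with
  | inl (inl (inl (inl a))) => a.2
  | inl (inl (inl (inr a))) => a.2
  | inl (inl (inr a)) => a.2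
  | inl (inr i) => i
  | inr i => i
  end.

(** The last case shares one sample between the gradients of g at (x, y) and at
    (x, z), with opposite signs. *)
Definition callnoise s (k : calls) (o : O) : 'rV[R]_(p + (q + q)) :=
  match k with
  | inl (inl (inl (inl a))) =>
      eps (Of a.2) (Gf a.2) (xyS s a.2) (xyS s a.2) (spread 0 etay 0) 0 o (xi_y sm s a.1 a.2 o)
  | inl (inl (inl (inr a))) =>
      eps (Og a.2) (Gg a.2) (xyS s a.2) (xyS s a.2) (spread 0 (alpha * etay) 0) 0 o (psi_y sm s a.1 a.2 o)
  | inl (inl (inr a)) =>
      eps (Og a.2) (Gg a.2) (xzS s a.2) (xzS s a.2) (spread 0 0 etaz) 0 o (psi_z sm s a.1 a.2 o)
  | inl (inr i) =>
      eps (Of i) (Gf i) (xyS s i) (xyS s i) (spread etax 0 0) 0 o (xi_x sm s i o)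
  | inr i =>
      eps (Og i) (Gg i) (xyS s i) (xzS s i) (spread (alpha * etax) 0 0) (spread (- (alpha * etax)) 0 0) o (psi_x sm s i o)
  end.

Lemma card_calls : #|calls| = (5 * n)%N.
Proof. by rewrite /call !card_sum !card_prod !card_ord; lia. Qed.

Lemma row_delta_mul (k : 'I_n) m (v : 'rV[R]_m) i : row i (delta_mx k 0 *m v) = (i == k)%:R *: v.
Proof. by apply/rowP => j; rewrite !mxE big_ord1 mxE eqxx andbT. Qed.

Lemma sum_pick m (F : 'I_n -> 'rV[R]_m) i : \sum_j (i == j)%:R *: F j = F i.
Proof.
rewrite (bigD1 i) //= eqxx scale1r big1 ?addr0 // => j /negbTE ji.
by rewrite eq_sym ji scale0r.
Qed.

Lemma sum_calls m (F : calls -> 'rV[R]_m) : \sum_k F k =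
  \sum_j F (inl (inl (inl (inl (ord0, j))))) + \sum_j F (inl (inl (inl (inr (ord0, j)))))
  + \sum_j F (inl (inl (inr (ord0, j)))) + \sum_j F (inl (inr j)) + \sum_j F (inr j).
Proof.
have pr (H : 'I_1 * 'I_n -> 'rV[R]_m) : \sum_k H k = \sum_j H (ord0, j).
  rewrite (eq_bigr (fun k => H (k.1, k.2))); last by case.
  by rewrite -(pair_bigA _ (fun a b => H (a, b))) /= big_ord1.
by rewrite !big_sumType /= !pr.
Qed.

Lemma noise_row s i o : row i (noise_sum (callnoise s) (fun k => delta_mx (agent k) 0) (enum calls) o) =
  callnoise s (inl (inl (inl (inl (ord0, i))))) o + callnoise s (inl (inl (inl (inr (ord0, i))))) o
  + callnoise s (inl (inl (inr (ord0, i)))) o + callnoise s (inl (inr i)) o + callnoise s (inr i) o.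
Proof.
rewrite /noise_sum linear_sum big_enum (eq_bigl xpredT) //.
rewrite (eq_bigr (fun k => (i == agent k)%:R *: callnoise s k o)); last by move=> k _; exact: row_delta_mul.
rewrite sum_calls; congr (_ + _ + _ + _ + _).
- exact: (sum_pick (fun j => callnoise s (inl (inl (inl (inl (ord0, j))))) o)).
- exact: (sum_pick (fun j => callnoise s (inl (inl (inl (inr (ord0, j))))) o)).
- exact: (sum_pick (fun j => callnoise s (inl (inl (inr (ord0, j)))) o)).
- exact: (sum_pick (fun j => callnoise s (inl (inr j)) o)).
- exact: (sum_pick (fun j => callnoise s (inr j) o)).
Qed.

Lemma HS_rec s o : HS s.+1 o = rowwise (Gst Gf Gg alpha etax etay etaz) (wS s o)
  + noise_sum (callnoise s) (fun k => delta_mx (agent k) 0) (enum calls) o.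
Proof.
apply/row_matrixP => i; rewrite linearD /= row_rowwise noise_row !row_rows Gst_st3.
have eD : st_delta (run s.+1 o) i = lsubmx (Of i (xyS s i o) (xi_x sm s i o)) +
    alpha *: (lsubmx (Og i (xyS s i o) (psi_x sm s i o)) - lsubmx (Og i (xzS s i o) (psi_x sm s i o))).
  by rewrite /Of /Og /xyS /xzS !row_mxKl !row_mxKr.
have eY : st_hy (run s.+1 o) i = rsubmx (Of i (xyS s i o) (xi_y sm s 0%N i o)) +
    alpha *: rsubmx (Og i (xyS s i o) (psi_y sm s 0%N i o)).
  by rewrite /Of /Og /xyS !row_mxKl !row_mxKr.
have eZ : st_hz (run s.+1 o) i = rsubmx (Og i (xzS s i o) (psi_z sm s 0%N i o)).
  by rewrite /Og /xzS !row_mxKl !row_mxKr.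
rewrite eD eY eZ {eD eY eZ} /callnoise /= /eps /err /px /py -/(xyS s i o) -/(xzS s i o).
move: (Of i _ _) (Og i (xyS s i o) _) (Og i (xzS s i o) _) (Of i _ _) (Og i _ _) (Og i _ _) => a1 a2 a3 a4 a5 a6.
move: (Gf i (xyS s i o)) (Gg i (xyS s i o)) (Gg i (xzS s i o)) => b1 b2 b3.
rewrite !mulmx0 !addr0 !mul_spreadE !st3D !scale0r; congr st3.
- by apply/rowP => j; rewrite !mxE; ring.
- by apply/rowP => j; rewrite !mxE; ring.
- by apply/rowP => j; rewrite !mxE; ring.
Qed.

Definition measv k (f : O -> 'I_n -> 'rV[R]_k) := forall i j, measurable_fun setT (fun o => f o i 0 j).

Hypothesis hreg : regular_oracles pb.

Lemma meas_oracle_f i (w : O -> 'rV[R]_(p + q)) (V : O -> X) j : (forall l, measurable_fun setT (fun o => w o 0 l)) ->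
  measurable_fun setT V -> measurable_fun setT (fun o => Of i (w o) (V o) 0 j).
Proof.
move=> hw hV; have [_ _ h _] := hreg i.
apply: (measurableT_comp (h j) (g := fun o => ((w o : g_sigma_algebraType (@open 'rV[R]_(p + q))), V o))).
by apply: measurable_fun_pair => //; exact: measurable_rV.
Qed.
Lemma meas_oracle_g i (w : O -> 'rV[R]_(p + q)) (V : O -> Y) j : (forall l, measurable_fun setT (fun o => w o 0 l)) ->
  measurable_fun setT V -> measurable_fun setT (fun o => Og i (w o) (V o) 0 j).
Proof.
move=> hw hV; have [_ _ _ h] := hreg i.
apply: (measurableT_comp (h j) (g := fun o => ((w o : g_sigma_algebraType (@open 'rV[R]_(p + q))), V o))).
by apply: measurable_fun_pair => //; exact: measurable_rV.
Qed.

Lemma measvD k (f g : O -> 'I_n -> 'rV[R]_k) : measv f -> measv g -> measv (fun o i => f o i + g o i).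
Proof. by move=> hf hg i j; under eq_fun do rewrite mxE; exact: measurable_funD. Qed.
Lemma measvZ k c (f : O -> 'I_n -> 'rV[R]_k) : measv f -> measv (fun o i => c *: f o i).
Proof. by move=> hf i j; under eq_fun do rewrite mxE; exact: measurable_funM. Qed.
Lemma measvB k (f g : O -> 'I_n -> 'rV[R]_k) : measv f -> measv g -> measv (fun o i => f o i - g o i).
Proof.
move=> hf hg; apply: measvD => // i j; have := measvZ (-1) hg i j.
by congr measurable_fun; apply/funext => o; rewrite scaleN1r.
Qed.
Lemma measv_mix k (f : O -> 'I_n -> 'rV[R]_k) : measv f -> measv (fun o i => mix W (f o) i).
Proof.
move=> hf i j; rewrite /mix; under eq_fun do rewrite summxE.
by apply: measurable_sum => l; under eq_fun do rewrite mxE; exact: measurable_funM.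
Qed.
Lemma measv_row_mx (f : O -> 'I_n -> 'rV[R]_p) (g : O -> 'I_n -> 'rV[R]_q) : measv f -> measv g ->
  forall i l, measurable_fun setT (fun o => row_mx (f o i) (g o i) 0 l).
Proof.
move=> hf hg i l; case: (split_ordP l) => j ->.
  by under eq_fun do rewrite row_mxEl; exact: hf.
by under eq_fun do rewrite row_mxEr; exact: hg.
Qed.
Lemma measv_lsub (f : O -> 'I_n -> 'rV[R]_(p + q)) : measv f -> measv (fun o i => lsubmx (f o i)).
Proof. by move=> hf i j; under eq_fun do rewrite mxE; exact: hf. Qed.
Lemma measv_rsub (f : O -> 'I_n -> 'rV[R]_(p + q)) : measv f -> measv (fun o i => rsubmx (f o i)).
Proof. by move=> hf i j; under eq_fun do rewrite mxE; exact: hf. Qed.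

Lemma run_meas s : [/\ measv (fun o => st_x (run s o)), measv (fun o => st_v (run s o)) & measv (fun o => st_delta (run s o))] /\
  [/\ measv (fun o => st_y (run s o)), measv (fun o => st_uy (run s o)) & measv (fun o => st_hy (run s o))] /\
  [/\ measv (fun o => st_z (run s o)), measv (fun o => st_uz (run s o)) & measv (fun o => st_hz (run s o))].
Proof.
have mcst k (f : 'I_n -> 'rV[R]_k) : measv (fun _ : O => f) by move=> i j; exact: measurable_cst.
elim: s => [|s [[mx mv md] [[my muy mhy] [mz muz mhz]]]].
  by split; [split; exact: mcst|split; split; exact: mcst].
have mxy i l : measurable_fun setT (fun o => xyS s i o 0 l) by exact: (measv_row_mx mx my).
have mxz i l : measurable_fun setT (fun o => xzS s i o 0 l) by exact: (measv_row_mx mx mz).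
have mOf (V : 'I_n -> {mfun O >-> X}) : measv (fun o i => Of i (xyS s i o) (V i o)).
  by move=> i j; apply: meas_oracle_f => //; exact: measurable_funPT.
have mOg (V : 'I_n -> {mfun O >-> Y}) : measv (fun o i => Og i (xyS s i o) (V i o)).
  by move=> i j; apply: meas_oracle_g => //; exact: measurable_funPT.
have mOz (V : 'I_n -> {mfun O >-> Y}) : measv (fun o i => Og i (xzS s i o) (V i o)).
  by move=> i j; apply: meas_oracle_g => //; exact: measurable_funPT.
have MD : measv (fun o => st_delta (run s.+1 o)).
  have h := measvD (measv_lsub (mOf (xi_x sm s))) (measvZ alpha (measvB (measv_lsub (mOg (psi_x sm s))) (measv_lsub (mOz (psi_x sm s))))).
  move=> i j; have := h i j; congr measurable_fun; apply/funext => o.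
  by rewrite /Of /Og /xyS /xzS !row_mxKl !row_mxKr.
have MY : measv (fun o => st_hy (run s.+1 o)).
  have h := measvD (measv_rsub (mOf (xi_y sm s 0%N))) (measvZ alpha (measv_rsub (mOg (psi_y sm s 0%N)))).
  move=> i j; have := h i j; congr measurable_fun; apply/funext => o.
  by rewrite /Of /Og /xyS !row_mxKl !row_mxKr.
have MZ : measv (fun o => st_hz (run s.+1 o)).
  have h := measv_rsub (mOz (psi_z sm s 0%N)).
  move=> i j; have := h i j; congr measurable_fun; apply/funext => o.
  by rewrite /Og /xzS !row_mxKl !row_mxKr.
have MV := measvB (measvD (measv_mix mv) MD) md.
have MUY := measvB (measvD (measv_mix muy) MY) mhy.
have MUZ := measvB (measvD (measv_mix muz) MZ) mhz.
split; [split=> //|split; split=> //].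
- exact: (measvB (measv_mix mx) (measvZ etax MV)).
- exact: (measvB (measv_mix my) (measvZ etay MUY)).
- exact: (measvB (measv_mix mz) (measvZ etaz MUZ)).
Qed.

Lemma history_meas s : history run s `<=` @measurable _ O.
Proof.
apply: smallest_sub; first exact: sigma_algebra_measurable.
move=> A [c [r [i [_ hc]]] [B mB <-]].
have [[mx mv md] [[my muy mhy] [mz muz mhz]]] := run_meas r.
suff mc : measurable_fun setT c by exact: mc.
by case: hc => [[k [->|->|->]]|[[k [->|->|->]]|[k [->|->|->]]]].
Qed.

Definition geny s := gen (history run s) (call_events sm (T := 1%N) s).

Lemma past_history s (c : O -> R) pre : iterate_coords run s c -> past (geny s pre) c.
Proof.
move=> hc _ B mB; rewrite setTI; apply: sub_gen_smallest; left.
apply: sub_gen_smallest; exists c => //; exists B => //; by rewrite setTI.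
Qed.

Lemma iterate_coords_le r s (c : O -> R) : (r <= s)%N -> iterate_coords run r c -> iterate_coords run s c.
Proof. by move=> rs [t [i [tr h]]]; exists t, i; split => //; exact: leq_trans rs. Qed.

Lemma coords_x s i k : iterate_coords run s (fun o => st_x (run s o) i 0 k).
Proof. by exists s, i; split => //; left; exists k; constructor 1. Qed.
Lemma coords_delta s i k : iterate_coords run s (fun o => st_delta (run s o) i 0 k).
Proof. by exists s, i; split => //; left; exists k; constructor 3. Qed.
Lemma coords_y s i k : iterate_coords run s (fun o => st_y (run s o) i 0 k).
Proof. by exists s, i; split => //; right; left; exists k; constructor 1. Qed.
Lemma coords_hy s i k : iterate_coords run s (fun o => st_hy (run s o) i 0 k).
Proof. by exists s, i; split => //; right; left; exists k; constructor 3. Qed.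
Lemma coords_z s i k : iterate_coords run s (fun o => st_z (run s o) i 0 k).
Proof. by exists s, i; split => //; right; right; exists k; constructor 1. Qed.
Lemma coords_hz s i k : iterate_coords run s (fun o => st_hz (run s o) i 0 k).
Proof. by exists s, i; split => //; right; right; exists k; constructor 3. Qed.

Lemma past_st3 F (a : O -> 'rV[R]_p) (b c : O -> 'rV[R]_q) : pastm F a -> pastm F b -> pastm F c ->
  pastm F (fun o => st3 (a o) (b o) (c o)).
Proof.
move=> ha hb hc i j; rewrite (ord1 i) /st3 /past; case: (split_ordP j) => l ->.
  by under eq_fun do rewrite row_mxEl; exact: ha.
under eq_fun do rewrite row_mxEr; case: (split_ordP l) => l' ->.
  by under eq_fun do rewrite row_mxEl; exact: hb.
by under eq_fun do rewrite row_mxEr; exact: hc.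
Qed.

Lemma past_rows F k (v : O -> 'I_n -> 'rV[R]_k) : (forall i, pastm F (fun o => v o i)) -> pastm F (fun o => rows (v o)).
Proof. by move=> h i j; rewrite /past; under eq_fun do rewrite mxE; exact: h. Qed.

Lemma wS_past r s : (r <= s)%N -> pastm (geny s [::]) (wS r).
Proof.
move=> rs; apply: past_rows => i; apply: past_st3 => a b; rewrite (ord1 a); apply: past_history;
  apply: iterate_coords_le rs _; [exact: coords_x|exact: coords_y|exact: coords_z].
Qed.
Lemma HS_past r s : (r <= s)%N -> pastm (geny s [::]) (HS r).
Proof.
move=> rs; apply: past_rows => i; apply: past_st3; apply: pastmZ => a b; rewrite (ord1 a); apply: past_history;
  apply: iterate_coords_le rs _; [exact: coords_delta|exact: coords_hy|exact: coords_hz].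
Qed.

Lemma xyS_past s i pre : pastm (geny s pre) (xyS s i).
Proof.
move=> a b; rewrite (ord1 a) /xyS /past; case: (split_ordP b) => l ->.
  by under eq_fun do rewrite row_mxEl; apply: past_history; exact: coords_x.
by under eq_fun do rewrite row_mxEr; apply: past_history; exact: coords_y.
Qed.
Lemma xzS_past s i pre : pastm (geny s pre) (xzS s i).
Proof.
move=> a b; rewrite (ord1 a) /xzS /past; case: (split_ordP b) => l ->.
  by under eq_fun do rewrite row_mxEl; apply: past_history; exact: coords_x.
by under eq_fun do rewrite row_mxEr; apply: past_history; exact: coords_z.
Qed.

End Run.

(** * The oracle errors are fresh noise *)

Section Fresh.
Context {R : realType} {n p q : nat}
  {dO : measure_display} {O : measurableType dO}
  {dX : measure_display} {X : measurableType dX}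
  {dY : measure_display} {Y : measurableType dY}.
Variables (P : probability O R) (pb : problem R n p q X Y) (W : 'M[R]_n) (sm : samples R n O X Y)
  (d : init_data R n p q) (alpha etax etay etaz : R).
Let run := dsgda_gt pb W sm alpha etax etay etaz 1 d.
Local Notation calls := (@call n 1%N).
Hypothesis hreg : regular_oracles pb.
Hypothesis hunb : unbiased_oracles pb.
Variables (sf sgv : R).
Hypothesis hvar : bounded_variance pb sf sgv.
Variable s : nat.
Hypothesis hfresh : [/\ forall t i, (t < 1)%N ->
        [/\ cond_law P (history run s) (xi_y sm s t i) (lawf pb i),
            cond_law P (history run s) (psi_y sm s t i) (lawg pb i) &
            cond_law P (history run s) (psi_z sm s t i) (lawg pb i)],
      forall i, cond_law P (history run s) (xi_x sm s i) (lawf pb i) /\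
                cond_law P (history run s) (psi_x sm s i) (lawg pb i) &
      cond_independent P (history run s) (call_events sm (T := 1%N) s)].

Local Notation Hs := (history run s).
Local Notation Ek := (call_events sm (T := 1%N) s).
Let HM : Hs `<=` @measurable _ O. Proof. exact: history_meas. Qed.
Let HT : Hs setT. Proof. exact: (@measurableT _ (g_sigma_algebraType _)). Qed.
Let HI : setI_closed Hs. Proof. by move=> A B; exact: (@measurableI _ (g_sigma_algebraType _)). Qed.

Lemma preimage_events dZ (Z : measurableType dZ) (V : {mfun O >-> Z}) :
  [/\ preimage_set_system setT V measurable `<=` @measurable _ O,
      setI_closed (preimage_set_system setT V measurable) & preimage_set_system setT V measurable setT].
Proof.
split.
- by move=> A [B mB <-]; apply: measurable_funPT.
- move=> A A' [B mB <-] [B' mB' <-]; exists (B `&` B'); first exact: measurableI.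
  by rewrite !setTI preimage_setI.
- by exists setT => //; rewrite preimage_setT setTI.
Qed.

Lemma events_ok k : [/\ Ek k `<=` @measurable _ O, setI_closed (Ek k) & Ek k setT].
Proof. by case: k => [[[[a|a]|a]|a]|a]; exact: preimage_events. Qed.

Lemma law_marginal dZ (Z : measurableType dZ) (V : {mfun O >-> Z}) (mu : probability Z R) :
  cond_law P Hs V mu -> forall B, measurable B -> P (V @^-1` B) = mu B.
Proof.
move=> h B mB; have mVB : measurable (V @^-1` B) by rewrite -[_ @^-1` _]setTI; exact: measurable_funPT.
have [e _] := cond_prob_cst HM HT mVB (h B mB).
by rewrite -[RHS]fineK ?fin_num_measure // e fineK // fin_num_measure.
Qed.

Lemma law_event dZ (Z : measurableType dZ) (V : {mfun O >-> Z}) (mu : probability Z R) :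
  cond_law P Hs V mu -> forall B, preimage_set_system setT V measurable B -> cond_prob P Hs B (cst (fine (P B))).
Proof.
move=> h B [C mC <-]; rewrite setTI (law_marginal h mC); exact: h.
Qed.

Lemma call_event k B : Ek k B -> cond_prob P Hs B (cst (fine (P B))).
Proof.
have [h1 h2 _] := hfresh.
case: k => [[[[a|a]|a]|a]|a] /=.
- by have [h _ _] := h1 a.1 a.2 (ltn_ord a.1); exact: law_event h _.
- by have [_ h _] := h1 a.1 a.2 (ltn_ord a.1); exact: law_event h _.
- by have [_ _ h] := h1 a.1 a.2 (ltn_ord a.1); exact: law_event h _.
- by have [h _] := h2 a; exact: law_event h _.
- by have [_ h] := h2 a; exact: law_event h _.
Qed.

(** The conditional laws are constant, so conditional independence given the
    history makes the history and all the calls mutually independent. *)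
Lemma calls_independent A (B : calls -> set O) : Hs A -> (forall k, Ek k (B k)) ->
  P (A `&` \bigcap_(k in [set: calls]) B k) = (P A * \prod_k P (B k))%E.
Proof.
move=> hA hB; have [_ _ hi] := hfresh.
have mB k : measurable (B k) by have [h _ _] := events_ok k; exact: h.
have h := hi B (fun k => cst (fine (P (B k)))) hB (fun k => call_event (hB k)).
have mD : measurable (\bigcap_(k in [set: calls]) B k).
  by apply: fin_bigcap_measurable; [exact: finite_finset|move=> k _; exact: mB].
have [e1 e2] := cond_prob_cst HM HT mD (h : cond_prob P Hs _ (cst (\prod_k fine (P (B k))))).
rewrite e2 //; congr (_ * _)%E; rewrite -[LHS]fineK ?fin_num_measure // -e1 -prodEFin.
by apply: eq_bigr => k _; rewrite fineK // fin_num_measure.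
Qed.

Local Notation geny := (geny pb W sm d alpha etax etay etaz s).

Lemma call_independent pre k dZ (Z : measurableType dZ) (V : {mfun O >-> Z}) (mu : probability Z R) :
  k \notin pre -> Ek k = preimage_set_system setT V measurable -> cond_law P Hs V mu ->
  forall A B, <<s geny pre >> A -> measurable B -> P (A `&` V @^-1` B) = (P A * mu B)%E.
Proof.
move=> hk eE hl A B hA mB; rewrite -(law_marginal hl mB).
have EM j : Ek j `<=` @measurable _ O by have [] := events_ok j.
have EI j : setI_closed (Ek j) by have [] := events_ok j.
have ET j : Ek j setT by have [] := events_ok j.
apply: (gen_indep HM EM HI HT EI ET calls_independent hk hA).
by rewrite eE; exists B => //; rewrite setTI.
Qed.

Lemma geny_meas pre : geny pre `<=` @measurable _ O.
Proof. by apply: gen_meas => // k; have [] := events_ok k. Qed.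

Variables (L B sg : R).
Hypotheses (lf : forall i, lip L (Gf pb i)) (lg : forall i, lip L (Gg pb i)).
Hypotheses (B0 : 0 <= B) (ex0 : 0 <= etax) (ey0 : 0 <= etay) (ez0 : 0 <= etaz) (a0 : 0 <= alpha).
Hypotheses (exB : etax <= 4 * B) (eyB : etay <= 4 * B) (ezB : etaz <= 4 * B) (axB : alpha * etax <= 4 * B) (ayB : alpha * etay <= 4 * B).
Hypotheses (sgf : 4 * (4 * B) ^+ 2 * sf ^+ 2 <= sg ^+ 2) (sgg : 4 * (4 * B) ^+ 2 * sgv ^+ 2 <= sg ^+ 2).

Let B4 : 0 <= 4 * B. Proof. by rewrite mulr_ge0. Qed.
Let sq c : 0 <= c -> c <= 4 * B -> c ^+ 2 <= (4 * B) ^+ 2.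
Proof. by move=> c0 h; rewrite ler_pXn2r ?nnegrE. Qed.

Lemma oracle_f_ok i : [/\ forall w j, (lawf pb i).-integrable setT (fun v => (Of pb i w v 0 j)%:E),
    forall w j, (\int[lawf pb i]_v (Of pb i w v 0 j)%:E = (Gf pb i w 0 j)%:E)%E &
    forall w, (\int[lawf pb i]_v (fnorm (Of pb i w v - Gf pb i w) ^+ 2)%:E <= (sf ^+ 2)%:E)%E].
Proof.
split=> [w j|w j|w].
- by have [h _ _ _] := hunb i (lsubmx w) (rsubmx w) j.
- by have [_ h _ _] := hunb i (lsubmx w) (rsubmx w) j; move: h; rewrite unlock hsubmxK.
- by have [h _] := hvar i (lsubmx w) (rsubmx w); move: h; rewrite unlock hsubmxK.
Qed.
Lemma oracle_g_ok i : [/\ forall w j, (lawg pb i).-integrable setT (fun v => (Og pb i w v 0 j)%:E),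
    forall w j, (\int[lawg pb i]_v (Og pb i w v 0 j)%:E = (Gg pb i w 0 j)%:E)%E &
    forall w, (\int[lawg pb i]_v (fnorm (Og pb i w v - Gg pb i w) ^+ 2)%:E <= (sgv ^+ 2)%:E)%E].
Proof.
split=> [w j|w j|w].
- by have [_ _ h _] := hunb i (lsubmx w) (rsubmx w) j.
- by have [_ _ _ h] := hunb i (lsubmx w) (rsubmx w) j; move: h; rewrite unlock hsubmxK.
- by have [_ h] := hvar i (lsubmx w) (rsubmx w); move: h; rewrite unlock hsubmxK.
Qed.

Let sp c1 c2 c3 : c1 ^+ 2 <= (4 * B) ^+ 2 -> c2 ^+ 2 + c3 ^+ 2 <= (4 * B) ^+ 2 ->
  forall u : 'rV[R]_(p + q), fnorm (u *m spread c1 c2 c3) <= 4 * B * fnorm u.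
Proof. by move=> h1 h2 u; exact: spread_norm. Qed.
Let z2 : 0 ^+ 2 <= (4 * B) ^+ 2. Proof. by rewrite expr0n sqr_ge0. Qed.
Let f0 : forall u : 'rV[R]_(p + q), fnorm (u *m (0 : 'M[R]_(p + q, p + (q + q)))) <= 4 * B * fnorm u.
Proof. by move=> u; rewrite mulmx0 fnorm0 mulr_ge0. Qed.
Let fy : forall u : 'rV[R]_(p + q), fnorm (u *m spread 0 etay 0) <= 4 * B * fnorm u.
Proof. by apply: sp => //; rewrite expr0n addr0; exact: sq. Qed.
Let fay : forall u : 'rV[R]_(p + q), fnorm (u *m spread 0 (alpha * etay) 0) <= 4 * B * fnorm u.
Proof. by apply: sp => //; rewrite expr0n addr0; apply: sq => //; rewrite mulr_ge0. Qed.
Let fz : forall u : 'rV[R]_(p + q), fnorm (u *m spread 0 0 etaz) <= 4 * B * fnorm u.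
Proof. by apply: sp => //; rewrite expr0n add0r; exact: sq. Qed.
Let fx : forall u : 'rV[R]_(p + q), fnorm (u *m spread etax 0 0) <= 4 * B * fnorm u.
Proof. by apply: sp; [exact: sq|rewrite expr0n addr0 sqr_ge0]. Qed.
Let fax : forall u : 'rV[R]_(p + q), fnorm (u *m spread (alpha * etax) 0 0) <= 4 * B * fnorm u.
Proof. by apply: sp; [apply: sq => //; rewrite mulr_ge0|rewrite expr0n addr0 sqr_ge0]. Qed.
Let fnx : forall u : 'rV[R]_(p + q), fnorm (u *m spread (- (alpha * etax)) 0 0) <= 4 * B * fnorm u.
Proof. by apply: sp; [rewrite sqrrN; apply: sq => //; rewrite mulr_ge0|rewrite expr0n addr0 sqr_ge0]. Qed.

Definition call_facts pre (e : O -> 'rV[R]_(p + (q + q))) :=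
  [/\ forall y j, past (geny pre) y -> L2 P y -> Ex P (fun o => y o * e o 0 j) = 0,
      forall y, past (geny pre) y -> (forall o, 0 <= y o) -> intg P y ->
        intg P (fun o => y o * fnorm (e o) ^+ 2) /\ Ex P (fun o => y o * fnorm (e o) ^+ 2) <= sg ^+ 2 * Ex P y &
      L2m P e].

Lemma facts_f pre k i (V : {mfun O >-> X}) w1 w2 F1 F2 : k \notin pre -> Ek k = preimage_set_system setT V measurable ->
  cond_law P Hs V (lawf pb i) -> pastm (geny pre) w1 -> pastm (geny pre) w2 ->
  (forall u : 'rV[R]_(p + q), fnorm (u *m F1) <= 4 * B * fnorm u) ->
  (forall u : 'rV[R]_(p + q), fnorm (u *m F2) <= 4 * B * fnorm u) ->
  call_facts pre (fun o => eps (Of pb i) (Gf pb i) w1 w2 F1 F2 o (V o)).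
Proof.
move=> hk eE hl p1 p2 h1 h2; have [ho1 ho2 ho3] := oracle_f_ok i.
have [_ _ gm _] := hreg i.
have hi := call_independent hk eE hl.
have mV : measurable_fun setT V by exact: measurable_funPT.
split.
- move=> y j py ly; exact: (eps_orth (Gr := Of pb i) gm ho1 ho2 ho3 (lf i) (@geny_meas pre) mV p1 p2 h1 h2 B4 sgf hi _ py ly).
- move=> y; exact: (eps_second (Gr := Of pb i) gm ho1 ho3 (lf i) (@geny_meas pre) mV p1 p2 h1 h2 B4 sgf hi).
- exact: (eps_L2 (Gr := Of pb i) gm ho1 ho3 (lf i) (@geny_meas pre) mV p1 p2 h1 h2 B4 sgf hi).
Qed.

Lemma facts_g pre k i (V : {mfun O >-> Y}) w1 w2 F1 F2 : k \notin pre -> Ek k = preimage_set_system setT V measurable ->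
  cond_law P Hs V (lawg pb i) -> pastm (geny pre) w1 -> pastm (geny pre) w2 ->
  (forall u : 'rV[R]_(p + q), fnorm (u *m F1) <= 4 * B * fnorm u) ->
  (forall u : 'rV[R]_(p + q), fnorm (u *m F2) <= 4 * B * fnorm u) ->
  call_facts pre (fun o => eps (Og pb i) (Gg pb i) w1 w2 F1 F2 o (V o)).
Proof.
move=> hk eE hl p1 p2 h1 h2; have [ho1 ho2 ho3] := oracle_g_ok i.
have [_ _ _ gm] := hreg i.
have hi := call_independent hk eE hl.
have mV : measurable_fun setT V by exact: measurable_funPT.
split.
- move=> y j py ly; exact: (eps_orth (Gr := Og pb i) gm ho1 ho2 ho3 (lg i) (@geny_meas pre) mV p1 p2 h1 h2 B4 sgg hi _ py ly).
- move=> y; exact: (eps_second (Gr := Og pb i) gm ho1 ho3 (lg i) (@geny_meas pre) mV p1 p2 h1 h2 B4 sgg hi).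
- exact: (eps_L2 (Gr := Og pb i) gm ho1 ho3 (lg i) (@geny_meas pre) mV p1 p2 h1 h2 B4 sgg hi).
Qed.

Lemma call_facts_all pre k : k \notin pre -> call_facts pre (callnoise pb W sm d alpha etax etay etaz s k).
Proof.
have [h1 h2 _] := hfresh.
have pxy i : pastm (geny pre) (xyS pb W sm d alpha etax etay etaz s i) by exact: xyS_past.
have pxz i : pastm (geny pre) (xzS pb W sm d alpha etax etay etaz s i) by exact: xzS_past.
case: k => [[[[a|a]|a]|a]|a] hk /=.
- have [h _ _] := h1 a.1 a.2 (ltn_ord a.1).
  exact: (facts_f hk erefl h (pxy _) (pxy _) fy f0).
- have [_ h _] := h1 a.1 a.2 (ltn_ord a.1).
  exact: (facts_g hk erefl h (pxy _) (pxy _) fay f0).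
- have [_ _ h] := h1 a.1 a.2 (ltn_ord a.1).
  exact: (facts_g hk erefl h (pxz _) (pxz _) fz f0).
- have [h _] := h2 a.
  exact: (facts_f hk erefl h (pxy _) (pxy _) fx f0).
- have [_ h] := h2 a.
  exact: (facts_g hk erefl h (pxy _) (pxz _) fax fnx).
Qed.

Lemma callnoise_past pre k : pastm (geny (k :: pre)) (callnoise pb W sm d alpha etax etay etaz s k).
Proof.
have sub : Ek k `<=` geny (k :: pre) by move=> A EA; right; exists k => //=; rewrite inE eqxx.
have pxy i : pastm (geny (k :: pre)) (xyS pb W sm d alpha etax etay etaz s i) by exact: xyS_past.
have pxz i : pastm (geny (k :: pre)) (xzS pb W sm d alpha etax etay etaz s i) by exact: xzS_past.
have gf i : forall j, measurable_fun setT (fun a : g_sigma_algebraType (@open 'rV[R]_(p + q)) * X =>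
    Of pb i (a.1 : 'rV[R]_(p + q)) a.2 0 j) by have [_ _ h _] := hreg i.
have gg i : forall j, measurable_fun setT (fun a : g_sigma_algebraType (@open 'rV[R]_(p + q)) * Y =>
    Og pb i (a.1 : 'rV[R]_(p + q)) a.2 0 j) by have [_ _ _ h] := hreg i.
case: k sub pxy pxz => [[[[a|a]|a]|a]|a] sub pxy pxz.
- exact: (eps_past (gf a.2) (lf a.2) _ _ (pxy _) (pxy _) sub).
- exact: (eps_past (gg a.2) (lg a.2) _ _ (pxy _) (pxy _) sub).
- exact: (eps_past (gg a.2) (lg a.2) _ _ (pxz _) (pxz _) sub).
- exact: (eps_past (gf a) (lf a) _ _ (pxy _) (pxy _) sub).
- exact: (eps_past (gg a) (lg a) _ _ (pxy _) (pxz _) sub).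
Qed.

Theorem run_fresh_noise : fresh_noise P sg geny (callnoise pb W sm d alpha etax etay etaz s).
Proof.
split.
- exact: geny_meas.
- by move=> k pre; exact: gen_cons.
- by move=> k pre y j hk; have [h _ _] := call_facts_all hk; exact: h.
- by move=> k pre y hk; have [_ h _] := call_facts_all hk; exact: h.
- by move=> k pre; exact: callnoise_past.
- by move=> k; have [_ _ h] := @call_facts_all [::] k isT.
Qed.

End Fresh.

(** * Averages over the agents and the start of the run *)

Section Averages.
Context {R : realType} {n m : nat}.
Hypothesis n0 : 0 < n%:R :> R.
Let ni0 : 0 <= n%:R^-1 :> R. Proof. by rewrite invr_ge0 ltW. Qed.

Lemma mean_le (a : 'I_n -> R) c : (forall i, a i <= c) -> n%:R^-1 * \sum_i a i <= c.
Proof.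
move=> h; rewrite ler_pdivrMl //; apply: le_trans (ler_sum _ (fun i _ => h i)) _.
by rewrite sumr_const card_ord mulr_natl.
Qed.

Lemma lip_meanG k L (G : 'I_n -> 'rV[R]_m -> 'rV[R]_k) : (forall i, lip L (G i)) ->
  lip L (fun w => n%:R^-1 *: \sum_i G i w).
Proof.
move=> h w w'; rewrite -scalerBr fnormZ ger0_norm // -sumrB.
apply: le_trans (ler_wpM2l ni0 (ler_fnorm_sum _ _ _)) _.
by apply: mean_le => i; exact: h.
Qed.

Lemma taylor_meanG k L (G : 'I_n -> 'rV[R]_m -> 'rV[R]_k) J : (forall i, taylor L (G i) (J i)) ->
  taylor L (fun w => n%:R^-1 *: \sum_i G i w) (fun w => n%:R^-1 *: \sum_i J i w).
Proof.
move=> h w v; rewrite -scalemxAr -!scalerBr fnormZ ger0_norm // mulmx_sumr -!sumrB.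
apply: le_trans (ler_wpM2l ni0 (ler_fnorm_sum _ _ _)) _.
by apply: mean_le => i; exact: h.
Qed.

Lemma qb_meanG C (h : 'I_n -> 'rV[R]_m -> R) G : (forall i, qb C (h i) (G i)) ->
  qb C (fun w => n%:R^-1 * \sum_i h i w) (fun w => n%:R^-1 *: \sum_i G i w).
Proof.
move=> H w v; rewrite dotpZl dotp_suml -!mulrBr normrM ger0_norm // -!sumrB.
apply: le_trans (ler_wpM2l ni0 (ler_norm_sum _ _ _)) _.
by apply: mean_le => i; exact: H.
Qed.

Lemma strconv_mean mu (h : 'I_n -> 'rV[R]_m -> R) : (forall i, strongly_convex mu (h i)) ->
  strongly_convex mu (fun w => n%:R^-1 * \sum_i h i w).
Proof.
move=> H w w' t t01; rewrite -subr_le0.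
have HE i := H i w w' t t01; move: (mu / 2 * t * (1 - t) * fnorm (w - w') ^+ 2) HE => E HE.
have -> : n%:R^-1 * \sum_i h i (t *: w + (1 - t) *: w') - (t * (n%:R^-1 * \sum_i h i w) + (1 - t) * (n%:R^-1 * \sum_i h i w') - E)
  = n%:R^-1 * \sum_i (h i (t *: w + (1 - t) *: w') - (t * h i w + (1 - t) * h i w' - E)).
  have s1 : \sum_(i < n) E = n%:R * E by rewrite sumr_const card_ord mulr_natl.
  rewrite !sumrB big_split /= -!mulr_sumr s1; field; exact: lt0r_neq0.
by apply: mean_le => i; rewrite subr_le0; exact: HE.
Qed.

End Averages.

Section Smooth.
Context {R : realType} {n p q : nat}
  {dX : measure_display} {X : measurableType dX} {dY : measure_display} {Y : measurableType dY}.
Variable pb : problem R n p q X Y.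
Variables (lf0 lf1 lf2 lg1 lg2 mu : R).
Hypothesis hs : smoothness pb lf0 lf1 lf2 lg1 lg2 mu.
Hypothesis n0 : 0 < n%:R :> R.

Definition Lmax : R := 1 + `|lf0| + `|lf1| + `|lf2| + `|lg1| + `|lg2|.
Lemma Lmax_bounds : [/\ 1 <= Lmax, lf0 <= Lmax, lf1 <= Lmax, lf2 <= Lmax & lg1 <= Lmax /\ lg2 <= Lmax].
Proof.
have h (x : R) := conj (normr_ge0 x) (ler_norm x).
have [? ?] := h lf0; have [? ?] := h lf1; have [? ?] := h lf2; have [? ?] := h lg1; have [? ?] := h lg2.
by rewrite /Lmax; split; [lra|lra|lra|lra|split; lra].
Qed.

Lemma lipgrad_mono m (a b : R) (h : 'rV[R]_m -> R) : a <= b -> lipschitz_gradient a h -> lipschitz_gradient b h.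
Proof. by move=> ab [d l]; split => //; exact: lip_mono ab l. Qed.
Lemma liphess_mono m (a b : R) (h : 'rV[R]_m -> R) : a <= b -> lipschitz_hessian a h -> lipschitz_hessian b h.
Proof. by move=> ab [d l]; split => // w w'; apply: le_trans (l w w') _; rewrite ler_wpM2r. Qed.

Lemma agent_smooth i : [/\ qb Lmax (joint (fi pb i)) (Gf pb i), lip Lmax (Gf pb i),
   taylor Lmax (Gf pb i) (hessian (joint (fi pb i))) &
   forall w w', fnorm (hessian (joint (fi pb i)) w - hessian (joint (fi pb i)) w') <= Lmax * fnorm (w - w')] /\
  [/\ qb Lmax (joint (gi pb i)) (Gg pb i), lip Lmax (Gg pb i),
   taylor Lmax (Gg pb i) (hessian (joint (gi pb i))) &
   forall w w', fnorm (hessian (joint (gi pb i)) w - hessian (joint (gi pb i)) w') <= Lmax * fnorm (w - w')].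
Proof.
have [b0 b1 b2 b3 [b4 b5]] := Lmax_bounds; have L0 : 0 <= Lmax by exact: le_trans b0.
have [_ [gf hf] [gg hg] _] := hs i.
have {}gf := lipgrad_mono b2 gf; have {}gg := lipgrad_mono b4 gg.
have {}hf := liphess_mono b3 hf; have {}hg := liphess_mono b5 hg.
split; split.
- exact: lipgrad_qb.
- by case: gf.
- exact: liphess_taylor.
- by case: hf.
- exact: lipgrad_qb.
- by case: gg.
- exact: liphess_taylor.
- by case: hg.
Qed.

Definition Gfbar := meanG (Gf pb).
Definition Ggbar := meanG (Gg pb).
Definition Jgbar w := n%:R^-1 *: \sum_i hessian (joint (gi pb i)) w.

Lemma mean_smooth : [/\ qb Lmax (joint (favg pb)) Gfbar, qb Lmax (joint (gavg pb)) Ggbar,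
  lip Lmax Gfbar, lip Lmax Ggbar & taylor Lmax Ggbar Jgbar].
Proof.
split.
- by apply: (qb_meanG n0 (h := fun i => joint (fi pb i))) => i; have [[]] := agent_smooth i.
- by apply: (qb_meanG n0 (h := fun i => joint (gi pb i))) => i; have [_ []] := agent_smooth i.
- by apply: (lip_meanG n0) => i; have [[]] := agent_smooth i.
- by apply: (lip_meanG n0) => i; have [_ []] := agent_smooth i.
- by apply: (taylor_meanG n0) => i; have [_ []] := agent_smooth i.
Qed.

Lemma favg_lip x y y' : `|favg pb x y - favg pb x y'| <= Lmax * fnorm (y - y').
Proof.
rewrite /favg -mulrBr normrM ger0_norm ?invr_ge0 ?(ltW n0) // -sumrB.
apply: le_trans (ler_wpM2l _ (ler_norm_sum _ _ _)) _; first by rewrite invr_ge0 ltW.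
apply: (mean_le n0) => i; have [h _ _ _] := hs i; apply: le_trans (h x y y') _.
by rewrite ler_wpM2r //; have [] := Lmax_bounds.
Qed.

Lemma gavg_strconv x : strongly_convex mu (gavg pb x).
Proof. by apply: (strconv_mean n0) => i; have [_ _ _ h] := hs i; exact: h. Qed.

(** The maximum over z of the Lagrangian is attained at the lower-level solution, so
    that [Omega] is f + a g up to a constant. *)
Lemma penalty_solE (mu0 : 0 < mu) a x : 0 <= a -> penalty_sol pb a x = ya (favg pb) (gavg pb) a x.
Proof.
move=> a0; have [qf qg lf lg tg] := mean_smooth; have [L1 _ _ _ _] := Lmax_bounds.
have LE y z : Lagr pb a x y z = pen (favg pb) (gavg pb) a x y - a * gavg pb x z.
  by rewrite /Lagr /pen /favg /gavg big_split /= -mulr_sumr sumrB; ring.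
have zmin z : gavg pb x (zs (gavg pb) x) <= gavg pb x z.
  exact: (psol_min (mu2 mu0) qg (g_first qg gavg_strconv)).
have OE y : Omega pb a x y = pen (favg pb) (gavg pb) a x y - a * gavg pb x (zs (gavg pb) x).
  have ub : ubound [set Lagr pb a x y z | z in [set: 'rV[R]_q]] (pen (favg pb) (gavg pb) a x y - a * gavg pb x (zs (gavg pb) x)).
    by move=> _ [z _ <-]; rewrite LE lerD2l lerN2 ler_wpM2l.
  apply/eqP; rewrite eq_le; apply/andP; split.
    by apply: ge_sup => //; exists (Lagr pb a x y 0); exists 0.
  by apply: ub_le_sup; [eexists; exact: ub|exists (zs (gavg pb) x) => //; rewrite LE].
rewrite /penalty_sol /ya /psol /argmin; congr get; apply/seteqP.
by split=> y h y'; have := h y'; rewrite !OE lerD2r.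
Qed.

Lemma meanG_Gst a ex ey ez w : meanG (Gst (Gf pb) (Gg pb) a ex ey ez) w = mdir Gfbar Ggbar a ex ey ez w.
Proof.
have e (i : 'I_n) : meanG (Gst (Gf pb) (Gg pb) a ex ey ez) w =
    Gst (fun _ : 'I_n => Gfbar) (fun=> Ggbar) a ex ey ez i w.
  rewrite /meanG /Gst !big_split /= !scalerDr -!mulmx_suml !scalemxAl //.
have i0 : 'I_n by apply: (@Ordinal n 0); rewrite -(ltr0n R).
rewrite (e i0) [in LHS](st3P w) Gst_st3 /mdir /dhat /Gpen /px /py; congr st3.
- by congr (_ *: _); apply/rowP => j; rewrite !mxE; ring.
- by congr (_ *: _); apply/rowP => j; rewrite !mxE.
Qed.

End Smooth.

Section Start.
Context {R : realType} {n p q : nat}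
  {dO : measure_display} {O : measurableType dO}
  {dX : measure_display} {X : measurableType dX}
  {dY : measure_display} {Y : measurableType dY}.
Variables (pb : problem R n p q X Y) (W : 'M[R]_n) (rho : R) (sm : samples R n O X Y)
  (d : init_data R n p q) (a ex ey ez : R).
Hypothesis hW : mixing_matrix W rho.

Lemma rows_cst m (v : 'rV[R]_m) : rows (fun _ : 'I_n => v) = const_mx 1 *m v.
Proof. by apply/matrixP => i j; rewrite !mxE big_ord1 mxE mul1r. Qed.

Lemma start_consensus o : dev (wS pb W sm d a ex ey ez 0 o) = 0.
Proof. by rewrite /wS /= rows_cst (dev_const hW). Qed.

Lemma start_mean o : mrow (wS pb W sm d a ex ey ez 0 o) = st3 (x0 d) (y0 d) (z0 d).
Proof. by rewrite /wS /= rows_cst (mrow_const hW). Qed.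

Lemma start_tracking o : admissible_init d ->
  mrow (US pb W sm d a ex ey ez 0 o) = mrow (HS pb W sm d a ex ey ez 0 o).
Proof. by move=> [hy hz]; rewrite !mrow_rows !avg_st3 /= !avgZ hy hz. Qed.

Lemma fnorm_rows k (v : 'I_n -> 'rV[R]_k) : fnorm (rows v) ^+ 2 = \sum_i fnorm (v i) ^+ 2.
Proof. by rewrite fnorm_sq_rows; apply: eq_bigr => i _; rewrite row_rows. Qed.

Lemma fnorm_sqD3 m k (A B C : 'M[R]_(m, k)) : fnorm (A + B + C) ^+ 2 <= 3 * (fnorm A ^+ 2 + fnorm B ^+ 2 + fnorm C ^+ 2).
Proof.
have h1 := ler_fnormD (A + B) C; have h2 := ler_fnormD A B.
have h3 : fnorm (A + B + C) ^+ 2 <= (fnorm A + fnorm B + fnorm C) ^+ 2.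
  by rewrite ler_pXn2r ?nnegrE ?addr_ge0 //; lra.
apply: le_trans h3 _; have := sqr_ge0 (fnorm A - fnorm B); have := sqr_ge0 (fnorm A - fnorm C).
have := sqr_ge0 (fnorm B - fnorm C); rewrite !expr2; lra.
Qed.

Lemma start_algebra (b e1 e2 e3 e4 e5 e6 e7 : R) : 0 <= b -> 0 <= e1 -> 0 <= e2 -> 0 <= e3 -> 0 <= e4 ->
  b * (e1 + e3) + 3 * (b * (e5 + e6 + e7)) + b * (e2 + e4) <= b * (3 * (e1 + e2 + e3 + e4 + e5 + e6 + e7)).
Proof.
move=> b0 h1 h2 h3 h4; have f : 0 <= b * (e1 + e2 + e3 + e4) by rewrite mulr_ge0 // !addr_ge0.
lra.
Qed.

Variables (B D0 : R).
Hypotheses (B0 : 0 <= B) (ex0 : 0 <= ex) (ey0 : 0 <= ey) (ez0 : 0 <= ez) (a0 : 0 <= a).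
Hypotheses (exB : ex <= 4 * B) (eyB : ey <= 4 * B) (ezB : ez <= 4 * B) (axB : a * ex <= 4 * B) (ayB : a * ey <= 4 * B).

Let Gs := Gst (Gf pb) (Gg pb) a ex ey ez.

(** Before the first iteration the trackers, the directions and the gradients are
    those of the initial data, scaled by step sizes at most 4 B. *)
Lemma start_disagreement o : init_size pb d <= D0 ->
  fnorm (W *m dev (US pb W sm d a ex ey ez 0 o) +
    dev (rowwise Gs (wS pb W sm d a ex ey ez 0 o) - HS pb W sm d a ex ey ez 0 o)) ^+ 2 <= 144 * `|D0| * n%:R * B ^+ 2.
Proof.
move=> hD; have n0 : 0 < n%:R :> R := nR0 hW.
have rho1 : rho <= 1 by have /andP[_ /ltW] := rho_bounds hW.
have B4 : 0 <= 4 * B by rewrite mulr_ge0.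
have sq c : 0 <= c -> c <= 4 * B -> c ^+ 2 <= (4 * B) ^+ 2 by move=> c0 h; rewrite ler_pXn2r ?nnegrE.
set U0 := US _ _ _ _ _ _ _ _ _ _; set H0 := HS _ _ _ _ _ _ _ _ _ _; set G0 := rowwise _ _.
have hWU : fnorm (W *m dev U0) <= fnorm U0.
  apply: le_trans (W_contract hW (mrow_dev hW U0)) _; apply: le_trans (fnorm_dev hW U0).
  by rewrite ler_piMl.
have -> : W *m dev U0 + dev (G0 - H0) = W *m dev U0 + dev G0 + - dev H0 by rewrite devB addrA.
apply: le_trans (fnorm_sqD3 _ _ _) _; rewrite fnormN.
have mono k (A B' : 'M[R]_(n, k)) : fnorm A <= fnorm B' -> fnorm A ^+ 2 <= fnorm B' ^+ 2.
  by move=> h; rewrite ler_pXn2r ?nnegrE.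
have m1 := mono _ _ _ hWU; have m2 := mono _ _ _ (fnorm_dev hW G0); have m3 := mono _ _ _ (fnorm_dev hW H0).
have sc2 k (c : R) (v : 'rV[R]_k) : 0 <= c -> c <= 4 * B -> fnorm (c *: v) ^+ 2 <= (4 * B) ^+ 2 * fnorm v ^+ 2.
  by move=> c0 h; rewrite fnormZ exprMn real_normK ?num_real // ler_wpM2r ?sqr_ge0 // sq.
have hU : fnorm U0 ^+ 2 <= \sum_i (4 * B) ^+ 2 * (fnorm (u0y d i) ^+ 2 + fnorm (u0z d i) ^+ 2).
  rewrite fnorm_rows; apply: ler_sum => i _; rewrite fnorm_st3 /= scaler0 fnorm0 expr0n add0r mulrDr.
  by apply: lerD; exact: sc2.
have hH : fnorm H0 ^+ 2 <= \sum_i (4 * B) ^+ 2 * (fnorm (h0y d i) ^+ 2 + fnorm (h0z d i) ^+ 2).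
  rewrite fnorm_rows; apply: ler_sum => i _; rewrite fnorm_st3 /= scaler0 fnorm0 expr0n add0r mulrDr.
  by apply: lerD; exact: sc2.
have spb c1 c2 c3 (u : 'rV[R]_(p + q)) : c1 ^+ 2 <= (4 * B) ^+ 2 -> c2 ^+ 2 + c3 ^+ 2 <= (4 * B) ^+ 2 ->
    fnorm (u *m spread c1 c2 c3) ^+ 2 <= (4 * B) ^+ 2 * fnorm u ^+ 2.
  move=> h1 h2; rewrite -exprMn ler_pXn2r ?nnegrE ?mulr_ge0 //; exact: spread_norm.
have hG : fnorm G0 ^+ 2 <= \sum_i 3 * ((4 * B) ^+ 2 *
   (fnorm (grad (joint (fi pb i)) (row_mx (x0 d) (y0 d))) ^+ 2 +
    fnorm (grad (joint (gi pb i)) (row_mx (x0 d) (y0 d))) ^+ 2 +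
    fnorm (grad (joint (gi pb i)) (row_mx (x0 d) (z0 d))) ^+ 2)).
  rewrite fnorm_sq_rows; apply: ler_sum => i _; rewrite row_rowwise row_rows /= /Gs /Gst !st3_selY st3_selZ.
  apply: le_trans (fnorm_sqD3 _ _ _) _; rewrite ler_pM2l // !mulrDr.
  apply: lerD; first apply: lerD.
  - by apply: spb; rewrite ?expr0n ?addr0; exact: sq.
  - by apply: spb; rewrite ?expr0n ?addr0; apply: sq => //; rewrite mulr_ge0.
  - by apply: spb; rewrite ?sqrrN ?expr0n ?add0r; apply: sq => //; rewrite mulr_ge0.
have hsum : (4 * B) ^+ 2 * (3 * (n%:R * init_size pb d)) <= (4 * B) ^+ 2 * (3 * (n%:R * `|D0|)).
  rewrite ler_wpM2l ?sqr_ge0 // ler_pM2l // ler_pM2l //; apply: le_trans hD _; exact: ler_norm.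
have hI : \sum_i (4 * B) ^+ 2 * (fnorm (u0y d i) ^+ 2 + fnorm (u0z d i) ^+ 2) +
    \sum_i 3 * ((4 * B) ^+ 2 * (fnorm (grad (joint (fi pb i)) (row_mx (x0 d) (y0 d))) ^+ 2 +
    fnorm (grad (joint (gi pb i)) (row_mx (x0 d) (y0 d))) ^+ 2 +
    fnorm (grad (joint (gi pb i)) (row_mx (x0 d) (z0 d))) ^+ 2)) +
    \sum_i (4 * B) ^+ 2 * (fnorm (h0y d i) ^+ 2 + fnorm (h0z d i) ^+ 2) <= (4 * B) ^+ 2 * (3 * (n%:R * init_size pb d)).
  rewrite /init_size mulVKf ?gt_eqF // -!big_split /= !mulr_sumr; apply: ler_sum => i _.
  by apply: start_algebra; rewrite ?sqr_ge0.
have -> : 144 * `|D0| * n%:R * B ^+ 2 = 3 * ((4 * B) ^+ 2 * (3 * (n%:R * `|D0|))) by ring.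
rewrite ler_pM2l //; apply: le_trans (_ : fnorm U0 ^+ 2 + fnorm G0 ^+ 2 + fnorm H0 ^+ 2 <= _).
  by apply: lerD => //; exact: lerD.
apply: le_trans hsum; apply: le_trans hI.
by apply: lerD => //; exact: lerD.
Qed.

End Start.

(** * Powers, expectations, and the gradient at the start *)

Section Powers.
Context {R : realType}.
Variables (n S : nat) (l : R).
Hypotheses (n1 : (1 < n)%N) (l0 : 0 < l) (l1 : l <= 1) (nS : n%:R `^ (4 / 3) <= S%:R :> R).

Definition root_lam : R := l `^ (1 / 2).
Definition root_n : R := n%:R `^ (1 / 7).
Definition root_S : R := S%:R `^ (1 / 7).
Definition root_n9 : R := n%:R `^ (1 / 9).

Let n0 : 0 < n%:R :> R. Proof. by rewrite ltr0n ltnW. Qed.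
Let S0 : 0 < S%:R :> R. Proof. by apply: lt_le_trans nS; exact: powR_gt0. Qed.

Lemma powR_frac (x : R) j m : x `^ (j%:R / m%:R) = (x `^ (1 / m%:R)) ^+ j.
Proof. by rewrite -powR_mulrn ?powR_ge0 // -powRrM; congr (_ `^ _); rewrite mul1r mulrC. Qed.

Lemma root_pow (x : R) m : (0 < m)%N -> 0 <= x -> (x `^ (1 / m%:R)) ^+ m = x.
Proof. by move=> m0 x0; rewrite -powR_frac divff ?powRr1 // pnatr_eq0 -lt0n. Qed.

Lemma powers_pos : [/\ 0 < root_lam, root_lam <= 1, 1 <= root_n, 0 < root_S & 1 <= root_n9].
Proof.
have e m : 0 <= 1 / m%:R :> R by rewrite divr_ge0.
have p1 (x : R) : 1 `^ x = 1 by rewrite powR1.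
have up m : 1 <= n%:R `^ (1 / m%:R) :> R.
  by rewrite -[leLHS](p1 (1 / m%:R)); apply: ge0_ler_powR => //; rewrite ?nnegrE ?ler1n ?ler0n // ltnW.
split; try exact: powR_gt0; try exact: up.
by rewrite -[leRHS](p1 (1 / 2)); apply: ge0_ler_powR; rewrite ?nnegrE ?(ltW l0).
Qed.

Lemma powers_id : [/\ root_lam ^+ 2 = l, root_n ^+ 7 = n%:R, root_S ^+ 7 = S%:R & root_n9 ^+ 9 = n%:R].
Proof. by split; rewrite root_pow // ltW. Qed.

Lemma powers_le : root_n ^+ 4 <= root_S ^+ 3.
Proof.
rewrite -!powR_frac; have e : 4 / 7 = 4 / 3 * (3 / 7) :> R by field.
by rewrite e powRrM; apply: ge0_ler_powR; rewrite ?nnegrE ?powR_ge0 ?divr_ge0.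
Qed.

Lemma powers_rates : [/\ l `^ (1 / 2) * (n * S)%:R `^ (1 / 7) = rA root_lam root_n root_S,
  l * n%:R `^ (2 / 7) / S%:R `^ (5 / 7) = rE root_lam root_n root_S,
  l `^ (3 / 2) * n%:R `^ (3 / 7) / S%:R `^ (4 / 7) = rB root_lam root_n root_S &
  l `^ (- (1 / 2)) / (n * S)%:R `^ (1 / 7) = (rA root_lam root_n root_S)^-1].
Proof.
have [e1 _ _ _] := powers_id.
have eA : (n * S)%:R `^ (1 / 7) = root_n * root_S by rewrite natrM powRM // ltW.
rewrite eA; split; rewrite ?powR_frac -/root_n -/root_S -/root_lam //.
- by rewrite /rE -e1.
- by rewrite powRN -/root_lam /rA [in RHS]invfM.
Qed.

End Powers.

Section Expectation.
Context {R : realType} {d : measure_display} {O : measurableType d} (P : probability O R).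

(** The integral of a nonnegative function is a supremum over the simple functions
    below it. This makes it monotone even in a function whose measurability is
    unknown, such as the norm of grad Phi at an iterate. *)
Lemma expectation_le_Ex (f g : O -> R) : (forall w, 0 <= f w) -> (forall w, f w <= g w) ->
  intg P g -> ('E_P[f] <= (Ex P g)%:E)%E.
Proof.
move=> f0 fg ig; have g0 w : 0 <= g w by exact: le_trans (fg w).
rewrite unlock /Ex /Rintegral fineK; last exact: integrable_fin_num.
rewrite !ge0_integralTE; [|by move=> w; rewrite lee_fin..].
apply: le_ereal_sup => _ [h hf <-]; exists h => // w.
by apply: le_trans (hf w) _; rewrite lee_fin.
Qed.

Lemma exists_le_mean S (a : nat -> R) c : (0 < S)%N -> \sum_(s < S) a s <= S%:R * c -> exists s : 'I_S, a s <= c.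
Proof.
move=> S0 h; apply: contrapT => hn.
have lt s : (s < S)%N -> c < a s by move=> sS; rewrite ltNge; apply/negP => hs; apply: hn; exists (Ordinal sS).
have : S%:R * c < \sum_(s < S) a s.
  have -> : S%:R * c = \sum_(s < S) c by rewrite sumr_const card_ord mulr_natl.
  by apply: ltr_sum => [|i _]; [apply/hasP; exists (Ordinal S0); rewrite ?mem_index_enum|exact: lt].
by rewrite ltNge h.
Qed.

End Expectation.

Section GradientBound.
Context {R : realType} {p q : nat}.
Variables (f g : 'rV[R]_p -> 'rV[R]_q -> R) (Gf Gg : 'rV[R]_(p + q) -> 'rV[R]_(p + q))
  (Jg : 'rV[R]_(p + q) -> 'M[R]_(p + q)) (L mu : R).
Hypotheses (L1 : 1 <= L) (mu0 : 0 < mu).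
Hypotheses (qf : qb L (joint f) Gf) (qg : qb L (joint g) Gg) (lf : lip L Gf) (lg : lip L Gg)
  (tg : taylor L Gg Jg) (f0 : forall x y y', `|f x y - f x y'| <= L * fnorm (y - y'))
  (sc : forall x, strongly_convex mu (g x)).

Definition grad0_bound (Delta : R) : R :=
  Cphi L mu + Num.sqrt (4 * ((3 * L + 9 * L ^+ 2 / mu) * a_min L mu) * (`|Delta| + 2 * (L ^+ 2 / mu))).

(** A gradient step on the penalized value with a = [a_min] decreases it by a
    multiple of the squared gradient, while Phi decreases by at most Delta. *)
Lemma grad_bounded (Delta : R) x0 : (forall x, f x0 (zs g x0) - f x (zs g x) <= Delta) ->
  fnorm (grad (fun x => f x (zs g x)) x0) <= grad0_bound Delta.
Proof.
move=> hD; set a := a_min L mu; set C := (3 * L + 9 * L ^+ 2 / mu) * a.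
have [a1 ha] := a_min_ge L1 mu0 (lexx (a_min L mu)).
have a0 : 0 < a by exact: lt_le_trans a1.
have L0 : 0 < L by exact: lt_le_trans L1.
have C0 : 0 < C.
  rewrite /C; apply: mulr_gt0 => //; apply: ltr_wpDr; first by rewrite divr_ge0 ?mulr_ge0 ?sqr_ge0 // ltW.
  exact: mulr_gt0.
set G := Ga f g Gf Gg a x0.
have q1 := Phia_qb L1 mu0 qf qg lf lg sc a1 ha x0 (- (2 * C)^-1 *: G).
rewrite -/C -/G dotpZr -fnorm_sq fnormZ exprMn real_normK ?num_real // sqrrN in q1.
have c1 := Phia_close L1 mu0 qf qg f0 sc a1 ha x0.
have c2 := Phia_close L1 mu0 qf qg f0 sc a1 ha (x0 + - (2 * C)^-1 *: G).
have dD := hD (x0 + - (2 * C)^-1 *: G).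
have hL : L ^+ 2 / mu / a <= L ^+ 2 / mu by rewrite ler_pdivrMr // ler_peMr // divr_ge0 ?sqr_ge0 // ltW.
have hG : fnorm G ^+ 2 <= 4 * C * (`|Delta| + 2 * (L ^+ 2 / mu)).
  move: q1 c1 c2 dD (ler_norm Delta); rewrite !ler_norml.
  set x1 := x0 + _; have -> : (2 * C)^-1 ^+ 2 * fnorm G ^+ 2 = fnorm G ^+ 2 / (4 * C) / C by field; rewrite gt_eqF.
  rewrite [C * _]mulrC divfK ?gt_eqF //.
  have -> : - (2 * C)^-1 * fnorm G ^+ 2 = - (2 * (fnorm G ^+ 2 / (4 * C))) by field; rewrite gt_eqF.
  move=> /andP[_ h1] /andP[h2 h3] /andP[h4 h5] h6 h7.
  by rewrite mulrC -ler_pdivrMr ?mulr_gt0 //; lra.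
have h1 := grad_Phi_close L1 mu0 qf qg lf lg tg f0 sc x0 (lexx (a_min L mu)).
have [P0 _ _ _] := Cphi_parts L1 mu0.
have h2 : Cphi L mu / a <= Cphi L mu by rewrite ler_pdivrMr // ler_peMr.
have h3 : fnorm G <= Num.sqrt (4 * C * (`|Delta| + 2 * (L ^+ 2 / mu))).
  have r0 := le_trans (sqr_ge0 (fnorm G)) hG.
  by apply: fnorm_sq_le; [exact: sqrtr_ge0|rewrite [leRHS]sqr_sqrtr].
have := ler_fnormD (grad (fun x => f x (zs g x)) x0 - G) G; rewrite subrK /grad0_bound => h4.
by apply: le_trans h4 _; apply: lerD => //; exact: le_trans h2.
Qed.

End GradientBound.

(** * Constants *)

Section Constants.
Context {R : realType}.
Variables (L mu sf sg Delta D0 Cw : R).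
Hypotheses (L1 : 1 <= L) (mu0 : 0 < mu).

(** [k_step] makes eta_x small enough for [pot_descent]; [k_noise] B bounds the
    standard deviation of a call; [k_pot] a is the curvature of the potential;
    [k_start] n B^2 bounds the initial disagreement, and [k_gap] the initial gap of
    the potential. The window has to be shorter than [k_eps] / B for the coefficient
    of the squared gradient to be small ([regime_contract]), and [k_large] is the
    least A from which the asymptotic argument applies. *)
Definition k_step : R := Num.min 1 (mu ^+ 2 / (64 * L ^+ 2)).
Definition k_noise : R := 8 * (`|sf| + `|sg|).
Definition k_pot : R := 5 * L + 2 * L ^+ 2 / mu.
Definition k_start : R := 144 * `|D0|.
Definition k_gap : R := 2 * (L ^+ 2 / mu) + `|Delta| + 3 * L * `|Cw|.
Definition k_eps : R := (144 * L * (102 * (1 + 16 * rc2 k_pot k_step)))^-1.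
Definition k_large : R := 1 + a_min L mu + 96 * k_pot + 192 * L + k_eps ^- 3.
Definition k_sum : R := rcC L k_pot k_noise k_start k_step k_gap.

Let L0 : 0 < L. Proof. exact: lt_le_trans L1. Qed.

Lemma k_step_bounds : [/\ 0 < k_step, k_step <= 1 & 64 * k_step * L ^+ 2 <= mu ^+ 2].
Proof.
have h : 0 < 64 * L ^+ 2 by rewrite mulr_gt0 // exprn_gt0.
split.
- by rewrite lt_min ltr01 divr_gt0 // exprn_gt0.
- by rewrite ge_min lexx.
- by rewrite mulrAC mulrC -ler_pdivlMr // ge_min lexx orbT.
Qed.
Lemma k_pot_ge0 : 0 <= k_pot.
Proof.
have h : 0 <= 2 * L ^+ 2 / mu by apply: divr_ge0; [rewrite mulr_ge0 ?sqr_ge0|exact: ltW].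
by apply: addr_ge0 => //; rewrite mulr_ge0 // ltW.
Qed.
Lemma k_rc2_ge0 : 0 <= rc2 k_pot k_step.
Proof. by have [h _ _] := k_step_bounds; apply: rc2_ge0 => //; exact: k_pot_ge0. Qed.
Lemma k_eps_gt0 : 0 < k_eps.
Proof.
have c0 := k_rc2_ge0; rewrite invr_gt0; apply: mulr_gt0; first by rewrite mulr_gt0.
by apply: mulr_gt0 => //; apply: ltr_wpDr => //; apply: mulr_ge0.
Qed.
Lemma k_large_bounds (A : R) : k_large <= A ->
  [/\ 1 <= A, a_min L mu <= A, 96 * k_pot <= A, 192 * L <= A & k_eps ^- 3 <= A].
Proof.
have h1 : 0 <= 4 * L / mu by rewrite divr_ge0 ?mulr_ge0 ?(ltW L0) // ltW.
have h2 := k_pot_ge0; have h3 : 0 <= k_eps ^- 3 by rewrite invr_ge0 exprn_ge0 // ltW // k_eps_gt0.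
have h0 := ltW L0; rewrite /k_large /a_min; move: h0 h1 h2 h3.
by set x1 := 4 * L / mu; set x2 := k_pot; set x3 := k_eps ^- 3 => h0 h1 h2 h3 h; split; lra.
Qed.

Section Regime.
Variables (A B E a ex ey ez : R).
Hypotheses (B0 : 0 < B) (E0 : 0 < E) (BE : B = A * E) (A1 : 1 <= A).
Hypotheses (ha : A <= a <= 2 * A) (hx : k_step * E <= ex <= 2 * k_step * E).
Hypotheses (hy : E <= ey <= 2 * E) (hz : B <= ez <= 2 * B).
Let A0 : 0 < A. Proof. exact: lt_le_trans A1. Qed.

Lemma regime_pos : [/\ 0 < a, 0 < ex, 0 < ey & 0 < ez].
Proof.
have [c0 _ _] := k_step_bounds; move: ha hx hy hz => /andP[h1 _] /andP[h2 _] /andP[h3 _] /andP[h4 _].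
by split; [exact: lt_le_trans h1|apply: lt_le_trans h2; exact: mulr_gt0|exact: lt_le_trans h3|exact: lt_le_trans h4].
Qed.

Lemma regime_scale : [/\ ex <= 4 * B, ey <= 4 * B, ez <= 4 * B, a * ex <= 4 * B & a * ey <= 4 * B].
Proof.
have [a0 x0 y0 z0] := regime_pos; have [c0 c1 _] := k_step_bounds.
move: ha hx hy hz => /andP[_ h1] /andP[_ h2] /andP[_ h3] /andP[_ h4].
have EB : E <= B by rewrite BE ler_peMl // ltW.
have x2 : ex <= 2 * E by apply: le_trans h2 _; rewrite ler_pM2r // ler_piMr.
have aE e : 0 < e -> e <= 2 * E -> a * e <= 4 * B.
  move=> e0 he; apply: le_trans (_ : (2 * A) * (2 * E) <= _); first by apply: ler_pM => //; exact: ltW.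
  by rewrite BE le_eqVlt; apply/orP; left; apply/eqP; ring.
by split; [lra|lra|lra|exact: aE|exact: aE].
Qed.

Lemma regime_kap : [/\ A / (2 * B) * ex <= 1, A / (2 * B) * ey <= 1 & A / (2 * B) * ez <= a].
Proof.
have [a0 x0 y0 z0] := regime_pos; have [c0 c1 _] := k_step_bounds.
move: ha hx hy hz => /andP[h1 _] /andP[_ h2] /andP[_ h3] /andP[_ h4].
have x2 : ex <= 2 * E by apply: le_trans h2 _; rewrite ler_pM2r // ler_piMr.
have k0 : 0 <= A / (2 * B) by rewrite divr_ge0 ?mulr_ge0 // ltW.
have e1 : A / (2 * B) * (2 * E) = 1 by rewrite BE; field; rewrite !gt_eqF.
have e2 : A / (2 * B) * (2 * B) = A by rewrite divfK // gt_eqF // mulr_gt0.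
split.
- by rewrite -[leRHS]e1 ler_wpM2l.
- by rewrite -[leRHS]e1 ler_wpM2l.
- by apply: le_trans h1; rewrite -[leRHS]e2 ler_wpM2l.
Qed.

Lemma regime_cb : [/\ 2 / ex <= 4 / k_step * (A / B), 1 / ey <= 4 / k_step * (A / B) & 2 * a / ez <= 4 / k_step * (A / B)].
Proof.
have [a0 x0 y0 z0] := regime_pos; have [c0 c1 _] := k_step_bounds.
move: ha hx hy hz => /andP[_ h1] /andP[h2 _] /andP[h3 _] /andP[h4 _].
have eAB : A / B = E^-1 by rewrite BE; field; rewrite !gt_eqF.
have i0 : 0 < k_step^-1 by rewrite invr_gt0.
have i1 : 1 <= k_step^-1 by rewrite invf_ge1.
have Ei : 0 < E^-1 by rewrite invr_gt0.
have p1 : E^-1 <= k_step^-1 * E^-1 by rewrite ler_peMl // ltW.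
rewrite eAB -mulrA; split.
- have h : ex^-1 <= k_step^-1 * E^-1 by rewrite -invfM lef_pV2 ?posrE ?mulr_gt0.
  have : 0 < k_step^-1 * E^-1 by exact: mulr_gt0.
  lra.
- have h : ey^-1 <= E^-1 by rewrite lef_pV2 ?posrE.
  lra.
- have h : ez^-1 <= B^-1 by rewrite lef_pV2 ?posrE.
  have h5 : a / ez <= 2 * A / B by apply: ler_pM => //; rewrite ?invr_ge0 ltW.
  have e5 : 2 * A / B = 2 * E^-1 by rewrite -eAB mulrA.
  rewrite e5 in h5; rewrite -mulrA; lra.
Qed.

Lemma regime_xz : 16 * a * L ^+ 2 * ex <= mu ^+ 2 * ez.
Proof.
have [a0 x0 y0 z0] := regime_pos; have [c0 _ c2] := k_step_bounds.
move: ha hx hy hz => /andP[_ h1] /andP[_ h2] _ /andP[h4 _].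
have L2 : 0 <= L ^+ 2 by exact: sqr_ge0.
have h5 : a * ex <= 2 * A * (2 * k_step * E) by apply: ler_pM => //; exact: ltW.
have -> : 16 * a * L ^+ 2 * ex = 16 * L ^+ 2 * (a * ex) by ring.
apply: le_trans (_ : 16 * L ^+ 2 * (2 * A * (2 * k_step * E)) <= _).
  by rewrite ler_wpM2l // mulr_ge0.
have -> : 16 * L ^+ 2 * (2 * A * (2 * k_step * E)) = 64 * k_step * L ^+ 2 * B by rewrite BE; ring.
by apply: ler_pM => //; [rewrite mulr_ge0 // mulr_ge0 // ltW|exact: ltW].
Qed.

Lemma regime_curvature : B <= 1 / A -> 96 * k_pot <= A -> 24 * (a * k_pot) <= A / (2 * B).
Proof.
move=> hB hA; have p0 := k_pot_ge0; move: ha => /andP[_ h1].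
rewrite ler_pdivlMr ?mulr_gt0 //.
have h2 : B * A <= 1 by rewrite -ler_pdivlMr.
have h3 : a * k_pot <= 2 * A * k_pot by rewrite ler_wpM2r.
have h4 : 24 * (a * k_pot) * (2 * B) <= 96 * k_pot * (B * A).
  have -> : 96 * k_pot * (B * A) = 24 * (2 * A * k_pot) * (2 * B) by ring.
  by rewrite ler_pM2r ?mulr_gt0 // ler_pM2l.
apply: le_trans h4 _; apply: le_trans hA; rewrite ler_piMr // mulr_ge0 //.
Qed.

Lemma regime_contract K l c : 0 < l -> 0 <= K -> K <= 12 * c / l -> B * c / l <= k_eps ->
  102 * (12 * B * L) ^+ 2 * K ^+ 2 <= 1 /\
  8 * rc2 k_pot k_step * (102 * (12 * B * L) ^+ 2 * K ^+ 2) <= 1 / 2.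
Proof.
move=> l0 K0 hK hE; have q0 := k_rc2_ge0; set Q := rc2 _ _ in q0 *.
set z := (102 * (1 + 16 * Q))^-1.
have z0 : 0 < z by rewrite invr_gt0 mulr_gt0 // ltr_wpDr // mulr_ge0.
have zi : z * (102 * (1 + 16 * Q)) = 1 by rewrite mulVf // gt_eqF // -invr_gt0.
have h1 : 12 * B * L * K <= z.
  apply: le_trans (_ : 144 * L * (B * c / l) <= _).
    have -> : 144 * L * (B * c / l) = 12 * B * L * (12 * c / l) by ring.
    by rewrite ler_wpM2l // mulr_ge0 ?(ltW L0) // mulr_ge0 // ltW.
  apply: le_trans (_ : 144 * L * k_eps <= _); first by rewrite ler_wpM2l // mulr_ge0 // ltW.
  by rewrite /k_eps -/Q [(144 * L * _)^-1]invfM mulrA mulfV ?mul1r // gt_eqF // mulr_gt0.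
have k0 : 0 <= 12 * B * L * K by rewrite mulr_ge0 // mulr_ge0 ?(ltW L0) // mulr_ge0 // ltW.
have h2 : (12 * B * L) ^+ 2 * K ^+ 2 <= z ^+ 2 by rewrite -exprMn ler_pXn2r ?nnegrE // ltW.
have zz : z ^+ 2 * (102 * (1 + 16 * Q)) = z by rewrite expr2 -mulrA zi mulr1.
have z1 : z <= 1 by rewrite invf_le1 ?mulr_gt0 // ?ltr_wpDr ?mulr_ge0 //; lra.
have qz : 0 <= Q * z ^+ 2 by rewrite mulr_ge0 ?sqr_ge0.
have qh := ler_wpM2l q0 h2; have z2 := sqr_ge0 z.
move: h2 qh zz z2 qz; rewrite -[102 * _ * _](mulrA 102) -[8 * Q * _](mulrA 8).
set X := (12 * B * L) ^+ 2 * K ^+ 2; set Z := z ^+ 2.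
have -> : Z * (102 * (1 + 16 * Q)) = 102 * Z + 16 * 102 * (Q * Z) by ring.
have -> : Q * (102 * X) = 102 * (Q * X) by ring.
by move=> h2 qh zz z2 qz; split; lra.
Qed.

Lemma regime_tracking l : 0 < l -> l <= 1 -> B <= l ^+ 2 / A -> 192 * L <= A -> 256 * (12 * B * L) ^+ 2 <= l ^+ 4.
Proof.
move=> l0 l1 hB hA.
have h1 : 16 * (12 * B * L) <= l ^+ 2.
  have -> : 16 * (12 * B * L) = 192 * L * B by ring.
  apply: le_trans (_ : A * B <= _); first by rewrite ler_wpM2r // ltW.
  by rewrite mulrC -ler_pdivlMr.
have -> : 256 * (12 * B * L) ^+ 2 = (16 * (12 * B * L)) ^+ 2 by ring.
have -> : l ^+ 4 = (l ^+ 2) ^+ 2 by rewrite -exprM.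
by rewrite ler_pXn2r ?nnegrE ?sqr_ge0 // !mulr_ge0 // ltW.
Qed.

End Regime.

Lemma noise_scale (B s : R) : `|s| <= `|sf| + `|sg| -> 4 * (4 * B) ^+ 2 * s ^+ 2 <= (k_noise * B) ^+ 2.
Proof.
move=> h; have -> : (k_noise * B) ^+ 2 = 4 * (4 * B) ^+ 2 * (`|sf| + `|sg|) ^+ 2 by rewrite /k_noise; ring.
apply: ler_wpM2l; first by rewrite mulr_ge0 ?sqr_ge0.
by rewrite -(real_normK (num_real s)) ler_pXn2r ?nnegrE ?addr_ge0.
Qed.

End Constants.

(** * Convergence in the asymptotic regime *)

Section Convergence.
Context {R : realType} {n p q : nat}
  {dO : measure_display} {O : measurableType dO}
  {dX : measure_display} {X : measurableType dX}
  {dY : measure_display} {Y : measurableType dY}.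
Variables (P : probability O R) (pb : problem R n p q X Y) (W : 'M[R]_n) (rho : R)
  (sm : samples R n O X Y) (d : init_data R n p q) (a ex ey ez : R) (S : nat).
Variables (lf0 lf1 lf2 lg1 lg2 mu sf sg Delta D0 Cw : R).
Hypothesis mu0 : 0 < mu.
Let run := dsgda_gt pb W sm a ex ey ez 1 d.
Hypotheses (hs : smoothness pb lf0 lf1 lf2 lg1 lg2 mu) (hreg : regular_oracles pb)
  (hunb : unbiased_oracles pb) (hvar : bounded_variance pb sf sg)
  (hfresh : fresh_samples P pb sm run 1 S) (hW : mixing_matrix W rho)
  (hadm : admissible_init d) (hinit : init_size pb d <= D0)
  (hDelta : forall x, Phi pb (x0 d) - Phi pb x <= Delta) (hwarm : warm_start pb d a Cw)
  (hS : n%:R `^ (4 / 3) <= S%:R :> R).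

Let L := Lmax lf0 lf1 lf2 lg1 lg2.
Let f := favg pb. Let g := gavg pb.
Let n0 : 0 < n%:R :> R. Proof. exact: nR0 hW. Qed.
Let L1 : 1 <= L. Proof. by have [] := Lmax_bounds lf0 lf1 lf2 lg1 lg2. Qed.
Let L0 : 0 <= L. Proof. exact: le_trans L1. Qed.
Let qf : qb L (joint f) (Gfbar pb). Proof. by have [h _ _ _ _] := mean_smooth hs n0; exact: h. Qed.
Let qg : qb L (joint g) (Ggbar pb). Proof. by have [_ h _ _ _] := mean_smooth hs n0; exact: h. Qed.
Let lf : lip L (Gfbar pb). Proof. by have [_ _ h _ _] := mean_smooth hs n0; exact: h. Qed.
Let lg : lip L (Ggbar pb). Proof. by have [_ _ _ h _] := mean_smooth hs n0; exact: h. Qed.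
Let tg : taylor L (Ggbar pb) (Jgbar pb). Proof. by have [_ _ _ _ h] := mean_smooth hs n0; exact: h. Qed.
Let f0 x y y' : `|f x y - f x y'| <= L * fnorm (y - y'). Proof. exact: favg_lip hs n0 x y y'. Qed.
Let sc x : strongly_convex mu (g x). Proof. exact: gavg_strconv hs n0 x. Qed.

Let r := root_lam (lam rho). Let u : R := root_n n. Let v : R := root_S S. Let c : R := root_n9 n.
Let l0 : 0 < lam rho. Proof. by have /andP[] := lam_bounds hW. Qed.
Let l1 : lam rho <= 1. Proof. by have /andP[] := lam_bounds hW. Qed.
Let n1 : (1 < n)%N. Proof. exact: n_gt1 hW. Qed.
Let r0 : 0 < r. Proof. by have [] := powers_pos n1 l0 l1 hS. Qed.
Let r1 : r <= 1. Proof. by have [] := powers_pos n1 l0 l1 hS. Qed.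
Let u1 : 1 <= u. Proof. by have [] := powers_pos n1 l0 l1 hS. Qed.
Let v0 : 0 < v. Proof. by have [] := powers_pos n1 l0 l1 hS. Qed.
Let c1 : 1 <= c. Proof. by have [] := powers_pos n1 l0 l1 hS. Qed.
Let uv : u ^+ 4 <= v ^+ 3. Proof. exact: powers_le hS. Qed.
Let cu : c ^+ 9 = u ^+ 7. Proof. by have [_ -> _ ->] := powers_id n S l0. Qed.
Let rl : r ^+ 2 = lam rho. Proof. by have [] := powers_id n S l0. Qed.
Let un : u ^+ 7 = n%:R. Proof. by have [] := powers_id n S l0. Qed.
Let vS : v ^+ 7 = S%:R. Proof. by have [] := powers_id n S l0. Qed.
Let S0 : (0 < S)%N. Proof. by rewrite -(ltr0n R) -vS exprn_gt0. Qed.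

Let A := rA r u v. Let B := rB r u v. Let E := rE r u v.
Let A0 : 0 < A. Proof. exact: rA_gt0. Qed.
Let B0 : 0 < B. Proof. exact: rB_gt0. Qed.
Let E0 : 0 < E. Proof. exact: rE_gt0. Qed.
Let BE : B = A * E. Proof. exact: rB_AE. Qed.

Hypotheses (ha : A <= a <= 2 * A) (hx : k_step L mu * E <= ex <= 2 * k_step L mu * E)
  (hy : E <= ey <= 2 * E) (hz : B <= ez <= 2 * B).
Hypothesis hA : k_large L mu <= A.

Let A1 : 1 <= A. Proof. by have [] := k_large_bounds L1 mu0 hA. Qed.
Let a1 : 1 <= a. Proof. by case/andP: ha => h _; exact: le_trans h. Qed.
Let amin : a_min L mu <= a.
Proof. by have [_ h _ _ _] := k_large_bounds L1 mu0 hA; case/andP: ha => h' _; exact: le_trans h'. Qed.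
Let ham : 4 * L / mu <= a. Proof. by have [] := a_min_ge L1 mu0 amin. Qed.
Let a0 : 0 < a. Proof. exact: lt_le_trans a1. Qed.

Let w := wS pb W sm d a ex ey ez.
Let G := Gst (Gf pb) (Gg pb) a ex ey ez.
Let J := Jst (fun i => hessian (joint (fi pb i))) (fun i => hessian (joint (gi pb i))) a ex ey ez.
Let Sg := \sum_(s < S) Ex P (fun o => fnorm (meanG G (mrow (w s o))) ^+ 2).
Let Sb := \sum_(s < S) Ex P (fun o => fnorm (disp G (mrow (w s o)) (dev (w s o))) ^+ 2).
Let Kw := window r c.

Let pos := regime_pos L1 mu0 B0 E0 A1 ha hx hy hz.
Let scl := regime_scale L1 mu0 B0 E0 BE A1 ha hx hy hz.

Lemma run_fresh s : (s < S)%N ->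
  fresh_noise P (k_noise sf sg * B) (geny pb W sm d a ex ey ez s) (callnoise pb W sm d a ex ey ez s).
Proof.
move=> sS; have [pa px py pz] := pos; have [s1 s2 s3 s4 s5] := scl.
have la i : lip L (Gf pb i) by have [[]] := agent_smooth hs i.
have lb i : lip L (Gg pb i) by have [_ []] := agent_smooth hs i.
apply: (run_fresh_noise hreg hunb hvar (hfresh sS) la lb (ltW B0)) => //; try exact: ltW.
- by apply: noise_scale; rewrite lerDl.
- by apply: noise_scale; rewrite lerDr.
Qed.

Let lw : L2m P (w 0%N).
Proof. exact: (L2m_cst P (rows (fun _ : 'I_n => st3 (x0 d) (y0 d) (z0 d)))). Qed.
Let lU : L2m P (US pb W sm d a ex ey ez 0%N).
Proof. exact: (L2m_cst P (rows (fun i => st3 (ex *: 0) (ey *: u0y d i) (ez *: u0z d i)))). Qed.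
Let lH : L2m P (HS pb W sm d a ex ey ez 0%N).
Proof. exact: (L2m_cst P (rows (fun i => st3 (ex *: 0) (ey *: h0y d i) (ez *: h0z d i)))). Qed.

Lemma run_bias : Sb <= 102 * (12 * B * L) ^+ 2 * Kw%:R ^+ 2 * Sg +
  rc3 L (k_noise sf sg) (k_start D0) * target r u v.
Proof.
have [pa px py pz] := pos; have [s1 s2 s3 s4 s5] := scl.
have [h1 h2 h3 h4 h5] := k_large_bounds L1 mu0 hA.
have [K0 hK _] := window_bounds r0 r1 c1; rewrite rl -/Kw in hK.
have ag i := agent_smooth hs i.
have gl i : lip (12 * B * L) (G i).
  by apply: Gst_lip => //; try exact: ltW; [move=> j; have [[]] := ag j|move=> j; have [_ []] := ag j].
have gt i : taylor (12 * B * L) (G i) (J i).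
  by apply: Gst_taylor => //; try exact: ltW; [move=> j; have [[]] := ag j|move=> j; have [_ []] := ag j].
have gj i k l : continuous (fun x => J i x k l).
  by apply: (@Jst_continuous _ _ _ _ _ _ L); [move=> j; have [[]] := ag j|move=> j; have [_ []] := ag j].
have e0 : 0 <= 12 * B * L by exact: mulr_ge0 (mulr_ge0 (ler0n R 12) (ltW B0)) L0.
have hE : B * c / lam rho <= k_eps L mu.
  by rewrite -rl; apply: rBcl_small => //; exact: k_eps_gt0.
have [q1 q2] := regime_contract L1 mu0 B0 l0 (ler0n R Kw) hK hE.
have hB : B <= lam rho ^+ 2 / A by rewrite -rl; exact: rB_small.
have q3 := regime_tracking L1 B0 A1 l0 l1 hB h4.
(* [bias_sum] reaches one iterate beyond the last step whose noise it uses *)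
have hS1 : S = S.-1.+1 by rewrite prednK.
have FN s : (s < S.-1)%N -> fresh_noise P (k_noise sf sg * B) (geny pb W sm d a ex ey ez s) (callnoise pb W sm d a ex ey ez s).
  by move=> sS; apply: run_fresh; rewrite hS1 ltnS ltnW.
have t0 : 0 < tht rho by have /andP[t34 _] := tht_bounds hW; apply: lt_le_trans t34; rewrite divr_gt0.
have bias := bias_sum hW e0 e0 gl gt gj (@card_calls n) (US_rec pb W sm d a ex ey ez) (wS_rec pb W sm d a ex ey ez)
  (HS_rec pb W sm d a ex ey ez) (fun o => start_tracking pb W sm a ex ey ez o hadm) (start_consensus pb sm d a ex ey ez hW)
  FN (@wS_past _ _ _ _ _ _ _ _ _ _ pb W sm d a ex ey ez) (@HS_past _ _ _ _ _ _ _ _ _ _ pb W sm d a ex ey ez) lw lU lH K0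
  (fun o => start_disagreement sm hW (ltW B0) (ltW px) (ltW py) (ltW pz) (ltW pa) s1 s2 s3 s4 s5 o hinit) q1 q3.
rewrite -hS1 in bias.
apply: (bias_rate r0 r1 u1 v0 uv c1 cu _ (t2 := (tht rho ^+ Kw) ^+ 2) _ _ _ _).
- exact: mulr_ge0.
- by rewrite ler1n.
- by rewrite rl.
- by apply: (window_forget r0 r1 c1 t0); rewrite rl.
- by rewrite rl un vS.
Qed.

Lemma run_rate : Sg <= k_sum L mu sf sg Delta D0 Cw * target r u v.
Proof.
have [pa px py pz] := pos; have [s1 s2 s3 s4 s5] := scl.
have [h1 h2 h3 h4 h5] := k_large_bounds L1 mu0 hA.
have [c0 _ _] := k_step_bounds L1 mu0.
have [K0 hK _] := window_bounds r0 r1 c1; rewrite rl -/Kw in hK.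
have ag i := agent_smooth hs i.
have gl i : lip (12 * B * L) (G i).
  by apply: Gst_lip => //; try exact: ltW; [move=> j; have [[]] := ag j|move=> j; have [_ []] := ag j].
have hE : B * c / lam rho <= k_eps L mu.
  by rewrite -rl; apply: rBcl_small => //; exact: k_eps_gt0.
have [q1 q2] := regime_contract L1 mu0 B0 l0 (ler0n R Kw) hK hE.
have [kx ky kz] := regime_kap L1 mu0 B0 E0 BE A1 ha hx hy hz.
have [cx cy cz] := regime_cb L1 mu0 B0 E0 BE A1 ha hx hy hz.
have xz := regime_xz L1 mu0 B0 E0 BE A1 ha hx hy hz.
have B1A : B <= 1 / A.
  apply: le_trans (rB_small r0 u1 v0 uv) _; rewrite ler_pM2r ?invr_gt0 // expr_le1 ?exprn_ge0 ?(ltW r0) //.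
  by rewrite expr_le1 // ltW.
have kc := regime_curvature L1 mu0 B0 A1 ha B1A h3.
have [LV hLV] := Gpot_lip L1 mu0 qg lf lg sc a1.
have Cv0 : 0 <= a * k_pot L mu by rewrite mulr_ge0 ?(ltW a0) //; exact: k_pot_ge0.
have hV : qb (a * k_pot L mu) (pot f g a) (Gpot g (Gfbar pb) (Ggbar pb) a) by exact: pot_qb.
have La0 : 0 <= L ^+ 2 / mu by rewrite divr_ge0 ?sqr_ge0 // ltW.
have La : L ^+ 2 / mu / a <= L ^+ 2 / mu by rewrite ler_pdivrMr // ler_peMr.
pose Vinf := Phi pb (x0 d) - `|Delta| - L ^+ 2 / mu.
pose V0 := Phi pb (x0 d) + L ^+ 2 / mu + 3 * L * `|Cw|.
have Vlow z : Vinf <= pot f g a z.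
  rewrite (st3P z); apply: le_trans (pot_lower L1 mu0 qf qg sc a1 ham _ _ _).
  have := Phia_close L1 mu0 qf qg f0 sc a1 ham (lsubmx z); rewrite ler_norml => /andP[_ e1].
  have e2 := hDelta (lsubmx z); have e3 := ler_norm Delta.
  have e4 : f (lsubmx z) (zs g (lsubmx z)) = Phi pb (lsubmx z) by [].
  rewrite /Vinf; lra.
have Vstart o : pot f g a (mrow (w 0%N o)) <= V0.
  rewrite (start_mean pb sm d a ex ey ez hW); apply: le_trans (pot_upper L1 mu0 qf qg sc a1 ham _ _ _) _.
  have avc m (x : 'rV[R]_m) : avg (fun _ : 'I_n => x) = x.
    by rewrite -mrow_rows rows_cst (mrow_const hW).
  move: hwarm; rewrite /warm_start /= !avc ge_max (penalty_solE hs n0 mu0 _ (ltW a0)) => /andP[w1 w2].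
  have wa : Cw * `|1 / a| <= `|Cw| / a by rewrite ger0_norm ?divr_ge0 ?(ltW a0) // mul1r ler_wpM2r ?invr_ge0 ?(ltW a0) // ler_norm.
  have {}w1 := le_trans w1 wa; have {}w2 := le_trans w2 wa.
  have aL : 0 <= a * L by rewrite mulr_ge0 // ltW.
  have e1 := ler_wpM2l aL w1; have e2 := ler_wpM2l aL w2.
  have e3 : a * L * (`|Cw| / a) = L * `|Cw| by field; rewrite gt_eqF.
  rewrite e3 in e1 e2.
  have := Phia_close L1 mu0 qf qg f0 sc a1 ham (x0 d); rewrite ler_norml => /andP[e4 _].
  have e5 : f (x0 d) (zs g (x0 d)) = Phi pb (x0 d) by [].
  have e6 : 2 * a * L * fnorm (y0 d - ya f g a (x0 d)) ^+ 2 = 2 * (a * L * fnorm (y0 d - ya f g a (x0 d)) ^+ 2) by ring.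
  rewrite e6 /V0; move: e1 e2 e4; rewrite -/f -/g -/(zs g) e5.
  set x1 := a * L * _; set x2 := a * L * _; lra.
have Vdesc z b : 3 / 8 * (A / (2 * B)) * fnorm (meanG G z) ^+ 2 - 4 / k_step L mu * (A / B) * fnorm b ^+ 2 <=
    dotp (Gpot g (Gfbar pb) (Ggbar pb) a z) (meanG G z) + dotp (Gpot g (Gfbar pb) (Ggbar pb) a z) b.
  rewrite (meanG_Gst pb n0); exact: (pot_descent (Gfbar pb) L1 mu0 qg lg sc a1 px py pz kx ky kz cx cy cz xz).
have ds := descent_sum hW gl (@card_calls n) (US_rec pb W sm d a ex ey ez) (wS_rec pb W sm d a ex ey ez)
  (HS_rec pb W sm d a ex ey ez) (fun o => start_tracking pb W sm a ex ey ez o hadm) run_fresh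
  (@wS_past _ _ _ _ _ _ _ _ _ _ pb W sm d a ex ey ez) lw lU lH Cv0 hV hLV Vlow Vstart kc Vdesc.
apply: (gradient_rate r0 r1 u1 v0 uv c1 cu (CL := k_pot L mu) _ c0 (Sb := Sb) (K := Kw%:R) (Cv := a * k_pot L mu)).
- exact: k_pot_ge0.
- by apply: sumr_ge0 => s _; apply: Ex_ge0 => o; exact: sqr_ge0.
- by apply: sumr_ge0 => s _; apply: Ex_ge0 => o; exact: sqr_ge0.
- exact: A1.
- by rewrite ler_wpM2r ?k_pot_ge0 //; case/andP: ha.
- exact: q2.
- exact: run_bias.
- have -> : k_gap L mu Delta Cw = V0 - Vinf by rewrite /k_gap /V0 /Vinf; ring.
  by rewrite un vS.
Qed.

Definition k_conv : R := Cphi L mu +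
  4 / k_step L mu * (1 + 5 * L / mu) * Num.sqrt (k_sum L mu sf sg Delta D0 Cw).

(** Some iterate has a mean squared direction at most the average; Jensen's
    inequality and [Ga_le_mdir] turn this into a bound on the gradient. *)
Lemma run_gradient : exists s : 'I_S,
  ('E_P[fun o => fnorm (grad (Phi pb) (avg (st_x (run s o))))] <= (k_conv / A)%:E)%E.
Proof.
have [pa px py pz] := pos.
have [cx cy cz] := regime_cb L1 mu0 B0 E0 BE A1 ha hx hy hz.
have [c0 _ _] := k_step_bounds L1 mu0; have k0 := k_pot_ge0 L1 mu0.
set k := k_sum L mu sf sg Delta D0 Cw.
have tE : k * target r u v = S%:R * (k * (B ^+ 2 / A ^+ 4)) by rewrite /target vS -[_ * B ^+ 2 / _]mulrA mulrCA.
have := run_rate; rewrite -/k tE => /(exists_le_mean (a := fun s => Ex P (fun o => fnorm (meanG G (mrow (w s o))) ^+ 2)) S0)[s hsg]; exists s.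
have ag i := agent_smooth hs i; have [s1 s2 s3 s4 s5] := scl.
have gl i : lip (12 * B * L) (G i).
  by apply: Gst_lip => //; try exact: ltW; [move=> j; have [[]] := ag j|move=> j; have [_ []] := ag j].
have lG : L2m P (fun o => meanG G (mrow (w s o))).
  exact: (meanG_L2 gl (US_rec pb W sm d a ex ey ez) (wS_rec pb W sm d a ex ey ez)
   (HS_rec pb W sm d a ex ey ez) run_fresh lw lU lH (ltnW (ltn_ord s))).
have lN := L2_fnorm lG.
set N := fun o => fnorm (meanG G (mrow (w s o))) in lN.
have hN : Ex P N <= Num.sqrt k * (B / A ^+ 2).
  have j := le_trans (Ex_jensen lN) hsg.
  have kk : 0 <= k.
    rewrite -(pmulr_lge0 _ (x := B ^+ 2 / A ^+ 4)) ?divr_gt0 ?exprn_gt0 //; exact: le_trans (sqr_ge0 _) j.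
  have q0 : 0 <= Num.sqrt k * (B / A ^+ 2) by rewrite mulr_ge0 ?sqrtr_ge0 // divr_ge0 ?exprn_ge0 // ltW.
  rewrite -(ler_pXn2r (n := 2)) ?nnegrE //; last by apply: Ex_ge0 => o; exact: fnorm_ge0.
  rewrite [leRHS]exprMn sqr_sqrtr //; apply: le_trans j _.
  by rewrite le_eqVlt; apply/orP; left; apply/eqP; field; rewrite gt_eqF.
have lm : 0 <= 1 + 5 * L / mu by rewrite addr_ge0 // divr_ge0 ?mulr_ge0 // ltW.
pose cc := 4 / k_step L mu * (A / B) * (1 + 5 * L / mu).
have cc0 : 0 <= cc by apply: mulr_ge0 => //; apply: mulr_ge0; apply: divr_ge0 => //; exact: ltW.
have [C0 _ _ _] := Cphi_parts L1 mu0.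
apply: le_trans (expectation_le_Ex (g := fun o => Cphi L mu / a + cc * N o) _ _ _) _.
- by move=> o; exact: fnorm_ge0.
- move=> o; have ex_ : avg (st_x (run s o)) = lsubmx (mrow (w s o)) by rewrite /w /wS mrow_rows avg_st3 /st3 row_mxKl.
  rewrite ex_; set x := lsubmx _.
  have h1 := grad_Phi_close L1 mu0 qf qg lf lg tg f0 sc x amin.
  have h2 := Ga_le_mdir L1 mu0 qf qg lf lg sc a1 ham px py pz cx cy cz (mrow (w s o)).
  rewrite -(meanG_Gst pb n0) in h2.
  have := ler_fnormD (grad (Phi pb) x - Ga f g (Gfbar pb) (Ggbar pb) a x) (Ga f g (Gfbar pb) (Ggbar pb) a x).
  by rewrite subrK => h3; apply: le_trans h3 _; exact: lerD.
- by apply: intgD; [exact: intg_cst|apply: intgZ; exact: L2_intg].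
have iN := L2_intg lN.
rewrite (ExD (intg_cst P _) (intgZ cc iN)) Ex_cst (ExZ _ iN) lee_fin.
have h1 : Cphi L mu / a <= Cphi L mu / A.
  by rewrite ler_wpM2l // lef_pV2 ?posrE //; case/andP: ha.
have h2 := ler_wpM2l cc0 hN.
apply: le_trans (lerD h1 h2) _; rewrite le_eqVlt; apply/orP; left; apply/eqP.
rewrite /k_conv /cc -/k; set kv := Num.sqrt k; set e := 1 + _.
by field; rewrite !gt_eqF.
Qed.

End Convergence.

(** * The convergence rate *)

Lemma consensus_cst (R : realType) (n m : nat) (x : 'rV[R]_m) : 0 < n%:R :> R ->
  consensus_error (fun _ : 'I_n => x) = 0.
Proof.
move=> n0; rewrite /consensus_error; have -> : avg (fun _ : 'I_n => x) = x.
  by rewrite /avg sumr_const card_ord -[x *+ n]scaler_nat scalerA mulVf ?scale1r // gt_eqF.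
have -> : stack (fun _ : 'I_n => x) - x^T *m const_mx 1 = 0.
  by apply/matrixP => i j; rewrite !mxE big_ord1 !mxE mulr1 subrr.
exact: fnorm0.
Qed.

Lemma theta_pos (R : realType) (C1 C2 x y : R) : 0 < x -> 0 < y -> theta_between C1 C2 x y -> C1 * y <= x <= C2 * y.
Proof. by move=> x0 y0; rewrite /theta_between !gtr0_norm. Qed.

Lemma expectation_cst_le (R : realType) dO (O : measurableType dO) (P : probability O R) (c k : R) : c <= k ->
  ('E_P[fun=> c] <= k%:E)%E.
Proof. by move=> ck; rewrite (expectation_cst P c) lee_fin. Qed.

Local Close Scope classical_set_scope.

Theorem theorem4p1 (R : realType)
    (lf0 lf1 lf2 lg1 lg2 mug sf sg cd : R) (Delta D0 Cw : R) (mug_gt0 : 0 < mug) :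
  exists Ca1 Ca2 Cx1 Cx2 Cy1 Cy2 Cz1 Cz2 C1 C2 : R,
  (0 < Ca1 < Ca2) /\ (0 < Cx1 < Cx2) /\ (0 < Cy1 < Cy2) /\ (0 < Cz1 < Cz2) /\
  0 < C1 /\ 0 < C2 /\
  forall (n p q S : nat)
    (dO : measure_display) (O : measurableType dO) (P : probability O R)
    (dX : measure_display) (X : measurableType dX)
    (dY : measure_display) (Y : measurableType dY)
    (pb : problem R n p q X Y) (W : 'M[R]_n) (rho : R)
    (sm : samples R n O X Y) (d : init_data R n p q)
    (alpha etax etay etaz : R),
  let run := dsgda_gt pb W sm alpha etax etay etaz 1 d in
  smoothness pb lf0 lf1 lf2 lg1 lg2 mug ->
  regular_oracles pb -> unbiased_oracles pb -> bounded_variance pb sf sg ->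
  fresh_samples P pb sm run 1 S ->
  mixing_matrix W rho ->
  bounded_direction P run S cd alpha ->
  admissible_init d ->
  init_size pb d <= D0 ->
  (forall x, Phi pb (x0 d) - Phi pb x <= Delta) ->
  0 < alpha -> 0 < etax -> 0 < etay -> 0 < etaz ->
  theta_between Ca1 Ca2 alpha
    ((1 - rho ^+ 2) `^ (1 / 2) * (n * S)%:R `^ (1 / 7)) ->
  theta_between Cx1 Cx2 etax
    ((1 - rho ^+ 2) * n%:R `^ (2 / 7) / S%:R `^ (5 / 7)) ->
  theta_between Cy1 Cy2 etay
    ((1 - rho ^+ 2) * n%:R `^ (2 / 7) / S%:R `^ (5 / 7)) ->
  theta_between Cz1 Cz2 etaz
    ((1 - rho ^+ 2) `^ (3 / 2) * n%:R `^ (3 / 7) / S%:R `^ (4 / 7)) ->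
  warm_start pb d alpha Cw ->
  n%:R `^ (4 / 3) <= S%:R :> R ->
  (\big[Order.min/+oo]_(s < S)
      'E_P[fun w => fnorm (grad (Phi pb) (avg (st_x (run s w))))]
    <= (C1 * ((1 - rho ^+ 2) `^ (- (1 / 2)) / (n * S)%:R `^ (1 / 7)))%:E)%E /\
  (\big[Order.min/+oo]_(s < S)
      ('E_P[fun w => consensus_error (st_x (run s w))] * (n%:R^-1)%:E)
    <= (C2 * (n%:R `^ (- (1 / 14)) / S%:R `^ (4 / 7) +
              n%:R `^ (1 / 7) * (1 - rho ^+ 2) `^ (- (3 / 2)) /
                S%:R `^ (6 / 7)))%:E)%E.
Proof.
set L := Lmax lf0 lf1 lf2 lg1 lg2.
have L1 : 1 <= L by have [] := Lmax_bounds lf0 lf1 lf2 lg1 lg2.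
have [c0 _ _] := k_step_bounds L1 mug_gt0; set c := k_step L mug in c0 *.
pose K := k_conv lf0 lf1 lf2 lg1 lg2 mug sf sg Delta D0 Cw.
pose K0 := grad0_bound L mug Delta.
pose Al := k_large L mug.
(* eta_x carries the small factor that the descent needs; in the constant of the rate,
   [K] serves for large A and [K0] with [Al] for small A *)
exists 1, 2, c, (2 * c), 1, 2, 1, 2, (1 + `|K| + `|K0| * `|Al|), 1.
have k1 : 0 < 1 + `|K| + `|K0| * `|Al| by rewrite -addrA ltr_wpDr // addr_ge0 // mulr_ge0.
do 4 (split; first by rewrite ?ltr01 ?c0 ?ltr1n //= ltr_pMl // ltr1n).
split=> //; split=> // n p q S dO O P dX X dY Y pb W rho sm d a ex ey ez run hs hreg hunb hvar hfresh hW _ hadm hinit hD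
  a0 x0_ y0_ z0_ ta tx ty tz hwarm hS.
have n0 := nR0 hW; have n1 := n_gt1 hW; have /andP[l0 l1] := lam_bounds hW.
have [r0 r1 u1 v0 _] := powers_pos n1 l0 l1 hS.
have [eA eE eB eT] := powers_rates n S l0.
have S0 : (0 < S)%N by rewrite -(ltr0n R); apply: lt_le_trans hS; exact: powR_gt0.
rewrite eA in ta; rewrite eE in tx ty; rewrite eB in tz; rewrite eT.
have A0 := rA_gt0 r0 u1 v0; have B0 := rB_gt0 r0 u1 v0; have E0 := rE_gt0 r0 u1 v0.
(* consensus: all agents start at the same point *)
split; last first.
  apply: le_trans (bigmin_le _ (Ordinal S0) _) _ => /=; rewrite (consensus_cst _ n0).
  rewrite (expectation_cst P 0) mul0e lee_fin mul1r.
  by rewrite addr_ge0 // ?divr_ge0 ?mulr_ge0 ?powR_ge0.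
have Ai : 0 < (rA (root_lam (lam rho)) (root_n n) (root_S S) : R)^-1 by rewrite invr_gt0.
set A := rA _ _ _ in A0 Ai ta *.
have [hA|hA] := leP Al A.
  have ha := theta_pos a0 A0 ta; have hx := theta_pos x0_ E0 tx.
  have hy := theta_pos y0_ E0 ty; have hz := theta_pos z0_ B0 tz; rewrite mul1r in ha; rewrite mul1r in hy; rewrite mul1r in hz.
  have [s hsg] := run_gradient mug_gt0 hs hreg hunb hvar hfresh hW hadm hinit hD hwarm hS ha hx hy hz hA.
  apply: le_trans (bigmin_le _ s _) _; apply: le_trans hsg _; rewrite lee_fin.
  rewrite ler_wpM2r ?(ltW Ai) //; apply: le_trans (ler_norm _) _.
  by rewrite addrAC lerDr addr_ge0 // mulr_ge0.
(* A is bounded, so a bound of order 1 at the initial point suffices *)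
apply: le_trans (bigmin_le _ (Ordinal S0) _) _ => /=; apply: expectation_cst_le.
have -> : avg (fun _ : 'I_n => x0 d) = x0 d by rewrite -mrow_rows rows_cst (mrow_const hW).
have [qf qg lf lg tg] := mean_smooth hs n0.
have := grad_bounded L1 mug_gt0 qf qg lf lg tg (favg_lip hs n0) (gavg_strconv hs n0) hD.
move=> h; apply: le_trans h _; apply: le_trans (ler_norm _) _.
rewrite ler_pdivlMr //; apply: le_trans (_ : `|K0| * `|Al| <= _); last by rewrite lerDr addr_ge0.
by rewrite ler_wpM2l // (le_trans (ltW hA)) // ler_norm.
Qed.
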